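(* Let $d\ge1$, $s\ge0$, $0<p<\infty$ and $0<q\le\infty$. Then: (a) if $s>0$, there is no reverse Carleson measure for $HF_s^{p,q}(B_d)$; (b) if $2\le q\le\infty$, a finite positive Borel measure $\mu$ on $\overline{B}_d$ is a reverse Carleson measure for $HF_0^{p,q}(B_d)$ if and only if there is $c>0$ with $\mu(Q)\ge c\,\sigma(Q)$ for every non-isotropic ball $Q\subset\partial B_d$; (c) if $0<q\le1$, there is no reverse Carleson measure for $HF_0^{p,q}(B_d)$.
   Context: $B_d$ is the open unit ball of $\mathbb{C}^d$, $\sigma$ the normalized surface measure on $\partial B_d$, $\langle z,w\rangle=\sum z_k\overline{w_k}$. A non-isotropic ball is a set $Q(\zeta,\delta)=\{\xi\in\partial B_d:|1-\langle\zeta,\xi\rangle|\le\delta\}$. For holomorphic $f(z)=\sum_\alpha c_\alpha z^\alpha$ on $B_d$ and $t\in\mathbb{R}$, $(I+\mathcal{R})^tf(z)=\sum_\alpha(1+|\alpha|)^tc_\alpha z^\alpha$ (here $\mathcal{R}f=\sum_k z_k\partial f/\partial z_k$ is the radial derivative). Let $[s]^+$ be the integer part of $s+1$. The holomorphic Triebel–Lizorkin space $HF_s^{p,q}(B_d)$ consists of holomorphic $f$ on $B_d$ with $\|f\|^p_{HF_s^{p,q}}=\int_{\partial B_d}\big(\int_0^1|(I+\mathcal{R})^{[s]^+}f(r\zeta)|^q(1-r^2)^{([s]^+-s)q-1}\,dr\big)^{p/q}d\sigma(\zeta)<\infty$, and for $q=\infty$ with the inner integral replaced by $\big(\sup_{0\le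 r<1}|(I+\mathcal{R})^{[s]^+}f(r\zeta)|(1-r^2)^{[s]^+-s}\big)^p$. A finite positive Borel measure $\mu$ on $\overline{B}_d$ is a reverse Carleson measure for $HF_s^{p,q}$ if there is $C>0$ with $\|f\|_{HF_s^{p,q}}\le C\|f\|_{L^p(\overline{B}_d,\mu)}$ for all $f\in HF_s^{p,q}\cap C(\overline{B}_d)$. *)

(* Defs.v *)
(* MathComp + MathComp-Analysis (R : realType), complex numbers R[i]
   from mathcomp-real-closed. *)
From HB Require Import structures.
From mathcomp Require Import all_boot all_order all_algebra.
From mathcomp Require Import all_classical all_reals all_analysis.
From mathcomp.real_closed Require Import complex.

Set Implicit Arguments.
Unset Strict Implicit.
Unset Printing Implicit Defensive.

Import Order.TTheory GRing.Theory Num.Theory numFieldNormedType.Exports.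
Local Open Scope ring_scope.
Local Open Scope classical_set_scope.

Section HFDefs.
Variable R : realType.

(* A point of C^d, coordinate k being (Re z_k, Im z_k).  The measurable
   structure is the product (= Borel) sigma-algebra of R^(2d). *)
Definition Pt (d : nat) := (d.-tuple (R * R))%type.

Definition coord {d} (z : Pt d) (k : 'I_d) : R[i] :=
  ((tnth z k).1 +i* (tnth z k).2)%C.

(* modulus of a complex number *)
Definition cabs (w : R[i]) : R :=
  Num.sqrt (complex.Re w ^+ 2 + complex.Im w ^+ 2).

(* Euclidean norm |z| on C^d *)
Definition pnorm {d} (z : Pt d) : R :=
  Num.sqrt (\sum_(k < d) ((tnth z k).1 ^+ 2 + (tnth z k).2 ^+ 2)).

Definition psub {d} (z w : Pt d) : Pt d :=
  [tuple ((tnth z k).1 - (tnth w k).1, (tnth z k).2 - (tnth w k).2) | k < d].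

Definition open_ball d : set (Pt d) := [set z | pnorm z < 1].
Definition closed_ball d : set (Pt d) := [set z | pnorm z <= 1].
Definition sphere d : set (Pt d) := [set z | pnorm z = 1].
Arguments open_ball d : clear implicits.
Arguments closed_ball d : clear implicits.
Arguments sphere d : clear implicits.

(* <z, w> = sum_k z_k conj(w_k) *)
Definition cinner {d} (z w : Pt d) : R[i] :=
  \sum_(k < d) coord z k * ((coord w k)^*)%C.

(* non-isotropic ball Q(zeta, delta) *)
Definition nonisotropic_ball {d} (zeta : Pt d) (delta : R) : set (Pt d) :=
  [set xi | sphere d xi /\ cabs (1 - cinner zeta xi) <= delta].

(* r * z *)
Definition scale {d} (r : R) (z : Pt d) : Pt d :=
  [tuple (r * (tnth z k).1, r * (tnth z k).2) | k < d].

(* unitary matrices and their action on C^d *)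
Definition unitary {d} (U : 'M[R[i]]_d) : Prop :=
  U *m (map_mx (@conjc R) U)^T = 1%:M.

Definition act {d} (U : 'M[R[i]]_d) (z : Pt d) : Pt d :=
  [tuple (complex.Re (\sum_(j < d) U k j * coord z j),
          complex.Im (\sum_(j < d) U k j * coord z j)) | k < d].

(* sigma = normalized surface measure on the sphere, characterized as the
   unique unitarily invariant Borel probability measure on the sphere. *)
Definition normalized_surface_measure d
    (sigma : {measure set (Pt d) -> \bar R}) : Prop :=
  [/\ sigma setT = 1%E, sigma (~` sphere d) = 0%E &
      forall U : 'M[R[i]]_d, unitary U ->
        forall E : set (Pt d), measurable E -> sigma (act U @^-1` E) = sigma E].

(* multi-indices, monomials, partial sums of power series *)
Definition mdeg {d} (a : d.-tuple nat) : nat := (\sum_(k < d) tnth a k)%N.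

Definition mono {d} (z : Pt d) (a : d.-tuple nat) : R[i] :=
  \prod_(k < d) coord z k ^+ tnth a k.

Definition midx {d N} (a : {ffun 'I_d -> 'I_N.+1}) : d.-tuple nat :=
  [tuple nat_of_ord (a k) | k < d].

(* sum_{|alpha| <= N} c_alpha z^alpha *)
Definition psum {d} (c : d.-tuple nat -> R[i]) (z : Pt d) (N : nat) : R[i] :=
  \sum_(a : {ffun 'I_d -> 'I_N.+1} | (mdeg (midx a) <= N)%N)
     c (midx a) * mono z (midx a).

(* sum_{|alpha| <= N} |c_alpha z^alpha| *)
Definition apsum {d} (c : d.-tuple nat -> R[i]) (z : Pt d) (N : nat) : R :=
  \sum_(a : {ffun 'I_d -> 'I_N.+1} | (mdeg (midx a) <= N)%N)
     cabs (c (midx a) * mono z (midx a)).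

(* the power series converges absolutely at z *)
Definition abs_summable {d} (c : d.-tuple nat -> R[i]) (z : Pt d) : Prop :=
  cvgn (apsum c z).

(* its value sum_alpha c_alpha z^alpha *)
Definition pseries {d} (c : d.-tuple nat -> R[i]) (z : Pt d) : R[i] :=
  ((limn (fun N => complex.Re (psum c z N))) +i*
   (limn (fun N => complex.Im (psum c z N))))%C.

(* f is holomorphic on B_d with Taylor coefficients c *)
Definition holo_on_ball d (c : d.-tuple nat -> R[i]) (f : Pt d -> R[i]) : Prop :=
  forall z, open_ball d z -> abs_summable c z /\ f z = pseries c z.

(* coefficients of (I + R)^k f *)
Definition radI {d} (k : nat) (c : d.-tuple nat -> R[i]) : d.-tuple nat -> R[i] :=
  fun a => (((1 + mdeg a)%:R ^+ k : R) +i* 0)%C * c a.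

(* [s]^+ = integer part of s + 1 (s >= 0) *)
Definition splus (s : R) : nat := (Num.truncn s).+1.

(* inner (radial) part of the HF_s^{p,q} quasi-norm at zeta *)
Definition HF_inner d (s : R) (q : \bar R) (c : d.-tuple nat -> R[i])
    (zeta : Pt d) : \bar R :=
  let k := splus s in
  let g := fun r : R => cabs (pseries (radI k c) (scale r zeta)) in
  match q with
  | q'%:E => (\int[lebesgue_measure]_(r in `[0%R, 1%R[)
               (powR (g r) q' * powR (1 - r ^+ 2) ((k%:R - s) * q' - 1))%:E)%E
  | +oo%E => ereal_sup [set (g r * powR (1 - r ^+ 2) (k%:R - s))%:E
                        | r in `[0%R, 1%R[]
  | -oo%E => 0%E
  end.

Definition outer_exp (p : R) (q : \bar R) : R :=
  match q with q'%:E => p / q' | _ => p end.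

(* ||f||_{HF_s^{p,q}}^p *)
Definition HF_pnorm d (sigma : {measure set (Pt d) -> \bar R}) (s p : R)
    (q : \bar R) (c : d.-tuple nat -> R[i]) : \bar R :=
  (\int[sigma]_(zeta in sphere d) poweR (HF_inner s q c zeta) (outer_exp p q))%E.

Definition HF_norm d (sigma : {measure set (Pt d) -> \bar R}) (s p : R)
    (q : \bar R) (c : d.-tuple nat -> R[i]) : \bar R :=
  poweR (HF_pnorm sigma s p q c) p^-1.

(* ||f||_{L^p(closed ball, mu)} *)
Definition Lp_norm d (mu : {measure set (Pt d) -> \bar R}) (p : R)
    (f : Pt d -> R[i]) : \bar R :=
  poweR (\int[mu]_(z in closed_ball d) (powR (cabs (f z)) p)%:E)%E p^-1.

(* f restricted to the closed ball is continuous *)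
Definition cont_closed_ball d (f : Pt d -> R[i]) : Prop :=
  forall z, closed_ball d z -> forall e : R, 0 < e ->
    exists2 delta : R, 0 < delta &
      forall w, closed_ball d w -> pnorm (psub w z) < delta ->
        cabs (f w - f z) < e.

(* finite positive Borel measure on the closed ball *)
Definition finite_measure_on_closed_ball d
    (mu : {measure set (Pt d) -> \bar R}) : Prop :=
  (mu setT < +oo)%E /\ mu (~` closed_ball d) = 0%E.

Definition reverse_carleson d (sigma : {measure set (Pt d) -> \bar R})
    (s p : R) (q : \bar R) (mu : {measure set (Pt d) -> \bar R}) : Prop :=
  exists2 C : R, 0 < C &
    forall (c : d.-tuple nat -> R[i]) (f : Pt d -> R[i]),
      holo_on_ball c f -> cont_closed_ball f ->
      (HF_pnorm sigma s p q c < +oo)%E ->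
      (HF_norm sigma s p q c <= C%:E * Lp_norm mu p f)%E.

End HFDefs.

Arguments open_ball {R} d.
Arguments closed_ball {R} d.
Arguments sphere {R} d.

(* Main.v *)
(** Slice integration reduces the norm of [HF_0^(p,q)], [q >= 2], to functions of one
    variable: with [h(l) = l f(l zeta)], [(I+R)f(l zeta) = h'(l)], and the inner integral is at
    most a power of [X = sup (1-r^2)^2 |h'|^2 + int |h'|^2 (1-r^2) dr].  The supremum is
    controlled by the radial maximal function (bounded on L^2 by a T T^* argument) and the
    integral by the Littlewood-Paley inequality, obtained from Green's formula in [x = ln r]
    applied to powers of [|h|^2] combined with a subharmonic majorant of the g-function itself.
    So [HF_0^(p,q)] is dominated by the Hardy norm, which in turn is dominated by [L^p(mu)] when
    [mu(Q) >= c sigma(Q)]: average a truncation of [|f|^p] over balls [Q(.,delta)], exchange the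
    integrals, and let [delta] tend to 0.

    Conversely, let [W] be the sum of [e_i z_i] over all words [i] of length [n] in the
    coordinates, with independent signs [e_i]; its variance at [z] is [|z|^(2n)].  Testing with
    [(1 + <z,z0>)^N W] and averaging over the signs (Khinchine and Paley-Zygmund), the left side
    is at least of the order of [n^(sp)], which is absurd for [s > 0] by taking [N = 0].  For
    [s = 0], letting [n] go to infinity kills [mu] inside the ball and gives the inequality
    for [|1 + <z,z0>|^(Np)] on the sphere; averaging it over [z0] in [Q] with normalisation, [N -> oo]
    concentrates both sides on [Q].  For [q <= 1], the sum of [W] over the lengths
    [1, 2, 4, ..., 2^(m-1)] has [p]-th moment at most [m^(p/2)] while its norm is at least of the
    order of [m^(p/q)]. *)
Require Import Defs.
From HB Require Import structures.
From mathcomp Require Import all_boot all_order all_algebra.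
From mathcomp Require Import all_classical all_reals all_analysis.
From mathcomp.real_closed Require Import complex.
From mathcomp Require Import measurable_realfun.
From mathcomp Require Import ring lra.
Set Implicit Arguments.
Unset Strict Implicit.
Unset Printing Implicit Defensive.
Import Order.TTheory GRing.Theory Num.Theory numFieldNormedType.Exports.
Local Open Scope ring_scope.
Local Open Scope classical_set_scope.
Require Import Defs.

(** Hardy space theory is not assumed. All disc estimates are for polynomials: derivatives are
    explicit, means are finite and can be absorbed, and zeros of |h| are avoided by adding a
    constant e > 0 before taking real powers. The variable x = ln r gives the Laplacian constant
    coefficients and turns the weight 1 - r into -x. The square function needs three regimes of s =
    p/2: for s <= 1 the factor |h|^(2s-2) in the Laplacian of |h|^(2s) is traded against the maximal
    function, while for s > 1 the power s - 1 of the squared g-function acts as a weight, which must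
    first be extended inside the disc. A slice of f is not a polynomial: it is dilated and
    truncated, and Fatou's lemma is used both in r and in the angle, so all constants must be
    uniform in the polynomial. The measure sigma is known only through its unitary invariance:
    rotations z -> e^(it) z replace polar coordinates, and all balls of one radius have equal
    measure because unitary maps act transitively on the sphere. In the lower bounds a single shell
    1 - r ~ 1/n already carries enough of the norm of a test function of degree n. *)

Lemma continuous_pairing (T U V : topologicalType) (f : T -> U) (g : T -> V) :
  continuous f -> continuous g -> continuous (fun x => (f x, g x)).
Proof.
move=> cf cg x; have := @cvg_pair T U V (nbhs x) (nbhs (f x)) (nbhs (g x)) _ _ _ f g (cf x) (cg x).
exact.
Qed.

(** * Integrals of continuous functions over segments *)

Section Cint.
Variable R : realType.
Implicit Types (f g F : R -> R) (a b : R).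

Definition cint a b f : R :=
  \int[@lebesgue_measure R]_(x in `[a, b]) f x.

Lemma cint_int a b f : continuous f ->
  (@lebesgue_measure R).-integrable `[a, b] (EFin \o f).
Proof.
move=> cf; apply: continuous_compact_integrable; first exact: segment_compact.
exact: continuous_subspaceT.
Qed.

Lemma cintE a b f : continuous f ->
  (\int[@lebesgue_measure R]_(x in `[a, b]) (f x)%:E)%E = (cint a b f)%:E.
Proof.
move=> cf; rewrite /cint /Rintegral fineK//.
by apply: integrable_fin_num => //; exact: cint_int.
Qed.

Lemma cintD a b f g : continuous f -> continuous g ->
  cint a b (fun x => f x + g x) = cint a b f + cint a b g.
Proof. by move=> cf cg; rewrite /cint RintegralD//; exact: cint_int. Qed.

Lemma cintZ a b (k : R) f : continuous f ->
  cint a b (fun x => k * f x) = k * cint a b f.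
Proof. by move=> cf; rewrite /cint RintegralZl//; exact: cint_int. Qed.

Lemma le_cint a b f g : continuous f -> continuous g ->
  (forall x, a <= x <= b -> f x <= g x) -> cint a b f <= cint a b g.
Proof.
move=> cf cg fg; apply: le_Rintegral => [//|||x]; [exact: cint_int..|].
by rewrite /= in_itv/=; exact: fg.
Qed.

Lemma cint_ge0 a b f : (forall x, a <= x <= b -> 0 <= f x) -> 0 <= cint a b f.
Proof. by move=> f0; apply: Rintegral_ge0 => x; rewrite /= in_itv/=; exact: f0. Qed.

Lemma eq_cint a b f g : (forall x, a <= x <= b -> f x = g x) -> cint a b f = cint a b g.
Proof.
by move=> fg; apply: eq_Rintegral => x; rewrite inE /= in_itv/=; exact: fg.
Qed.

Lemma cint_FTC a b f F : a <= b -> continuous f ->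
  (forall x : R, a <= x <= b -> is_derive x 1 F (f x)) -> cint a b f = F b - F a.
Proof.
rewrite le_eqVlt => /predU1P[->|ab] cf dF.
  by rewrite /cint set_itv1 Rintegral_set1 subrr.
have cF (x : R) : a <= x <= b -> {for x, continuous F}.
  move=> xab; apply/differentiable_continuous/derivable1_diffP.
  by have := dF x xab => -[].
have oo (x : R) : x \in `]a, b[%R -> a <= x <= b.
  by rewrite in_itv/= => /andP[ax xb]; rewrite !ltW.
apply/EFin_inj; rewrite -cintE// EFinB; apply: continuous_FTC2 => //.
- exact: continuous_subspaceT.
- split; first by move=> x /oo xab; have := dF x xab => -[].
  + by apply/cvg_at_right_filter/cF; rewrite lexx ltW.
  + by apply/cvg_at_left_filter/cF; rewrite lexx ltW.
- by move=> x /oo xab; rewrite derive1E; have := dF x xab => -[].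
Qed.

Lemma cint_cst a b (k : R) : a <= b -> cint a b (fun=> k) = k * (b - a).
Proof.
move=> ab; rewrite mulrBr; apply: (@cint_FTC a b (fun=> k) (fun x => k * x)) => //.
  by move=> x; exact: cst_continuous.
by move=> x _; rewrite -[X in is_derive _ _ _ X]mulr1; exact: is_deriveZ.
Qed.

Lemma continuous2_bounded (F : R * R -> R) a b c d : continuous F ->
  exists2 M : R, 0 < M & forall x y, a <= x <= b -> c <= y <= d -> `|F (x, y)| <= M.
Proof.
move=> cF; have cA : compact (`[a, b] `*` `[c, d] : set (R * R)%type).
  by apply: compact_setX; exact: segment_compact.
have /compact_bounded[M [_ MP]] := continuous_compact (continuous_subspaceT cF) cA.
exists (Num.max M 0 + 1); first by rewrite ltr_pwDr// le_max lexx orbT.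
move=> x y xab ycd; apply: (MP (Num.max M 0 + 1) _ (F (x, y))).
  by rewrite (le_lt_trans (y := Num.max M 0)) ?le_max ?lexx// ltrDl.
by exists (x, y) => //; split; rewrite /= in_itv.
Qed.

Lemma continuous_slice1 (F : R * R -> R) (x : R) : continuous F -> continuous (fun y => F (x, y)).
Proof.
move=> cF y; apply: (@continuous_comp _ _ _ (fun y => (x, y)) F); last exact: cF.
by apply: continuous_pairing => z; [exact: cst_continuous|exact: id].
Qed.

Lemma continuous_slice2 (F : R * R -> R) (y : R) : continuous F -> continuous (fun x => F (x, y)).
Proof.
move=> cF x; apply: (@continuous_comp _ _ _ (fun x => (x, y)) F); last exact: cF.
by apply: continuous_pairing => z; [exact: id|exact: cst_continuous].
Qed.

Lemma cint_continuous (F : R * R -> R) c d : continuous F ->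
  continuous (fun x => cint c d (fun y => F (x, y))).
Proof.
move=> cF x.
have [M M0 FM] := @continuous2_bounded F (x - 1) (x + 1) c d cF.
have := @continuity_under_integral R _ _ (@lebesgue_measure R) (fun x y => F (x, y)) `[c, d]%classic.
move=> /(_ (measurable_itv _) (x - 1) (x + 1)); apply.
- by move=> z _; apply: cint_int; exact: continuous_slice1.
- by apply: aeW => y _ z _; exact: continuous_slice2.
- by apply: (@cint_int c d (fun=> M)); move=> ?; exact: cst_continuous.
- move=> z; rewrite /= in_itv/= => /andP[z1 z2]; apply: aeW => y.
  by rewrite /= in_itv/= => yd; apply: FM => //; rewrite !ltW.
- by rewrite inE/= in_itv/= ltrBlDr ltrDl ltr01.
Qed.

Lemma floor_approx_cvg (x : R) :
  (Num.floor (n.+1%:R * x))%:~R / n.+1%:R @[n --> \oo] --> x.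
Proof.
apply/cvgrPdist_le => e e0; near=> n.
have n0 : (0 : R) < n.+1%:R by [].
have H1 : ((Num.floor (n.+1%:R * x))%:~R : R) <= n.+1%:R * x by exact: floor_le.
have H2 : n.+1%:R * x < (Num.floor (n.+1%:R * x))%:~R + 1 by rewrite -intrD1; exact: floorD1_gt.
have H3 : 1 < e * n.+1%:R.
  rewrite -ltr_pdivrMr// div1r; near: n; exact: (near_infty_natSinv_lt (PosNum e0)).
have -> : x - (Num.floor (n.+1%:R * x))%:~R / n.+1%:R
   = (n.+1%:R * x - (Num.floor (n.+1%:R * x))%:~R) / n.+1%:R by field; rewrite gt_eqF.
rewrite ler_norml ler_pdivlMr// ler_pdivrMr//.
by apply/andP; split; nra.
Unshelve. all: by end_near. Qed.

(** Measurability is for the product sigma-algebra. Freezing the first variable at the grid point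
    below it, with mesh [1 / (n + 1)], gives functions whose preimages are countable unions of
    rectangles; they converge pointwise to [F]. *)
Lemma measurable_continuous2 (F : R * R -> R) : continuous F -> measurable_fun setT F.
Proof.
move=> cF; pose g (n : nat) (x : R) : R := (Num.floor (n.+1%:R * x))%:~R / n.+1%:R.
have cg (x y : R) : F (g n x, y) @[n --> \oo] --> F (x, y).
  apply: (@continuous_cvg nat R R \oo _ (fun n => g n x) (fun x => F (x, y)) x).
    exact: continuous_slice2.
  exact: floor_approx_cvg.
apply: (@measurable_fun_cvg _ _ R setT (fun n z => F (g n z.1, z.2))); last first.
  by move=> [x y] _ /=; exact: cg.
move=> n _ A mA; rewrite setTI.
rewrite (_ : _ @^-1` A = \bigcup_(k : int) ((fun x : R => Num.floor (n.+1%:R * x)) @^-1` [set k]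
   `*` ((fun y => F (k%:~R / n.+1%:R, y)) @^-1` A))); last first.
  apply/seteqP; split => [[x y]/= Fxy|[x y] [k _ [/= <-]]//].
  by exists (Num.floor (n.+1%:R * x)).
apply: countable_bigcupT_measurable; first exact: countableP.
move=> k; apply: measurableX.
  rewrite (_ : _ @^-1` _ = `[k%:~R / n.+1%:R, (k + 1)%:~R / n.+1%:R[%classic)//.
  have n0 : (0 : R) < n.+1%:R by [].
  apply/seteqP; split => x /=; rewrite in_itv/= ler_pdivrMr// ltr_pdivlMr// [x * _]mulrC.
    by move=> <-; rewrite floor_le floorD1_gt.
  exact: floor_def.
rewrite -[X in measurable X]setTI; apply: continuous_measurable_fun => //.
exact: continuous_slice1.
Qed.

Lemma cint_fubini (F : R * R -> R) a b c d : continuous F ->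
  cint a b (fun x => cint c d (fun y => F (x, y))) =
  cint c d (fun y => cint a b (fun x => F (x, y))).
Proof.
move=> cF; pose ab : set R := `[a, b]%classic; pose cd : set R := `[c, d]%classic.
have mab : measurable ab by exact: measurable_itv.
have mcd : measurable cd by exact: measurable_itv.
have [M M0 FM] := @continuous2_bounded F a b c d cF.
(* Extension by zero outside the rectangle: Fubini's theorem is applied on the whole plane, where
   integrability follows from boundedness. *)
pose G z := (F z * (\1_ab z.1 * \1_cd z.2))%:E.
have mG : measurable_fun setT G.
  apply/measurable_EFinP; apply: measurable_funM; first exact: measurable_continuous2.
  by apply: measurable_funM; apply: (measurableT_comp (measurable_indic _)) .
have iG : ((@lebesgue_measure R) \x (@lebesgue_measure R))%E.-integrable setT G.
  have mAB : measurable (ab `*` cd) by apply: measurableX.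
  apply/integrableP; split => //.
  apply: (@le_lt_trans _ _ (\int[(@lebesgue_measure R) \x (@lebesgue_measure R)]_z
      (M%:E * (\1_(ab `*` cd) z)%:E))%E).
    apply: ge0_le_integral => //.
    - exact: measurableT_comp.
    - by apply: measurable_funeM; apply/measurable_EFinP; exact: measurable_indic.
    move=> [x y] _ /=; rewrite /G !indicE in_setX/= normrM normrM -!EFinM lee_fin.
    have [/set_mem/= xab|] := boolP (x \in ab); last by rewrite !(normr0, mul0r, mulr0).
    have [/set_mem/= ycd|] := boolP (y \in cd); last by rewrite !(normr0, mul0r, mulr0).
    rewrite normr1 !mulr1; apply: FM.
      by move: xab; rewrite /ab/= in_itv.
    by move: ycd; rewrite /cd/= in_itv.
  rewrite ge0_integralZl_EFin//; last 2 first.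
  - by apply/measurable_EFinP; exact: measurable_indic.
  - exact: ltW.
  rewrite integral_indic// setIT [X in (_ * X < _)%E]product_measure1E//.
  have H (u v : R) : (@lebesgue_measure R `[u, v]%classic < +oo)%E.
    by rewrite lebesgue_measure_itv/=; case: ifP => _; rewrite ?ltry// -EFinB ltry.
  apply: lte_mul_pinfty; rewrite ?lee_fin ?(ltW M0)//.
  apply: lte_mul_pinfty; rewrite ?measure_ge0// ?ge0_fin_numE ?measure_ge0//; exact: H.
have H (f : R -> R) (a' b' : R) (k : R) : continuous f ->
  (\int[@lebesgue_measure R]_x (k * (f x * \1_(`[a', b']%classic) x))%:E = (k * cint a' b' f)%:E)%E.
  move=> cf; rewrite EFinM -cintE// -integralZl//; last exact: cint_int.
  rewrite [RHS]integral_mkcond; apply: eq_integral => x _.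
  rewrite patchE indicE; case: ifP => _; first by rewrite mulr1 EFinM.
  by rewrite !mulr0.
have := @Fubini _ _ _ _ R (@lebesgue_measure R) (@lebesgue_measure R) G iG.
under eq_integral.
  move=> x _; under eq_integral.
    move=> y _; rewrite /G/= [\1_ab x * _]mulrC mulrA [_ * \1_ab x]mulrC; over.
  rewrite (H (fun y => F (x, y)) c d); last exact: continuous_slice1.
  rewrite mulrC -[_ * _]mul1r.
  over.
rewrite (H (fun x => cint c d (fun y => F (x, y))) a b); last exact: cint_continuous.
rewrite mul1r => E1; apply/EFin_inj; rewrite E1.
under eq_integral.
  move=> y _; under eq_integral.
    move=> x _; rewrite /G/= mulrA [_ * \1_cd y]mulrC; over.
  rewrite (H (fun x => F (x, y)) a b); last exact: continuous_slice2.
  rewrite mulrC -[_ * _]mul1r.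
  over.
rewrite (H (fun y => cint a b (fun x => F (x, y))) c d) ?mul1r//.
apply: (@cint_continuous (fun z => F (z.2, z.1))).
move=> z; apply: (@continuous_comp _ _ _ (fun z : R * R => (z.2, z.1)) F); last exact: cF.
apply: (@continuous_pairing _ _ _ (fun z : R * R => z.2) (fun z : R * R => z.1)).
  by move=> ?; exact: cvg_snd.
by move=> ?; exact: cvg_fst.
Qed.

End Cint.

(** * Rules for derivatives and continuity *)

Section Deriv.
Variable R : realType.
Implicit Types (f g : R -> R) (x df dg : R).

Lemma isdD f g x df dg : is_derive x 1 f df -> is_derive x 1 g dg ->
  is_derive x 1 (fun y => f y + g y) (df + dg).
Proof. by move=> hf hg; exact: (@is_deriveD _ _ _ f g). Qed.

Lemma isdN f x df : is_derive x 1 f df -> is_derive x 1 (fun y => - f y) (- df).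
Proof. by move=> hf; exact: (@is_deriveN _ _ _ f). Qed.

Lemma isdB f g x df dg : is_derive x 1 f df -> is_derive x 1 g dg ->
  is_derive x 1 (fun y => f y - g y) (df - dg).
Proof. by move=> hf hg; apply: isdD => //; exact: isdN. Qed.

Lemma isdM f g x df dg : is_derive x 1 f df -> is_derive x 1 g dg ->
  is_derive x 1 (fun y => f y * g y) (df * g x + f x * dg).
Proof.
move=> hf hg; have := @is_deriveM _ _ f g x 1 df dg hf hg.
by rewrite addrC /GRing.scale/= [g x * df]mulrC.
Qed.

Lemma isdcst (c x : R) : is_derive x 1 (fun=> c) 0.
Proof. exact: is_derive_cst. Qed.

Lemma isdid (x : R) : is_derive x 1 (fun y : R => y) 1.
Proof. exact: is_derive_id. Qed.

Lemma isdcomp f g x df dg : is_derive (g x) 1 f df -> is_derive x 1 g dg ->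
  is_derive x 1 (fun y => f (g y)) (df * dg).
Proof. by move=> hf hg; exact: is_derive1_comp. Qed.

(** Separates the computation of a derivative by the rules above from the algebra that brings it to
    the wanted form. *)
Lemma isdE f x df dg : is_derive x 1 f df -> df = dg -> is_derive x 1 f dg.
Proof. by move=> + <-. Qed.

Lemma isd_cont f (h : R -> R) : (forall x : R, is_derive x 1 f (h x)) -> continuous f.
Proof.
move=> hf x; apply/differentiable_continuous/derivable1_diffP.
by have := hf x => -[].
Qed.

End Deriv.

Section Cts.
Variables (T : topologicalType) (R : realType).
Implicit Types f g : T -> R.

Lemma ctsD f g : continuous f -> continuous g -> continuous (fun x => f x + g x).
Proof. by move=> cf cg x; apply: cvgD; [exact: cf|exact: cg]. Qed.
Lemma ctsN f : continuous f -> continuous (fun x => - f x).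
Proof. by move=> cf x; apply: cvgN; exact: cf. Qed.
Lemma ctsB f g : continuous f -> continuous g -> continuous (fun x => f x - g x).
Proof. by move=> cf cg x; apply: cvgB; [exact: cf|exact: cg]. Qed.
Lemma ctsM f g : continuous f -> continuous g -> continuous (fun x => f x * g x).
Proof. by move=> cf cg x; apply: cvgM; [exact: cf|exact: cg]. Qed.
Lemma cts_cst (c : R) : continuous (fun _ : T => c).
Proof. by move=> x; exact: cvg_cst. Qed.
Lemma cts_comp (h : R -> R) f : continuous h -> continuous f -> continuous (fun x => h (f x)).
Proof. by move=> ch cf x; apply: (@continuous_comp _ _ _ f h); [exact: cf|exact: ch]. Qed.
Lemma cts_powR (a : R) f : (forall x, 0 < f x) -> continuous f -> continuous (fun x => f x `^ a).
Proof.
move=> f0 cf x; apply: (@continuous_comp _ _ _ f (fun y => y `^ a)); first exact: cf.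
apply/differentiable_continuous/derivable1_diffP.
by have := is_derive1_powR a (f0 x) => -[].
Qed.
Lemma ctsX f n : continuous f -> continuous (fun x => f x ^+ n).
Proof.
move=> cf; elim: n => [|n IH].
  by under eq_fun do rewrite expr0; exact: cts_cst.
by under eq_fun do rewrite exprS; exact: ctsM.
Qed.
Lemma cts_max f g : continuous f -> continuous g -> continuous (fun x => Num.max (f x) (g x)).
Proof. by move=> cf cg x; apply: continuous_max; [exact: cf|exact: cg]. Qed.

End Cts.

Lemma cts_id (T : topologicalType) : continuous (fun x : T => x).
Proof. by move=> x; exact: cvg_id. Qed.
Lemma cts_fst (R : realType) (f : R -> R) : continuous f -> continuous (fun z : R * R => f z.1).
Proof. by move=> cf; apply: cts_comp => // z; exact: cvg_fst. Qed.
Lemma cts_snd (R : realType) (f : R -> R) : continuous f -> continuous (fun z : R * R => f z.2).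
Proof. by move=> cf; apply: cts_comp => // z; exact: cvg_snd. Qed.

(** * Twice differentiable functions in log-polar coordinates *)

Section C2.
Variable R : realType.

Definition cont2 (F : R -> R -> R) := continuous (fun z : R * R => F z.1 z.2).

(** A function of [x = ln r] and the angle [t], packaged with its derivatives so that sums, products
    and powers compute them. Only pure second derivatives are kept: [f11 + f22] is [r^2] times the
    Euclidean Laplacian and has the same sign. Periodicity of [fn] reduces angles to a compact set;
    that of [f2] makes the angular term of Green's formula vanish. *)
Record c2 := C2 {
  fn : R -> R -> R; f1 : R -> R -> R; f2 : R -> R -> R; f11 : R -> R -> R; f22 : R -> R -> R;
  c2D1 : forall x t : R, is_derive x 1 (fn^~ t) (f1 x t);
  c2D2 : forall x t : R, is_derive t 1 (fn x) (f2 x t);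
  c2D11 : forall x t : R, is_derive x 1 (f1^~ t) (f11 x t);
  c2D22 : forall x t : R, is_derive t 1 (f2 x) (f22 x t);
  c2C : cont2 fn; c2C1 : cont2 f1; c2C2 : cont2 f2; c2C11 : cont2 f11; c2C22 : cont2 f22;
  c2P : forall x t : R, fn x (t + pi *+ 2) = fn x t;
  c2P2 : forall x t : R, f2 x (t + pi *+ 2) = f2 x t }.

Definition lap (a : c2) x t := f11 a x t + f22 a x t.

Definition c2cst (k : R) : c2.
Proof.
apply: (@C2 (fun _ _ => k) (fun _ _ => 0) (fun _ _ => 0) (fun _ _ => 0) (fun _ _ => 0));
  try (by move=> *; exact: isdcst); try (by move=> *; exact: cts_cst); by [].
Defined.

Definition c2add (a b : c2) : c2.
Proof.
apply: (@C2 (fun x t => fn a x t + fn b x t) (fun x t => f1 a x t + f1 b x t)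
  (fun x t => f2 a x t + f2 b x t) (fun x t => f11 a x t + f11 b x t)
  (fun x t => f22 a x t + f22 b x t)).
- by move=> x t; apply: isdD; exact: c2D1.
- by move=> x t; apply: isdD; exact: c2D2.
- by move=> x t; apply: isdD; exact: c2D11.
- by move=> x t; apply: isdD; exact: c2D22.
- by apply: ctsD; exact: c2C.
- by apply: ctsD; exact: c2C1.
- by apply: ctsD; exact: c2C2.
- by apply: ctsD; exact: c2C11.
- by apply: ctsD; exact: c2C22.
- by move=> x t; rewrite !c2P.
- by move=> x t; rewrite !c2P2.
Defined.

Definition c2mul (a b : c2) : c2.
Proof.
apply: (@C2 (fun x t => fn a x t * fn b x t)
  (fun x t => f1 a x t * fn b x t + fn a x t * f1 b x t)
  (fun x t => f2 a x t * fn b x t + fn a x t * f2 b x t)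
  (fun x t => (f11 a x t * fn b x t + f1 a x t * f1 b x t) + (f1 a x t * f1 b x t + fn a x t * f11 b x t))
  (fun x t => (f22 a x t * fn b x t + f2 a x t * f2 b x t) + (f2 a x t * f2 b x t + fn a x t * f22 b x t))).
- by move=> x t; apply: isdM; exact: c2D1.
- by move=> x t; apply: isdM; exact: c2D2.
- by move=> x t; apply: isdD; apply: isdM; try exact: c2D11; exact: c2D1.
- by move=> x t; apply: isdD; apply: isdM; try exact: c2D22; exact: c2D2.
- by apply: ctsM; exact: c2C.
- by apply: ctsD; apply: ctsM; try exact: c2C; exact: c2C1.
- by apply: ctsD; apply: ctsM; try exact: c2C; exact: c2C2.
- by apply: ctsD; apply: ctsD; apply: ctsM; try exact: c2C; try exact: c2C1; exact: c2C11.
- by apply: ctsD; apply: ctsD; apply: ctsM; try exact: c2C; try exact: c2C2; exact: c2C22.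
- by move=> x t; rewrite !c2P.
- by move=> x t; rewrite !c2P2 !c2P.
Defined.

Lemma cont2_powR (a : c2) (a0 : forall x t : R, 0 < fn a x t) r : cont2 (fun x t => fn a x t `^ r).
Proof. by apply: cts_powR; [move=> z; exact: a0|exact: c2C]. Qed.

(** A positive base admits every real exponent. For [|p|^2], which may vanish, a positive constant
    is added first ([abs2e]). *)
Definition c2pow (s : R) (a : c2) (a0 : forall x t : R, 0 < fn a x t) : c2.
Proof.
apply: (@C2 (fun x t => fn a x t `^ s)
  (fun x t => s * (fn a x t `^ (s - 1) * f1 a x t))
  (fun x t => s * (fn a x t `^ (s - 1) * f2 a x t))
  (fun x t => s * ((s - 1) * fn a x t `^ (s - 1 - 1) * f1 a x t * f1 a x t + fn a x t `^ (s - 1) * f11 a x t))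
  (fun x t => s * ((s - 1) * fn a x t `^ (s - 1 - 1) * f2 a x t * f2 a x t + fn a x t `^ (s - 1) * f22 a x t))).
- move=> x t; rewrite mulrA; apply: (isdcomp (f := fun y => y `^ s)); last exact: c2D1.
  exact: is_derive1_powR.
- move=> x t; rewrite mulrA; apply: (isdcomp (f := fun y => y `^ s)); last exact: c2D2.
  exact: is_derive1_powR.
- move=> x t; apply: (isdE (isdM (isdcst s x) (isdM (isdcomp (g := (fn a)^~ t) (is_derive1_powR (s - 1) (a0 x t))
    (c2D1 a x t)) (c2D11 a x t)))).
  by rewrite mul0r add0r.
- move=> x t; apply: (isdE (isdM (isdcst s t) (isdM (isdcomp (g := fn a x) (is_derive1_powR (s - 1) (a0 x t))
    (c2D2 a x t)) (c2D22 a x t)))).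
  by rewrite mul0r add0r.
- exact: cont2_powR.
- by apply: ctsM; [exact: cts_cst|apply: ctsM; [exact: cont2_powR|exact: c2C1]].
- by apply: ctsM; [exact: cts_cst|apply: ctsM; [exact: cont2_powR|exact: c2C2]].
- apply: ctsM; first exact: cts_cst; apply: ctsD; apply: ctsM.
  + apply: ctsM; last exact: c2C1; apply: ctsM; last exact: cont2_powR; exact: cts_cst.
  + exact: c2C1.
  + exact: cont2_powR.
  + exact: c2C11.
- apply: ctsM; first exact: cts_cst; apply: ctsD; apply: ctsM.
  + apply: ctsM; last exact: c2C2; apply: ctsM; last exact: cont2_powR; exact: cts_cst.
  + exact: c2C2.
  + exact: cont2_powR.
  + exact: c2C22.
- by move=> x t; rewrite !c2P.
- by move=> x t; rewrite !c2P2 !c2P.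
Defined.

(** * Polynomials in polar coordinates [z = e^(x + i t)] *)

Definition cis (t : R) : R[i] := (cos t +i* sin t)%C.
Definition zz (x t : R) : R[i] := ((expR x * cos t) +i* (expR x * sin t))%C.
(** The Euler operator [z d/dz]. On [p(e^(x + i t))] it is the derivative in [x], and [i] times it
    is the derivative in [t], so iterating this one operator yields all the partial derivatives. *)
Definition pdx (p : {poly R[i]}) := 'X * p^`().
Definition rp (p : {poly R[i]}) x t := complex.Re p.[zz x t].
Definition ip (p : {poly R[i]}) x t := complex.Im p.[zz x t].

Lemma ReM (u v : R[i]) : complex.Re (u * v) = complex.Re u * complex.Re v - complex.Im u * complex.Im v.
Proof. by case: u v => [a b] [c d]. Qed.
Lemma ImM (u v : R[i]) : complex.Im (u * v) = complex.Re u * complex.Im v + complex.Im u * complex.Re v.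
Proof. by case: u v => [a b] [c d]. Qed.
Lemma ReD (u v : R[i]) : complex.Re (u + v) = complex.Re u + complex.Re v.
Proof. by case: u v => [a b] [c d]. Qed.
Lemma ImD (u v : R[i]) : complex.Im (u + v) = complex.Im u + complex.Im v.
Proof. by case: u v => [a b] [c d]. Qed.

Lemma dzz1r (x t : R) : is_derive x 1 (fun x => expR x * cos t) (expR x * cos t).
Proof.
by apply: (isdE (isdM (is_derive_expR x) (isdcst _ x))); rewrite mulr0 addr0.
Qed.
Lemma dzz1i (x t : R) : is_derive x 1 (fun x => expR x * sin t) (expR x * sin t).
Proof.
by apply: (isdE (isdM (is_derive_expR x) (isdcst _ x))); rewrite mulr0 addr0.
Qed.
Lemma dzz2r (x t : R) : is_derive t 1 (fun t => expR x * cos t) (- (expR x * sin t)).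
Proof.
by apply: (isdE (isdM (isdcst _ t) (is_derive_cos t))); rewrite mul0r add0r mulrN.
Qed.
Lemma dzz2i (x t : R) : is_derive t 1 (fun t => expR x * sin t) (expR x * cos t).
Proof.
by apply: (isdE (isdM (isdcst _ t) (is_derive_sin t))); rewrite mul0r add0r.
Qed.

Lemma rp_ip_derive1 p (x t : R) :
  is_derive x 1 (fun x => rp p x t) (rp (pdx p) x t) /\
  is_derive x 1 (fun x => ip p x t) (ip (pdx p) x t).
Proof.
rewrite /rp /ip /pdx; elim/poly_ind: p => [|p c [IHr IHi]].
  by rewrite deriv0 mulr0; split; (under eq_fun do rewrite horner0); rewrite horner0; exact: isdcst.
split; (under eq_fun do rewrite hornerD hornerM hornerX hornerC (ReD, ImD) (ReM, ImM)).
  apply: (isdE (isdD (isdB (isdM IHr (dzz1r x t)) (isdM IHi (dzz1i x t))) (isdcst _ x))).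
  rewrite derivD derivM derivX derivC mulr1 !(horner0, hornerD, hornerM, hornerX, ReD, ReM, ImM, ImD)/=; ring.
apply: (isdE (isdD (isdD (isdM IHr (dzz1i x t)) (isdM IHi (dzz1r x t))) (isdcst _ x))).
rewrite derivD derivM derivX derivC mulr1 !(horner0, hornerD, hornerM, hornerX, ReD, ReM, ImM, ImD)/=; ring.
Qed.

Lemma rp_ip_derive2 p (x t : R) :
  is_derive t 1 (rp p x) (- ip (pdx p) x t) /\
  is_derive t 1 (ip p x) (rp (pdx p) x t).
Proof.
rewrite /rp /ip /pdx; elim/poly_ind: p => [|p c [IHr IHi]].
  by rewrite deriv0 mulr0; split; (under eq_fun do rewrite horner0); rewrite horner0/= ?oppr0; exact: isdcst.
split; (under eq_fun do rewrite hornerD hornerM hornerX hornerC (ReD, ImD) (ReM, ImM)).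
  apply: (isdE (isdD (isdB (isdM IHr (dzz2r x t)) (isdM IHi (dzz2i x t))) (isdcst _ t))).
  rewrite derivD derivM derivX derivC mulr1 !(horner0, hornerD, hornerM, hornerX, ReD, ReM, ImM, ImD)/=; ring.
apply: (isdE (isdD (isdD (isdM IHr (dzz2i x t)) (isdM IHi (dzz2r x t))) (isdcst _ t))).
rewrite derivD derivM derivX derivC mulr1 !(horner0, hornerD, hornerM, hornerX, ReD, ReM, ImM, ImD)/=; ring.
Qed.

Lemma cont2_rp_ip p : cont2 (rp p) /\ cont2 (ip p).
Proof.
have cr : cont2 (fun x t => expR x * cos t).
  apply: ctsM; [apply: cts_fst; exact: continuous_expR|apply: cts_snd; exact: continuous_cos].
have ci : cont2 (fun x t => expR x * sin t).
  apply: ctsM; [apply: cts_fst; exact: continuous_expR|apply: cts_snd; exact: continuous_sin].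
rewrite /rp /ip /cont2; elim/poly_ind: p => [|p c [IHr IHi]].
  split; (under eq_fun do rewrite horner0); exact: cts_cst.
split; (under eq_fun do rewrite hornerD hornerM hornerX hornerC (ReD, ImD) (ReM, ImM)).
  by apply: ctsD; [apply: ctsB; apply: ctsM|exact: cts_cst].
by apply: ctsD; [apply: ctsD; apply: ctsM|exact: cts_cst].
Qed.

Lemma zzP (x t : R) : zz x (t + pi *+ 2) = zz x t.
Proof. by rewrite /zz cosD2pi sinD2pi. Qed.

Lemma rpP p (x t : R) : rp p x (t + pi *+ 2) = rp p x t.
Proof. by rewrite /rp zzP. Qed.
Lemma ipP p (x t : R) : ip p x (t + pi *+ 2) = ip p x t.
Proof. by rewrite /ip zzP. Qed.

Definition c2re (p : {poly R[i]}) : c2.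
Proof.
apply: (@C2 (rp p) (rp (pdx p)) (fun x t => - ip (pdx p) x t) (rp (pdx (pdx p)))
  (fun x t => - rp (pdx (pdx p)) x t)).
- by move=> x t; have [] := rp_ip_derive1 p x t.
- by move=> x t; have [] := rp_ip_derive2 p x t.
- by move=> x t; have [] := rp_ip_derive1 (pdx p) x t.
- by move=> x t; apply: isdN; have [] := rp_ip_derive2 (pdx p) x t.
- by have [] := cont2_rp_ip p.
- by have [] := cont2_rp_ip (pdx p).
- by apply: ctsN; have [] := cont2_rp_ip (pdx p).
- by have [] := cont2_rp_ip (pdx (pdx p)).
- by apply: ctsN; have [] := cont2_rp_ip (pdx (pdx p)).
- exact: rpP.
- by move=> x t; rewrite ipP.
Defined.

Definition c2im (p : {poly R[i]}) : c2.
Proof.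
apply: (@C2 (ip p) (ip (pdx p)) (rp (pdx p)) (ip (pdx (pdx p)))
  (fun x t => - ip (pdx (pdx p)) x t)).
- by move=> x t; have [] := rp_ip_derive1 p x t.
- by move=> x t; have [] := rp_ip_derive2 p x t.
- by move=> x t; have [] := rp_ip_derive1 (pdx p) x t.
- by move=> x t; have [] := rp_ip_derive2 (pdx p) x t.
- by have [] := cont2_rp_ip p.
- by have [] := cont2_rp_ip (pdx p).
- by have [] := cont2_rp_ip (pdx p).
- by have [] := cont2_rp_ip (pdx (pdx p)).
- by apply: ctsN; have [] := cont2_rp_ip (pdx (pdx p)).
- exact: ipP.
- by move=> x t; rewrite rpP.
Defined.

(* [|p|^2], whose Laplacian is [4 |p_x|^2] *)
Definition c2abs2 (p : {poly R[i]}) : c2 := c2add (c2mul (c2re p) (c2re p)) (c2mul (c2im p) (c2im p)).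

Definition a2 (p : {poly R[i]}) x t : R := rp p x t ^+ 2 + ip p x t ^+ 2.

Lemma fn_abs2 p (x t : R) : fn (c2abs2 p) x t = a2 p x t.
Proof. by rewrite /= /a2 !expr2. Qed.

Lemma lap_abs2 p (x t : R) : lap (c2abs2 p) x t = 4 * a2 (pdx p) x t.
Proof. by rewrite /lap /= /a2; ring. Qed.

(** An equality, by the Cauchy-Riemann equations. Together with [lap_abs2] it leaves exactly
    [4 s^2 |p|^(2s-2) |p_x|^2] as the Laplacian of [|p|^(2s)] away from zeros, nonnegative for every
    [s > 0]. *)
Lemma grad_abs2 p (x t : R) : f1 (c2abs2 p) x t ^+ 2 + f2 (c2abs2 p) x t ^+ 2 = 4 * a2 p x t * a2 (pdx p) x t.
Proof. by rewrite /= /a2; ring. Qed.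

Lemma lap_re p (x t : R) : lap (c2re p) x t = 0.
Proof. by rewrite /lap/= subrr. Qed.

End C2.

(** * Poisson integrals and subharmonic functions on the disc *)

Section CircleMean.
Variable R : realType.
Implicit Types (f g : R -> R).
Local Notation tau := (pi *+ 2 : R).

Definition per f := forall t, f (t + tau) = f t.

Lemma tau_gt0 : 0 < tau.
Proof. by rewrite mulrn_wgt0// pi_gt0. Qed.

Lemma cint_cat a b c f : continuous f -> a <= b -> b <= c ->
  cint a b f + cint b c f = cint a c f.
Proof.
move=> cf ab bc; rewrite /cint.
have E := @Rintegral_itvB R f (BLeft a) (BRight c) b (cint_int _ _ cf) _ _.
rewrite -(@Rintegral_itv_obnd_cbnd R b (BRight c) f); last first.
  apply: integrableS (cint_int b c cf) => //; apply: subset_itvr; by rewrite bnd_simp.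
by rewrite -E// addrC subrK.
Qed.

Lemma cint_shift f s a b : continuous f -> a <= b -> cint a b (fun t => f (t + s)) = cint (a + s) (b + s) f.
Proof.
(* The primitive lives on a slightly larger interval, so that it is differentiable at the endpoints
   of the given one too. *)
move=> cf ab; set A := a + s - 1; set B := b + s + 1.
have cfs : continuous (fun t => f (t + s)).
  by apply: (cts_comp (h := f) (f := fun t => t + s)) => //; apply: ctsD; [exact: cts_id|exact: cts_cst].
have dF (x : R) : A < x < B -> is_derive x 1 (fun x => cint A x f) (f x).
  move=> /andP[Ax xB].
  have [] := @continuous_FTC1_closed R f A x B xB (cint_int _ _ cf) Ax (cf x) => d1 d2.
  by rewrite -d2 derive1E; exact: DeriveDef.
have -> : cint a b (fun t => f (t + s)) = cint A (b + s) f - cint A (a + s) f.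
  apply: (@cint_FTC _ a b (fun t => f (t + s)) (fun t => cint A (t + s) f)) => // x /andP[ax xb].
  rewrite -[X in is_derive _ _ _ X]mulr1.
  apply: (isdcomp (g := fun t => t + s) (dF _ _)).
    by rewrite /A /B; apply/andP; split; lra.
  by apply: (isdE (isdD (isdid x) (isdcst s x))); rewrite addr0.
by rewrite -(@cint_cat A (a + s) (b + s))// ?[cint A _ _ + _]addrC ?addrK// /A; lra.
Qed.

Definition cm f : R := tau^-1 * cint 0 tau f.

Lemma cmD f g : continuous f -> continuous g -> cm (fun x => f x + g x) = cm f + cm g.
Proof. by move=> cf cg; rewrite /cm cintD// mulrDr. Qed.
Lemma cmZ k f : continuous f -> cm (fun x => k * f x) = k * cm f.
Proof. by move=> cf; rewrite /cm cintZ// mulrCA. Qed.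
Lemma cmZr k f : continuous f -> cm (fun x => f x * k) = cm f * k.
Proof. by move=> cf; rewrite mulrC -cmZ//; congr cm; apply/funext => x; rewrite mulrC. Qed.
Lemma cmB f g : continuous f -> continuous g -> cm (fun x => f x - g x) = cm f - cm g.
Proof.
move=> cf cg; rewrite (_ : (fun x => _) = (fun x => f x + (-1) * g x)).
  by rewrite cmD// ?cmZ ?mulN1r//; apply: ctsM => //; exact: cts_cst.
by apply/funext => x; rewrite mulN1r.
Qed.
Lemma le_cm f g : continuous f -> continuous g -> (forall x, f x <= g x) -> cm f <= cm g.
Proof.
move=> cf cg fg; apply: ler_wpM2l; first by rewrite invr_ge0 ltW// tau_gt0.
by apply: le_cint => // x _; exact: fg.
Qed.
Lemma cm_ge0 f : (forall x, 0 <= f x) -> 0 <= cm f.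
Proof.
move=> f0; apply: mulr_ge0; first by rewrite invr_ge0 ltW// tau_gt0.
by apply: cint_ge0.
Qed.
Lemma cm_cst k : cm (fun=> k) = k.
Proof.
rewrite /cm cint_cst; last by rewrite ltW// tau_gt0.
by rewrite subr0 mulrCA mulVf ?mulr1// gt_eqF// tau_gt0.
Qed.
Lemma cm_norm f : continuous f -> `|cm f| <= cm (fun x => `|f x|).
Proof.
move=> cf; have cn : continuous (fun x => `|f x|) by apply: cts_comp => // x; exact: norm_continuous.
rewrite ler_norml -mulN1r -cmZ//; apply/andP; split; apply: le_cm => //.
- by apply: ctsM => //; exact: cts_cst.
- by move=> x; rewrite mulN1r lerNl -normrN ler_norm.
- by move=> x; exact: ler_norm.
Qed.
Lemma cm_sum n (F : 'I_n -> R -> R) : (forall i, continuous (F i)) ->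
  cm (fun t => \sum_(i < n) F i t) = \sum_(i < n) cm (F i).
Proof.
elim: n F => [|n IH] F cF.
  by under eq_fun do rewrite big_ord0; rewrite cm_cst big_ord0.
rewrite big_ord_recr/= -IH// -cmD//.
  by congr cm; apply/funext => t; rewrite big_ord_recr.
have -> : (fun x => \sum_(i < n) F (widen_ord (leqnSn n) i) x) =
  \sum_(i < n) F (widen_ord (leqnSn n) i) by apply/funext => x; rewrite fct_sumE.
by elim/big_ind : _ => [|f g cf cg|i _]; [exact: cts_cst|exact: ctsD|exact: cF].
Qed.

Lemma cm_shift f s : continuous f -> per f -> cm (fun t => f (t + s)) = cm f.
Proof.
move=> cf pf; rewrite /cm; congr (_ * _); rewrite cint_shift ?ltW ?tau_gt0// add0r.
suff : forall a b, a <= b -> cint a (a + tau) f = cint b (b + tau) f.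
  move=> H; rewrite (addrC tau); have [s0|s0] := leP 0 s; first by rewrite -(H 0 s)// add0r.
  by rewrite (H s 0) ?add0r// ltW.
move=> a b ab; have t0 : 0 <= tau by exact: ltW tau_gt0.
have E : cint a b f = cint (a + tau) (b + tau) f.
  by rewrite -cint_shift//; apply: eq_cint => x _; rewrite pf.
have H1 := @cint_cat a (a + tau) (b + tau) f cf; have H2 := @cint_cat a b (b + tau) f cf.
have {}H1 := H1 _ _; have {}H2 := H2 _ _; move: H1 H2; rewrite E => H1 H2.
by have {}H1 := H1 ltac:(lra) ltac:(lra); have {}H2 := H2 ltac:(lra) ltac:(lra); lra.
Qed.

Lemma cm_fubini (F : R * R -> R) : continuous F ->
  cm (fun x => cm (fun y => F (x, y))) = cm (fun y => cm (fun x => F (x, y))).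
Proof.
move=> cF; have cF' : continuous (fun z : R * R => F (z.2, z.1)).
  move=> z; apply: (@continuous_comp _ _ _ (fun z : R * R => (z.2, z.1)) F); last exact: cF.
  by apply: (@continuous_pairing _ _ _ (fun z : R * R => z.2) (fun z : R * R => z.1)) => ?;
    [exact: cvg_snd|exact: cvg_fst].
rewrite /cm cintZ; last exact: cint_continuous.
by rewrite cintZ ?cint_fubini//; exact: (@cint_continuous R (fun z => F (z.2, z.1)) 0 tau cF').
Qed.

Lemma cm_cint (F : R * R -> R) a b : continuous F ->
  cm (fun t => cint a b (fun x => F (x, t))) = cint a b (fun x => cm (fun t => F (x, t))).
Proof.
move=> cF; rewrite /cm cintZ ?cint_fubini//; exact: cint_continuous.
Qed.

Lemma cm_continuous (F : R * R -> R) : continuous F -> continuous (fun x => cm (fun t => F (x, t))).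
Proof. by move=> cF; apply: ctsM; [exact: cts_cst|exact: cint_continuous]. Qed.

End CircleMean.

Section Poisson.
Variable R : realType.
Local Notation tau := (pi *+ 2 : R).
Implicit Types (r t th : R) (psi : R -> R).

Lemma per_int psi (k : int) t : per psi -> psi (t + k%:~R * tau) = psi t.
Proof.
move=> pf; have Hn (n : nat) s : psi (s + n%:R * tau) = psi s.
  by rewrite mulr_natl (periodicn (f := psi)).
case: k => n; first exact: Hn.
by rewrite NegzE mulrNz mulNr -[in RHS](subrK (n.+1%:R * tau) t) Hn.
Qed.

Lemma mod_tau t : exists k : int, 0 <= t + k%:~R * tau <= tau.
Proof.
exists (- Num.floor (t / tau)); have t0 := @tau_gt0 R.
have h1 : ((Num.floor (t / tau))%:~R : R) <= t / tau by exact: floor_le.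
have h2 : t / tau < (Num.floor (t / tau))%:~R + 1 by rewrite -intrD1; exact: floorD1_gt.
rewrite ler_pdivlMr// in h1; rewrite ltr_pdivrMr// in h2.
by rewrite mulrNz mulNr; apply/andP; split; lra.
Qed.

Lemma expzz n (x t : R) : zz x t ^+ n = zz (n%:R * x) (n%:R * t).
Proof.
elim: n => [|n IH]; first by rewrite expr0 !mul0r /zz expR0 cos0 sin0 mulr1 mulr0.
rewrite exprS IH /zz -natr1 !mulrDl !mul1r [n%:R * x + x]addrC [n%:R * t + t]addrC expRD cosD sinD.
by apply/eqP; rewrite eq_complex/=; apply/andP; split; apply/eqP; ring.
Qed.

Lemma rp_sum (p : {poly R[i]}) n x t : (size p <= n)%N -> rp p x t =
  \sum_(k < n) expR (k%:R * x) * (complex.Re p`_k * cos (k%:R * t) - complex.Im p`_k * sin (k%:R * t)).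
Proof.
move=> pn; rewrite /rp (horner_coef_wide _ pn).
rewrite (big_morph _ (@ReD R) (erefl : complex.Re (0 : R[i]) = 0)); apply: eq_bigr => k _.
by rewrite expzz ReM /=; ring.
Qed.

Lemma cts_cosl (a b : R) : continuous (fun t => cos (a * t + b)).
Proof.
apply: cts_comp; first exact: continuous_cos.
by apply: ctsD; [apply: ctsM; [exact: cts_cst|exact: cts_id]|exact: cts_cst].
Qed.
Lemma cts_sinl (a b : R) : continuous (fun t => sin (a * t + b)).
Proof.
apply: cts_comp; first exact: continuous_sin.
by apply: ctsD; [apply: ctsM; [exact: cts_cst|exact: cts_id]|exact: cts_cst].
Qed.

Lemma cts_cosn (a : R) : continuous (fun t => cos (a * t)).
Proof. by have := @cts_cosl a 0; under eq_fun do rewrite addr0. Qed.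
Lemma cts_sinn (a : R) : continuous (fun t => sin (a * t)).
Proof. by have := @cts_sinl a 0; under eq_fun do rewrite addr0. Qed.

Lemma natX_per (n : nat) : n%:R * tau = 0 + tau *+ n.
Proof. by rewrite add0r mulr_natl. Qed.

Lemma cm_cos n : cm (fun t => cos (n.+1%:R * t)) = 0.
Proof.
have n0 : (n.+1%:R : R) != 0 by rewrite pnatr_eq0.
rewrite /cm (_ : cint _ _ _ = 0) ?mulr0//.
have -> : cint 0 tau (fun t => cos (n.+1%:R * t)) =
  n.+1%:R^-1 * sin (n.+1%:R * tau) - n.+1%:R^-1 * sin (n.+1%:R * 0).
  apply: (cint_FTC (F := fun t => n.+1%:R^-1 * sin (n.+1%:R * t))).
  - by rewrite ltW// tau_gt0.
  - exact: cts_cosn.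
  move=> x _; apply: (isdE (isdM (isdcst _ x) (isdcomp (g := fun t => n.+1%:R * t)
    (is_derive_sin _) (isdM (isdcst _ x) (isdid x))))).
  by rewrite !mul0r !add0r mulr1 mulrCA mulVf ?mulr1.
by rewrite natX_per (periodicn (@sinD2pi R)) mulr0 sin0 mulr0 subrr.
Qed.

Lemma cm_sin n : cm (fun t => sin (n.+1%:R * t)) = 0.
Proof.
have n0 : (n.+1%:R : R) != 0 by rewrite pnatr_eq0.
rewrite /cm (_ : cint _ _ _ = 0) ?mulr0//.
have -> : cint 0 tau (fun t => sin (n.+1%:R * t)) =
  n.+1%:R^-1 * - cos (n.+1%:R * tau) - n.+1%:R^-1 * - cos (n.+1%:R * 0).
  apply: (cint_FTC (F := fun t => n.+1%:R^-1 * - cos (n.+1%:R * t))).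
  - by rewrite ltW// tau_gt0.
  - exact: cts_sinn.
  move=> x _; apply: (isdE (isdM (isdcst _ x) (isdN (isdcomp (g := fun t => n.+1%:R * t)
    (is_derive_cos _) (isdM (isdcst _ x) (isdid x)))))).
  by rewrite !mul0r !add0r mulr1 mulNr opprK mulrCA mulVf ?mulr1.
by rewrite natX_per (periodicn (@cosD2pi R)) mulr0 cos0 subrr.
Qed.

(** The Poisson kernel of the unit disc at radius [r], normalised to have circular mean 1
    ([cm_pk1]). *)
Definition pk r t : R := (1 - r ^+ 2) / (1 - 2 * r * cos t + r ^+ 2).

Lemma pkden_gt0 r t : 0 <= r < 1 -> 0 < 1 - 2 * r * cos t + r ^+ 2.
Proof.
move=> /andP[r0 r1]; have := cos_le1 t => c1.
have : 0 < (1 - r) ^+ 2 by rewrite exprn_gt0// subr_gt0.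
by rewrite !expr2; nra.
Qed.

Lemma pk_gt0 r t : 0 <= r < 1 -> 0 < pk r t.
Proof.
move=> r01; rewrite divr_gt0 ?pkden_gt0//.
by case/andP: r01 => r0 r1; rewrite subr_gt0 expr_lt1.
Qed.
Lemma pk_ge0 r t : 0 <= r < 1 -> 0 <= pk r t.
Proof. by move/(pk_gt0 t)/ltW. Qed.

Lemma pk_cts r : 0 <= r < 1 -> continuous (pk r).
Proof.
move=> r01 t; apply: cvgM; first exact: cvg_cst.
apply: cvgV; first by rewrite gt_eqF// pkden_gt0.
apply: cvgD; last exact: cvg_cst.
apply: cvgB; first exact: cvg_cst.
by apply: cvgM; [exact: cvg_cst|exact: continuous_cos].
Qed.

Lemma pk_per r : per (pk r).
Proof. by move=> t; rewrite /pk cosD2pi. Qed.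

Lemma pkN r t : pk r (- t) = pk r t.
Proof. by rewrite /pk cosN. Qed.

Lemma pk_le r t : 0 <= r < 1 -> pk r t <= (1 + r) / (1 - r).
Proof.
move=> r01; have d0 := pkden_gt0 t r01; case/andP: r01 => r0 r1.
rewrite ler_pdivrMr// mulrAC ler_pdivlMr ?subr_gt0//.
by have := cos_le1 t => c1; rewrite !expr2; nra.
Qed.

Lemma pk_lower r t : 0 <= r < 1 -> (1 - r) / (1 + r) <= pk r t.
Proof.
move=> r01; have d0 := pkden_gt0 t r01; case/andP: r01 => r0 r1.
have p0 : 0 < 1 + r by rewrite ltr_pwDl.
rewrite ler_pdivlMr// mulrAC ler_pdivrMr//.
have c1 : 0 <= 1 + cos t by rewrite -lerBlDl sub0r cos_geN1.
have r2 : 0 <= 1 - r by rewrite subr_ge0 ltW.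
rewrite !expr2.
have : 0 <= r * (1 + cos t) * (1 - r) by rewrite !mulr_ge0.
by nra.
Qed.

Section recurrence.
Variables (r : R) (r01 : 0 < r < 1).

Let r01' : 0 <= r < 1. Proof. by case/andP: r01 => /ltW -> ->. Qed.

(** The solutions are combinations of [r^n] and [r^(-n)]; boundedness excludes the second, because
    [r^n (e (n+1) - r e n)] is constant in [n] and tends to 0. This gives the Fourier coefficients
    of the Poisson kernel without summing a series. *)
Lemma bounded_recurrence (e : nat -> R) (M : R) : (forall n, `|e n| <= M) ->
  (forall n, r * (e n.+2 + e n) = (1 + r ^+ 2) * e n.+1) -> forall n, e n = r ^+ n * e 0.
Proof.
case/andP: r01 => r0 r1; move=> eM er.
have H n : r ^+ n * (e n.+1 - r * e n) = e 1 - r * e 0.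
  elim: n => [|n IH]; first by rewrite expr0 mul1r.
  rewrite -IH exprSr -mulrA; congr (_ * _).
  by have := er n; rewrite expr2 => E; lra.
have d0 : e 1 - r * e 0 = 0.
  apply/eqP/negPn/negP => d0.
  have : r ^+ n @[n --> \oo] --> 0 by apply: cvg_expr; rewrite ger0_norm ?ltW.
  have M0 : 0 <= M by apply: le_trans (eM 0).
  move/cvgrPdist_lt => /(_ (`|e 1 - r * e 0| / (2 * M + 1))) [].
    by rewrite divr_gt0 ?normr_gt0//; lra.
  move=> N _ /(_ N (leqnn N)) /=; rewrite sub0r normrN ger0_norm ?exprn_ge0 ?ltW//.
  rewrite ltr_pdivlMr; last by lra.
  rewrite -(H N) normrM ger0_norm ?exprn_ge0 ?ltW//.
  rewrite ltr_pM2l ?exprn_gt0// ltNge => /negP; apply.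
  have h1 := eM N.+1; have h2 := eM N.
  apply: le_trans (ler_normB _ _) _; rewrite normrM (gtr0_norm r0).
  have := normr_ge0 (e N); nra.
elim=> [|n IH]; first by rewrite expr0 mul1r.
have := H n; rewrite d0 => /eqP; rewrite mulf_eq0 expf_eq0 (gt_eqF r0) andbF/= subr_eq0 => /eqP ->.
by rewrite IH exprS mulrA.
Qed.

Let cpk := pk_cts r01'.

Lemma cm_pk_kernel f : continuous f -> cm (fun t => pk r t * ((1 + r ^+ 2) * f t - 2 * r * (cos t * f t))) = (1 - r ^+ 2) * cm f.
Proof.
move=> cf; rewrite -cmZ//; congr cm; apply/funext => t.
have := pkden_gt0 t r01'; rewrite /pk => d0.
by field; rewrite gt_eqF.
Qed.

(** Multiplying the kernel by its denominator leaves the constant [1 - r^2], so a function of mean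
    zero yields a linear relation between three coefficients. For cosines and sines it is the
    recurrence above. *)
Lemma cm_pk_rec f g h : continuous f -> continuous g -> continuous h -> cm f = 0 ->
  (forall t, 2 * cos t * f t = g t + h t) ->
  r * (cm (fun t => pk r t * g t) + cm (fun t => pk r t * h t)) = (1 + r ^+ 2) * cm (fun t => pk r t * f t).
Proof.
move=> cf cg ch f0 fgh; have := cm_pk_kernel cf; rewrite f0 mulr0.
have -> : (fun t => pk r t * ((1 + r ^+ 2) * f t - 2 * r * (cos t * f t))) =
  (fun t => (1 + r ^+ 2) * (pk r t * f t) - r * (pk r t * g t + pk r t * h t)).
  apply/funext => t; have := fgh t => E.
  have -> : 2 * r * (cos t * f t) = r * (g t + h t) by rewrite -E; ring.
  by ring.
have c1 : continuous (fun t => pk r t * f t) by apply: ctsM.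
have c2 : continuous (fun t => pk r t * g t) by apply: ctsM.
have c3 : continuous (fun t => pk r t * h t) by apply: ctsM.
rewrite cmB; last 2 first.
- by apply: ctsM => //; exact: cts_cst.
- by apply: ctsM; [exact: cts_cst|apply: ctsD].
rewrite !cmZ//; last by apply: ctsD.
by rewrite cmD// => /eqP; rewrite subr_eq0 => /eqP ->.
Qed.

Lemma cm_pk_le f : continuous f -> (forall t, `|f t| <= 1) -> `|cm (fun t => pk r t * f t)| <= cm (pk r).
Proof.
move=> cf f1; apply: le_trans (cm_norm _) _; first by apply: ctsM.
apply: le_cm => //; first by apply: cts_comp; [move=> ?; exact: norm_continuous|apply: ctsM].
by move=> t; rewrite normrM ger0_norm ?pk_ge0// ler_piMr ?pk_ge0.
Qed.

Lemma cos_rec n t : 2 * cos t * cos (n.+1%:R * t) = cos (n.+2%:R * t) + cos (n%:R * t).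
Proof.
have -> : n.+2%:R * t = n.+1%:R * t + t by rewrite -[n.+2%:R]natr1; ring.
have -> : n%:R * t = n.+1%:R * t - t by rewrite -[n.+1%:R]natr1; ring.
by rewrite cosB cosD; ring.
Qed.

Lemma sin_rec n t : 2 * cos t * sin (n.+1%:R * t) = sin (n.+2%:R * t) + sin (n%:R * t).
Proof.
have -> : n.+2%:R * t = n.+1%:R * t + t by rewrite -[n.+2%:R]natr1; ring.
have -> : n%:R * t = n.+1%:R * t - t by rewrite -[n.+1%:R]natr1; ring.
by rewrite sinB sinD; ring.
Qed.

(** The mean [e 0] is the unknown initial value of the recurrence. It is found from [e 1 = r e 0]
    and the kernel identity for the constant 1, which reads [(1 + r^2) e 0 - 2 r e 1 = 1 - r^2]. *)
Lemma cm_pk1 : cm (pk r) = 1.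
Proof.
have H := @bounded_recurrence (fun n => cm (fun t => pk r t * cos (n%:R * t))) (cm (pk r)).
have {}H : forall n, cm (fun t => pk r t * cos (n%:R * t)) = r ^+ n * cm (fun t => pk r t * cos (0 * t)).
  apply: H => [n|n].
    by apply: cm_pk_le; [exact: cts_cosn|move=> t; rewrite ler_norml cos_geN1 cos_le1].
  by apply: cm_pk_rec; [exact: cts_cosn..|exact: cm_cos|exact: cos_rec].
have E0 : cm (fun t => pk r t * cos (0 * t)) = cm (pk r).
  by congr cm; apply/funext => t; rewrite mul0r cos0 mulr1.
have := H 1; rewrite expr1 E0 => E1.
have : cm (fun t => (1 + r ^+ 2) * pk r t - 2 * r * (pk r t * cos (1 * t))) = 1 - r ^+ 2.
  have H1 := @cm_pk_kernel (fun=> 1) (@cts_cst _ _ _); rewrite cm_cst in H1.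
  by rewrite -[RHS]mulr1 -H1; congr cm; apply/funext => t; rewrite mul1r; ring.
have cc : continuous (fun t => pk r t * cos (1 * t)) by apply: ctsM => //; exact: cts_cosn.
rewrite cmB; last 2 first.
- by apply: ctsM => //; exact: cts_cst.
- by apply: ctsM => //; exact: cts_cst.
have {}E1 : cm (fun t => pk r t * cos (1 * t)) = r * cm (pk r) by exact: E1.
rewrite (cmZ _ cpk) (cmZ _ cc) E1 => E.
have d0 : 0 < 1 - r ^+ 2 by case/andP: r01 => r0 r1; rewrite subr_gt0 expr_lt1// ltW.
by apply: (mulfI (lt0r_neq0 d0)); rewrite mulr1 -[RHS]E expr2; ring.
Qed.

Lemma cm_pk_cos n : cm (fun t => pk r t * cos (n%:R * t)) = r ^+ n.
Proof.
have -> : r ^+ n = r ^+ n * cm (fun t => pk r t * cos (0 * t)).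
  rewrite (_ : (fun t => _) = pk r) ?cm_pk1 ?mulr1//.
  by apply/funext => t; rewrite mul0r cos0 mulr1.
apply: (@bounded_recurrence (fun n => cm (fun t => pk r t * cos (n%:R * t))) (cm (pk r))) => [{}n|{}n].
  by apply: cm_pk_le; [exact: cts_cosn|move=> t; rewrite ler_norml cos_geN1 cos_le1].
by apply: cm_pk_rec; [exact: cts_cosn..|exact: cm_cos|exact: cos_rec].
Qed.

Lemma cm_pk_sin n : cm (fun t => pk r t * sin (n%:R * t)) = 0.
Proof.
have -> : 0 = r ^+ n * cm (fun t => pk r t * sin (0 * t)).
  rewrite (_ : (fun t => _) = fun=> 0) ?cm_cst ?mulr0//.
  by apply/funext => t; rewrite mul0r sin0 mulr0.
apply: (@bounded_recurrence (fun n => cm (fun t => pk r t * sin (n%:R * t))) (cm (pk r))) => [{}n|{}n].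
  by apply: cm_pk_le; [exact: cts_sinn|move=> t; rewrite ler_norml sin_geN1 sin_le1].
by apply: cm_pk_rec; [exact: cts_sinn..|exact: cm_sin|exact: sin_rec].
Qed.

End recurrence.

Definition PI psi r th : R := cm (fun t => pk r (t - th) * psi t).

Lemma cts_pkB r th : 0 <= r < 1 -> continuous (fun t => pk r (t - th)).
Proof.
move=> r01; apply: (cts_comp (h := pk r) (f := fun t => t - th)); first exact: pk_cts.
by apply: ctsB; [exact: cts_id|exact: cts_cst].
Qed.

Lemma PI_shift psi r th : 0 <= r < 1 -> continuous psi -> per psi ->
  PI psi r th = cm (fun t => pk r t * psi (t + th)).
Proof.
move=> r01 cpsi ppsi; rewrite /PI -(@cm_shift _ (fun t => pk r (t - th) * psi t) th).
- by congr cm; apply/funext => t; rewrite addrK.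
- by apply: ctsM => //; exact: cts_pkB.
- by move=> t; rewrite ppsi addrAC pk_per.
Qed.

Lemma rp_cts p (x : R) : continuous (rp p x).
Proof. by have [c _] := cont2_rp_ip p => t; exact: (@continuous_slice1 _ (fun z => rp p z.1 z.2) x c). Qed.

(** Real parts of polynomials are reproduced by the Poisson integral. This is checked on Fourier
    coefficients: the kernel of radius [e^x] multiplies the [k]-th one by [e^(k x)]. *)
Lemma PI_rp (p : {poly R[i]}) x y th : x < 0 -> PI (rp p y) (expR x) th = rp p (x + y) th.
Proof.
move=> x0; have e01 : 0 < expR x < 1 by rewrite expR_gt0 expR_lt1.
have e01' : 0 <= expR x < 1 by rewrite expR_ge0 expR_lt1.
rewrite PI_shift//; [|exact: rp_cts|exact: rpP].
have cpk := pk_cts e01'.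
rewrite (rp_sum _ _ (leqnn (size p))).
pose F (k : 'I_(size p)) t := expR (k%:R * y) *
  ((complex.Re p`_k * cos (k%:R * th) - complex.Im p`_k * sin (k%:R * th)) * (pk (expR x) t * cos (k%:R * t))
   - (complex.Re p`_k * sin (k%:R * th) + complex.Im p`_k * cos (k%:R * th)) * (pk (expR x) t * sin (k%:R * t))).
have cc n : continuous (fun t => pk (expR x) t * cos (n%:R * t)) by apply: ctsM => //; exact: cts_cosn.
have cs n : continuous (fun t => pk (expR x) t * sin (n%:R * t)) by apply: ctsM => //; exact: cts_sinn.
have cz (k : R) (f : R -> R) : continuous f -> continuous (fun t => k * f t) by move=> cf; apply: ctsM => //; exact: cts_cst.
rewrite (_ : (fun t => _) = (fun t => \sum_k F k t)); last first.
  apply/funext => t; rewrite (rp_sum _ _ (leqnn (size p))) mulr_sumr; apply: eq_bigr => k _.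
  by rewrite /F !mulrDr cosD sinD; ring.
rewrite cm_sum; last by move=> k; apply: (cz); apply: ctsB; apply: (cz).
apply: eq_bigr => k _; rewrite /F cmZ; last by apply: ctsB; apply: (cz).
rewrite cmB; [|exact: (cz)|exact: (cz)]; rewrite !cmZ// cm_pk_cos// cm_pk_sin// mulr0 subr0.
by rewrite [k%:R * (x + y)]mulrDr expRD [expR (k%:R * x)]expRM_natl; ring.
Qed.

End Poisson.

(** * Approximation of boundary functions by real parts of polynomials *)

Section Density.
Variable R : realType.
Local Notation tau := (pi *+ 2 : R).
Implicit Types (r t th b : R) (psi : R -> R).

(** Partial sum of the Fourier series of the Poisson kernel. *)
Definition pkJ J r t : R := 1 + \sum_(j < J) 2 * r ^+ j.+1 * cos (j.+1%:R * t).

(** By [cos_rec] the product with the denominator telescopes; the two remaining terms are of size at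
    most [2 r^J] and give the uniform error of [pkJ_approx]. *)
Lemma pkJE J r t : (1 - 2 * r * cos t + r ^+ 2) * pkJ J r t =
  1 - r ^+ 2 - 2 * r ^+ J.+1 * cos (J.+1%:R * t) + 2 * r ^+ J.+2 * cos (J%:R * t).
Proof.
rewrite /pkJ; elim: J => [|J IH].
  by rewrite big_ord0 mul0r cos0 mul1r expr1; ring.
rewrite big_ord_recr/= addrA mulrDr IH.
have E := cos_rec J t.
have -> : (1 - 2 * r * cos t + r ^+ 2) * (2 * r ^+ J.+1 * cos (J.+1%:R * t)) =
  2 * r ^+ J.+1 * cos (J.+1%:R * t) * (1 + r ^+ 2) - 2 * r ^+ J.+1 * r * (2 * cos t * cos (J.+1%:R * t)) by ring.
by rewrite E !exprS; ring.
Qed.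

Lemma pkJ_approx J r t : 0 <= r < 1 -> `|pkJ J r t - pk r t| <= 4 * r ^+ J / (1 - r) ^+ 2.
Proof.
move=> r01; have d0 := pkden_gt0 t r01; case/andP: r01 => r0 r1.
have -> : pkJ J r t - pk r t = (2 * r ^+ J.+2 * cos (J%:R * t) - 2 * r ^+ J.+1 * cos (J.+1%:R * t)) /
   (1 - 2 * r * cos t + r ^+ 2).
  have -> : pkJ J r t = (1 - 2 * r * cos t + r ^+ 2) * pkJ J r t / (1 - 2 * r * cos t + r ^+ 2).
    by rewrite mulrAC divff ?mul1r// gt_eqF.
  by rewrite pkJE /pk -mulrBl; congr (_ / _); ring.
have h0 : 0 < (1 - r) ^+ 2 by rewrite exprn_gt0// subr_gt0.
rewrite normrM normfV (gtr0_norm d0); apply: ler_pM => //.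
- by rewrite invr_ge0 ltW.
- have c1 : `|cos (J%:R * t)| <= 1 by rewrite ler_norml cos_geN1 cos_le1.
  have c2 : `|cos (J.+1%:R * t)| <= 1 by rewrite ler_norml cos_geN1 cos_le1.
  have rJ : 0 <= r ^+ J by rewrite exprn_ge0.
  apply: le_trans (ler_normB _ _) _.
  rewrite !normrM !(ger0_norm (exprn_ge0 _ r0)) !exprS normr_nat.
  have h1 : r * r ^+ J <= r ^+ J by rewrite ler_piMl// ltW.
  have h2 : r * (r * r ^+ J) <= r ^+ J by rewrite (le_trans _ h1)// ler_piMl ?mulr_ge0// ltW.
  have h3 : 0 <= r * (r * r ^+ J) by rewrite !mulr_ge0.
  have h4 : 0 <= r * r ^+ J by rewrite !mulr_ge0.
  have k1 : r * (r * r ^+ J) * `|cos (J%:R * t)| <= r ^+ J * 1 by rewrite ler_pM.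
  have k2 : r * r ^+ J * `|cos (J.+1%:R * t)| <= r ^+ J * 1 by rewrite ler_pM.
  by rewrite ?(ger0_norm r0) -!mulrA in k1 k2 *; lra.
- rewrite lef_pV2 ?posrE//; have : 0 <= r * (1 - cos t) by rewrite mulr_ge0// subr_ge0 cos_le1.
  by rewrite !expr2; lra.
Qed.

Lemma pkJ_cts J r th : continuous (fun t => pkJ J r (t - th)).
Proof.
apply: ctsD; first exact: cts_cst.
rewrite (_ : (fun _ => _) = \sum_(j < J) (fun t => 2 * r ^+ j.+1 * cos (j.+1%:R * (t - th)))); last first.
  by apply/funext => t; rewrite fct_sumE.
elim/big_ind: _ => [|f g cf cg|j _]; [exact: cts_cst|exact: ctsD|].
apply: ctsM; first exact: cts_cst.
by under eq_fun do rewrite mulrBr; exact: cts_cosl.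
Qed.

Lemma PI_cts_int psi r th : 0 <= r < 1 -> continuous psi -> continuous (fun t => pk r (t - th) * psi t).
Proof. by move=> r01 cpsi; apply: ctsM => //; exact: cts_pkB. Qed.

Lemma cts_norm psi : continuous psi -> continuous (fun t => `|psi t|).
Proof. by move=> c; apply: cts_comp => // x; exact: norm_continuous. Qed.

(** The Fourier coefficients of [psi] damped by [b^k], so that the real part at [e^(x + i t)] is the
    Poisson integral at radius [b e^x] with the kernel truncated at degree [J]. The factor 2 for
    [k > 0] accounts for the frequency [-k]. *)
Definition tpoly b J psi : {poly R[i]} :=
  \poly_(k < J.+1) ((if k == 0%N then 1 else 2) * b ^+ k * cm (fun t => cos (k%:R * t) * psi t)
     +i* - ((if k == 0%N then 1 else 2) * b ^+ k * cm (fun t => sin (k%:R * t) * psi t)))%C.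

Lemma tpolyE b J psi x th : continuous psi ->
  rp (tpoly b J psi) x th = cm (fun t => pkJ J (b * expR x) (t - th) * psi t).
Proof.
move=> cpsi; rewrite (rp_sum _ _ (size_poly _ _)).
have cc k : continuous (fun t => cos (k * t) * psi t) by apply: ctsM => //; exact: cts_cosn.
have cs k : continuous (fun t => sin (k * t) * psi t) by apply: ctsM => //; exact: cts_sinn.
pose F (k : 'I_J.+1) t := (if k == 0%N :> nat then 1 else 2) * (b * expR x) ^+ k *
   (cos (k%:R * th) * (cos (k%:R * t) * psi t) + sin (k%:R * th) * (sin (k%:R * t) * psi t)).
have cz (k : R) (f : R -> R) : continuous f -> continuous (fun t => k * f t).
  by move=> cf; apply: ctsM => //; exact: cts_cst.
rewrite (_ : (fun t => _) = (fun t => \sum_(k < J.+1) F k t)).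
  rewrite cm_sum; last by move=> k; apply: (cz); apply: ctsD; apply: (cz).
  apply: eq_bigr => k _; rewrite /F cmZ; last by apply: ctsD; apply: (cz).
  rewrite cmD; [|exact: (cz)|exact: (cz)]; rewrite !cmZ//.
  by rewrite coef_poly ltn_ord/= expRM_natl exprMn; ring.
apply/funext => t; rewrite big_ord_recl/= /F/= expr0 !mul0r cos0 sin0 /pkJ mulrDl; congr (_ + _).
  by ring.
rewrite mulr_suml; apply: eq_bigr => j _; rewrite /bump/= add1n mulrBr cosB; ring.
Qed.

Lemma tpoly_approx b J psi x th : 0 <= b < 1 -> x <= 0 -> continuous psi ->
  `|rp (tpoly b J psi) x th - PI psi (b * expR x) th| <= 4 * b ^+ J / (1 - b) ^+ 2 * cm (fun t => `|psi t|).
Proof.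
move=> b01 x0 cpsi; have e1 : expR x <= 1 by rewrite -expR0 ler_expR.
have e0 := expR_gt0 x.
case/andP: (b01) => b0 b1.
have be : b * expR x <= b by rewrite ler_piMr.
have be0 : 0 <= b * expR x by rewrite mulr_ge0// ltW.
have be1 : b * expR x < 1 by exact: le_lt_trans be b1.
have be01 : 0 <= b * expR x < 1 by rewrite be0.
rewrite tpolyE// -cmB; last 2 first.
- by apply: ctsM => //; exact: pkJ_cts.
- exact: PI_cts_int.
have cd : continuous (fun t => pkJ J (b * expR x) (t - th) * psi t - pk (b * expR x) (t - th) * psi t).
  by apply: ctsB; [apply: ctsM => //; exact: pkJ_cts|exact: PI_cts_int].
apply: le_trans (cm_norm cd) _; rewrite -cmZ; last exact: cts_norm.
apply: le_cm; [exact: cts_norm|by apply: ctsM; [exact: cts_cst|exact: cts_norm]|].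
move=> t; rewrite -mulrBl normrM ler_wpM2r//.
apply: le_trans (pkJ_approx _ _ be01) _.
apply: ler_pM.
- by rewrite mulr_ge0// exprn_ge0.
- by rewrite invr_ge0 exprn_ge0// subr_ge0 ltW.
- by rewrite ler_pM2l// lerXn2r ?nnegrE.
rewrite lef_pV2 ?posrE ?exprn_gt0 ?subr_gt0//.
by rewrite lerXn2r ?nnegrE ?subr_ge0 ?lerB// ltW.
Qed.

Lemma geo_small (b c e : R) : 0 <= b < 1 -> 0 < e -> exists J, 4 * b ^+ J / (1 - b) ^+ 2 * c <= e.
Proof.
case/andP=> b0 b1 e0.
have h0 : 0 < (1 - b) ^+ 2 by rewrite exprn_gt0// subr_gt0.
have : b ^+ n @[n --> \oo] --> 0 by apply: cvg_expr; rewrite ger0_norm.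
have c0 : 0 < 4 * (`|c| + 1) by rewrite mulr_gt0// ltr_wpDl.
move/cvgrPdist_lt => /(_ (e * (1 - b) ^+ 2 / (4 * (`|c| + 1)))) [].
  by rewrite divr_gt0// mulr_gt0.
move=> N _ /(_ N (leqnn N)) /=; rewrite sub0r normrN ger0_norm ?exprn_ge0//.
rewrite ltr_pdivlMr// => H; exists N.
rewrite mulrAC ler_pdivrMr//; apply: le_trans (ltW H).
have h1 := ler_norm c; have h2 : 0 <= b ^+ N by rewrite exprn_ge0.
by nra.
Qed.

Lemma PI_le psi phi r th : 0 <= r < 1 -> continuous psi -> continuous phi -> (forall t, psi t <= phi t) ->
  PI psi r th <= PI phi r th.
Proof.
move=> r01 c1 c2 h; apply: le_cm; [exact: PI_cts_int..|move=> t].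
by rewrite ler_wpM2l// pk_ge0.
Qed.

Lemma PI_cst k r th : 0 < r < 1 -> PI (fun=> k) r th = k.
Proof.
move=> r01; have r01' : 0 <= r < 1 by case/andP: r01 => /ltW -> ->.
rewrite PI_shift//; last exact: cts_cst.
by rewrite cmZr ?cm_pk1 ?mul1r//; exact: pk_cts.
Qed.

Lemma PID psi phi r th : 0 <= r < 1 -> continuous psi -> continuous phi ->
  PI (fun t => psi t + phi t) r th = PI psi r th + PI phi r th.
Proof.
move=> r01 c1 c2; rewrite /PI -cmD; [|exact: PI_cts_int..].
by congr cm; apply/funext => t; rewrite mulrDr.
Qed.

Lemma PIZ k psi r th : 0 <= r < 1 -> continuous psi ->
  PI (fun t => k * psi t) r th = k * PI psi r th.
Proof.
move=> r01 c1; rewrite /PI -cmZ; last exact: PI_cts_int.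
by congr cm; apply/funext => t; rewrite mulrCA.
Qed.

Lemma PI_cts psi r : 0 <= r < 1 -> continuous psi -> continuous (PI psi r).
Proof.
move=> r01 cpsi; apply: (@cm_continuous _ (fun z => pk r (z.2 - z.1) * psi z.2)).
apply: ctsM; last exact: cts_snd.
apply: (cts_comp (h := pk r) (f := fun z : R * R => z.2 - z.1)); first exact: pk_cts.
by apply: ctsB; [exact: (cts_snd (@cts_id R))|exact: (cts_fst (@cts_id R))].
Qed.

Lemma PI_per psi r : per (PI psi r).
Proof. by move=> t; rewrite /PI; congr cm; apply/funext => s; rewrite opprD addrA -[in LHS]pk_per subrK. Qed.

Lemma PI_ge0 psi r th : 0 <= r < 1 -> (forall t, 0 <= psi t) -> 0 <= PI psi r th.
Proof. by move=> r01 p0; apply: cm_ge0 => t; rewrite mulr_ge0// pk_ge0. Qed.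

Lemma PI_dist psi phi r th e : 0 < r < 1 -> continuous psi -> continuous phi ->
  (forall t, `|psi t - phi t| <= e) -> `|PI psi r th - PI phi r th| <= e.
Proof.
move=> r01 c1 c2 h; have r01' : 0 <= r < 1 by case/andP: r01 => /ltW -> ->.
have H (f g : R -> R) : continuous f -> continuous g -> (forall t, `|f t - g t| <= e) -> PI f r th <= PI g r th + e.
  move=> cf cg fg; rewrite -[X in _ + X](@PI_cst e r th)// -PID//; last exact: cts_cst.
  apply: PI_le => //; first by apply: ctsD => //; exact: cts_cst.
  by move=> t; have := fg t; rewrite ler_norml => /andP[_]; lra.
have h1 := H psi phi c1 c2 h.
have h2 : PI phi r th <= PI psi r th + e by apply: (H) => // t; rewrite distrC.
by rewrite ler_norml; apply/andP; split; lra.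
Qed.

(** For real parts of polynomials this is [PI_rp]. In general [PI psi b] is uniformly within [e / 2]
    of such a function, whose value at radius [a] is in turn within [e / 2] of [PI psi (a b)]. *)
Lemma PI_semigroup psi a b th : 0 < a < 1 -> 0 <= b < 1 -> continuous psi -> per psi ->
  PI (PI psi b) a th = PI psi (a * b) th.
Proof.
move=> a01 b01 cpsi ppsi; apply/eqP; rewrite -subr_eq0 -normr_le0; apply/ler_addgt0Pr => e e0; rewrite add0r.
have e2 : 0 < e / 2 by rewrite divr_gt0.
have [J HJ] := geo_small (cm (fun t => `|psi t|)) b01 e2.
case/andP: (a01) => a0 a1.
have la : ln a < 0 by rewrite ln_lt0.
have H1 := tpoly_approx J th b01 (ltW la) cpsi.
rewrite lnK ?posrE// in H1.
have H2 : `|PI (PI psi b) a th - PI (rp (tpoly b J psi) 0) a th| <= e / 2.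
  apply: PI_dist => //; [exact: PI_cts|exact: rp_cts|move=> t].
  rewrite distrC; have := tpoly_approx J t b01 (lexx 0) cpsi.
  by rewrite expR0 mulr1 => /le_trans; apply.
have := PI_rp (tpoly b J psi) 0 th la; rewrite lnK ?posrE// addr0 => E; rewrite E in H2.
rewrite [a * b]mulrC (le_trans (ler_distD (rp (tpoly b J psi) (ln a) th) _ _))//.
by rewrite [leRHS]splitr lerD// (le_trans H1).
Qed.

(** Uniform continuity in the form used by Korovkin's theorem: differences that are not small occur
    only where [1 - cos] is bounded below. The kernel then has to be tested only against 1 and the
    cosine. *)
Lemma korovkin psi e : continuous psi -> per psi -> 0 < e ->
  exists2 K, 0 <= K & forall t th, `|psi t - psi th| <= e + K * (1 - cos (t - th)).
Proof.
move=> cpsi ppsi e0; have t0 := @tau_gt0 R.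
pose D (z : R * R) := `|psi z.1 - psi z.2|.
have cD : continuous D by apply: cts_comp; [move=> x; exact: norm_continuous|apply: ctsB; [exact: cts_fst|exact: cts_snd]].
pose A : set (R * R) := (`[0, tau] `*` `[0, tau]) `&` [set z | e <= D z].
have cA : compact A.
  apply: (@subclosed_compact _ _ (`[0, tau] `*` `[0, tau])); last by move=> z [].
    apply: closedI; first by apply: compact_closed => //; apply: compact_setX; exact: segment_compact.
    rewrite (_ : [set z | _] = D @^-1` [set x | e <= x])//.
    by apply: closed_comp => //; exact: closed_ge.
  by apply: compact_setX; exact: segment_compact.
(* Periodicity moves both angles into [[0, tau]], where compactness is available; the cosine of
   their difference does not change. *)
have red (P : R -> R -> Prop) : (forall t th, 0 <= t <= tau -> 0 <= th <= tau -> P (psi t - psi th) (cos (t - th))) ->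
    forall t th, P (psi t - psi th) (cos (t - th)).
  move=> H t th; have [k hk] := mod_tau t; have [l hl] := mod_tau th.
  have := H _ _ hk hl; rewrite !(@per_int R psi _ _ ppsi).
  have -> : t + k%:~R * tau - (th + l%:~R * tau) = t - th + (k - l)%:~R * tau by rewrite intrB; ring.
  by rewrite (@per_int R cos)//; exact: cosD2pi.
have [M M0 DM] := @continuous2_bounded _ D 0 tau 0 tau cD.
have [A0|A0] := pselect (A !=set0); last first.
  exists 0 => //; apply: (red (fun x c => `|x| <= e + 0 * (1 - c))) => t th ht hth; rewrite mul0r addr0 leNgt; apply/negP => H.
  by case: A0; exists (t, th); split; [split; rewrite /= in_itv|exact: ltW].
pose G (z : R * R) := 1 - cos (z.1 - z.2).
have cG : continuous G.
  apply: ctsB; first exact: cts_cst.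
  by apply: cts_comp; [exact: continuous_cos|apply: ctsB; [exact: (cts_fst (@cts_id R))|exact: (cts_snd (@cts_id R))]].
have [z /set_mem Az Gz] := compact_EVT_min A0 cA (continuous_subspaceT cG).
(* On the square [1 - cos] vanishes only for angles that differ by 0 or by a full period. There
   [psi] takes equal values, which [A] excludes. *)
have m0 : 0 < G z.
  rewrite lt_neqAle subr_ge0 cos_le1 andbT eq_sym subr_eq0; apply/negP => /eqP c1.
  case: Az => -[/=]; rewrite !in_itv/= => /andP[a1 a2] /andP[b1 b2].
  rewrite leNgt => /negP; apply; rewrite /D.
  set u := z.1 - z.2 in c1; have c2 : cos (`|u| / 2 *+ 2) = 1.
    rewrite -mulr_natr divfK ?pnatr_eq0//.
    by case: (ger0P u) => u0; rewrite ?cosN.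
  have s0 : sin (`|u| / 2) = 0.
    have := cos2Dsin2 (`|u| / 2); rewrite cos_mulr2n in c2 => c3.
    by apply/eqP; rewrite -sqrf_eq0; apply/eqP; rewrite mulr2n in c2; lra.
  have ut : `|u| <= tau by rewrite ler_norml /u; apply/andP; split; lra.
  have [u0|u0] := eqVneq u 0.
    by move/eqP: u0; rewrite subr_eq0 => /eqP ->; rewrite subrr normr0.
  have up : 0 < `|u| by rewrite normr_gt0.
  have [ult|] := ltP `|u| tau.
    have : 0 < sin (`|u| / 2) by apply: sin_gt0_pi; rewrite divr_gt0//= ltr_pdivrMr// mulr_natr.
    by rewrite s0 ltxx.
  move=> ule; have {ule ut} : `|u| = tau by apply/eqP; rewrite eq_le ut.
  case: (ger0P u) => u1 uE.
    have -> : z.1 = z.2 + tau by rewrite -uE /u; ring.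
    by rewrite ppsi subrr normr0.
  have -> : z.2 = z.1 + tau by rewrite -uE /u; ring.
  by rewrite ppsi subrr normr0.
exists (M / G z); first by rewrite divr_ge0// ltW.
apply: (red (fun x c => `|x| <= e + M / G z * (1 - c))) => t th ht hth; have [h|h] := leP e `|psi t - psi th|; last first.
  have h1 : 0 <= M / G z by rewrite divr_ge0// ltW.
  have h2 : 0 <= 1 - cos (t - th) by rewrite subr_ge0 cos_le1.
  by apply: (le_trans (ltW h)); rewrite lerDl mulr_ge0.
have /Gz hG : (t, th) \in A by rewrite inE; split; [split; rewrite /= in_itv|].
have hM : `|psi t - psi th| <= M.
  by have := DM t th ht hth; rewrite /D/= normr_id.
apply: (le_trans hM); apply: (@le_trans _ _ (M / G z * (1 - cos (t - th)))); last by rewrite lerDr ltW.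
by rewrite mulrAC ler_pdivlMr// ler_pM2l.
Qed.

Lemma PI_approx_id psi e : continuous psi -> per psi -> 0 < e ->
  exists2 b, 0 < b < 1 & forall r th, b <= r < 1 -> `|PI psi r th - psi th| <= e.
Proof.
move=> cpsi ppsi e0; have e2 : 0 < e / 2 by rewrite divr_gt0.
have [K K0 HK] := korovkin cpsi ppsi e2.
have K1 : 0 < 2 * (K + 1) + e by rewrite ltr_wpDl// mulr_ge0// addr_ge0.
have K2 : 0 < 2 * (K + 1) by rewrite mulr_gt0// ltr_wpDl.
(* The error turns out to be at most [e / 2 + K (1 - r)], by [cm_pk_cos]; this radius makes the
   second term at most [e / 2]. *)
exists (2 * (K + 1) / (2 * (K + 1) + e)).
  by rewrite divr_gt0//= ltr_pdivrMr// mul1r ltrDl.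
move=> r th /andP[br r1]; have r0 : 0 < r by rewrite (lt_le_trans _ br)// divr_gt0.
have r01 : 0 < r < 1 by rewrite r0.
have r01' : 0 <= r < 1 by rewrite ltW.
have cp := pk_cts r01'.
have cpsi' : continuous (fun t => psi (t + th)) by apply: (cts_comp (h := psi) (f := fun t => t + th)) => //; apply: ctsD; [exact: cts_id|exact: cts_cst].
have cpp : continuous (fun t => pk r t * psi (t + th)) by apply: ctsM.
have cpc : continuous (fun t => pk r t * psi th) by apply: ctsM => //; exact: cts_cst.
rewrite PI_shift// -[X in _ - X]mul1r -(cm_pk1 r01) -cmZr// -cmB//.
have cc : continuous (fun t => pk r t * cos (1%:R * t)) by apply: ctsM => //; exact: cts_cosn.
apply: (@le_trans _ _ (cm (fun t => (e / 2 + K) * pk r t - K * (pk r t * cos (1%:R * t))))).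
  apply: le_trans (cm_norm _) _; first exact: ctsB.
  apply: le_cm; first by apply: cts_norm; exact: ctsB.
    by apply: ctsB; apply: ctsM => //; exact: cts_cst.
  move=> t; rewrite -mulrBr normrM ger0_norm ?pk_ge0//.
  have := HK (t + th) th; rewrite addrK mul1r => h.
  have -> : (e / 2 + K) * pk r t - K * (pk r t * cos t) = pk r t * (e / 2 + K * (1 - cos t)) by ring.
  by rewrite ler_wpM2l// pk_ge0.
rewrite cmB; [|by apply: ctsM => //; exact: cts_cst..].
rewrite (cmZ _ cp) (cmZ _ cc) (cm_pk_cos r01) cm_pk1// expr1.
have : K * (1 - r) <= e / 2.
  move: br; rewrite ler_pdivrMr// => br.
  by rewrite ler_pdivlMr//; nra.
by lra.
Qed.

Lemma rp_dense psi e : continuous psi -> per psi -> 0 < e ->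
  exists p : {poly R[i]}, forall t, `|rp p 0 t - psi t| <= e.
Proof.
move=> cpsi ppsi e0; have e2 : 0 < e / 2 by rewrite divr_gt0.
have [b b01 Hb] := PI_approx_id cpsi ppsi e2.
have b01' : 0 <= b < 1 by case/andP: b01 => /ltW -> ->.
have [J HJ] := geo_small (cm (fun t => `|psi t|)) b01' e2.
exists (tpoly b J psi) => t.
rewrite (le_trans (ler_distD (PI psi b t) _ _))// [leRHS]splitr lerD//.
  have := tpoly_approx J t b01' (lexx 0) cpsi; rewrite expR0 mulr1 => /le_trans; exact.
by apply: Hb; rewrite lexx; case/andP: b01.
Qed.

End Density.

(** * Maximum principle and subharmonic powers *)

Section MaxPrinciple.
Variable R : realType.
Local Notation tau := (pi *+ 2 : R).

Lemma second_derivative_test (f g : R -> R) (a b c d : R) : (forall x : R, is_derive x 1 f (g x)) ->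
  is_derive c 1 g d -> a < c < b -> (forall x, a < x < b -> f x <= f c) -> d <= 0.
Proof.
move=> df dg /andP[ac cb] fc; have ab : a <= b by rewrite ltW// (lt_trans ac).
have gc : g c = 0.
  have D0 : is_derive c 1 f 0.
    apply: (@derive1_at_max _ f a b c ab).
    - by move=> t _; have := df t => -[].
    - by rewrite in_itv/= ac.
    - by move=> t; rewrite in_itv/= => /fc.
  by rewrite -(@derive_val _ _ _ _ _ _ _ (df c)) (@derive_val _ _ _ _ _ _ _ D0).
rewrite leNgt; apply/negP => d0.
have [e e0 He] : exists2 e, 0 < e & forall h, 0 < h < e -> 0 < g (c + h).
  have dgv := @ex_derive _ _ _ _ _ _ _ dg.
  have : h^-1 *: ((g \o shift c) (h *: 1) - g c) @[h --> 0^'] --> d.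
    by rewrite -(@derive_val _ _ _ _ _ _ _ dg); exact: dgv.
  move=> /cvgr_gt/(_ 0 d0) [e /= e0 He]; exists e => // h /andP[h0 he].
  have /(_ _ _)/= := He h; rewrite sub0r normrN gtr0_norm// => /(_ he (lt0r_neq0 h0)).
  by rewrite gc subr0 /GRing.scale/= mulr1 pmulr_rgt0 ?invr_gt0// addrC.
pose y := c + Num.min e (b - c) / 2.
have m0 : 0 < Num.min e (b - c) by rewrite lt_min e0 subr_gt0.
have cy : c < y by rewrite /y ltrDl divr_gt0.
have m1 : Num.min e (b - c) <= e by rewrite ge_min lexx.
have m2 : Num.min e (b - c) <= b - c by rewrite ge_min lexx orbT.
have [z] := @MVT R f g c y cy (fun x _ => df x) (continuous_subspaceT (isd_cont df)).
rewrite in_itv/= => /andP[cz zy] E.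
have gz : 0 < g z.
  have -> : z = c + (z - c) by ring.
  by apply: He; rewrite subr_gt0 cz/=; move: zy; rewrite /y; lra.
have : f y <= f c by apply: fc; rewrite (lt_trans ac cy)/= /y; lra.
by rewrite leNgt => /negP; apply; rewrite -subr_gt0 E mulr_gt0// subr_gt0.
Qed.

(** The half-cylinder [x <= 0] is not compact. The perturbation [d (x + e^x - 1)] repairs this: it
    vanishes at [x = 0], beats the bound [M] as [x] tends to minus infinity, and has the strictly
    positive Laplacian [d e^x], so an interior maximum contradicts the second derivative test. *)
Lemma max_principle (b : c2 R) M : (forall x t, x <= 0 -> fn b x t <= M) ->
  (forall x t, x <= 0 -> 0 <= lap b x t) -> (forall t, fn b 0 t <= 0) ->
  forall x t, x <= 0 -> fn b x t <= 0.
Proof.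
move=> bM lb b0 x0 t0 x0le; rewrite leNgt; apply/negP => v0; set v := fn b x0 t0 in v0.
have expl x : x <= 0 -> expR x <= (1 : R) by move=> h; rewrite -expR0 ler_expR.
(* The perturbation at [x0] is [- d k] while [v = d (k + 1)], so the perturbed function still equals
   [d > 0] at the point in question. *)
pose k := 1 - x0 - expR x0.
have k0 : 0 <= k by rewrite /k; have := expl _ x0le; lra.
have k1 : 0 < k + 1 by lra.
pose d := v / (k + 1); have d0 : 0 < d by rewrite divr_gt0.
pose F (z : R * R) := fn b z.1 z.2 + d * (z.1 + expR z.1 - 1).
have cF : continuous F.
  apply: ctsD; first exact: c2C.
  apply: ctsM; first exact: cts_cst.
  apply: ctsB; last exact: cts_cst.
  by apply: ctsD; [exact: (cts_fst (@cts_id R))|apply: cts_fst; exact: continuous_expR].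
(* Far enough for the perturbed function to be nonpositive at [x = - X], and for the rectangle to
   contain [x0]. *)
pose X := Num.max (M / d) (- x0) + 1.
have XM : M / d < X by rewrite /X ltr_pwDr// le_max lexx.
have Xx : - x0 < X by rewrite /X ltr_pwDr// le_max lexx orbT.
have X0 : 0 < X by lra.
pose A : set (R * R) := `[- X, 0] `*` `[0, tau].
have cA : compact A by apply: compact_setX; exact: segment_compact.
have A0 : A !=set0.
  exists (0, 0); split; rewrite /= in_itv/= lexx ?andbT ?oppr_le0 ?ltW//; exact: tau_gt0.
have [[x1 t1] /set_mem Az Gz] := compact_EVT_max A0 cA (continuous_subspaceT cF).
have Fmax x t : - X <= x <= 0 -> F (x, t) <= F (x1, t1).
  move=> xX; have [l hl] := mod_tau t.
  have -> : F (x, t) = F (x, t + l%:~R * tau).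
    by rewrite /F/= (@per_int R (fn b x))// => s; exact: c2P.
  by apply: Gz; rewrite inE; split; rewrite /= in_itv.
have Fpos : 0 < F (x1, t1).
  apply: lt_le_trans (Fmax x0 t0 _); last by apply/andP; split; lra.
  rewrite /F/= -/v.
  have -> : d * (x0 + expR x0 - 1) = - (d * k) by rewrite /k; ring.
  have -> : v = d * (k + 1) by rewrite /d divfK// gt_eqF.
  by rewrite mulrDr mulr1 addrAC subrr add0r.
case: Az => /=; rewrite !in_itv/= => /andP[x1X x1le] t1in.
have x1lt : x1 < 0.
  rewrite lt_neqAle x1le andbT; apply/negP => /eqP x1E; move: Fpos.
  by rewrite /F/= x1E expR0 add0r subrr mulr0 addr0 ltNge b0.
have x1gt : - X < x1.
  rewrite lt_neqAle x1X andbT; apply/negP => /eqP x1E; move: Fpos; rewrite ltNge => /negP; apply.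
  rewrite /F/= -x1E; have h1 := bM (- X) t1; have h2 := expl (- X).
  have {}h1 := h1 ltac:(lra); have {}h2 := h2 ltac:(lra).
  rewrite ltr_pdivrMr// in XM.
  have : d * (- X + expR (- X) - 1) <= d * - X by rewrite ler_pM2l//; lra.
  lra.
have H1 : f11 b x1 t1 + d * expR x1 <= 0.
  apply: (@second_derivative_test (fun x => F (x, t1)) (fun x => f1 b x t1 + d * (1 + expR x)) (- X) 0 x1).
  - move=> x; apply: (isdE (isdD (c2D1 b x t1) (isdM (isdcst d x) (isdB (isdD (isdid x) (is_derive_expR x)) (isdcst 1 x))))).
    by rewrite mul0r add0r subr0.
  - apply: (isdE (isdD (c2D11 b x1 t1) (isdM (isdcst d x1) (isdD (isdcst 1 x1) (is_derive_expR x1))))).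
    by rewrite mul0r !add0r.
  - by rewrite x1gt.
  - by move=> x /andP[h1 h2]; apply: Fmax; rewrite !ltW.
have H2 : f22 b x1 t1 <= 0.
  apply: (@second_derivative_test (fun t => F (x1, t)) (f2 b x1) (t1 - 1) (t1 + 1) t1).
  - move=> t; apply: (isdE (isdD (c2D2 b x1 t) (isdcst (d * (x1 + expR x1 - 1)) t))).
    by rewrite addr0.
  - exact: c2D22.
  - by apply/andP; split; lra.
  - by move=> t _; apply: Fmax; rewrite x1X.
have := lb x1 t1 x1le; rewrite /lap => H3.
have := expR_gt0 x1 => H4.
have : 0 < d * expR x1 by rewrite mulr_gt0.
lra.
Qed.

Lemma rpN (p : {poly R[i]}) x t : rp (- p) x t = - rp p x t.
Proof. by rewrite /rp hornerN; case: (p.[_]). Qed.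

Lemma ip_rp (p : {poly R[i]}) x t : ip p x t = rp ((0 +i* (-1))%C *: p) x t.
Proof. by rewrite /rp /ip hornerZ ReM/=; ring. Qed.

Lemma rp_bounded (p : {poly R[i]}) : exists2 M, 0 <= M & forall x t, x <= 0 -> `|rp p x t| <= M.
Proof.
exists (\sum_(k < size p) (`|complex.Re p`_k| + `|complex.Im p`_k|)); first by apply: sumr_ge0 => k _; rewrite addr_ge0.
move=> x t x0; rewrite (rp_sum _ _ (leqnn _)); apply: le_trans (ler_norm_sum _ _ _) _.
apply: ler_sum => k _; rewrite normrM -[leRHS]mul1r ler_pM//.
  by rewrite ger0_norm ?expR_ge0// -expR0 ler_expR mulr_ge0_le0.
apply: le_trans (ler_normB _ _) _; rewrite !normrM lerD// ler_piMr//.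
  by rewrite ler_norml cos_geN1 cos_le1.
by rewrite ler_norml sin_geN1 sin_le1.
Qed.

Lemma a2_ge0 (p : {poly R[i]}) x t : 0 <= a2 p x t.
Proof. by rewrite addr_ge0// sqr_ge0. Qed.

Lemma a2_bounded (p : {poly R[i]}) : exists2 M, 0 <= M & forall x t, x <= 0 -> a2 p x t <= M.
Proof.
have [M M0 HM] := rp_bounded p; have [N N0 HN] := rp_bounded ((0 +i* (-1))%C *: p).
exists (M ^+ 2 + N ^+ 2); first by rewrite addr_ge0// sqr_ge0.
move=> x t x0; rewrite /a2 ip_rp lerD// -[leLHS]real_normK ?num_real// lerXn2r ?nnegrE//; [exact: HM|exact: HN].
Qed.

Lemma c2_cts (b : c2 R) x : continuous (fn b x).
Proof.
have H : continuous (fun z : R * R => fn b z.1 z.2) := @c2C R b.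
by move=> t; exact: (@continuous_slice1 R (fun z : R * R => fn b z.1 z.2) x H).
Qed.

(** The comparison function is the real part of a polynomial within [e / 2] of the boundary values.
    Subtracting it and [e / 2] leaves something nonpositive on the boundary, and [PI_rp] evaluates
    the polynomial inside. *)
Lemma poisson_majorant (b : c2 R) M : (forall x t, x <= 0 -> fn b x t <= M) ->
  (forall x t, x <= 0 -> 0 <= lap b x t) ->
  forall x t, x < 0 -> fn b x t <= PI (fn b 0) (expR x) t.
Proof.
move=> bM lb x t x0; apply/ler_addgt0Pr => e e0; have e2 : 0 < e / 2 by rewrite divr_gt0.
have cb : continuous (fn b 0) by exact: c2_cts.
have [p Hp] := rp_dense cb (c2P b 0) e2.
have [N N0 HN] := rp_bounded p.
pose b' := c2add b (c2add (c2re (- p)) (c2cst (- (e / 2)))).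
have : fn b' x t <= 0.
  apply: (@max_principle b' (M + N)) => [y s y0|y s y0|s|]; last exact: ltW.
  - rewrite /= rpN; have := bM y s y0; have := HN y s y0; rewrite ler_norml => /andP[h1 h2]; lra.
  - have := lb y s y0; have := lap_re (- p) y s; rewrite /lap/=; lra.
  - by rewrite /= rpN; have := Hp s; rewrite ler_norml => /andP[h1 h2]; lra.
rewrite /= rpN => H1.
have e01 : 0 < expR x < 1 by rewrite expR_gt0 expR_lt1.
have := PI_rp p 0 t x0; rewrite addr0 => E.
have := @PI_dist _ (rp p 0) (fn b 0) (expR x) t (e / 2) e01 (@rp_cts R p 0) cb Hp.
by rewrite E ler_norml => /andP[h1 h2]; lra.
Qed.

Lemma lap_pow s (a : c2 R) (a0 : forall x t, 0 < fn a x t) x t :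
  lap (c2pow s a0) x t = s * ((s - 1) * fn a x t `^ (s - 1 - 1) * (f1 a x t ^+ 2 + f2 a x t ^+ 2)
    + fn a x t `^ (s - 1) * lap a x t).
Proof. by rewrite /lap/=; ring. Qed.

Lemma powR_pred (a s : R) : 0 < a -> a `^ (s - 1) = a `^ (s - 1 - 1) * a.
Proof. by move=> a0; rewrite -[X in _ * X](powRr1 (ltW a0)) -powRD ?subrK// (gt_eqF a0) implybT. Qed.

Section abs2eps.
Variables (p : {poly R[i]}) (e : R) (e0 : 0 < e).

Definition abs2e := c2add (c2abs2 p) (c2cst e).

Lemma fn_abs2e x t : fn abs2e x t = a2 p x t + e.
Proof. by rewrite -fn_abs2. Qed.

Lemma abs2e_gt0 x t : 0 < fn abs2e x t.
Proof. by rewrite fn_abs2e ltr_wpDl// a2_ge0. Qed.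

Lemma fn_abs2e_pow s x t : fn (c2pow s abs2e_gt0) x t = (a2 p x t + e) `^ s.
Proof. by rewrite -fn_abs2e. Qed.

(** With [a = |p|^2] and [D = |p_x|^2] the Laplacian is exactly [4 s (a + e)^(s - 2) D (s a + e)];
    the inequality [s a + e >= min(s, 1) (a + e)] treats small and large [s] together. *)
Lemma lap_abs2e_pow s x t : 0 < s ->
  4 * s * Num.min s 1 * (a2 p x t + e) `^ (s - 1) * a2 (pdx p) x t <= lap (c2pow s abs2e_gt0) x t.
Proof.
move=> s0; rewrite lap_pow.
have -> : f1 abs2e x t ^+ 2 + f2 abs2e x t ^+ 2 = 4 * a2 p x t * a2 (pdx p) x t.
  by rewrite -grad_abs2 /abs2e /=; ring.
have -> : lap abs2e x t = 4 * a2 (pdx p) x t by rewrite -lap_abs2 /lap/=; ring.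
rewrite fn_abs2e; set a := a2 p x t; set D := a2 (pdx p) x t.
have a0 : 0 <= a by exact: a2_ge0.
have D0 : 0 <= D by exact: a2_ge0.
have ae : 0 < a + e by rewrite ltr_wpDl.
rewrite (powR_pred s ae); set P := (a + e) `^ _.
have P0 : 0 <= P by exact: powR_ge0.
have -> : s * ((s - 1) * P * (4 * a * D) + P * (a + e) * (4 * D)) = 4 * s * P * D * (s * a + e) by ring.
have -> : 4 * s * Num.min s 1 * (P * (a + e)) * D = 4 * s * P * D * (Num.min s 1 * (a + e)) by ring.
apply: ler_wpM2l; first by rewrite !mulr_ge0// ltW.
have m1 : Num.min s 1 <= s by rewrite ge_min lexx.
have m2 : Num.min s 1 <= 1 by rewrite ge_min lexx orbT.
by rewrite mulrDr lerD// ?ler_wpM2r// ler_piMl// ltW.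
Qed.

Lemma lap_abs2e_pow_ge0 s x t : 0 < s -> 0 <= lap (c2pow s abs2e_gt0) x t.
Proof.
move=> s0; apply: le_trans (lap_abs2e_pow x t s0).
by rewrite !mulr_ge0 ?powR_ge0 ?a2_ge0 ?le_min ?ler01 ?ltW.
Qed.

Lemma abs2e_pow_bounded s : 0 < s -> exists M, forall x t, x <= 0 -> fn (c2pow s abs2e_gt0) x t <= M.
Proof.
move=> s0; have [M M0 HM] := a2_bounded p; exists ((M + e) `^ s) => x t x0.
have := a2_ge0 p x t => a0; have := HM x t x0 => h.
by have e0' := e0; rewrite fn_abs2e_pow; apply: ge0_ler_powR; rewrite ?nnegrE; lra.
Qed.

End abs2eps.

(** Serves to remove the regularising constant. Below the threshold [d] the left side is at most
    [(2 d)^s = n]; above it [y + e <= y (1 + x)], where [(1 + x)^s = 1 + k] and [k M^s <= n]. *)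
Lemma powR_addeps s M n : 0 < s -> 0 <= M -> 0 < n ->
  exists2 e, 0 < e & forall y : R, 0 <= y <= M -> (y + e) `^ s <= y `^ s + n.
Proof.
move=> s0 M0 n0; have Ms : 0 <= M `^ s by exact: powR_ge0.
pose k := n / (M `^ s + 1); have k0 : 0 < k by rewrite divr_gt0// ltr_wpDl.
pose d := n `^ s^-1 / 2; have d0 : 0 < d by rewrite divr_gt0// powR_gt0.
pose x := (1 + k) `^ s^-1 - 1.
have k1 : 0 < 1 + k by rewrite addr_gt0.
have x0 : 0 < x.
  have E1 : (1 : R) `^ s^-1 = 1 by rewrite powR1.
  rewrite subr_gt0 -[ltLHS]E1; apply: gt0_ltr_powR; rewrite ?invr_gt0 ?nnegrE; lra.
exists (Num.min d (d * x)); first by rewrite lt_min d0 mulr_gt0.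
move=> y /andP[y0 yM].
have e1 : Num.min d (d * x) <= d by rewrite ge_min lexx.
have e2 : Num.min d (d * x) <= d * x by rewrite ge_min lexx orbT.
have e3 : 0 < Num.min d (d * x) by rewrite lt_min d0 mulr_gt0.
have [yd|dy] := ltP y d.
  apply: (@le_trans _ _ n); last by rewrite lerDr powR_ge0.
  have nE : n = (n `^ s^-1) `^ s by rewrite -powRrM mulVf ?gt_eqF// powRr1// ltW.
  rewrite [leRHS]nE.
  have -> : n `^ s^-1 = d + d by rewrite /d; lra.
  by apply: ge0_ler_powR; rewrite ?nnegrE; lra.
have h : y + Num.min d (d * x) <= y * (1 + x).
  by rewrite [y * (1 + x)]mulrDr mulr1 lerD2l (le_trans e2)// ler_pM2r.
apply: (@le_trans _ _ ((y * (1 + x)) `^ s)).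
  by apply: ge0_ler_powR; rewrite ?nnegrE; lra.
rewrite powRM//; last by rewrite addr_ge0// ltW.
rewrite (_ : 1 + x = (1 + k) `^ s^-1); last by rewrite /x addrC subrK.
rewrite -powRrM mulVf ?gt_eqF// powRr1 ?(ltW k1)// [_ * (1 + k)]mulrDr mulr1 lerD2l.
have yMs : y `^ s <= M `^ s by apply: ge0_ler_powR; rewrite ?nnegrE; lra.
by rewrite /k mulrA ler_pdivrMr ?ltr_wpDl//; nra.
Qed.

Lemma a2_cts (p : {poly R[i]}) x : continuous (a2 p x).
Proof.
apply: ctsD; apply: ctsX; first exact: rp_cts.
have -> : ip p x = rp ((0 +i* (-1))%C *: p) x by apply/funext => t; rewrite ip_rp.
exact: rp_cts.
Qed.
Lemma a2_per (p : {poly R[i]}) x : per (a2 p x).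
Proof. by move=> t; rewrite /a2 rpP ipP. Qed.

Lemma cts_powR_ge0 (T : topologicalType) (f : T -> R) s : 0 < s -> (forall x, 0 <= f x) -> continuous f ->
  continuous (fun x => f x `^ s).
Proof.
move=> s0 f0 cf x; have [fx|] := ltP 0 (f x).
  apply: (@continuous_comp _ _ _ f (fun y => y `^ s)); first exact: cf.
  apply/differentiable_continuous/derivable1_diffP.
  by have := is_derive1_powR s fx => -[].
move=> fx; have {}fx : f x = 0 by apply/eqP; rewrite eq_le fx f0.
rewrite /continuous_at fx powR0 ?gt_eqF//.
apply/cvgrPdist_lt => e e0.
have : f @ x --> f x by exact: cf.
rewrite fx => /cvgrPdist_lt/(_ (e `^ s^-1)); rewrite powR_gt0// => /(_ isT).
apply: filterS => y; rewrite !sub0r !normrN !ger0_norm ?powR_ge0// => fy.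
have eE : e = (e `^ s^-1) `^ s by rewrite -powRrM mulVf ?gt_eqF// powRr1// ltW.
by rewrite [ltRHS]eE; apply: gt0_ltr_powR; rewrite ?nnegrE// powR_ge0.
Qed.

(* because [|p|^(2s)] is subharmonic *)
Lemma a2_powR_PI (p : {poly R[i]}) s x t : 0 < s -> x < 0 ->
  a2 p x t `^ s <= PI (fun t => a2 p 0 t `^ s) (expR x) t.
Proof.
move=> s0 x0; apply/ler_addgt0Pr => n n0; have [M M0 HM] := a2_bounded p.
have [e e0 He] := powR_addeps s0 M0 n0.
have [N HN] := abs2e_pow_bounded p e0 s0.
have := poisson_majorant HN (fun x t _ => lap_abs2e_pow_ge0 p e0 x t s0) t x0.
have ee : 0 < expR x < 1 by rewrite expR_gt0 expR_lt1.
have ee' : 0 <= expR x < 1 by rewrite expR_ge0 expR_lt1.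
rewrite fn_abs2e_pow => H.
have c1 : continuous (fun t => a2 p 0 t `^ s) by apply: cts_powR_ge0 => //; [exact: a2_ge0|exact: a2_cts].
apply: (@le_trans _ _ ((a2 p x t + e) `^ s)).
  by have := a2_ge0 p x t => a0; apply: ge0_ler_powR; rewrite ?nnegrE; lra.
apply: (le_trans H); rewrite -[X in _ + X](@PI_cst _ n (expR x) t)// -PID//; last exact: cts_cst.
apply: PI_le => //.
- exact: (@c2_cts (c2pow s (abs2e_gt0 p e0)) 0).
- by apply: ctsD => //; exact: cts_cst.
- by move=> u; rewrite fn_abs2e_pow He// a2_ge0/=; exact: HM.
Qed.

End MaxPrinciple.

(** * The radial maximal theorem in L^2 *)

Section Maximal.
Variable R : realType.
Local Notation tau := (pi *+ 2 : R).
Implicit Types (psi phi f g : R -> R).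

(** The range [[r^2, r]] contains the product of [r] with any larger radius below 1, which is what
    composing two Poisson integrals produces. Numerator and denominator each cost a factor 2. *)
Lemma pk_compare (r s t : R) : 2^-1 <= r < 1 -> r ^+ 2 <= s <= r -> pk s t <= 4 * pk r t.
Proof.
move=> /andP[r2 r1] /andP[rs sr]; have r0 : 0 < r by lra.
have s0 : 0 <= s by apply: le_trans rs; rewrite sqr_ge0.
have s1 : s < 1 by lra.
have dr := @pkden_gt0 _ r t ltac:(by rewrite ltW).
have ds := @pkden_gt0 _ s t ltac:(by rewrite s0).
rewrite /pk mulrA ler_pdivrMr// mulrAC ler_pdivlMr//.
have c0 : 0 <= 1 - cos t by rewrite subr_ge0 cos_le1.
have D : 1 - 2 * r * cos t + r ^+ 2 <= 2 * (1 - 2 * s * cos t + s ^+ 2).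
  have h1 : (1 - r) ^+ 2 <= (1 - s) ^+ 2 by rewrite lerXn2r ?nnegrE; lra.
  have h2 : r * (1 - cos t) <= 2 * s * (1 - cos t).
    by rewrite ler_wpM2r//; rewrite expr2 in rs; nra.
  have h3 : 0 <= (1 - r) ^+ 2 by rewrite sqr_ge0.
  by rewrite !expr2 in h1 h3 *; lra.
have N : 1 - s ^+ 2 <= 2 * (1 - r ^+ 2).
  have h1 : (r ^+ 2) ^+ 2 <= s ^+ 2 by rewrite lerXn2r ?nnegrE ?sqr_ge0.
  by move: h1; rewrite !expr2; nra.
have N0 : 0 <= 1 - s ^+ 2 by rewrite subr_ge0 expr_le1// ltW.
apply: (@le_trans _ _ ((2 * (1 - r ^+ 2)) * (2 * (1 - 2 * s * cos t + s ^+ 2)))); first by apply: ler_pM => //; exact: ltW.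
lra.
Qed.

Lemma PI_compare psi r s th : 2^-1 <= r < 1 -> r ^+ 2 <= s <= r -> continuous psi -> (forall t, 0 <= psi t) ->
  PI psi s th <= 4 * PI psi r th.
Proof.
move=> r01 rs cpsi p0.
have hr : 0 <= r < 1 by case/andP: r01 => h1 ->; rewrite (le_trans _ h1).
have hs : 0 <= s < 1.
  case/andP: rs => h1 h2; case/andP: hr => h3 h4.
  by rewrite (le_trans _ h1) ?sqr_ge0//= (le_lt_trans h2).
rewrite -PIZ//.
rewrite /PI; apply: le_cm; [exact: PI_cts_int|apply: PI_cts_int => //|].
  by apply: ctsM => //; exact: cts_cst.
by move=> t; rewrite mulrA [_ * 4]mulrC ler_wpM2r// pk_compare.
Qed.

Lemma PI_sym f g r : 0 <= r < 1 -> continuous f -> continuous g ->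
  cm (fun t => f t * PI g r t) = cm (fun t => g t * PI f r t).
Proof.
move=> r01 cf cg; pose F (z : R * R) := f z.1 * (pk r (z.2 - z.1) * g z.2).
have cF : continuous F.
  apply: ctsM; first exact: cts_fst.
  apply: ctsM; last exact: cts_snd.
  apply: (cts_comp (h := pk r) (f := fun z : R * R => z.2 - z.1)); first exact: pk_cts.
  by apply: ctsB; [exact: (cts_snd (@cts_id R))|exact: (cts_fst (@cts_id R))].
transitivity (cm (fun x => cm (fun y => F (x, y)))).
  by congr cm; apply/funext => t; rewrite /F/= cmZ//; exact: PI_cts_int.
rewrite cm_fubini//; congr cm; apply/funext => t.
rewrite /PI -cmZ; last exact: PI_cts_int.
by congr cm; apply/funext => s; rewrite /F/= -[t - s]opprB pkN; ring.
Qed.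

(** Dyadic radii 1/2, 3/4, 7/8 and so on. A maximum over finitely many of them is continuous and, up
    to a constant, controls the radii in between ([PI_mxP]). *)
Definition rk (k : nat) : R := 1 - (2^-1) ^+ k.+1.

Lemma half_expn (k : nat) : 0 < (2^-1 : R) ^+ k <= 1.
Proof.
have h : (2^-1 : R) <= 1 by lra.
have h0 : 0 < (2^-1 : R) by lra.
by rewrite exprn_gt0//= exprn_ile1// ltW.
Qed.

Lemma rk_itv k : 2^-1 <= rk k < 1.
Proof.
have /andP[h1 h2] := half_expn k; have /andP[h3 _] := half_expn k.+1.
by rewrite /rk; rewrite exprS in h3 *; apply/andP; split; lra.
Qed.
Lemma rk_ge k : 0 <= rk k < 1.
Proof. by have /andP[h1 h2] := rk_itv k; rewrite h2 (le_trans _ h1). Qed.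
Lemma rk_gt k : 0 < rk k < 1.
Proof. by have /andP[h1 h2] := rk_itv k; rewrite h2 (lt_le_trans _ h1). Qed.
Lemma rk_le k l : (k <= l)%N -> rk k <= rk l.
Proof.
by move=> kl; rewrite lerB// ler_wiXn2l//; lra.
Qed.

Lemma cm_sq_le f : continuous f -> cm f ^+ 2 <= cm (fun t => f t ^+ 2).
Proof.
move=> cf; have c2f : continuous (fun t => f t ^+ 2) by exact: ctsX.
have : 0 <= cm (fun t => (f t - cm f) ^+ 2) by apply: cm_ge0 => t; exact: sqr_ge0.
have -> : (fun t => (f t - cm f) ^+ 2) = (fun t => (f t ^+ 2 + (- (2 * cm f)) * f t) + cm f ^+ 2).
  by apply/funext => t; ring.
have c3 : continuous (fun t => - (2 * cm f) * f t) by apply: ctsM => //; exact: cts_cst.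
rewrite cmD; [|exact: ctsD|exact: cts_cst].
by rewrite cmD// cmZ// cm_cst !expr2; lra.
Qed.

Section weights.
Variables (K : nat) (w : 'I_K -> R -> R).
Hypothesis cw : forall k, continuous (w k).
Hypothesis pw : forall k, per (w k).
Hypothesis w0 : forall k t, 0 <= w k t.
Hypothesis w1 : forall t, \sum_k w k t = 1.

(** Linearised maximal operator: a continuous partition of unity stands for the choice of a radius
    at each point, and bounds independent of that choice hold for the maximum. [Tws] is its
    adjoint. *)
Definition Tw psi th := \sum_k w k th * PI psi (rk k) th.
Definition Tws f t := \sum_k PI (fun s => w k s * f s) (rk k) t.

Lemma cts_sum (n : nat) (F : 'I_n -> R -> R) : (forall k, continuous (F k)) -> continuous (fun t => \sum_k F k t).
Proof.
move=> cF; rewrite (_ : (fun t => _) = \sum_(k < n) F k); last by apply/funext => t; rewrite fct_sumE.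
by elim/big_ind: _ => [|f g cf cg|k _]; [exact: cts_cst|exact: ctsD|exact: cF].
Qed.

Lemma Tw_cts psi : continuous psi -> continuous (Tw psi).
Proof. by move=> c; apply: cts_sum => k; apply: ctsM => //; apply: PI_cts => //; exact: rk_ge. Qed.
Lemma Tw_per psi : per (Tw psi).
Proof. by move=> t; apply: eq_bigr => k _; rewrite pw PI_per. Qed.
Lemma Tw_ge0 psi : (forall t, 0 <= psi t) -> forall t, 0 <= Tw psi t.
Proof. by move=> p0 t; apply: sumr_ge0 => k _; rewrite mulr_ge0// PI_ge0//; exact: rk_ge. Qed.
Lemma cwf k f : continuous f -> continuous (fun s => w k s * f s).
Proof. by move=> cf; apply: ctsM. Qed.
Lemma Tws_cts f : continuous f -> continuous (Tws f).
Proof. by move=> c; apply: cts_sum => k; apply: PI_cts; [exact: rk_ge|exact: cwf]. Qed.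

Lemma Tw_adj f psi : continuous f -> continuous psi ->
  cm (fun t => f t * Tw psi t) = cm (fun t => psi t * Tws f t).
Proof.
move=> cf cpsi.
have -> : (fun t => f t * Tw psi t) = (fun t => \sum_k (w k t * f t) * PI psi (rk k) t).
  by apply/funext => t; rewrite /Tw mulr_sumr; apply: eq_bigr => k _; ring.
rewrite cm_sum; last by move=> k; apply: ctsM; [exact: cwf|apply: PI_cts => //; exact: rk_ge].
have -> : (fun t => psi t * Tws f t) = (fun t => \sum_k psi t * PI (fun s => w k s * f s) (rk k) t).
  by apply/funext => t; rewrite /Tws mulr_sumr.
rewrite cm_sum; last by move=> k; apply: ctsM => //; apply: PI_cts; [exact: rk_ge|exact: cwf].
by apply: eq_bigr => k _; rewrite (PI_sym (rk_ge k))//; exact: cwf.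
Qed.

(* The kernel of the composite of [Tw] with its adjoint [Tws], at radii [r_k] and [r_l], is the
   Poisson kernel of radius [r_k r_l], comparable with that of the smaller of the two radii. *)
Lemma Tws_sq f : continuous f -> per f -> (forall t, 0 <= f t) ->
  cm (fun t => Tws f t ^+ 2) <= 8 * cm (fun t => f t * Tw f t).
Proof.
move=> cf pf f0; have cwf' k := @cwf k f cf.
have f0' k t : 0 <= w k t * f t by rewrite mulr_ge0.
pose a k l := cm (fun t => (w k t * f t) * PI (fun s => w l s * f s) (rk k) t).
have cPI k l j : continuous (fun t => (w k t * f t) * PI (fun s => w l s * f s) (rk j) t).
  by apply: ctsM => //; apply: PI_cts; [exact: rk_ge|exact: cwf].
have a0 k l : 0 <= a k l.
  by apply: cm_ge0 => t; rewrite mulr_ge0// PI_ge0//; exact: rk_ge.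
have key (k l : 'I_K) : (k <= l)%N ->
    cm (fun t => (w k t * f t) * PI (PI (fun s => w l s * f s) (rk l)) (rk k) t) <= 4 * a k l.
  move=> kl; rewrite /a -cmZ//; apply: le_cm.
  - by apply: ctsM => //; apply: PI_cts; [exact: rk_ge|apply: PI_cts; [exact: rk_ge|exact: cwf]].
  - by apply: ctsM => //; exact: cts_cst.
  move=> t; rewrite PI_semigroup; [|exact: rk_gt|exact: rk_ge|exact: cwf|by move=> s; rewrite pw pf].
  rewrite [leRHS]mulrCA ler_wpM2l//; apply: PI_compare => //; first exact: rk_itv.
  have := rk_le kl; have /andP[h1 h2] := rk_gt k; have /andP[h3 h4] := rk_gt l => h5.
  by rewrite expr2; apply/andP; split; nra.
have E k l : cm (fun t => PI (fun s => w k s * f s) (rk k) t * PI (fun s => w l s * f s) (rk l) t) <=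
   4 * a k l + 4 * a l k.
  have [kl|/ltnW kl] := leqP k l.
    rewrite (_ : cm _ = cm (fun t => (w k t * f t) * PI (PI (fun s => w l s * f s) (rk l)) (rk k) t)).
      by apply: (le_trans (key _ _ kl)); rewrite lerDl mulr_ge0.
    rewrite [RHS]PI_sym; [|exact: rk_ge|exact: cwf|by apply: PI_cts; [exact: rk_ge|exact: cwf]].
    by congr cm; apply/funext => t; rewrite mulrC.
  rewrite (_ : cm _ = cm (fun t => (w l t * f t) * PI (PI (fun s => w k s * f s) (rk k)) (rk l) t)).
    by apply: (le_trans (key _ _ kl)); rewrite lerDr mulr_ge0.
  by rewrite [RHS]PI_sym; [|exact: rk_ge|exact: cwf|by apply: PI_cts; [exact: rk_ge|exact: cwf]].
have -> : (fun t => Tws f t ^+ 2) =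
  (fun t => \sum_k \sum_l PI (fun s => w k s * f s) (rk k) t * PI (fun s => w l s * f s) (rk l) t).
  by apply/funext => t; rewrite expr2 /Tws mulr_suml; apply: eq_bigr => k _; rewrite mulr_sumr.
have cPP k l : continuous (fun t => PI (fun s => w k s * f s) (rk k) t * PI (fun s => w l s * f s) (rk l) t).
  by apply: ctsM; apply: PI_cts; try exact: rk_ge; exact: cwf.
rewrite cm_sum; last by move=> k; exact: cts_sum.
apply: (@le_trans _ _ (\sum_k \sum_l (4 * a k l + 4 * a l k))).
  by apply: ler_sum => k _; rewrite cm_sum//; apply: ler_sum => l _; exact: E.
have S : \sum_k \sum_l a k l = cm (fun t => f t * Tw f t).
  have -> : (fun t => f t * Tw f t) = (fun t => \sum_k \sum_l (w k t * f t) * PI (fun s => w l s * f s) (rk k) t).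
    apply/funext => t; rewrite /Tw mulr_sumr; apply: eq_bigr => k _; rewrite -mulr_sumr mulrA [f t * _]mulrC.
    congr (_ * _); rewrite /PI -cm_sum; last by move=> l; apply: PI_cts_int; [exact: rk_ge|exact: cwf].
    by congr cm; apply/funext => s; rewrite -mulr_sumr -mulr_suml w1 mul1r.
  rewrite cm_sum; last by move=> k; exact: cts_sum.
  by apply: eq_bigr => k _; rewrite cm_sum.
have S' : \sum_k \sum_l a l k = \sum_k \sum_l a k l by rewrite exchange_big.
have gs (x y : 'I_K -> 'I_K -> R) :
    \sum_k \sum_l (4 * x k l + 4 * y k l) = 4 * (\sum_k \sum_l x k l) + 4 * (\sum_k \sum_l y k l).
  clear; rewrite !mulr_sumr -big_split; apply: eq_bigr => k _.
  by rewrite !mulr_sumr -big_split.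
by rewrite (gs a (fun k l => a l k)) S' S -mulrDl (_ : 4 + 4 = 8 :> R)//; ring.
Qed.

(** The constant depends on the number [K] of radii; it only provides some bound from which
    [Tw_improve] can start. *)
Lemma Tw_crude : exists2 A, 0 <= A & forall psi, continuous psi -> (forall t, 0 <= psi t) ->
  cm (fun t => Tw psi t ^+ 2) <= A * cm (fun t => psi t ^+ 2).
Proof.
pose B := \sum_(k < K) (1 + rk k) / (1 - rk k).
have Bk (k : 'I_K) : 0 <= (1 + rk k) / (1 - rk k).
  by have /andP[h1 h2] := rk_ge k; rewrite divr_ge0//; lra.
have B0 : 0 <= B by apply: sumr_ge0.
exists (B ^+ 2); first exact: sqr_ge0.
move=> psi cpsi p0; have cm0 : 0 <= cm psi by exact: cm_ge0.
apply: (@le_trans _ _ ((B * cm psi) ^+ 2)); last by rewrite exprMn ler_wpM2l ?sqr_ge0//; exact: cm_sq_le.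
rewrite -(@cm_cst R ((B * cm psi) ^+ 2)); apply: le_cm; [by apply: ctsX; exact: Tw_cts|exact: cts_cst|move=> t].
suff H : Tw psi t <= B * cm psi.
  have T0 := @Tw_ge0 psi p0 t; have Bc : 0 <= B * cm psi by exact: mulr_ge0.
  by rewrite lerXn2r ?nnegrE.
rewrite /Tw /B mulr_suml; apply: ler_sum => k _; rewrite -[leRHS]mul1r; apply: ler_pM => //.
- by apply: PI_ge0 => //; exact: rk_ge.
- by rewrite -(w1 t) (bigD1 k)//= lerDl sumr_ge0.
rewrite -cmZ//; apply: le_cm; [by apply: PI_cts_int => //; exact: rk_ge|by apply: ctsM => //; exact: cts_cst|move=> s].
by rewrite ler_wpM2r// pk_le//; exact: rk_ge.
Qed.

(** With [F = Tw psi] one has [|F|^2 = <psi, Tws F>] and [|Tws F|^2 <= 8 <F, Tw F> <= 8 A |F|^2].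
    The weighted arithmetic-geometric inequality with parameter [8 A] then absorbs one copy of
    [|F|^2]. *)
Lemma Tw_improve A : 0 < A -> (forall psi, continuous psi -> per psi -> (forall t, 0 <= psi t) ->
  cm (fun t => Tw psi t ^+ 2) <= A ^+ 2 * cm (fun t => psi t ^+ 2)) ->
  forall psi, continuous psi -> per psi -> (forall t, 0 <= psi t) ->
  cm (fun t => Tw psi t ^+ 2) <= 8 * A * cm (fun t => psi t ^+ 2).
Proof.
move=> A0 HA psi cpsi ppsi p0; set F := Tw psi.
have cF : continuous F by exact: Tw_cts.
have pF : per F by exact: Tw_per.
have F0 t : 0 <= F t by exact: Tw_ge0.
have cTF : continuous (Tw F) by exact: Tw_cts.
have cSF : continuous (Tws F) by exact: Tws_cts.
have amgm (l : R) f g : 0 < l -> continuous f -> continuous g ->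
    2 * cm (fun t => f t * g t) <= l * cm (fun t => f t ^+ 2) + l^-1 * cm (fun t => g t ^+ 2).
  move=> l0 cf cg.
  have c1 : continuous (fun t => f t ^+ 2) by exact: ctsX.
  have c2 : continuous (fun t => g t ^+ 2) by exact: ctsX.
  have c3 : continuous (fun t => f t * g t) by exact: ctsM.
  have cz k (h : R -> R) : continuous h -> continuous (fun t => k * h t) by move=> ch; apply: ctsM => //; exact: cts_cst.
  rewrite -!cmZ// -cmD; [|exact: (cz)|exact: (cz)]; apply: le_cm; [exact: (cz)|by apply: ctsD; exact: (cz)|move=> t].
  rewrite -subr_ge0 (_ : _ - _ = l^-1 * (l * f t - g t) ^+ 2); first by rewrite mulr_ge0 ?sqr_ge0// invr_ge0 ltW.
  by field; rewrite gt_eqF.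
have h1 := HA F cF pF F0.
have h2 := amgm A F (Tw F) A0 cF cTF.
have h3 := Tws_sq cF pF F0.
have A8 : 0 < 8 * A by rewrite mulr_gt0.
have h4 := amgm (8 * A) psi (Tws F) A8 cpsi cSF.
have h5 := Tw_adj cF cpsi; rewrite -/F in h5.
have E : cm (fun t => F t ^+ 2) = cm (fun t => F t * F t) by congr cm; apply/funext => t; rewrite expr2.
rewrite -E in h5; rewrite -h5 in h4.
set cF2 := cm (fun t => F t ^+ 2) in h1 h2 h4 *; set cP2 := cm (fun t => psi t ^+ 2) in h4 *.
set cT2 := cm (fun t => Tw F t ^+ 2) in h1 h2; set cFT := cm (fun t => F t * Tw F t) in h2 h3.
set cS2 := cm _ in h3 h4; clear h5 E; clearbody cF2 cP2 cT2 cFT cS2.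
have h6 : A^-1 * cT2 <= A * cF2.
  by rewrite ler_pdivrMl// mulrA -expr2.
have h7 : cFT <= A * cF2 by lra.
have h8 : (8 * A)^-1 * cS2 <= cF2.
  by rewrite ler_pdivrMl//; apply: (le_trans h3); rewrite -mulrA ler_pM2l.
lra.
Qed.

(** If [A] bounds the operator, so does [sqrt (8 A)]; hence the infimum of the admissible bounds is
    at most the fixed point 8, and 64 is its square. *)
Lemma Tw_bound psi : continuous psi -> per psi -> (forall t, 0 <= psi t) ->
  cm (fun t => Tw psi t ^+ 2) <= 64 * cm (fun t => psi t ^+ 2).
Proof.
pose P A := 0 < A /\ forall psi, continuous psi -> per psi -> (forall t, 0 <= psi t) ->
  cm (fun t => Tw psi t ^+ 2) <= A ^+ 2 * cm (fun t => psi t ^+ 2).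
have m0 f : 0 <= cm (fun t => f t ^+ 2) by apply: cm_ge0 => t; exact: sqr_ge0.
have PA : exists A, P A.
  have [B B0 HB] := Tw_crude; exists (B + 1); split; first by lra.
  move=> phi c1 p1 q1; apply: (le_trans (HB phi c1 q1)); rewrite ler_wpM2r// expr2; nra.
have P8 A : P A -> P (Num.sqrt (8 * A)).
  move=> [A0 HA]; split; first by rewrite sqrtr_gt0 mulr_gt0.
  move=> phi c1 p1 q1; rewrite sqr_sqrtr; last by rewrite mulr_ge0// ltW.
  exact: Tw_improve.
pose S := [set A : R | P A].
have Sinf : has_inf S by split; [case: PA => A HA; exists A|exists 0 => A [/ltW]].
have i0 : 0 <= inf S by apply: lb_le_inf; [case: Sinf|move=> A [/ltW]].
have i8 : inf S <= 8.
  rewrite leNgt; apply/negP => i8.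
  have e0 : 0 < (inf S ^+ 2 - 8 * inf S) / 8 by rewrite expr2; nra.
  have [A [A0 HA] Ai] := inf_adherent e0 Sinf.
  have /(ge_inf Sinf.2) h := P8 _ (conj A0 HA).
  have : inf S ^+ 2 <= Num.sqrt (8 * A) ^+ 2 by rewrite lerXn2r ?nnegrE ?sqrtr_ge0.
  by rewrite sqr_sqrtr ?mulr_ge0 ?(ltW A0)//; lra.
move=> cpsi ppsi p0; apply/ler_addgt0Pr => e e0.
pose c := cm (fun t => psi t ^+ 2); have c0 : 0 <= c by exact: m0.
pose d := Num.min 1 (e / (17 * (c + 1))).
have c1 : 0 < 17 * (c + 1) by lra.
have d0 : 0 < d by rewrite lt_min ltr01 divr_gt0.
have d1 : d <= 1 by rewrite ge_min lexx.
have d2 : d * (17 * (c + 1)) <= e by rewrite -ler_pdivlMr// ge_min lexx orbT.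
have [A [A0 HA] Ai] := inf_adherent d0 Sinf.
apply: (le_trans (HA psi cpsi ppsi p0)); rewrite -/c.
have : A ^+ 2 <= 64 + 17 * d by rewrite expr2; nra.
move=> h; apply: (@le_trans _ _ ((64 + 17 * d) * c)); first by rewrite ler_wpM2r.
by nra.
Qed.

End weights.

Definition mxP K psi t : R := \big[Num.max/0]_(k < K) PI psi (rk k) t.

Lemma mxP_cts K psi : continuous psi -> continuous (mxP K psi).
Proof.
move=> cpsi.
suff H n (f : nat -> R -> R) : (forall k, continuous (f k)) -> continuous (fun t => \big[Num.max/0]_(k < n) f k t).
  by apply: (H K (fun k => PI psi (rk k))) => k; apply: PI_cts => //; exact: rk_ge.
elim: n f => [|n IH] f cf.
  by under eq_fun do rewrite big_ord0; exact: cts_cst.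
under eq_fun do rewrite big_ord_recl/=.
by apply: cts_max => //; exact: (IH (fun k => f k.+1)).
Qed.

Lemma mxP_ge K psi (k : 'I_K) t : PI psi (rk k) t <= mxP K psi t.
Proof. exact: (@le_bigmax _ R 'I_K 0 (fun k => PI psi (rk k) t) k). Qed.

Lemma mxP_ge0 K psi t : 0 <= mxP K psi t.
Proof. exact: bigmax_ge_id. Qed.

Theorem maximal_L2 K psi : continuous psi -> per psi -> (forall t, 0 <= psi t) ->
  cm (fun t => mxP K psi t ^+ 2) <= 64 * cm (fun t => psi t ^+ 2).
Proof.
move=> cpsi ppsi p0; have m0 f : 0 <= cm (fun t => f t ^+ 2) by apply: cm_ge0 => t; exact: sqr_ge0.
case: K => [|K].
  rewrite (_ : (fun t => _) = fun=> 0); first by rewrite cm_cst mulr_ge0.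
  by apply/funext => t; rewrite /mxP big_ord0 expr0n.
set m := mxP K.+1 psi; have cmx : continuous m by exact: mxP_cts.
have pm : per m by move=> t; rewrite /m /mxP; apply: eq_bigr => k _; rewrite PI_per.
pose c := cm (fun t => psi t ^+ 2); have c0 : 0 <= c by exact: m0.
apply/ler_addgt0Pr => e e0; pose n := Num.min 1 (e / (3 + 64 * c)).
have c1 : 0 < 3 + 64 * c by lra.
have n0 : 0 < n by rewrite lt_min ltr01 divr_gt0.
have n1 : n <= 1 by rewrite ge_min lexx.
have n2 : n * (3 + 64 * c) <= e by rewrite -ler_pdivlMr// ge_min lexx orbT.
(* Raw weights, supported where the [k]-th mean comes within [n] of the maximum. The margin [n > 0]
   makes their sum positive, hence the quotients continuous, and costs [n] in [T1]. *)
pose v (k : 'I_K.+1) t := Num.max 0 (PI psi (rk k) t - m t + n).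
have cPI (k : 'I_K.+1) : continuous (PI psi (rk k)) by apply: PI_cts => //; exact: rk_ge.
have cv k : continuous (v k).
  by apply: cts_max; [exact: cts_cst|apply: ctsD; [exact: ctsB|exact: cts_cst]].
have v0 k t : 0 <= v k t by rewrite le_max lexx.
pose V t := \sum_k v k t.
have cV : continuous V by exact: cts_sum.
have V0 t : 0 < V t.
  rewrite lt_neqAle sumr_ge0// andbT eq_sym; apply/negP => /eqP VE.
  have vE (k : 'I_K.+1) : PI psi (rk k) t <= m t - n.
    have : v k t = 0 by apply/eqP; rewrite eq_le v0 andbT -VE /V (bigD1 k)//= lerDl sumr_ge0.
    rewrite /v => h; have : PI psi (rk k) t - m t + n <= 0 by rewrite -[leRHS]h le_max lexx orbT.
    lra.
  have mn : 0 <= m t - n by apply: le_trans (vE ord0); apply: PI_ge0 => //; exact: rk_ge.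
  have : m t <= m t - n by rewrite {1}/m /mxP; apply: bigmax_le => // k _; exact: vE.
  by lra.
pose w k t := v k t / V t.
have cw k : continuous (w k).
  by move=> t; apply: cvgM; [exact: cv|apply: cvgV; [rewrite gt_eqF|exact: cV]].
have pv k : per (v k) by move=> t; rewrite /v PI_per pm.
have pw k : per (w k).
  by move=> t; rewrite /w pv /V; congr (_ / _); apply: eq_bigr => j _; rewrite pv.
have w0 k t : 0 <= w k t by rewrite divr_ge0// ltW.
have w1 t : \sum_(k < K.+1) w k t = 1 by rewrite -mulr_suml -/(V t) divff// gt_eqF// V0.
have T1 t : m t - n <= Tw w psi t.
  rewrite -[leLHS]mul1r -(w1 t) mulr_suml; apply: ler_sum => k _.
  have [vk|vk] := eqVneq (v k t) 0; first by rewrite /w vk !mul0r.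
  rewrite ler_wpM2l//.
  by move: vk; rewrite /v; case: (ltP 0 (PI psi (rk k) t - m t + n)) => h; rewrite ?eqxx//; lra.
set T := Tw w psi in T1; have cT : continuous T by exact: Tw_cts.
have T0 t : 0 <= T t by exact: Tw_ge0.
have cT2 : continuous (fun t => T t ^+ 2) by exact: ctsX.
apply: (@le_trans _ _ (cm (fun t => (1 + n) * T t ^+ 2 + (n + n ^+ 2)))).
  apply: le_cm; [exact: ctsX|by apply: ctsD; [apply: ctsM => //; exact: cts_cst|exact: cts_cst]|move=> t].
  have h := T1 t; have h1 : m t ^+ 2 <= (T t + n) ^+ 2.
    by rewrite lerXn2r ?nnegrE ?mxP_ge0//; [have := T0 t; lra|lra].
  apply: (le_trans h1); have : 0 <= n * (T t - 1) ^+ 2 by rewrite mulr_ge0 ?sqr_ge0// ltW.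
  by rewrite !expr2; lra.
rewrite cmD; [|by apply: ctsM => //; exact: cts_cst|exact: cts_cst].
rewrite cmZ// cm_cst; have := Tw_bound cw pw w0 w1 cpsi ppsi p0; rewrite -/T -/c => h.
by rewrite expr2; nra.
Qed.

End Maximal.

(** * The Littlewood-Paley inequality *)

Section Green.
Variable R : realType.
Local Notation tau := (pi *+ 2 : R).

Lemma c2_lap_cts (b : c2 R) : continuous (fun z : R * R => lap b z.1 z.2).
Proof. by apply: ctsD; [exact: c2C11|exact: c2C22]. Qed.

Lemma cts_pair1 (F : R -> R -> R) x : cont2 F -> continuous (F x).
Proof. by move=> cF t; exact: (@continuous_slice1 R (fun z : R * R => F z.1 z.2) x cF). Qed.
Lemma cts_pair2 (F : R -> R -> R) t : cont2 F -> continuous (F^~ t).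
Proof. by move=> cF x; exact: (@continuous_slice2 R (fun z : R * R => F z.1 z.2) t cF). Qed.

Lemma cm_f22 (b : c2 R) x : cm (f22 b x) = 0.
Proof.
rewrite /cm.
have -> : cint 0 tau (f22 b x) = f2 b x tau - f2 b x 0.
  apply: cint_FTC; first by rewrite ltW// tau_gt0.
    by apply: cts_pair1; exact: c2C22.
  by move=> t _; exact: c2D22.
by rewrite -[tau]add0r c2P2 subrr mulr0.
Qed.

Lemma cm_lap (b : c2 R) x : cm (lap b x) = cm (f11 b x).
Proof.
rewrite /lap cmD ?cm_f22 ?addr0//; apply: cts_pair1; [exact: c2C11|exact: c2C22].
Qed.

(** Circular means of a subharmonic function are convex in [x], so a negative slope at [x0] would
    persist to the left and push the mean above [M]; this happens at [X]. *)
Lemma cm_f1_ge0 (b : c2 R) M x0 : (forall x t, x <= 0 -> fn b x t <= M) ->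
  (forall x t, x <= 0 -> 0 <= fn b x t) ->
  (forall x t, x <= 0 -> 0 <= lap b x t) -> x0 <= 0 -> 0 <= cm (f1 b x0).
Proof.
move=> bM b0 lb x00; rewrite leNgt; apply/negP => k0.
have c11 := @c2C11 R b; have c1 := @c2C1 R b; have c0 := @c2C R b.
have mono x : x <= x0 -> cm (f1 b x) <= cm (f1 b x0).
  move=> xx; rewrite -subr_ge0 -cmB; [|exact: cts_pair1..].
  have -> : (fun t => f1 b x0 t - f1 b x t) = (fun t => cint x x0 (fun y => f11 b y t)).
    apply/funext => t; apply/esym.
    apply: (@cint_FTC _ x x0 (fun y => f11 b y t) (fun y => f1 b y t)) => //; first exact: cts_pair2.
    by move=> y _; exact: c2D11.
  rewrite (@cm_cint _ (fun z => f11 b z.1 z.2))//; apply: cint_ge0 => y /andP[_ yx].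
  by rewrite /= -/(cm (f11 b y)) -cm_lap; apply: cm_ge0 => t; apply: lb; exact: le_trans yx x00.
have M0 : 0 <= M by apply: le_trans (bM 0 0 (lexx _)); exact: b0.
pose X := x0 - (M + 1) / - cm (f1 b x0).
have k1 : 0 < - cm (f1 b x0) by rewrite oppr_gt0.
have Xx : X <= x0 by rewrite /X lerBlDr lerDl divr_ge0 ?ltW//; lra.
have : cm (fn b x0) - cm (fn b X) <= cm (f1 b x0) * (x0 - X).
  rewrite -cmB; [|exact: cts_pair1..].
  have -> : (fun t => fn b x0 t - fn b X t) = (fun t => cint X x0 (fun y => f1 b y t)).
    apply/funext => t; apply/esym.
    apply: (@cint_FTC _ X x0 (fun y => f1 b y t) (fun y => fn b y t)) => //; first exact: cts_pair2.
    by move=> y _; exact: c2D1.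
  rewrite (@cm_cint _ (fun z => f1 b z.1 z.2))//= -cint_cst//; apply: le_cint.
  - exact: (@cm_continuous _ (fun z => f1 b z.1 z.2)).
  - exact: cts_cst.
  - by move=> y /andP[_ yx]; exact: mono.
have -> : cm (f1 b x0) * (x0 - X) = - (M + 1).
  by rewrite /X; field; rewrite lt_eqF.
have h1 : 0 <= cm (fn b x0) by apply: cm_ge0 => t; exact: b0.
have h2 : cm (fn b X) <= M.
  by rewrite -[leRHS](@cm_cst R); apply: le_cm; [exact: cts_pair1|exact: cts_cst|move=> t; apply: bM; exact: le_trans Xx x00].
by lra.
Qed.

(** Two integrations by parts against [- x]. The terms at [- L] have nonnegative means and are
    dropped, and the angular second derivative has mean zero. *)
Lemma green (b : c2 R) L M : 0 <= L -> (forall x t, x <= 0 -> fn b x t <= M) ->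
  (forall x t, x <= 0 -> 0 <= fn b x t) ->
  (forall x t, x <= 0 -> 0 <= lap b x t) ->
  cm (fun t => cint (- L) 0 (fun x => - x * lap b x t)) <= cm (fn b 0).
Proof.
move=> L0 bM b0 lb; have L0' : - L <= 0 by rewrite oppr_le0.
have c11 := @c2C11 R b; have c22 := @c2C22 R b; have c1 := @c2C1 R b; have c0 := @c2C R b.
have cx : continuous (fun x : R => - x) by apply: ctsN; exact: cts_id.
have cxF (F : R -> R -> R) : cont2 F -> continuous (fun z : R * R => - z.1 * F z.1 z.2).
  by move=> cF; apply: ctsM => //; exact: cts_fst.
rewrite (@cm_cint _ (fun z => - z.1 * lap b z.1 z.2)); last by apply: (cxF (lap b)); exact: c2_lap_cts.
rewrite (_ : (fun x => _) = (fun x => cm (fun t => - x * f11 b x t))); last first.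
  apply/funext => x /=; rewrite !cmZ ?cm_lap//; first exact: cts_pair1.
  exact: (@cts_pair1 (lap b) x (@c2_lap_cts b)).
rewrite -(@cm_cint _ (fun z => - z.1 * f11 b z.1 z.2)); last exact: (cxF).
have -> : (fun t => cint (- L) 0 (fun x => - x * f11 b x t)) =
   (fun t => fn b 0 t - (L * f1 b (- L) t + fn b (- L) t)).
  apply/funext => t.
  have -> : cint (- L) 0 (fun x => - x * f11 b x t) =
      (- 0 * f1 b 0 t + fn b 0 t) - (- - L * f1 b (- L) t + fn b (- L) t).
    apply: (@cint_FTC _ (- L) 0 _ (fun x => - x * f1 b x t + fn b x t)) => //.
      by apply: ctsM => //; exact: cts_pair2.
    move=> x _; apply: (isdE (isdD (isdM (isdN (isdid x)) (c2D11 b x t)) (c2D1 b x t))).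
    by ring.
  by rewrite oppr0 mul0r add0r opprK.
have cL : continuous (fun t => L * f1 b (- L) t) by apply: ctsM; [exact: cts_cst|exact: cts_pair1].
rewrite cmB; [|exact: cts_pair1|by apply: ctsD => //; exact: cts_pair1].
rewrite cmD//; last exact: cts_pair1.
rewrite cmZ; last exact: cts_pair1.
have h1 := cm_f1_ge0 bM b0 lb L0'.
have h2 : 0 <= cm (fn b (- L)) by apply: cm_ge0 => t; exact: b0.
by rewrite lerBlDr lerDl addr_ge0// mulr_ge0.
Qed.

End Green.

(** * The g-function for exponents at most 1 *)

Section LPsmall.
Variable R : realType.
Implicit Types (h : {poly R[i]}) (s : R).

Lemma pk_up (r s t : R) : 0 <= r -> r <= s -> s <= (1 + r) / 2 -> r < 1 -> pk s t <= 4 * pk r t.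
Proof.
move=> r0 rs sr r1; have s1 : s < 1 by lra.
have s0 : 0 <= s by lra.
have dr := @pkden_gt0 _ r t ltac:(by rewrite r0).
have ds := @pkden_gt0 _ s t ltac:(by rewrite s0).
rewrite /pk mulrA ler_pdivrMr// mulrAC ler_pdivlMr//.
have c0 : 0 <= 1 - cos t by rewrite subr_ge0 cos_le1.
have D : 1 - 2 * r * cos t + r ^+ 2 <= 4 * (1 - 2 * s * cos t + s ^+ 2).
  have h1 : ((1 - r) / 2) ^+ 2 <= (1 - s) ^+ 2 by rewrite lerXn2r ?nnegrE; lra.
  have h2 : r * (1 - cos t) <= s * (1 - cos t) by rewrite ler_wpM2r.
  have h3 : 0 <= s * (1 - cos t) by rewrite mulr_ge0.
  by rewrite !expr2 in h1 *; lra.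
have N : 1 - s ^+ 2 <= 1 - r ^+ 2 by rewrite lerB// lerXn2r ?nnegrE.
have N0 : 0 <= 1 - s ^+ 2 by rewrite subr_ge0 expr_le1// ltW.
apply: (@le_trans _ _ ((1 - r ^+ 2) * (4 * (1 - 2 * s * cos t + s ^+ 2)))); first by apply: ler_pM => //; exact: ltW.
lra.
Qed.

Lemma PI_up (psi : R -> R) r s th : 0 <= r -> r <= s -> s <= (1 + r) / 2 -> r < 1 -> continuous psi ->
  (forall t, 0 <= psi t) -> PI psi s th <= 4 * PI psi r th.
Proof.
move=> r0 rs sr r1 cpsi p0.
have hr : 0 <= r < 1 by rewrite r0.
have hs : 0 <= s < 1 by apply/andP; split; lra.
rewrite -PIZ// /PI; apply: le_cm; [exact: PI_cts_int|apply: PI_cts_int => //|].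
  by apply: ctsM => //; exact: cts_cst.
by move=> t; rewrite mulrA [_ * 4]mulrC ler_wpM2r// pk_up.
Qed.

Lemma rkS k : rk R k.+1 = (1 + rk R k) / 2.
Proof. by rewrite /rk [_ ^+ k.+2]exprS; lra. Qed.

Lemma rk_find K (r : R) : 2^-1 <= r -> r <= rk R K.+1 -> exists2 k : 'I_K.+1, rk R k <= r & r <= (1 + rk R k) / 2.
Proof.
move=> r2; elim: K => [|K IH] rK.
  by exists ord0; rewrite ?rkS// /rk expr1 in rK *; lra.
have [/IH[k h1 h2]|h] := leP r (rk R K.+1); first by exists (widen_ord (leqnSn _) k).
by exists ord_max; [exact: ltW|rewrite -rkS].
Qed.

Lemma PI_mxP K (psi : R -> R) r t : 2^-1 <= r -> r <= rk R K.+1 -> continuous psi -> (forall t, 0 <= psi t) ->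
  PI psi r t <= 4 * mxP K.+1 psi t.
Proof.
move=> r2 rK cpsi p0; have [k h1 h2] := rk_find r2 rK.
have /andP[k0 k1] := rk_ge R k.
apply: (le_trans (PI_up t k0 h1 h2 k1 cpsi p0)).
by rewrite ler_pM2l//; exact: mxP_ge.
Qed.

(** Covers the radii between 1 and the last radius of a finite maximal function. *)
Lemma a2_lip h : exists2 M, 0 <= M & forall x y t, y <= x -> x <= 0 -> a2 h x t <= a2 h y t + M * (x - y).
Proof.
have [M0 M00 H0] := rp_bounded h; have [M1 M10 H1] := rp_bounded (pdx h).
have [N0 N00 K0] := rp_bounded ((0 +i* (-1))%C *: h); have [N1 N10 K1] := rp_bounded ((0 +i* (-1))%C *: pdx h).
exists (2 * M0 * M1 + 2 * N0 * N1); first by rewrite addr_ge0// !mulr_ge0.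
move=> x y t yx x0; rewrite -!fn_abs2.
have [] := @MVT_segment R (fun x => fn (c2abs2 h) x t) (fun x => f1 (c2abs2 h) x t) y x yx.
- by move=> z _; exact: c2D1.
- by apply: continuous_subspaceT; apply: cts_pair2; exact: c2C.
move=> c; rewrite in_itv/= => /andP[yc cx] E.
rewrite -lerBlDl E ler_wpM2r ?subr_ge0//.
have c0 : c <= 0 by exact: le_trans cx x0.
have := H0 c t c0; have := H1 c t c0; have := K0 c t c0; have := K1 c t c0; rewrite -!ip_rp => k1 k0 h1 h0.
rewrite /= (_ : _ + _ = 2 * (rp h c t * rp (pdx h) c t) + 2 * (ip h c t * ip (pdx h) c t)); last by ring.
rewrite -!mulrA; apply: lerD; rewrite ler_pM2l//; apply: (le_trans (ler_norm _)); rewrite normrM; exact: ler_pM.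
Qed.

Lemma rk_near1 (e : R) : 0 < e -> exists K, ln (rk R K) >= - e.
Proof.
move=> e0; have he : expR (- e) < 1 by rewrite expR_lt1 oppr_lt0.
have : (2^-1 : R) ^+ n @[n --> \oo] --> 0 by apply: cvg_expr; rewrite ger0_norm; lra.
move/cvgrPdist_lt => /(_ (1 - expR (- e))); rewrite subr_gt0 he => /(_ isT) [N _ /(_ N.+1 (leqnSn N))] /=.
rewrite sub0r normrN ger0_norm ?exprn_ge0 ?invr_ge0//.
move=> H; exists N; rewrite -ler_expR lnK ?posrE; last by have /andP[] := rk_gt R N.
by rewrite /rk; lra.
Qed.

(* Radial maximal function of [|h|^2], up to an arbitrarily small error. *)
Lemma a2_star h s e : 0 < s -> 0 < e -> exists K, forall x t, - ln 2 <= x <= 0 ->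
  a2 h x t <= (4 * mxP K (fun t => a2 h 0 t `^ s) t) `^ s^-1 + e.
Proof.
move=> s0 e0; have [M M0 HM] := a2_lip h.
have [K HK] := rk_near1 (divr_gt0 e0 (ltr_wpDl M0 ltr01)).
exists K.+1 => x t /andP[xL x0].
set psi := fun t => _; have cpsi : continuous psi by apply: cts_powR_ge0 => //; [exact: a2_ge0|exact: a2_cts].
have p0 u : 0 <= psi u by exact: powR_ge0.
have key y : - ln 2 <= y -> expR y <= rk R K.+1 -> a2 h y t <= (4 * mxP K.+1 psi t) `^ s^-1.
  move=> yL yK; have y1 : expR y < 1 by apply: (le_lt_trans yK); have /andP[] := rk_ge R K.+1.
  have y0 : y < 0 by rewrite -(expR_lt1 y).
  have y2 : 2^-1 <= expR y by rewrite -(@lnK _ 2^-1) ?posrE ?invr_gt0// ler_expR lnV ?posrE.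
  have h1 := a2_powR_PI h t s0 y0.
  have h2 := le_trans h1 (PI_mxP t y2 yK cpsi p0).
  have -> : a2 h y t = (a2 h y t `^ s) `^ s^-1 by rewrite -powRrM mulfV ?gt_eqF// powRr1// a2_ge0.
  by apply: ge0_ler_powR; rewrite ?nnegrE ?invr_ge0 ?powR_ge0 ?mulr_ge0 ?mxP_ge0// ltW.
have [xK|xK] := leP (expR x) (rk R K.+1).
  by apply: (le_trans (key x xL xK)); rewrite lerDl ltW.
pose y := ln (rk R K.+1).
have rK0 : 0 < rk R K.+1 by have /andP[] := rk_gt R K.+1.
have yE : expR y = rk R K.+1 by rewrite lnK.
have yx : y <= x by rewrite -ler_expR yE ltW.
have yK : - (e / (M + 1)) <= y.
  by apply: (le_trans HK); rewrite ler_ln ?posrE//; [exact: rk_le|have /andP[] := rk_gt R K].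
have yL : - ln 2 <= y.
  by rewrite -ler_expR yE expRN lnK ?posrE//; have /andP[] := rk_itv R K.+1.
apply: (le_trans (HM x y t yx x0)); apply: lerD; first by apply: key => //; rewrite yE.
have M1 : 0 < M + 1 by lra.
apply: (@le_trans _ _ (M * (e / (M + 1)))); first by rewrite ler_wpM2l//; lra.
by rewrite mulrA ler_pdivrMr//; nra.
Qed.

(** Square of the g-function in [x = ln r]: [- x] stands for [1 - r], and [a2 (pdx h)] is
    [r^2 |h'|^2]. It starts at [r = 1/2]; smaller radii are left to the pointwise gradient bound in
    [inner2_bound]. *)
Definition LPG h t : R := cint (- ln 2) 0 (fun x => - x * a2 (pdx h) x t).

Lemma cont2_a2 h : cont2 (a2 h).
Proof.
have [cr ci] := cont2_rp_ip h.
by apply: ctsD; apply: ctsX.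
Qed.

Lemma cts_nx (F : R -> R -> R) : cont2 F -> continuous (fun z : R * R => - z.1 * F z.1 z.2).
Proof. by move=> cF; apply: ctsM => //; apply: cts_fst; apply: ctsN; exact: cts_id. Qed.

Lemma cts_nx1 (F : R -> R -> R) (t : R) : cont2 F -> continuous (fun x : R => - x * F x t).
Proof. by move=> cF; exact: (@cts_pair2 R (fun x t => - x * F x t) t (@cts_nx F cF)). Qed.

Lemma cts_cint_nx (F : R -> R -> R) a b : cont2 F -> continuous (fun t => cint a b (fun x => - x * F x t)).
Proof.
move=> cF; apply: (@cint_continuous _ (fun z => - z.2 * F z.2 z.1)).
move=> z; apply: (@continuous_comp _ _ _ (fun z : R * R => (z.2, z.1)) (fun z => - z.1 * F z.1 z.2)).
  by apply: (@continuous_pairing _ _ _ (fun z : R * R => z.2) (fun z : R * R => z.1)) => ?;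
    [exact: cvg_snd|exact: cvg_fst].
exact: cts_nx.
Qed.

Lemma LPG_cts h : continuous (LPG h).
Proof. by apply: cts_cint_nx; exact: cont2_a2. Qed.
Lemma LPG_per h : per (LPG h).
Proof. by move=> t; apply: eq_cint => x _; rewrite a2_per. Qed.
Lemma LPG_ge0 h t : 0 <= LPG h t.
Proof. by apply: cint_ge0 => x /andP[_ x0]; rewrite mulr_ge0 ?oppr_ge0// a2_ge0. Qed.

Lemma ln2_gt0 : 0 < ln (2 : R).
Proof. by rewrite ln_gt0 ?ltr1n. Qed.

Lemma powR_split (x s : R) : 0 <= x -> x `^ (1 - s) * x `^ s = x.
Proof. by move=> x0; rewrite -powRD subrK ?powRr1// oner_eq0. Qed.

Lemma powR_young (x y s : R) : 0 <= s <= 1 -> 0 <= x -> 0 <= y -> x `^ (1 - s) * y `^ s <= x + y.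
Proof.
move=> /andP[s0 s1] x0 y0; have [xy|/ltW yx] := leP x y.
  apply: (@le_trans _ _ y); last by lra.
  rewrite -[leRHS](powR_split s y0) ler_wpM2r ?powR_ge0//.
  by apply: ge0_ler_powR; rewrite ?nnegrE; lra.
apply: (@le_trans _ _ x); last by lra.
rewrite -[leRHS](powR_split s x0) ler_wpM2l ?powR_ge0//.
by apply: ge0_ler_powR; rewrite ?nnegrE; lra.
Qed.

Lemma powR_add_le (x y s : R) : 0 <= s -> 0 <= x -> 0 <= y -> (x + y) `^ s <= 2 `^ s * (x `^ s + y `^ s).
Proof.
move=> s0 x0 y0; have px := powR_ge0 x s; have py := powR_ge0 y s; have p2 := powR_ge0 2 s.
have [xy|/ltW yx] := leP x y.
  apply: (@le_trans _ _ ((2 * y) `^ s)); first by apply: ge0_ler_powR; rewrite ?nnegrE; lra.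
  by rewrite powRM// ler_wpM2l//; lra.
apply: (@le_trans _ _ ((2 * x) `^ s)); first by apply: ge0_ler_powR; rewrite ?nnegrE; lra.
by rewrite powRM// ler_wpM2l//; lra.
Qed.

(** Write [|h_x|^2 = (|h|^2 + e)^(1 - s) F], where [F] is controlled by the Laplacian of
    [(|h|^2 + e)^s]. Bounding the first factor by the maximal function [A] gives
    [LPG <= A^(1 - s) E], hence [LPG^s <= A^s + E] by Young's inequality. The maximal theorem and
    Green's formula bound the two means. *)
Lemma LP_small s h : 0 < s <= 1 ->
  cm (fun t => LPG h t `^ s) <= (2 `^ s * 1024 + (4 * s * s)^-1) * cm (fun t => a2 h 0 t `^ s).
Proof.
case/andP=> s0 s1; set C := _ + _; apply/ler_addgt0Pr => n n0.
have s20 : 0 < s / 2 by lra.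
have C1 : 0 < (4 * s * s)^-1 by rewrite invr_gt0 !mulr_gt0.
have [M M0 HM] := a2_bounded h.
pose n' := n / (2 * (4 * s * s)^-1).
have n'0 : 0 < n' by rewrite divr_gt0// mulr_gt0.
have [e1 e10 He1] := powR_addeps s0 M0 n'0.
have p2 : 0 < 2 `^ s :> R by rewrite powR_gt0.
pose e2 := (n / (2 * 2 `^ s)) `^ s^-1 / 2.
have e20 : 0 < e2 by rewrite divr_gt0// powR_gt0// divr_gt0// mulr_gt0.
pose e := Num.min e1 e2; have e0 : 0 < e by rewrite lt_min e10.
have [K HK] := a2_star h s20 e0.
(* The exponent [s / 2] makes [psi^2 = |h|^(2 s)], so the L^2 maximal theorem serves for every
   [s]. *)
set psi := (fun t => a2 h 0 t `^ (s / 2)) in HK.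
have cpsi : continuous psi by apply: cts_powR_ge0 => //; [exact: a2_ge0|exact: a2_cts].
have ppsi : per psi by move=> t; rewrite /psi a2_per.
have p0 t : 0 <= psi t by exact: powR_ge0.
pose N := mxP K psi; have cN : continuous N by exact: mxP_cts.
have N0 t : 0 <= N t by exact: mxP_ge0.
pose b := c2pow s (abs2e_gt0 h e0).
pose F x t := (a2 h x t + e) `^ (s - 1) * a2 (pdx h) x t.
have cF : cont2 F.
  apply: ctsM; last exact: cont2_a2.
  apply: cts_powR; first by move=> z; rewrite ltr_wpDl// a2_ge0.
  by apply: ctsD; [exact: cont2_a2|exact: cts_cst].
pose E t := cint (- ln 2) 0 (fun x => - x * F x t).
have cE : continuous E by exact: cts_cint_nx.
have F0 x t : 0 <= F x t by rewrite mulr_ge0 ?powR_ge0 ?a2_ge0.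
have E0 t : 0 <= E t by apply: cint_ge0 => x /andP[_ x0]; rewrite mulr_ge0 ?oppr_ge0.
have ce : continuous (fun t => (a2 h 0 t + e) `^ s).
  apply: cts_powR_ge0 => //; first by move=> t; rewrite addr_ge0 ?a2_ge0// ltW.
  by apply: ctsD; [exact: a2_cts|exact: cts_cst].
have ca : continuous (fun t => a2 h 0 t `^ s) by apply: cts_powR_ge0 => //; [exact: a2_ge0|exact: a2_cts].
have hE : cm E <= (4 * s * s)^-1 * cm (fun t => (a2 h 0 t + e) `^ s).
  rewrite ler_pdivlMl ?mulr_gt0// -cmZ//.
  have [B HB] := abs2e_pow_bounded h e0 s0.
  have := @green _ b (ln 2) B (ltW ln2_gt0) HB _ _.
  have -> : fn b 0 = (fun t => (a2 h 0 t + e) `^ s) by apply/funext => t; rewrite fn_abs2e_pow.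
  move=> G; apply: le_trans (G _ _); last 2 first.
  - by move=> x t _; rewrite fn_abs2e_pow powR_ge0.
  - by move=> x t _; exact: lap_abs2e_pow_ge0.
  apply: le_cm; [by apply: ctsM => //; exact: cts_cst|by apply: cts_cint_nx; exact: c2_lap_cts|move=> t].
  rewrite /E -cintZ; last exact: cts_nx1.
  apply: le_cint; [by apply: ctsM; [exact: cts_cst|exact: cts_nx1]|by apply: cts_nx1; exact: c2_lap_cts|].
  move=> x /andP[_ x0]; rewrite mulrCA ler_wpM2l ?oppr_ge0//.
  apply: le_trans (lap_abs2e_pow h e0 x t s0); rewrite (min_idPl s1) /F.
  by rewrite !mulrA.
pose A t := (4 * N t) `^ (s / 2)^-1 + 2 * e.
have A0 t : 0 < A t by rewrite ltr_wpDl ?powR_ge0// mulr_gt0.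
have GA t : LPG h t <= A t `^ (1 - s) * E t.
  rewrite /LPG /E -cintZ; last exact: cts_nx1.
  apply: le_cint; [by apply: cts_nx1; exact: cont2_a2|by apply: ctsM; [exact: cts_cst|exact: cts_nx1]|].
  move=> x /andP[xL x0]; rewrite mulrCA ler_wpM2l ?oppr_ge0// /F mulrA ler_peMl ?a2_ge0//.
  have ae : a2 h x t + e <= A t.
    by have := HK x t ltac:(by rewrite xL); rewrite -/N /A; lra.
  have a0 : 0 < a2 h x t + e by rewrite ltr_wpDl// a2_ge0.
  rewrite -[s - 1]opprB powRN ler_pdivlMr ?powR_gt0// mul1r.
  by apply: ge0_ler_powR; rewrite ?nnegrE; lra.
have GA' t : LPG h t `^ s <= 2 `^ s * (16 * N t ^+ 2) + 2 `^ s * (2 * e) `^ s + E t.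
  apply: (@le_trans _ _ ((A t `^ s) `^ (1 - s) * E t `^ s)).
    rewrite -powRrM [s * _]mulrC powRrM -powRM ?powR_ge0//.
    by apply: ge0_ler_powR; rewrite ?nnegrE ?mulr_ge0 ?powR_ge0 ?LPG_ge0// ltW.
  apply: (le_trans (powR_young _ _ _)); rewrite ?powR_ge0 ?(ltW s0)//.
  have e20' : 0 <= 2 * e by rewrite mulr_ge0// ltW.
  rewrite lerD2r -mulrDr; apply: (le_trans (powR_add_le (ltW s0) (powR_ge0 _ _) e20')).
  rewrite -powRrM (_ : (s / 2)^-1 * s = 2); last by field; rewrite gt_eqF.
  by rewrite powR_mulrn ?mulr_ge0// exprMn -natrX lexx.
have cN2 : continuous (fun t => N t ^+ 2) by exact: ctsX.
have cz k (f : R -> R) : continuous f -> continuous (fun t => k * f t) by move=> cf; apply: ctsM => //; exact: cts_cst.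
apply: (@le_trans _ _ (cm (fun t => 2 `^ s * (16 * N t ^+ 2) + 2 `^ s * (2 * e) `^ s + E t))).
  apply: le_cm => //.
    by apply: cts_powR_ge0 => //; [exact: LPG_ge0|exact: LPG_cts].
  by apply: ctsD => //; apply: ctsD; [by apply: (cz); exact: (cz)|exact: cts_cst].
rewrite cmD//; last by apply: ctsD; [apply: (cz); exact: (cz)|exact: cts_cst].
rewrite cmD; [|by apply: (cz); exact: (cz)|exact: cts_cst].
rewrite cm_cst cmZ; last exact: (cz).
rewrite cmZ//.
have hN : cm (fun t => N t ^+ 2) <= 64 * cm (fun t => a2 h 0 t `^ s).
  apply: (le_trans (maximal_L2 K cpsi ppsi p0)); rewrite ler_pM2l//.
  rewrite (_ : (fun t => psi t ^+ 2) = (fun t => a2 h 0 t `^ s))//.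
  apply/funext => t; rewrite /psi -powR_mulrn ?powR_ge0// -powRrM; congr (_ `^ _); lra.
have he2 : 2 `^ s * (2 * e) `^ s <= n / 2.
  rewrite mulrC -ler_pdivlMr//.
  have nE : n / 2 / 2 `^ s = ((n / (2 * 2 `^ s)) `^ s^-1) `^ s.
    rewrite -powRrM mulVf ?gt_eqF// powRr1; last by rewrite ltW// divr_gt0// mulr_gt0.
    by field; rewrite gt_eqF.
  rewrite nE; apply: ge0_ler_powR; rewrite ?nnegrE ?powR_ge0 ?(ltW s0) ?mulr_ge0// ?(ltW e0)//.
  have : e <= e2 by rewrite ge_min lexx orbT.
  by rewrite /e2; lra.
have hae : cm (fun t => (a2 h 0 t + e) `^ s) <= cm (fun t => a2 h 0 t `^ s) + n'.
  rewrite -[X in _ + X](@cm_cst R) -cmD//; last exact: cts_cst.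
  apply: le_cm => //; first by apply: ctsD => //; exact: cts_cst.
  move=> t; apply: le_trans (He1 (a2 h 0 t) _); last by rewrite a2_ge0/=; exact: HM.
  have a0 := a2_ge0 h 0 t; have ee1 : e <= e1 by rewrite ge_min lexx.
  have ae := addr_ge0 a0 (ltW e0); have ae1 := addr_ge0 a0 (ltW e10).
  by apply: ge0_ler_powR; rewrite ?nnegrE ?(ltW s0)// lerD2l.
have hn : (4 * s * s)^-1 * n' = n / 2 by rewrite /n'; field; rewrite !gt_eqF.
rewrite /C; set cA := cm (fun t => a2 h 0 t `^ s) in hN hae *.
have h1 : 2 `^ s * (16 * cm (fun t => N t ^+ 2)) <= 2 `^ s * (16 * (64 * cA)) by rewrite ler_pM2l// ler_pM2l.
have h2 : (4 * s * s)^-1 * cm (fun t => (a2 h 0 t + e) `^ s) <= (4 * s * s)^-1 * (cA + n') by rewrite ler_pM2l.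
by rewrite mulrDr hn in h2; rewrite mulrDl; lra.
Qed.

End LPsmall.

(** * Dilations, weights and subharmonic majorants *)

Section LPlarge.
Variable R : realType.
Implicit Types (h : {poly R[i]}) (s : R).

Lemma cint_scale2 (f : R -> R) (a b : R) : continuous f -> a <= b ->
  cint (2 * a) (2 * b) f = 2 * cint a b (fun y => f (2 * y)).
Proof.
move=> cf ab; set A := 2 * a - 1; set B := 2 * b + 1.
have c2x : continuous (fun y : R => 2 * y) by apply: ctsM; [exact: cts_cst|exact: cts_id].
have cfs : continuous (fun y : R => f (2 * y)) by exact: (cts_comp (h := f)).
have dF (x : R) : A < x < B -> is_derive x 1 (fun x => cint A x f) (f x).
  move=> /andP[Ax xB].
  have [] := @continuous_FTC1_closed R f A x B xB (cint_int _ _ cf) Ax (cf x) => d1 d2.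
  by rewrite -d2 derive1E; exact: DeriveDef.
rewrite -cintZ//.
have -> : cint a b (fun y => 2 * f (2 * y)) = cint A (2 * b) f - cint A (2 * a) f.
  apply: (@cint_FTC _ a b (fun y => 2 * f (2 * y)) (fun t => cint A (2 * t) f)) => //.
    by apply: ctsM => //; exact: cts_cst.
  move=> x /andP[ax xb].
  rewrite mulrC; apply: (isdcomp (g := fun t => 2 * t) (dF _ _)).
    by rewrite /A /B; apply/andP; split; lra.
  by apply: (isdE (isdM (isdcst 2 x) (isdid x))); rewrite mul0r add0r mulr1.
by rewrite -(@cint_cat _ A (2 * a) (2 * b))// ?[cint A _ _ + _]addrC ?addrK// /A; lra.
Qed.

Lemma a2_dil h (x y t : R) : a2 (h \Po ((expR y +i* 0)%C *: 'X)) x t = a2 h (y + x) t.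
Proof.
rewrite /a2 /rp /ip horner_comp hornerZ hornerX (_ : (_ +i* _)%C * zz x t = zz (y + x) t)//.
by rewrite /zz expRD; apply/eqP; rewrite eq_complex/=; apply/andP; split; apply/eqP; ring.
Qed.

Lemma a2_PI h (y t : R) : y < 0 -> a2 h (2 * y) t <= PI (a2 h y) (expR y) t.
Proof.
move=> y0; have := @a2_powR_PI R (h \Po ((expR y +i* 0)%C *: 'X)) 1 y t ltr01 y0.
rewrite powRr1 ?a2_ge0// a2_dil (_ : 2 * y = y + y); last by ring.
rewrite (_ : (fun t => _) = a2 h y)//.
by apply/funext => u; rewrite powRr1 ?a2_ge0// a2_dil addr0.
Qed.

(* Passing from [D (2 y)] to the Poisson mean of [D y] lets the symmetric kernel act on the weight. *)
Lemma LP_weight h (phi : R -> R) (u : R -> R -> R) : continuous phi -> (forall t, 0 <= phi t) ->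
  cont2 u -> (forall x t, 0 <= u x t) ->
  (forall x t, x < 0 -> PI phi (expR x) t <= u x t) ->
  cm (fun t => LPG h t * phi t) <=
  4 * cm (fun t => cint (- ln 2) 0 (fun x => - x * (a2 (pdx h) x t * u x t))).
Proof.
move=> cphi p0 cu u0 hu; set L := ln 2; have L0 : 0 < L by exact: ln2_gt0.
pose D := a2 (pdx h); have cD : cont2 D by exact: cont2_a2.
have cDu : cont2 (fun x t => D x t * u x t) by apply: ctsM.
have c2x : continuous (fun z : R * R => (2 * z.1, z.2)).
  apply: (@continuous_pairing _ _ _ (fun z : R * R => 2 * z.1) (fun z : R * R => z.2)).
    by apply: cts_fst; apply: ctsM; [exact: cts_cst|exact: cts_id].
  by move=> z; exact: cvg_snd.
have cD2 : cont2 (fun x t => D (2 * x) t).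
  by move=> z; apply: (@continuous_comp _ _ _ (fun z : R * R => (2 * z.1, z.2)) (fun z => D z.1 z.2)); [exact: c2x|exact: cD].
have cDp : cont2 (fun x t => D (2 * x) t * phi t) by apply: ctsM => //; exact: cts_snd.
have -> : (fun t => LPG h t * phi t) = (fun t => 4 * cint (- (L / 2)) 0 (fun x => - x * (D (2 * x) t * phi t))).
  apply/funext => t; rewrite /LPG -/L.
  have -> : cint (- L) 0 (fun x => - x * a2 (pdx h) x t) =
      2 * cint (- (L / 2)) 0 (fun x => - (2 * x) * D (2 * x) t).
    rewrite -(@cint_scale2 (fun x => - x * D x t)) ?mulr0 ?mulrN; [|exact: cts_nx1|by rewrite oppr_le0 divr_ge0// ltW].
    by rewrite mulrC divfK.
  rewrite (_ : (fun x => _ * (D (2 * x) t * _)) = (fun x => phi t * (- x * D (2 * x) t))); last by apply/funext => x; ring.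
  rewrite (_ : (fun x => - (2 * x) * _) = (fun x => 2 * (- x * D (2 * x) t))); last by apply/funext => x; ring.
  rewrite !cintZ; [by ring|exact: (@cts_nx1 _ (fun x t => D (2 * x) t))..].
rewrite cmZ; last exact: (@cts_cint_nx _ (fun x t => D (2 * x) t * phi t)).
rewrite ler_pM2l//.
apply: (@le_trans _ _ (cm (fun t => cint (- (L / 2)) 0 (fun x => - x * (D x t * u x t))))).
  rewrite (@cm_cint _ (fun z => - z.1 * (D (2 * z.1) z.2 * phi z.2))); last exact: (@cts_nx _ (fun x t => D (2 * x) t * phi t)).
  rewrite (@cm_cint _ (fun z => - z.1 * (D z.1 z.2 * u z.1 z.2))); last exact: (@cts_nx _ (fun x t => D x t * u x t)).
  apply: le_cint => [||x /andP[_ x0]].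
  - by apply: (@cm_continuous _ (fun z => - z.1 * (D (2 * z.1) z.2 * phi z.2))); exact: (@cts_nx _ (fun x t => D (2 * x) t * phi t)).
  - by apply: (@cm_continuous _ (fun z => - z.1 * (D z.1 z.2 * u z.1 z.2))); exact: (@cts_nx _ (fun x t => D x t * u x t)).
  have c1 : continuous (fun t => D (2 * x) t * phi t) by exact: (@cts_pair1 _ (fun x t => D (2 * x) t * phi t)).
  have c2 : continuous (fun t => D x t * u x t) by exact: (@cts_pair1 _ (fun x t => D x t * u x t)).
  rewrite /= !cmZ//; move: x0; rewrite le_eqVlt => /predU1P[->|x0]; first by rewrite oppr0 !mul0r.
  rewrite ler_wpM2l ?oppr_ge0 ?(ltW x0)//.
  have e01 : 0 <= expR x < 1 by rewrite expR_ge0 expR_lt1.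
  have cDx : continuous (D x) by exact: cts_pair1.
  apply: (@le_trans _ _ (cm (fun t => phi t * PI (D x) (expR x) t))).
    apply: le_cm => //; first by apply: ctsM => //; exact: PI_cts.
    by move=> t; rewrite mulrC ler_wpM2l//; exact: a2_PI.
  rewrite PI_sym//; apply: le_cm => //; first by apply: ctsM => //; exact: PI_cts.
  by move=> t; rewrite ler_wpM2l ?a2_ge0//; exact: hu.
apply: le_cm; [exact: (@cts_cint_nx _ (fun x t => D x t * u x t))..|move=> t].
rewrite -(@cint_cat _ (- L) (- (L / 2)) 0); [|exact: (@cts_nx1 _ (fun x t => D x t * u x t))|lra|lra].
rewrite lerDr; apply: cint_ge0 => x /andP[_ xL].
by rewrite mulr_ge0 ?mulr_ge0 ?a2_ge0// oppr_ge0; lra.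
Qed.

Lemma per_bounded (f : R -> R) : continuous f -> per f -> exists2 M, 0 <= M & forall t, `|f t| <= M.
Proof.
move=> cf pf; have [M M0 HM] := @continuous2_bounded R (fun z => f z.1) 0 (pi *+ 2) 0 0 (cts_fst cf).
exists M; first exact: ltW.
by move=> t; have [k hk] := mod_tau t; rewrite -(per_int k t pf); apply: (HM _ 0 hk); rewrite lexx.
Qed.

Lemma sqrt_le_add (a d : R) : 0 <= a -> 0 <= d -> Num.sqrt (a ^+ 2 + d ^+ 2) <= a + d.
Proof.
move=> a0 d0; rewrite -[leRHS]ger0_norm ?addr_ge0// -sqrtr_sqr ler_wsqrtr//.
by rewrite -subr_ge0 (_ : _ - _ = 2 * (a * d)) ?mulr_ge0//; ring.
Qed.

(* The square root of [y^2 + e^2] is convex in [y] and dominates [y]. *)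
Lemma positive_majorant (psi : R -> R) e : continuous psi -> per psi -> (forall t, 0 <= psi t) -> 0 < e ->
  exists u : c2 R, [/\ forall x t, 0 < fn u x t, forall x t, 0 <= lap u x t,
    forall x t, x < 0 -> PI psi (expR x) t <= fn u x t,
    forall t, fn u 0 t <= psi t + e &
    exists2 M, 0 <= M & forall x t, x <= 0 -> fn u x t <= M].
Proof.
move=> cpsi ppsi p0 e0; have d0 : 0 < e / 3 by rewrite divr_gt0.
(* Three errors of size [d] add up to [e]: the approximation by [p], the shift that puts [y] above
   [psi] on the circle, and the smoothing of the absolute value. *)
set d := e / 3 in d0; have [p Hp] := rp_dense cpsi ppsi d0.
pose y := c2add (c2re p) (c2cst d).
pose v := c2add (c2mul y y) (c2cst (d ^+ 2)).
have vE x t : fn v x t = fn y x t ^+ 2 + d ^+ 2 by rewrite /= !expr2.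
have v0 x t : 0 < fn v x t by rewrite vE ltr_wpDl ?sqr_ge0// exprn_gt0.
exists (c2pow 2^-1 v0).
have uE x t : fn (c2pow 2^-1 v0) x t = Num.sqrt (fn y x t ^+ 2 + d ^+ 2).
  by rewrite -vE -powR12_sqrt// ltW.
have uy x t : fn y x t <= fn (c2pow 2^-1 v0) x t.
  rewrite uE; apply: (@le_trans _ _ `|fn y x t|); first exact: ler_norm.
  by rewrite -sqrtr_sqr ler_wsqrtr// lerDl sqr_ge0.
split.
- by move=> x t; exact: (powR_gt0 _ (v0 x t)).
- move=> x t; rewrite lap_pow; set P := fn v x t `^ _.
  rewrite (powR_pred _ (v0 x t)) -/P.
  have P0 : 0 <= P by exact: powR_ge0.
  have := lap_re p x t; rewrite /lap /= => lp.
  rewrite (_ : _ * _ = P * (d ^+ 2 * (rp (pdx p) x t ^+ 2 + ip (pdx p) x t ^+ 2))); last by field.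
  by apply: mulr_ge0 => //; apply: mulr_ge0; [exact: sqr_ge0|apply: addr_ge0; exact: sqr_ge0].
- move=> x t x0; apply: le_trans (uy x t).
  have e01 : 0 < expR x < 1 by rewrite expR_gt0 expR_lt1.
  have := PI_rp p 0 t x0; rewrite addr0 => E.
  have := @PI_dist _ (rp p 0) psi (expR x) t d e01 (@rp_cts R p 0) cpsi Hp.
  by rewrite E /= ler_norml => /andP[h1 h2]; lra.
- move=> t; rewrite uE.
  have := Hp t; rewrite ler_norml => /andP[h1 h2]; have := p0 t => h3.
  have yE : fn y 0 t = rp p 0 t + d by [].
  have y0 : 0 <= fn y 0 t by rewrite yE; lra.
  apply: (@le_trans _ _ (fn y 0 t + d)); last by rewrite yE /d; rewrite /d in h1 h2; lra.
  by apply: sqrt_le_add => //; exact: ltW.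
- have [M M0 HM] := rp_bounded p; exists (M + d + d); first by rewrite !addr_ge0// ltW.
  move=> x t x0; rewrite uE; have := HM x t x0; rewrite ler_norml => /andP[h1 h2].
  have yE : fn y x t = rp p x t + d by [].
  have Md0 : 0 <= M + d by rewrite addr_ge0// ltW.
  apply: le_trans (sqrt_le_add Md0 (ltW d0)); rewrite ler_wsqrtr// lerD2r yE.
  rewrite -[leLHS]real_normK ?num_real// lerXn2r ?nnegrE//.
  by rewrite ler_norml; apply/andP; split; lra.
Qed.

(** A substitute for Jensen's inequality: multiply by [u^(1 - n)] and use
    [f^n u^(1 - n) <= f + u]. *)
Lemma PI_powR_le (f : R -> R) r t n (u : R) : 0 < r < 1 -> 0 < n <= 1 -> continuous f -> (forall t, 0 <= f t) -> 0 < u ->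
  PI f r t <= u -> PI (fun t => f t `^ n) r t <= 2 * u `^ n.
Proof.
move=> r01 /andP[n0 n1] cf f0 u0 fu; have r01' : 0 <= r < 1 by case/andP: r01 => /ltW -> ->.
have cfn : continuous (fun t => f t `^ n) by exact: cts_powR_ge0.
have U0 : 0 < u `^ (1 - n) by rewrite powR_gt0.
rewrite -(ler_pM2l U0) -PIZ// mulrCA powR_split ?(ltW u0)//.
apply: (@le_trans _ _ (PI (fun t => f t + u) r t)).
  apply: PI_le => //; [by apply: ctsM => //; exact: cts_cst|by apply: ctsD => //; exact: cts_cst|].
  move=> v; rewrite [leRHS]addrC; apply: powR_young; [by rewrite n1 ltW|exact: ltW|exact: f0].
rewrite PID//; last exact: cts_cst.
by rewrite PI_cst//; lra.
Qed.

Lemma LPG_powR_cts h s : 0 < s -> continuous (fun t => LPG h t `^ s).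
Proof. by move=> s0; apply: cts_powR_ge0 => //; [exact: LPG_ge0|exact: LPG_cts]. Qed.

Lemma a2_powR_cts h s : 0 < s -> continuous (fun t => a2 h 0 t `^ s).
Proof. by move=> s0; apply: cts_powR_ge0 => //; [exact: a2_ge0|exact: a2_cts]. Qed.

Lemma LPG_pow_split h s : 0 < s -> cm (fun t => LPG h t `^ s) = cm (fun t => LPG h t * LPG h t `^ (s - 1)).
Proof.
move=> s0; congr cm; apply/funext => t.
have [->|] := eqVneq (LPG h t) 0; first by rewrite mul0r powR0 ?gt_eqF.
move=> h0; have hp : 0 < LPG h t by rewrite lt_neqAle eq_sym h0 LPG_ge0.
rewrite -[X in X * _](powRr1 (ltW hp)) -powRD ?(gt_eqF hp) ?implybT//; congr (_ `^ _); lra.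
Qed.

Lemma cm_addeps (f : R -> R) s eta : 0 < s -> 0 < eta -> continuous f -> per f -> (forall t, 0 <= f t) ->
  exists2 e, 0 < e & cm (fun t => (f t + e) `^ s) <= cm (fun t => f t `^ s) + eta.
Proof.
move=> s0 n0 cf pf f0; have [M M0 HM] := per_bounded cf pf.
have [e e0 He] := powR_addeps s0 M0 n0; exists e => //.
rewrite -[X in _ + X](@cm_cst R) -cmD; [|exact: cts_powR_ge0|exact: cts_cst].
apply: le_cm.
- apply: cts_powR_ge0 => //; first by move=> t; rewrite addr_ge0// ltW.
  by apply: ctsD => //; exact: cts_cst.
- by apply: ctsD; [exact: cts_powR_ge0|exact: cts_cst].
by move=> t; apply: He; rewrite f0/= (le_trans (ler_norm _) (HM t)).
Qed.

End LPlarge.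

(** * The g-function for exponents above 1 *)

Section LPmain.
Variable R : realType.
Implicit Types (h : {poly R[i]}) (s : R).

Lemma lapD (a b : c2 R) x t : lap (c2add a b) x t = lap a x t + lap b x t.
Proof. by rewrite /lap /=; ring. Qed.

Lemma lapM (a b : c2 R) x t : lap (c2mul a b) x t =
  lap a x t * fn b x t + fn a x t * lap b x t + 2 * (f1 a x t * f1 b x t + f2 a x t * f2 b x t).
Proof. by rewrite /lap /=; ring. Qed.

Lemma lapZ k (a : c2 R) x t : lap (c2mul (c2cst k) a) x t = k * lap a x t.
Proof. by rewrite /lap /=; ring. Qed.

(** A duality principle: a weighted mean of [LPG] is bounded as soon as some nonnegative [b],
    bounded for [x <= 0], has Laplacian at least [k |h_x|^2 W], with [W] above the Poisson extension
    of the weight. The next two cases differ in the choice of [b]. *)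
Lemma LP_green h (b : c2 R) (phi : R -> R) (W : R -> R -> R) (k M : R) :
  continuous phi -> (forall t, 0 <= phi t) -> cont2 W -> (forall x t, 0 <= W x t) ->
  (forall x t, x < 0 -> PI phi (expR x) t <= W x t) ->
  0 < k -> (forall x t, 0 <= fn b x t) -> (forall x t, x <= 0 -> fn b x t <= M) ->
  (forall x t, k * (a2 (pdx h) x t * W x t) <= lap b x t) ->
  k * cm (fun t => LPG h t * phi t) <= 4 * cm (fn b 0).
Proof.
move=> cphi p0 cW W0 hW k0 b0 bM hk.
pose F x t := a2 (pdx h) x t * W x t.
have cF : cont2 F by apply: ctsM => //; exact: cont2_a2.
have F0 x t : 0 <= F x t by apply: mulr_ge0 => //; exact: a2_ge0.
have hG := @green _ b (ln 2) M (ltW (ln2_gt0 R)) bM (fun x t _ => b0 x t)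
  (fun x t _ => le_trans (mulr_ge0 (ltW k0) (F0 x t)) (hk x t)).
have h1 : k * cm (fun t => cint (- ln 2) 0 (fun x => - x * F x t)) <= cm (fn b 0).
  apply: le_trans hG; rewrite -cmZ; last exact: cts_cint_nx.
  apply: le_cm; [by apply: ctsM; [exact: cts_cst|exact: cts_cint_nx]|by apply: cts_cint_nx; exact: c2_lap_cts|move=> t].
  rewrite -cintZ; last exact: cts_nx1.
  apply: le_cint; [by apply: ctsM; [exact: cts_cst|exact: cts_nx1]|by apply: cts_nx1; exact: c2_lap_cts|].
  by move=> x /andP[_ x0]; rewrite mulrCA ler_wpM2l ?oppr_ge0//; exact: hk.
have h2 := LP_weight h cphi p0 cW W0 hW.
apply: (@le_trans _ _ (k * (4 * cm (fun t => cint (- ln 2) 0 (fun x => - x * F x t))))).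
  by rewrite ler_pM2l.
by rewrite mulrCA ler_pM2l.
Qed.

(** With [n = s - 1], the weight is [LPG^n]. Take [u] subharmonic above [LPG] and
    [b = (|h|^2 + k u)^s]: its Laplacian dominates a multiple of [u^n |h_x|^2], and its boundary
    values bring back [k^s LPG^s], which a small [k] absorbs. *)
Lemma LP_mid s : 1 < s <= 2 -> exists2 C, 0 <= C & forall h,
  cm (fun t => LPG h t `^ s) <= C * cm (fun t => a2 h 0 t `^ s).
Proof.
case/andP=> s1 s2; have s0 : 0 < s by lra.
pose n := s - 1; have n01 : 0 < n <= 1 by rewrite /n; apply/andP; split; lra.
have [n0 n1] := andP n01.
pose P : R := 2 `^ s; have P0 : 0 < P by rewrite powR_gt0.
(* Gives [4 P k = s], so that the term coming back is half of the left side. *)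
pose k : R := s / (4 * P); have k0 : 0 < k by rewrite divr_gt0// mulr_gt0.
have kn0 : 0 < k `^ n by rewrite powR_gt0.
exists (4 * P / (s * k `^ n)) => [|h].
  by rewrite divr_ge0// ltW// mulr_gt0.
set X := cm _; set A := cm _; apply/ler_addgt0Pr => eta eta0.
have cG := @LPG_cts R h; have G0 := LPG_ge0 h.
have [e e0 He] := cm_addeps s0 eta0 cG (@LPG_per R h) G0.
have [u [u0 lu hu u1 [Mu Mu0 HMu]]] := positive_majorant cG (@LPG_per R h) G0 e0.
pose a := c2add (c2abs2 h) (c2mul (c2cst k) u).
have aE x t : fn a x t = a2 h x t + k * fn u x t by rewrite -fn_abs2.
have a0 x t : 0 < fn a x t by rewrite aE ltr_wpDl ?a2_ge0// mulr_gt0.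
have [M M0 HM] := a2_bounded h.
have cz (m : R) (f : R -> R) : continuous f -> continuous (fun t => m * f t) by move=> cf; apply: ctsM => //; exact: cts_cst.
have key : 2 * s * k `^ n * cm (fun t => LPG h t * LPG h t `^ n) <= 4 * cm (fn (c2pow s a0) 0).
  apply: (@LP_green h (c2pow s a0) (fun t => LPG h t `^ n) (fun x t => 2 * fn u x t `^ n) _ ((M + k * Mu) `^ s)).
  - exact: LPG_powR_cts.
  - by move=> t; exact: powR_ge0.
  - apply: ctsM; first exact: cts_cst.
    by apply: cts_powR; [move=> z; exact: u0|exact: c2C].
  - by move=> x t; rewrite mulr_ge0 ?powR_ge0.
  - move=> x t x0; apply: PI_powR_le => //; last exact: hu.
    by rewrite expR_gt0 expR_lt1.
  - by rewrite !mulr_gt0.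
  - by move=> x t; exact: powR_ge0.
  - move=> x t x0; rewrite [leLHS](_ : _ = fn a x t `^ s)//.
    have hM := HM x t x0; have hk : k * fn u x t <= k * Mu by rewrite ler_pM2l//; exact: HMu.
    have ax := a0 x t.
    apply: ge0_ler_powR; rewrite ?nnegrE ?(ltW s0) ?(ltW ax)//; rewrite aE in ax *; lra.
  move=> x t; rewrite lap_pow; set D := a2 (pdx h) x t; set V := fn u x t.
  have D0 : 0 <= D by exact: a2_ge0.
  have V0 : 0 < V by exact: u0.
  have h2 : 4 * D <= lap a x t.
    by rewrite lapD lap_abs2 lapZ lerDl mulr_ge0// ltW.
  have h3 : k `^ n * V `^ n <= fn a x t `^ n.
    have k0' := ltW k0; have V0' := ltW V0; have kV : 0 <= k * V by exact: mulr_ge0.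
    rewrite -powRM//; apply: ge0_ler_powR; rewrite ?nnegrE ?(ltW n0) ?(ltW (a0 x t))//.
    by rewrite aE lerDr a2_ge0.
  have h4 : k `^ n * V `^ n * (4 * D) <= fn a x t `^ n * lap a x t.
    by apply: ler_pM => //; rewrite mulr_ge0 ?powR_ge0.
  have h5 : 0 <= (s - 1) * fn a x t `^ (s - 1 - 1) * (f1 a x t ^+ 2 + f2 a x t ^+ 2).
    by apply: mulr_ge0; [apply: mulr_ge0; [exact: ltW|exact: powR_ge0]|apply: addr_ge0; exact: sqr_ge0].
  rewrite (_ : 2 * s * _ * _ = s * (k `^ n * V `^ n * (4 * D))); last by ring.
  by rewrite ler_pM2l//; apply: (le_trans h4); rewrite lerDr.
have GX : cm (fun t => LPG h t * LPG h t `^ n) = X by rewrite /X LPG_pow_split.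
have cGe : continuous (fun t => (LPG h t + e) `^ s).
  apply: cts_powR_ge0 => //; first by move=> t; rewrite addr_ge0// ltW.
  by apply: ctsD => //; exact: cts_cst.
have ca : continuous (fun t => a2 h 0 t `^ s) by apply: cts_powR_ge0 => //; [exact: a2_ge0|exact: a2_cts].
have hB : cm (fn (c2pow s a0) 0) <= P * (A + k `^ s * (X + eta)).
  apply: (@le_trans _ _ (cm (fun t => P * (a2 h 0 t `^ s + k `^ s * (LPG h t + e) `^ s)))).
    apply: le_cm; first exact: c2_cts.
      by apply: (cz); apply: ctsD => //; exact: (cz).
    move=> t; rewrite [leLHS](_ : _ = fn a 0 t `^ s)// aE.
    have k0' := ltW k0; have Ge0 : 0 <= LPG h t + e by rewrite addr_ge0// ltW.
    rewrite -[k `^ s * _]powRM//.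
    apply: le_trans (powR_add_le (ltW s0) (a2_ge0 h 0 t) _); last by rewrite mulr_ge0.
    have ut := ltW (u0 0 t); have at0 := a2_ge0 h 0 t.
    have ku : 0 <= k * fn u 0 t by exact: mulr_ge0.
    have kG : 0 <= k * (LPG h t + e) by exact: mulr_ge0.
    have h1 := addr_ge0 at0 ku; have h2 := addr_ge0 at0 kG.
    apply: ge0_ler_powR; rewrite ?nnegrE ?(ltW s0)//.
    by rewrite lerD2l ler_pM2l//; exact: u1.
  rewrite cmZ; last by apply: ctsD => //; exact: (cz).
  rewrite ler_pM2l// cmD//; last exact: (cz).
  by rewrite lerD2l cmZ// ler_pM2l ?powR_gt0.
rewrite GX in key.
have ks : k `^ s = k * k `^ n.
  by rewrite -[k in k * _]powRr1 ?(ltW k0)// -powRD ?subrKC//; apply/implyP => _; rewrite gt_eqF.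
have kP : 4 * P * k = s by rewrite /k; field; rewrite gt_eqF.
rewrite ks in hB; have q0 : 0 < s * k `^ n by rewrite mulr_gt0.
have h7 : 2 * s * k `^ n * X <= 4 * (P * (A + k * k `^ n * (X + eta))) by apply: (le_trans key); rewrite ler_pM2l.
rewrite -(ler_pM2l q0) [leRHS](_ : _ = 4 * P * A + s * k `^ n * eta); last by field; rewrite !gt_eqF.
have : 4 * (P * (A + k * k `^ n * (X + eta))) = 4 * P * A + s * k `^ n * X + s * k `^ n * eta.
  by rewrite -kP; ring.
lra.
Qed.

(** The mixed gradient term is at most twice the geometric mean of [D z] and [w q], thus at most
    their sum. *)
Lemma cross_le (a D q v z w : R) : 0 <= D -> 0 <= q -> 0 <= z -> 0 <= w ->
  a <= z * w -> v ^+ 2 <= 4 * a * D * q -> - v <= D * z + w * q.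
Proof.
move=> D0 q0 z0 w0 azw hv; have Dq : 0 <= D * q by exact: mulr_ge0.
have y0 : 0 <= D * z + w * q by rewrite addr_ge0// mulr_ge0.
have h : v ^+ 2 <= (D * z + w * q) ^+ 2.
  apply: (le_trans hv); apply: (@le_trans _ _ (4 * (z * w) * (D * q))).
    by rewrite -mulrA ler_wpM2r// ler_pM2l.
  have := sqr_ge0 (D * z - w * q); nra.
by rewrite leNgt; apply/negP => vy; nra.
Qed.

Lemma dot2_le (x1 x2 y1 y2 : R) :
  (x1 * y1 + x2 * y2) ^+ 2 <= (x1 ^+ 2 + x2 ^+ 2) * (y1 ^+ 2 + y2 ^+ 2).
Proof. by rewrite -subr_ge0 (_ : _ - _ = (x1 * y2 - x2 * y1) ^+ 2) ?sqr_ge0//; ring. Qed.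

(** Now [n = s - 1 >= 1], and [u] majorises [k LPG^n] itself. The Laplacian of [|h|^2 u] contains
    [4 |h_x|^2 u], but also a mixed gradient term without sign. The powers [(|h|^2 + d)^s] and
    [u^r], with [r = s / n] the exponent conjugate to [s], are added to [b] to dominate it. *)
Lemma LP_large s : 2 <= s -> exists2 C, 0 <= C & forall h,
  cm (fun t => LPG h t `^ s) <= C * cm (fun t => a2 h 0 t `^ s).
Proof.
move=> s2.
have fin (y B A e i g : R) : 0 <= A -> 0 <= e -> 0 <= g -> i <= 4^-1 * (A + e) ->
  B <= A + (i + (y / 4 + (e + g))) -> 2 * y <= 4 * B -> y <= 5 * A + (5 * e + 4 * g) by lra.
have s0 : 0 < s by lra.
have s1 : 1 <= s by lra.
pose n := s - 1; have n1 : 1 <= n by rewrite /n; lra.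
have n0 : 0 < n by lra.
pose r := s / n; have rE : r = 1 + n^-1 by rewrite /r /n; field; rewrite gt_eqF.
have ni0 : 0 < n^-1 by rewrite invr_gt0.
have ni1 : n^-1 <= 1 by rewrite invf_le1.
have r0 : 0 < r by rewrite rE addr_gt0.
have r1 : 1 <= r by rewrite rE lerDl ltW.
have rn : n * r = s by rewrite /r; field; rewrite gt_eqF.
(* Chosen so that [c] times the Laplacian of [u^r] dominates [2 u^(r - 2) |grad u|^2]. *)
pose c : R := 2 / (r * (r - 1)).
have rr : 0 < r * (r - 1) by rewrite mulr_gt0// rE addrAC subrr add0r.
have c0 : 0 < c by rewrite divr_gt0.
have cr : c * (r * (r - 1)) = 2 by rewrite /c divfK ?gt_eqF.
(* Absorption constant: since [k^r = k m], it gives [(1 + c) k^r = k / 4]. *)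
pose m : R := (4 * (1 + c))^-1; have m0 : 0 < m by rewrite invr_gt0 mulr_gt0// addr_gt0.
pose k := m `^ n; have k0 : 0 < k by rewrite powR_gt0.
have kr : k `^ r = k * m.
  rewrite /k -powRrM rn (_ : s = n + 1); last by rewrite /n subrK.
  by rewrite powRD ?powRr1 ?(ltW m0)//; apply/implyP => _; rewrite gt_eqF.
exists (5 / k) => [|h]; first by rewrite divr_ge0// ltW.
set X := cm _; set A := cm _; apply/ler_addgt0Pr => eta' eta'0.
have c5 : 0 < 5 + 4 * c by lra.
pose eta := eta' * k / (5 + 4 * c).
have eta0 : 0 < eta by rewrite divr_gt0// mulr_gt0.
have cz (y : R) (f : R -> R) : continuous f -> continuous (fun t => y * f t) by move=> cf; apply: ctsM => //; exact: cts_cst.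
have cGn := @LPG_powR_cts R h n n0.
pose f t := k * LPG h t `^ n.
have cf : continuous f by exact: (cz).
have f0 t : 0 <= f t by rewrite mulr_ge0 ?powR_ge0// ltW.
have pf : per f by move=> t; rewrite /f LPG_per.
have fr : cm (fun t => f t `^ r) = k `^ r * X.
  rewrite /X -cmZ; last exact: LPG_powR_cts.
  congr cm; apply/funext => t; rewrite /f powRM ?powR_ge0 ?(ltW k0)//.
  by rewrite -powRrM rn.
have [e e0 He] := cm_addeps r0 eta0 cf pf f0.
have [u [u0 lu hu u1 [Mu Mu0 HMu]]] := positive_majorant cf pf f0 e0.
have ca0 : continuous (a2 h 0) by exact: a2_cts.
have pa0 : per (a2 h 0) by move=> t; rewrite a2_per.
have [d d0 Hd] := cm_addeps s0 eta0 ca0 pa0 (a2_ge0 h 0).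
pose b2 := c2pow s (abs2e_gt0 h d0); pose b3 := c2pow r u0.
pose b := c2add (c2mul (c2abs2 h) u) (c2add (c2mul (c2cst (2 * s)^-1) b2) (c2mul (c2cst c) b3)).
have bE x t : fn b x t = a2 h x t * fn u x t + ((2 * s)^-1 * (a2 h x t + d) `^ s + c * fn u x t `^ r).
  by rewrite -fn_abs2e_pow -fn_abs2.
have is0 : 0 < (2 * s)^-1 by rewrite invr_gt0 mulr_gt0.
have is1 : (2 * s)^-1 <= 4^-1 by rewrite lef_pV2 ?posrE ?mulr_gt0// (_ : 4 = 2 * 2) ?ler_pM2l//; ring.
have [M M0 HM] := a2_bounded h.
have [M2 HM2] := abs2e_pow_bounded h d0 s0.
have key : 2 * cm (fun t => LPG h t * f t) <= 4 * cm (fn b 0).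
  apply: (@LP_green h b f (fn u) _ (M * Mu + ((2 * s)^-1 * M2 + c * Mu `^ r))) => //.
  - exact: c2C.
  - by move=> x t; exact: ltW.
  - move=> x t; rewrite bE; have := a2_ge0 h x t; have ut := ltW (u0 x t) => at0.
    apply: addr_ge0; first exact: mulr_ge0.
    by apply: addr_ge0; apply: mulr_ge0; rewrite ?powR_ge0 ?(ltW c0) ?(ltW is0).
  - move=> x t x0; have ut := ltW (u0 x t); have at0 := a2_ge0 h x t.
    have h1 := HM x t x0; have h2 := HMu x t x0; have := HM2 x t x0; rewrite fn_abs2e_pow => h3.
    rewrite bE; apply: lerD; first exact: ler_pM.
    apply: lerD; first by rewrite ler_pM2l.
    by rewrite ler_pM2l//; apply: ge0_ler_powR; rewrite ?nnegrE ?(ltW r0).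
  move=> x t; set D := a2 (pdx h) x t; set V := fn u x t; set a := a2 h x t.
  have D0 : 0 <= D by exact: a2_ge0.
  have a0 : 0 <= a by exact: a2_ge0.
  have V0 : 0 < V by exact: u0.
  pose q := f1 u x t ^+ 2 + f2 u x t ^+ 2.
  have q0 : 0 <= q by rewrite addr_ge0// sqr_ge0.
  pose w := V `^ (r - 1 - 1); have w0 : 0 <= w by exact: powR_ge0.
  (* This [z] satisfies both [z <= V + a^n] and [a <= z w]: [a <= z^(1/n) = z z^(r - 2)], where the
     exponent [r - 2] is not positive and [V <= z]. *)
  pose z := Num.max V (a `^ n).
  have an0 : 0 <= a `^ n by exact: powR_ge0.
  have z0 : 0 < z by rewrite lt_max V0.
  have zle : z <= V + a `^ n by rewrite ge_max lerDl an0 lerDr ltW.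
  have az : a <= z * w.
    apply: (@le_trans _ _ (z `^ n^-1)).
      rewrite -[a in leLHS]powRr1// -(mulfV (lt0r_neq0 n0)) powRrM.
      by apply: ge0_ler_powR; rewrite ?nnegrE ?(ltW ni0) ?(ltW z0)// le_max lexx orbT.
    rewrite (_ : n^-1 = 1 + (r - 1 - 1)); last by rewrite rE; ring.
    rewrite powRD; last by apply/implyP => _; rewrite gt_eqF.
    rewrite powRr1 ?(ltW z0)// ler_pM2l// /w (_ : r - 1 - 1 = - (1 - n^-1)) ?powRN; last by rewrite rE; ring.
    rewrite lef_pV2 ?posrE ?powR_gt0//; apply: ge0_ler_powR; rewrite ?nnegrE ?(ltW z0) ?(ltW V0)//.
      by rewrite subr_ge0.
    by rewrite le_max lexx.
  pose v := f1 (c2abs2 h) x t * f1 u x t + f2 (c2abs2 h) x t * f2 u x t.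
  have hv : v ^+ 2 <= 4 * a * D * q.
    by rewrite -grad_abs2; exact: dot2_le.
  have hc := cross_le D0 q0 (ltW z0) w0 az hv.
  have hz : D * z <= D * V + D * a `^ n by rewrite -mulrDr ler_wpM2l.
  have l2 : 2 * (D * a `^ n) <= (2 * s)^-1 * lap b2 x t.
    have := lap_abs2e_pow h d0 x t s0; rewrite -/b2 -/a -/D; rewrite (min_idPr s1) mulr1 => hl; rewrite -ler_pdivrMl// invrK; apply: le_trans hl.
    rewrite (_ : 2 * s * _ = 4 * s * (D * a `^ n)); last by ring.
    rewrite -[leRHS]mulrA ler_pM2l ?mulr_gt0// mulrC ler_wpM2r//.
    have d0' := ltW d0; have ad := addr_ge0 a0 d0'.
    by apply: ge0_ler_powR; rewrite ?nnegrE ?(ltW n0)// lerDl.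
  have l3 : 2 * (w * q) <= c * lap b3 x t.
    rewrite lap_pow -/V -/w -/q.
    rewrite [leRHS](_ : _ = c * (r * (r - 1)) * (w * q) + c * r * (V `^ (r - 1) * lap u x t)); last by ring.
    rewrite cr lerDl; apply: mulr_ge0; first by rewrite mulr_ge0// ltW.
    by apply: mulr_ge0; [exact: powR_ge0|exact: lu].
  have l1 : 0 <= a * lap u x t by apply: mulr_ge0 => //; exact: lu.
  rewrite /b lapD lapM lapD !lapZ lap_abs2 fn_abs2 -/v -/a -/D -/V.
  clear hv; clearbody v; move: l1 l2 l3 hc hz; rewrite -(mulrA 4).
  by clear; move: (a * _) (_ * lap b2 x t) (c * _) (D * z) (w * q) (D * V) (D * _) => *; lra.
have GX : cm (fun t => LPG h t * f t) = k * X.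
  rewrite /X LPG_pow_split// -cmZ; last by apply: ctsM => //; exact: LPG_cts.
  by congr cm; apply/funext => t; rewrite /f mulrCA.
have ca : continuous (fun t => a2 h 0 t `^ s) by apply: cts_powR_ge0 => //; exact: a2_ge0.
have cad : continuous (fun t => (a2 h 0 t + d) `^ s).
  apply: cts_powR_ge0 => //; first by move=> t; rewrite addr_ge0 ?a2_ge0// ltW.
  by apply: ctsD => //; exact: cts_cst.
have cfe : continuous (fun t => (f t + e) `^ r).
  apply: cts_powR_ge0 => //; first by move=> t; rewrite addr_ge0// ltW.
  by apply: ctsD => //; exact: cts_cst.
have hB : cm (fn b 0) <= A + ((2 * s)^-1 * (A + eta) + (1 + c) * (k * m * X + eta)).
  apply: (@le_trans _ _ (cm (fun t => a2 h 0 t `^ s + ((2 * s)^-1 * (a2 h 0 t + d) `^ s + (1 + c) * (f t + e) `^ r)))).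
    apply: le_cm; first exact: c2_cts.
      by apply: ctsD => //; apply: ctsD; exact: (cz).
    move=> t; rewrite bE; have ut := ltW (u0 0 t); have at0 := a2_ge0 h 0 t.
    have ur : fn u 0 t `^ r <= (f t + e) `^ r.
      by apply: ge0_ler_powR; rewrite ?nnegrE ?(ltW r0) ?addr_ge0 ?(ltW e0)//; exact: u1.
    have ri : 0 <= r^-1 <= 1 by rewrite invr_ge0 ltW//= invf_le1.
    have au : a2 h 0 t * fn u 0 t <= a2 h 0 t `^ s + fn u 0 t `^ r.
      apply: le_trans (powR_young ri (powR_ge0 _ _) (powR_ge0 _ _)).
      rewrite -!powRrM mulfV ?gt_eqF// powRr1// (_ : s * (1 - r^-1) = 1) ?powRr1//.
      by rewrite /r invf_div mulrBr mulr1 mulrCA mulfV ?gt_eqF// mulr1 /n; ring.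
    have uc : c * fn u 0 t `^ r <= c * (f t + e) `^ r by rewrite ler_pM2l.
    move: au ur uc; rewrite (mulrDl 1 c) mul1r.
    by clear; move: (a2 h 0 t * _) (_ `^ s) (_^-1 * _) (fn u 0 t `^ r) (c * (f t + e) `^ r) (c * _) (_ `^ r) => *; lra.
  rewrite cmD//; last by apply: ctsD; exact: (cz).
  rewrite cmD; [|exact: (cz)..].
  rewrite lerD2l !cmZ//; apply: lerD; first by rewrite ler_pM2l.
  by rewrite ler_pM2l ?addr_gt0// -kr -fr.
rewrite GX in key.
have A0 : 0 <= A by rewrite -(cm_cst (0 : R)); apply: le_cm => //; [exact: cts_cst|move=> t; exact: powR_ge0].
have hs : (2 * s)^-1 * (A + eta) <= 4^-1 * (A + eta) by rewrite ler_wpM2r// addr_ge0// ltW.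
have hm : (1 + c) * (k * m * X + eta) = k * X / 4 + (1 + c) * eta.
  by rewrite /m; field; rewrite gt_eqF// addr_gt0.
have he : (5 + 4 * c) * eta = eta' * k by rewrite /eta mulrC divfK ?gt_eqF.
rewrite -(ler_pM2l k0) [leRHS](_ : _ = 5 * A + eta' * k); last by field; rewrite gt_eqF.
rewrite -he (mulrDl 5) -(mulrA 4); rewrite hm (mulrDl 1 c) mul1r in hB.
by apply: (fin _ _ _ _ _ _ A0 (ltW eta0) _ hs hB key); apply: mulr_ge0; exact: ltW.
Qed.

(* Littlewood-Paley: on the circle [a2 h 0] is [|h|^2] and [LPG h] is the square of the g-function. *)
Lemma LP s : 0 < s -> exists2 C, 0 <= C & forall h,
  cm (fun t => LPG h t `^ s) <= C * cm (fun t => a2 h 0 t `^ s).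
Proof.
move=> s0; case: (leP s 1) => s1.
  exists (2 `^ s * 1024 + (4 * s * s)^-1) => [|h]; last by apply: LP_small; rewrite s0.
  have ss : 0 < 4 * s * s by rewrite !mulr_gt0.
  by apply: addr_ge0; [apply: mulr_ge0; [exact: powR_ge0|exact: ler0n]|rewrite invr_ge0 ltW].
case: (leP s 2) => s2; first by apply: LP_mid; rewrite s1.
by apply: LP_large; exact: ltW.
Qed.

End LPmain.

(** * Gradient bounds and the radial integral *)

Section Gradient.
Variable R : realType.
Implicit Types (h : {poly R[i]}).

Definition rcis (r t : R) : R[i] := ((r * cos t) +i* (r * sin t))%C.
Definition n2 (w : R[i]) : R := complex.Re w ^+ 2 + complex.Im w ^+ 2.

Lemma zz_rcis x t : zz x t = rcis (expR x) t.
Proof. by []. Qed.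
Lemma n2_ge0 w : 0 <= n2 w.
Proof. by rewrite addr_ge0// sqr_ge0. Qed.
Lemma a2_n2 h x t : a2 h x t = n2 h.[zz x t].
Proof. by []. Qed.
Lemma n2_sub (a b : R[i]) : n2 (a - b) <= 2 * n2 a + 2 * n2 b.
Proof.
case: a b => [a1 a2] [b1 b2]; rewrite /n2/= -subr_ge0.
rewrite (_ : _ - _ = (a1 + b1) ^+ 2 + (a2 + b2) ^+ 2); last by ring.
by rewrite addr_ge0// sqr_ge0.
Qed.
Lemma n2M (a b : R[i]) : n2 (a * b) = n2 a * n2 b.
Proof. by case: a b => [a1 a2] [b1 b2]; rewrite /n2/=; ring. Qed.

Lemma n2_rcis r t : n2 (rcis r t) = r ^+ 2.
Proof. by rewrite /n2/= !exprMn -mulrDr cos2Dsin2 mulr1. Qed.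

Lemma n2_rcisB r' t' r t : n2 (rcis r' t' - rcis r t) = r' ^+ 2 + r ^+ 2 - 2 * r * r' * cos (t' - t).
Proof.
rewrite cosB /n2/=; apply/eqP; rewrite -subr_eq0; apply/eqP.
rewrite (_ : _ - _ = r' ^+ 2 * ((cos t' ^+ 2 + sin t' ^+ 2) - 1) + r ^+ 2 * ((cos t ^+ 2 + sin t ^+ 2) - 1)); last by ring.
by rewrite !cos2Dsin2 subrr !mulr0 addr0.
Qed.

Lemma sqr_le_itv (x y : R) : 0 <= y -> x ^+ 2 <= y ^+ 2 -> - y <= x <= y.
Proof. by move=> y0 xy; rewrite -ler_norml -(@ler_pXn2r _ 2) ?nnegrE// real_normK ?num_real. Qed.

Lemma cm_rp h : cm (rp h 0) = complex.Re h`_0.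
Proof.
pose F (k : 'I_(size h).+1) (t : R) := complex.Re h`_k * cos (k%:R * t) - complex.Im h`_k * sin (k%:R * t).
have -> : rp h 0 = (fun t => \sum_(k < (size h).+1) F k t).
  by apply/funext => t; rewrite (rp_sum _ _ (leqnSn (size h))); apply: eq_bigr => k _; rewrite mulr0 expR0 mul1r.
have cc k : continuous (fun t : R => complex.Re h`_k * cos (k%:R * t)).
  by apply: ctsM; [exact: cts_cst|exact: cts_cosn].
have cs k : continuous (fun t : R => complex.Im h`_k * sin (k%:R * t)).
  by apply: ctsM; [exact: cts_cst|exact: cts_sinn].
rewrite cm_sum; last by move=> k; apply: ctsB; [exact: cc|exact: cs].
rewrite big_ord_recl big1 ?addr0 => [|k _].
  rewrite (_ : F ord0 = fun=> complex.Re h`_0) ?cm_cst//.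
  by apply/funext => t; rewrite /F /= mul0r cos0 sin0 mulr1 mulr0 subr0.
rewrite /F lift0 cmB; [|exact: cc|exact: cs].
by rewrite !cmZ; [|exact: cts_sinn|exact: cts_cosn]; rewrite cm_cos cm_sin !mulr0 subrr.
Qed.

Lemma mean0 h B : (forall t, a2 h 0 t <= B) -> n2 h`_0 <= B.
Proof.
move=> hB; have [c1 c2] := cont2_rp_ip h.
have cr : continuous (rp h 0) by exact: cts_pair1.
have ci : continuous (ip h 0) by exact: cts_pair1.
have Ei : complex.Im h`_0 = cm (ip h 0).
  rewrite (_ : ip h 0 = rp ((0 +i* (-1))%C *: h) 0); last by apply/funext => t; exact: ip_rp.
  by rewrite cm_rp coefZ ReM/=; ring.
rewrite /n2 -cm_rp Ei; apply: (@le_trans _ _ (cm (a2 h 0))).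
  rewrite /a2 cmD; [|exact: ctsX..].
  by apply: lerD; exact: cm_sq_le.
by rewrite -[leRHS](@cm_cst R); apply: le_cm; [exact: a2_cts|exact: cts_cst|exact: hB].
Qed.

(** [mean0] is applied to the polynomial [k], rescaled to the unit disc, and then to its difference
    quotient at 0; subtracting the value at 0 costs the factor 4. *)
Lemma cauchy h (z : R[i]) (d B : R) : (forall t, n2 h.[z + rcis d t] <= B) ->
  d ^+ 2 * n2 h^`().[z] <= 4 * B.
Proof.
move=> hB; pose D : R[i] := (d +i* 0)%C; pose k := h \Po (D *: 'X + z%:P).
have kE t : k.[zz 0 t] = h.[z + rcis d t].
  rewrite /k horner_comp hornerD hornerZ hornerX hornerC addrC; congr (_.[_ + _]).
  by rewrite /zz /rcis expR0; apply/eqP; rewrite eq_complex/=; apply/andP; split; apply/eqP; ring.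
have h0 : n2 k`_0 <= B by apply: mean0 => t; rewrite a2_n2 kE.
have h1 : n2 (drop_poly 1 k)`_0 <= 4 * B.
  apply: mean0 => t; rewrite a2_n2.
  have E : k.[zz 0 t] = k`_0 + (drop_poly 1 k).[zz 0 t] * zz 0 t.
    rewrite -{1}(poly_take_drop 1 k) hornerD hornerM hornerXn expr1; congr (_ + _).
    by rewrite /take_poly horner_poly big_ord1 expr0 mulr1.
  have N1 : n2 (zz 0 t) = 1 by rewrite zz_rcis expR0 n2_rcis expr1n.
  have -> : n2 ((drop_poly 1 k).[zz 0 t]) = n2 (k.[zz 0 t] - k`_0).
    by rewrite E addrC addKr n2M N1 mulr1.
  by apply: (le_trans (n2_sub _ _)); have := hB t; rewrite -kE; lra.
rewrite coef_drop_poly add0n in h1.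
rewrite (_ : _ * _ = n2 k`_1)//.
have -> : k`_1 = D * h^`().[z].
  have <- : k^`().[0] = k`_1 by rewrite horner_coef0 coef_deriv mulr1n.
  rewrite /k deriv_comp hornerM horner_comp derivD derivZ derivX derivC addr0.
  by rewrite hornerD !hornerZ hornerX !hornerC mulr0 add0r mulr1 mulrC.
by rewrite n2M /n2 /D/= expr0n/= addr0.
Qed.

Lemma polar (w : R[i]) : exists r t, 0 <= r /\ w = rcis r t.
Proof.
case: w => u v; pose r := Num.sqrt (u ^+ 2 + v ^+ 2).
have r2 : r ^+ 2 = u ^+ 2 + v ^+ 2 by rewrite sqr_sqrtr ?addr_ge0 ?sqr_ge0.
have [r0|rn0] := eqVneq r 0.
  exists 0, 0; split=> //; move: r2; rewrite r0 expr0n/= => /esym/eqP.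
  rewrite paddr_eq0 ?sqr_ge0// !sqrf_eq0 => /andP[/eqP-> /eqP->].
  by rewrite /rcis !mul0r.
have r0 : 0 < r by rewrite lt_neqAle eq_sym rn0 sqrtr_ge0.
have hu : -1 <= u / r <= 1.
  rewrite ler_pdivlMr// ler_pdivrMr// mulN1r mul1r; apply: sqr_le_itv; first exact: ltW.
  by rewrite r2 lerDl sqr_ge0.
pose a := acos (u / r).
have ca : cos a = u / r by rewrite acosK// in_itv.
have sa : sin a = `|v| / r.
  rewrite sin_acos// (_ : 1 - _ = (v / r) ^+ 2); first by rewrite sqrtr_sqr normrM normfV (gtr0_norm r0).

  by rewrite !expr_div_n (_ : v ^+ 2 = r ^+ 2 - u ^+ 2); [field|rewrite r2; ring].
have [v0|v0] := leP 0 v.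
  exists r, a; split; first exact: ltW.
  by rewrite /rcis ca sa (ger0_norm v0); apply/eqP; rewrite eq_complex/=; apply/andP; split; apply/eqP; field.
exists r, (- a); split; first exact: ltW.
by rewrite /rcis cosN sinN ca sa (ltr0_norm v0); apply/eqP; rewrite eq_complex/=; apply/andP; split; apply/eqP; field.
Qed.

(** The numerators compare with factor 3 and the squared distances to the boundary point with factor
    4, because the two points are closer than half the distance to the circle. *)
Lemma harnack (r r' t t' s : R) : 0 <= r < 1 -> 0 <= r' -> n2 (rcis r' t' - rcis r t) <= ((1 - r) / 2) ^+ 2 ->
  r' < 1 /\ pk r' (s - t') <= 12 * pk r (s - t).
Proof.
move=> /andP[r0 r1] r'0 H.
have c1 := cos_le1 (t' - t); have rr0 : 0 <= r * r' by exact: mulr_ge0.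
have h1 : (r' - r) ^+ 2 <= ((1 - r) / 2) ^+ 2.
  apply: le_trans H; rewrite n2_rcisB -subr_ge0 (_ : _ - _ = 2 * (r * r') * (1 - cos (t' - t))); last by ring.
  by rewrite !mulr_ge0// subr_ge0.
have /andP[h2 h3] : - ((1 - r) / 2) <= r' - r <= (1 - r) / 2 by apply: sqr_le_itv => //; lra.
have r'1 : r' < 1 by lra.
split=> //.
have dE q u : 1 - 2 * q * cos (s - u) + q ^+ 2 = n2 (rcis 1 s - rcis q u) by rewrite n2_rcisB; ring.
have dw : 0 < n2 (rcis 1 s - rcis r' t') by rewrite -dE; apply: pkden_gt0; rewrite r'0.
have dz : 0 < n2 (rcis 1 s - rcis r t) by rewrite -dE; apply: pkden_gt0; rewrite r0.
rewrite /pk !dE.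
have dz1 : (1 - r) ^+ 2 <= n2 (rcis 1 s - rcis r t).
  rewrite n2_rcisB -subr_ge0 (_ : _ - _ = 2 * r * (1 - cos (s - t))); last by ring.
  by rewrite !mulr_ge0// subr_ge0 cos_le1.
have tri : n2 (rcis 1 s - rcis r t) <= 2 * n2 (rcis 1 s - rcis r' t') + 2 * n2 (rcis r' t' - rcis r t).
  have := n2_sub (rcis 1 s - rcis r' t') (- (rcis r' t' - rcis r t)).
  rewrite (_ : n2 (- _) = n2 (rcis r' t' - rcis r t)); last by case: (_ - _) => x y; rewrite /n2/= !sqrrN.
  by rewrite opprK addrA subrK.
have d4 : n2 (rcis 1 s - rcis r t) <= 4 * n2 (rcis 1 s - rcis r' t').
  have E : ((1 - r) / 2) ^+ 2 = (1 - r) ^+ 2 / 4 by field.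
  rewrite E in H; lra.
rewrite ler_pdivrMr// mulrA mulrAC ler_pdivlMr//.
have n1 : 1 - r' ^+ 2 <= 3 * (1 - r ^+ 2).
  have : 0 <= (1 - r) * r by rewrite mulr_ge0// subr_ge0 ltW.
  have : 0 <= (1 - r') * (1 - r') by rewrite -expr2 sqr_ge0.
  rewrite !expr2; lra.
have n0 : 0 <= 1 - r' ^+ 2 by rewrite subr_ge0 expr_le1// ltW.
apply: (@le_trans _ _ (3 * (1 - r ^+ 2) * (4 * n2 (rcis 1 s - rcis r' t')))); last by lra.
by apply: ler_pM => //; exact: ltW.
Qed.

Lemma PI_le_mxP K (psi : R -> R) r t : 0 <= r -> r <= rk R K -> continuous psi -> (forall t, 0 <= psi t) ->
  PI psi r t <= 9 * mxP K.+1 psi t.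
Proof.
move=> r0 rK cpsi p0; have m0 := mxP_ge0 K.+1 psi t.
have [r2|r2] := leP 2^-1 r.
  have := PI_mxP t r2 (le_trans rK (rk_le R (leqnSn K))) cpsi p0; lra.
have r1 : 0 <= r < 1 by apply/andP; split; lra.
have r1' := rk_ge R 0.
apply: (@le_trans _ _ (9 * PI psi (rk R 0) t)); last by rewrite ler_pM2l//; exact: (mxP_ge psi (ord0 : 'I_K.+1)).
rewrite -PIZ// /PI; apply: le_cm; [exact: PI_cts_int|apply: PI_cts_int => //; apply: ctsM => //; exact: cts_cst|].
move=> u; rewrite [leRHS]mulrCA mulrA ler_wpM2r//.
apply: (le_trans (pk_le (u - t) r1)); have := pk_lower (u - t) r1'.
have -> : rk R 0 = 2^-1 by rewrite /rk expr1; lra.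
have : (1 + r) / (1 - r) <= 3 by rewrite ler_pdivrMr; lra.
have -> : (1 - 2^-1) / (1 + 2^-1) = 3^-1 :> R by field.
lra.
Qed.

(** Cauchy's estimate on a circle of radius [d = (1 - r) / 4], where [|h|^(2 s)] lies below its
    Poisson integral. The constant [108 = 12 * 9] comes from [harnack] and [PI_le_mxP], and
    [256 = 4 * 64] from [cauchy] and [1 - r^2 <= 8 d]. *)
Lemma gradient h s K r t : 0 < s -> 0 <= r -> r <= rk R K ->
  (1 - r ^+ 2) ^+ 2 * n2 h^`().[rcis r t] <= 256 * (108 * mxP K.+1 (fun t => a2 h 0 t `^ s) t) `^ s^-1.
Proof.
move=> s0 r0 rK; set psi := fun t => _; set B := _ `^ s^-1.
have /andP[_ rk1] := rk_ge R K.
have r1 : r < 1 by exact: le_lt_trans rK rk1.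
have r01 : 0 <= r < 1 by rewrite r0.
have cpsi : continuous psi by apply: cts_powR_ge0 => //; [exact: a2_ge0|exact: a2_cts].
have p0 u : 0 <= psi u by exact: powR_ge0.
have key r' t' : 0 < r' -> n2 (rcis r' t' - rcis r t) <= ((1 - r) / 2) ^+ 2 -> n2 h.[rcis r' t'] <= B.
  move=> r'0 H; have [r'1 _] := harnack 0 r01 (ltW r'0) H.
  have e' : expR (ln r') = r' by rewrite lnK.
  have -> : n2 h.[rcis r' t'] = a2 h (ln r') t' by rewrite a2_n2 zz_rcis e'.
  have l0 : ln r' < 0 by rewrite -expR_lt1 e'.
  have h1 := a2_powR_PI h t' s0 l0; rewrite e' -/psi in h1.
  have h2 : PI psi r' t' <= 12 * PI psi r t.
    rewrite -PIZ// /PI; apply: le_cm; [apply: PI_cts_int => //; by rewrite (ltW r'0)|apply: PI_cts_int => //; apply: ctsM => //; exact: cts_cst|].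
    by move=> u; rewrite [leRHS]mulrCA mulrA ler_wpM2r//; have [] := harnack u r01 (ltW r'0) H.
  have h3 := PI_le_mxP t r0 rK cpsi p0.
  have -> : a2 h (ln r') t' = (a2 h (ln r') t' `^ s) `^ s^-1 by rewrite -powRrM mulfV ?gt_eqF// powRr1// a2_ge0.
  have m0 := mxP_ge0 K.+1 psi t; have pa := powR_ge0 (a2 h (ln r') t') s.
  have si : 0 <= s^-1 by rewrite invr_ge0 ltW.
  by apply: ge0_ler_powR; rewrite ?nnegrE//; lra.
set d := (1 - r) / 4; have d0 : 0 < d by rewrite divr_gt0// subr_gt0.
have E2 : (1 - r) / 2 = 2 * d by rewrite /d; field.
have dE : d = (1 - r) / 4 by []; clearbody d.
have C : d ^+ 2 * n2 h^`().[rcis r t] <= 4 * B.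
  apply: cauchy => u; have [r' [t' [r'0 E]]] := polar (rcis r t + rcis d u).
  have D : n2 (rcis r' t' - rcis r t) = d ^+ 2 by rewrite -E addrC addKr n2_rcis.
  rewrite E; move: r'0; rewrite le_eqVlt => /predU1P[r'0|r'0]; last first.
    apply: key => //; rewrite D E2 exprMn ler_peMl ?sqr_ge0//; lra.
  (* A point of the circle lying at the origin has no logarithm. There [h] is bounded by its values
     on the circle of radius [d] about the origin, all within [2 d = (1 - r) / 2] of the centre. *)
  have rd : r <= d.
    rewrite -r'0 n2_rcisB mulr0 mul0r subr0 expr0n/= add0r in D.
    by have /andP[] := @sqr_le_itv r d (ltW d0) ltac:(by rewrite D).
  have -> : h.[rcis r' t'] = (h \Po ((expR (ln d) +i* 0)%C *: 'X))`_0.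
    by rewrite -horner_coef0 horner_comp hornerZ hornerX mulr0 -r'0 /rcis !mul0r.
  apply: mean0 => v; rewrite a2_dil addr0 a2_n2 zz_rcis lnK//.
  apply: key => //; rewrite n2_rcisB E2.
  apply: (@le_trans _ _ ((d + r) ^+ 2)); last by rewrite lerXn2r ?nnegrE; lra.
  rewrite -subr_ge0 (_ : _ - _ = 2 * (r * d) * (1 + cos (v - t))); last by ring.
  have c0 : 0 <= 1 + cos (v - t) by have := cos_geN1 (v - t); lra.
  by apply: mulr_ge0 => //; apply: mulr_ge0 => //; apply: mulr_ge0 => //; exact: ltW.
have n0 := n2_ge0 h^`().[rcis r t].
apply: (@le_trans _ _ (64 * d ^+ 2 * n2 h^`().[rcis r t])); last by lra.
rewrite ler_wpM2r// (_ : 64 * d ^+ 2 = (2 * (1 - r)) ^+ 2); last by rewrite dE; field.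
have q1 : 0 <= 1 - r ^+ 2 by rewrite subr_ge0 expr_le1// ltW.
have q2 : 0 <= 2 * (1 - r) by lra.
have q3 : 1 - r ^+ 2 <= 2 * (1 - r) by rewrite expr2; nra.
by rewrite lerXn2r ?nnegrE.
Qed.

Lemma cint_exp (g : R -> R) (a b : R) : continuous g -> a <= b ->
  cint (expR a) (expR b) g = cint a b (fun x => expR x * g (expR x)).
Proof.
move=> cg ab; set A := expR a - 1; set B := expR b + 1.
have eab : expR a <= expR b by rewrite ler_expR.
have cgs : continuous (fun x : R => expR x * g (expR x)).
  apply: ctsM; first exact: continuous_expR.
  apply: (cts_comp (h := g)) => //; exact: continuous_expR.
have dF (x : R) : A < x < B -> is_derive x 1 (fun x => cint A x g) (g x).
  move=> /andP[Ax xB].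
  have [] := @continuous_FTC1_closed R g A x B xB (cint_int _ _ cg) Ax (cg x) => d1 d2.
  by rewrite -d2 derive1E; exact: DeriveDef.
have -> : cint a b (fun x => expR x * g (expR x)) = cint A (expR b) g - cint A (expR a) g.
  apply: (@cint_FTC _ a b (fun x => expR x * g (expR x)) (fun t => cint A (expR t) g)) => //.
  move=> x /andP[ax xb]; rewrite mulrC.
  have h1 : expR a <= expR x by rewrite ler_expR.
  have h2 : expR x <= expR b by rewrite ler_expR.
  have hx : A < expR x < B by rewrite /A /B; apply/andP; split; lra.
  exact: (isdcomp (g := expR) (dF _ hx) (is_derive_expR x)).
by rewrite -(@cint_cat _ A (expR a) (expR b))// ?[cint A _ _ + _]addrC ?addrK// /A; lra.
Qed.

Lemma cts_n2_ray h t : continuous (fun r : R => n2 h.[rcis r t]).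
Proof.
suff [cr ci] : continuous (fun r : R => complex.Re h.[rcis r t]) /\ continuous (fun r : R => complex.Im h.[rcis r t]).
  by apply: ctsD; apply: ctsX.
have c1 : continuous (fun r : R => r * cos t) by apply: ctsM; [exact: cts_id|exact: cts_cst].
have c2 : continuous (fun r : R => r * sin t) by apply: ctsM; [exact: cts_id|exact: cts_cst].
elim/poly_ind: h => [|p c [IHr IHi]].
  split; (under eq_fun do rewrite horner0); exact: cts_cst.
split; (under eq_fun do rewrite hornerD hornerM hornerX hornerC (ReD, ImD) (ReM, ImM)).
  by apply: ctsD; [apply: ctsB; apply: ctsM|exact: cts_cst].
by apply: ctsD; [apply: ctsD; apply: ctsM|exact: cts_cst].
Qed.

(** Below [1/2] the weight is at least [3/4] and the pointwise bound suffices. Above, put [r = e^x]: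
    the inequalities [1 - e^(2 x) <= - 2 x] and [2 e^x >= 1] compare the integrand with that of
    [LPG]. *)
Lemma inner2_bound h K t A : 
  (forall r, 0 <= r -> r <= rk R K -> (1 - r ^+ 2) ^+ 2 * n2 h^`().[rcis r t] <= A) ->
  cint 0 (rk R K) (fun r => n2 h^`().[rcis r t] * (1 - r ^+ 2)) <= A + 4 * LPG h t.
Proof.
move=> HA; have /andP[k2 k1] := rk_itv R K.
have k0 : 0 < rk R K by lra.
set g := fun r => _; have cg : continuous g.
  apply: ctsM; first exact: cts_n2_ray.
  by apply: ctsB; [exact: cts_cst|apply: ctsX; exact: cts_id].
rewrite -(@cint_cat _ 0 2^-1 (rk R K))//.
have A0 : 0 <= A by apply: le_trans (HA 0 (lexx _) (ltW k0)); rewrite mulr_ge0 ?sqr_ge0 ?n2_ge0.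
apply: lerD.
  apply: (@le_trans _ _ (cint 0 2^-1 (fun=> 4 / 3 * A))); last by rewrite cint_cst; lra.
  apply: le_cint => //; first exact: cts_cst.
  move=> r /andP[r0 r2]; have := HA r r0 (le_trans r2 k2).
  have r22 : r ^+ 2 <= 4^-1 by rewrite expr2; nra.
  have := n2_ge0 h^`().[rcis r t]; rewrite /g; set n := n2 _; set q := 1 - r ^+ 2 => n0 hA.
  have q34 : 3 / 4 <= q by rewrite /q; lra.
  have : 3 / 4 * (q * n) <= q * (q * n) by rewrite ler_wpM2r// mulr_ge0//; lra.
  rewrite expr2 in hA; lra.
have E2 : (2^-1 : R) = expR (- ln 2) by rewrite expRN lnK// posrE.
have EK : rk R K = expR (ln (rk R K)) by rewrite lnK.
have lK : - ln 2 <= ln (rk R K) by rewrite -ler_expR -E2 -EK.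
have lK0 : ln (rk R K) <= 0 by rewrite -ler_expR -EK expR0 ltW.
rewrite {1}E2 EK cint_exp//.
have cD := @cts_nx1 R (a2 (pdx h)) t (@cont2_a2 R (pdx h)).
rewrite /LPG -(@cint_cat _ (- ln 2) (ln (rk R K)) 0)// mulrDr -[leLHS]addr0; apply: lerD; last first.
  by rewrite mulr_ge0//; apply: cint_ge0 => x /andP[_ x0]; rewrite mulr_ge0 ?a2_ge0// oppr_ge0.
rewrite -cintZ//; apply: le_cint.
- apply: ctsM; first exact: continuous_expR.
  apply: (cts_comp (h := g)) => //; exact: continuous_expR.
- by apply: ctsM => //; exact: cts_cst.
move=> x /andP[x2 xK]; rewrite /g a2_n2 /pdx hornerM hornerX n2M zz_rcis n2_rcis.
set n := n2 _; have n0 : 0 <= n by exact: n2_ge0.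
have e2 : 2^-1 <= expR x by rewrite E2 ler_expR.
have e1 : 1 - expR x ^+ 2 <= - (2 * x).
  by have := expR_ge1Dx (2 * x); rewrite (_ : expR (2 * x) = expR x ^+ 2); [lra|rewrite (_ : 2 * x = x + x) ?expRD//; ring].
have x0 : x <= 0 by exact: le_trans xK lK0.
have h1 : expR x * (n * (1 - expR x ^+ 2)) <= expR x * (n * - (2 * x)).
  by rewrite ler_wpM2l ?expR_ge0// ler_wpM2l.
apply: (le_trans h1).
have h2 : 0 <= n * - x * (2 * expR x * (2 * expR x - 1)).
  by rewrite !mulr_ge0 ?expR_ge0 ?oppr_ge0//; lra.
rewrite -subr_ge0 (_ : _ - _ = n * - x * (2 * expR x * (2 * expR x - 1)))//; ring.
Qed.

(** One function [X] controls the quantities of both [q = oo] and [q = 2], from which every [q >= 2]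
    follows by [power_trade]. The constant depends neither on the polynomial nor on the cut-off
    radius, so limits can be taken. *)
Lemma LP_interface p : 0 < p -> exists2 C, 0 <= C & forall K h, exists X : R -> R,
  [/\ continuous X, forall t, 0 <= X t,
    cm (fun t => X t `^ (p / 2)) <= C * cm (fun t => a2 h 0 t `^ (p / 2)),
    forall t r, 0 <= r -> r <= rk R K -> (1 - r ^+ 2) ^+ 2 * n2 h^`().[rcis r t] <= X t &
    forall t, cint 0 (rk R K) (fun r => n2 h^`().[rcis r t] * (1 - r ^+ 2)) <= X t].
Proof.
move=> p0; have p2 : 0 < p / 2 by rewrite divr_gt0.
have [C C0 HC] := LP p2; have p4 : 0 < p / 4 by rewrite divr_gt0.
exists (2 `^ (p / 2) * (256 `^ (p / 2) * (108 ^+ 2 * 64) + 4 `^ (p / 2) * C)).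
  by rewrite mulr_ge0 ?addr_ge0 ?mulr_ge0 ?powR_ge0.
move=> K h; pose psi t := a2 h 0 t `^ (p / 4).
have cpsi : continuous psi by apply: cts_powR_ge0 => //; [exact: a2_ge0|exact: a2_cts].
have ppsi : per psi by move=> t; rewrite /psi a2_per.
have psi0 t : 0 <= psi t by exact: powR_ge0.
pose N := mxP K.+1 psi; have cN : continuous N by exact: mxP_cts.
have N0 t : 0 <= N t by exact: mxP_ge0.
pose A t := 256 * (108 * N t) `^ (p / 4)^-1.
have A0 t : 0 <= A t by rewrite mulr_ge0 ?powR_ge0.
have cz k (f : R -> R) : continuous f -> continuous (fun t => k * f t) by move=> cf; apply: ctsM => //; exact: cts_cst.
have cA : continuous A.
  by apply: (cz); apply: cts_powR_ge0; [rewrite invr_gt0|move=> t; rewrite mulr_ge0|exact: (cz)].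
have cG := @LPG_cts R h; have G0 := LPG_ge0 h.
have cX : continuous (fun t => A t + 4 * LPG h t) by apply: ctsD => //; exact: (cz).
have X0 t : 0 <= A t + 4 * LPG h t by rewrite addr_ge0// mulr_ge0.
have HA t r : 0 <= r -> r <= rk R K -> (1 - r ^+ 2) ^+ 2 * n2 h^`().[rcis r t] <= A t by move=> r0 rK; exact: gradient.
exists (fun t => A t + 4 * LPG h t); split=> //; last 2 first.
- by move=> t r r0 rK; apply: (le_trans (HA t r r0 rK)); rewrite lerDl mulr_ge0.
- by move=> t; apply: inner2_bound => r; exact: HA.
have cN2 : continuous (fun t => N t ^+ 2) by exact: ctsX.
have cGp := @LPG_powR_cts R h _ p2.
apply: (@le_trans _ _ (cm (fun t => 2 `^ (p / 2) * (256 `^ (p / 2) * 108 ^+ 2) * N t ^+ 2 + 2 `^ (p / 2) * 4 `^ (p / 2) * LPG h t `^ (p / 2)))).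
  apply: le_cm; [exact: cts_powR_ge0|by apply: ctsD; exact: (cz)|move=> t].
  apply: (le_trans (powR_add_le (ltW p2) (A0 t) _)); first by rewrite mulr_ge0.
  rewrite powRM// [X in X + _](_ : A t `^ (p / 2) = 256 `^ (p / 2) * 108 ^+ 2 * N t ^+ 2).
    by rewrite le_eqVlt; apply/orP; left; apply/eqP; ring.
  rewrite /A powRM ?powR_ge0// -powRrM (_ : (p / 4)^-1 * (p / 2) = 2); last by field; rewrite gt_eqF.
  by rewrite powR_mulrn ?mulr_ge0// exprMn mulrA.
rewrite cmD ?cmZ//; [|exact: (cz)..].
have hN : cm (fun t => N t ^+ 2) <= 64 * cm (fun t => a2 h 0 t `^ (p / 2)).
  apply: (le_trans (maximal_L2 K.+1 cpsi ppsi psi0)); rewrite ler_pM2l//.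
  rewrite (_ : (fun t => psi t ^+ 2) = (fun t => a2 h 0 t `^ (p / 2)))//.
  apply/funext => t; rewrite /psi -powR_mulrn ?powR_ge0// -powRrM; congr (_ `^ _); lra.
rewrite [X in _ <= X * _]mulrDr [leRHS]mulrDl; apply: lerD.
  rewrite [leRHS](_ : _ = 2 `^ (p / 2) * (256 `^ (p / 2) * 108 ^+ 2) * (64 * cm (fun t => a2 h 0 t `^ (p / 2)))); last by ring.
  by rewrite ler_wpM2l// !mulr_ge0 ?powR_ge0// exprn_ge0.
rewrite [leRHS](_ : _ = 2 `^ (p / 2) * 4 `^ (p / 2) * (C * cm (fun t => a2 h 0 t `^ (p / 2)))); last by ring.
by rewrite ler_wpM2l ?mulr_ge0 ?powR_ge0//; exact: HC.
Qed.

End Gradient.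

(** * Homogeneous expansions and slices *)

Section Geometry.
Variables (R : realType) (d : nat).
Implicit Types (z : Pt R d) (w : R[i]) (c : d.-tuple nat -> R[i]).

Lemma cabs_ge0 w : 0 <= cabs w.
Proof. exact: sqrtr_ge0. Qed.
Lemma cabs_sq w : cabs w ^+ 2 = n2 w.
Proof. by rewrite sqr_sqrtr ?addr_ge0 ?sqr_ge0. Qed.
Lemma cabsM w v : cabs (w * v) = cabs w * cabs v.
Proof. by rewrite /cabs -[X in Num.sqrt X]/(n2 _) n2M sqrtrM ?n2_ge0. Qed.
Lemma cabs_norm w : `|w| = (cabs w)%:C%C.
Proof. by rewrite normc_def. Qed.
Lemma cabsD w v : cabs (w + v) <= cabs w + cabs v.
Proof. by have := ler_normD w v; rewrite !cabs_norm -rmorphD/= lecR. Qed.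
Lemma cabsN w : cabs (- w) = cabs w.
Proof. by case: w => a b; rewrite /cabs/= !sqrrN. Qed.
Lemma cabsB w v : cabs (w - v) = cabs (v - w).
Proof. by rewrite -cabsN opprB. Qed.
Lemma ReB (w v : R[i]) : complex.Re (w - v) = complex.Re w - complex.Re v.
Proof. by case: w v => [a b] [a' b']. Qed.
Lemma ImB (w v : R[i]) : complex.Im (w - v) = complex.Im w - complex.Im v.
Proof. by case: w v => [a b] [a' b']. Qed.
Lemma cabs0 : cabs (0 : R[i]) = 0.
Proof. by rewrite /cabs/= expr0n/= addr0 sqrtr0. Qed.
Lemma cabs_real (r : R) : 0 <= r -> cabs (r +i* 0)%C = r.
Proof. by move=> r0; rewrite /cabs/= expr0n/= addr0 sqrtr_sqr ger0_norm. Qed.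
Lemma cabsX w n : cabs (w ^+ n) = cabs w ^+ n.
Proof.
elim: n => [|n IH]; last by rewrite !exprS cabsM IH.
by rewrite !expr0 (_ : 1 = (1 +i* 0)%C) ?cabs_real.
Qed.
Lemma cabs_sum I (r : seq I) (P : pred I) (F : I -> R[i]) :
  cabs (\sum_(i <- r | P i) F i) <= \sum_(i <- r | P i) cabs (F i).
Proof.
elim/big_ind2: _ => [|x y u v h1 h2|//]; first by rewrite cabs0.
by apply: (le_trans (cabsD _ _)); exact: lerD.
Qed.
Lemma Re_cabs w : `|complex.Re w| <= cabs w.
Proof. by rewrite -sqrtr_sqr ler_wsqrtr// lerDl sqr_ge0. Qed.
Lemma Im_cabs w : `|complex.Im w| <= cabs w.
Proof. by rewrite -sqrtr_sqr ler_wsqrtr// lerDr sqr_ge0. Qed.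
Lemma cabs_le w : cabs w <= `|complex.Re w| + `|complex.Im w|.
Proof.
have -> : cabs w = Num.sqrt (`|complex.Re w| ^+ 2 + `|complex.Im w| ^+ 2) by rewrite !real_normK ?num_real.
exact: sqrt_le_add.
Qed.
Lemma cabs_rcis (r t : R) : 0 <= r -> cabs (rcis r t) = r.
Proof. by move=> r0; rewrite /cabs -[X in Num.sqrt X]/(n2 _) n2_rcis sqrtr_sqr ger0_norm. Qed.

Definition pn2 z : R := \sum_(k < d) n2 (coord z k).
Lemma pn2_ge0 z : 0 <= pn2 z.
Proof. by apply: sumr_ge0 => k _; exact: n2_ge0. Qed.
Lemma pnormE z : pnorm z = Num.sqrt (pn2 z).
Proof. by []. Qed.
Lemma sphereP z : sphere d z <-> pn2 z = 1.
Proof.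
rewrite /sphere/= pnormE; split=> [h|->]; last exact: sqrtr1.
by rewrite -(sqr_sqrtr (pn2_ge0 z)) h expr1n.
Qed.
Lemma closed_ballP z : closed_ball d z <-> pn2 z <= 1.
Proof. by rewrite /closed_ball/= pnormE -[X in _ <= X]sqrtr1 ler_psqrt// nnegrE ?pn2_ge0. Qed.
Lemma open_ballP z : open_ball d z <-> pn2 z < 1.
Proof. by rewrite /open_ball/= pnormE -[X in _ < X]sqrtr1 ltr_sqrt. Qed.

Definition cscale w z : Pt R d :=
  [tuple (complex.Re (w * coord z k), complex.Im (w * coord z k)) | k < d].

Lemma coord_cscale w z k : coord (cscale w z) k = w * coord z k.
Proof. by rewrite {1}/coord tnth_mktuple/=; case: (_ * _). Qed.
Lemma coord_inj z z' : (forall k, coord z k = coord z' k) -> z = z'.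
Proof.
move=> h; apply: eq_from_tnth => k; have := h k; rewrite /coord.
by case: (tnth z k) (tnth z' k) => [a b] [a' b'] /= [-> ->].
Qed.
Lemma scaleE (r : R) z : scale r z = cscale (r +i* 0)%C z.
Proof.
apply: coord_inj => k; rewrite coord_cscale /coord tnth_mktuple/=.
by apply/eqP; rewrite eq_complex/=; apply/andP; split; apply/eqP; ring.
Qed.
Lemma cscaleA w v z : cscale w (cscale v z) = cscale (w * v) z.
Proof. by apply: coord_inj => k; rewrite !coord_cscale mulrA. Qed.
Lemma pn2_cscale w z : pn2 (cscale w z) = n2 w * pn2 z.
Proof. by rewrite /pn2 mulr_sumr; apply: eq_bigr => k _; rewrite coord_cscale n2M. Qed.
Lemma mono_cscale w z a : mono (cscale w z) a = w ^+ mdeg a * mono z a.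
Proof.
rewrite /mono /mdeg -prodrXr -big_split/=.
by apply: eq_bigr => k _; rewrite coord_cscale exprMn.
Qed.
Lemma scale_rcis (r t : R) z : scale r (cscale (cis t) z) = cscale (rcis r t) z.
Proof.
rewrite scaleE cscaleA; congr cscale.
by apply/eqP; rewrite eq_complex/=; apply/andP; split; apply/eqP; ring.
Qed.

Definition hom c z m : R[i] :=
  \sum_(a : {ffun 'I_d -> 'I_m.+1} | mdeg (midx a) == m) c (midx a) * mono z (midx a).
Definition ahom c z m : R :=
  \sum_(a : {ffun 'I_d -> 'I_m.+1} | mdeg (midx a) == m) cabs (c (midx a) * mono z (midx a)).

Lemma le_mdeg (a : d.-tuple nat) k : (tnth a k <= mdeg a)%N.
Proof. by rewrite /mdeg (bigD1 k)//= leq_addr. Qed.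

(** Each exponent of a multi-index of degree [m] is at most [m], so both sides run over the same
    multi-indices although the bounds on the exponents differ. *)
Lemma graded (V : nmodType) (F : d.-tuple nat -> V) N :
  \sum_(a : {ffun 'I_d -> 'I_N.+1} | (mdeg (midx a) <= N)%N) F (midx a) =
  \sum_(m < N.+1) \sum_(a : {ffun 'I_d -> 'I_m.+1} | mdeg (midx a) == m) F (midx a).
Proof.
rewrite (partition_big (fun a : {ffun 'I_d -> 'I_N.+1} => inord (mdeg (midx a)) : 'I_N.+1) predT)//=.
apply: eq_bigr => m _.
have mN : (m <= N)%N by rewrite -ltnS.
have h0 (b : {ffun 'I_d -> 'I_m.+1}) : midx [ffun k => widen_ord (mN : (m.+1 <= N.+1)%N) (b k)] = midx b.
  by apply: eq_from_tnth => k; rewrite !tnth_mktuple ffunE.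
pose h' (a : {ffun 'I_d -> 'I_N.+1}) : {ffun 'I_d -> 'I_m.+1} := [ffun k => inord (a k)].
rewrite (reindex_onto (fun b : {ffun 'I_d -> 'I_m.+1} => [ffun k => widen_ord (mN : (m.+1 <= N.+1)%N) (b k)] : {ffun 'I_d -> 'I_N.+1}) h')/=.
  apply: eq_big => [b|b _]; last by rewrite h0.
  rewrite h0; have -> : h' [ffun k => widen_ord (mN : (m.+1 <= N.+1)%N) (b k)] == b.
    by apply/eqP/ffunP => k; apply: val_inj; rewrite !ffunE/= inordK.
  rewrite andbT; apply/andP/eqP => [[bN /eqP/(congr1 val)/=]|bm]; first by rewrite inordK.
  rewrite bm; split=> //; apply/eqP/val_inj; rewrite /= inordK//.
move=> a /andP[aN /eqP am]; apply/ffunP => k; apply: val_inj; rewrite !ffunE/= inordK// ltnS.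
have := congr1 val am; rewrite /= inordK ?ltnS// => <-.
by have := le_mdeg (midx a) k; rewrite tnth_mktuple.
Qed.

Lemma psum_hom c z N : psum c z N = \sum_(m < N.+1) hom c z m.
Proof. exact: (graded (fun a => c a * mono z a)). Qed.
Lemma apsum_hom c z N : apsum c z N = \sum_(m < N.+1) ahom c z m.
Proof. exact: (graded (fun a => cabs (c a * mono z a))). Qed.
Lemma hom_cscale c w z m : hom c (cscale w z) m = w ^+ m * hom c z m.
Proof. by rewrite /hom mulr_sumr; apply: eq_bigr => a /eqP am; rewrite mono_cscale am mulrCA. Qed.
Lemma ahom_cscale c w z m : ahom c (cscale w z) m = cabs w ^+ m * ahom c z m.
Proof. by rewrite /ahom mulr_sumr; apply: eq_bigr => a /eqP am; rewrite mono_cscale am mulrCA (cabsM (w ^+ m)) cabsX. Qed.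
Lemma cabs_hom c z m : cabs (hom c z m) <= ahom c z m.
Proof. exact: cabs_sum. Qed.
Lemma ahom_ge0 c z m : 0 <= ahom c z m.
Proof. by apply: sumr_ge0 => a _; exact: cabs_ge0. Qed.
Lemma hom_radI k c z m : hom (radI k c) z m = ((1 + m)%:R ^+ k +i* 0)%C * hom c z m.
Proof. by rewrite /hom mulr_sumr; apply: eq_bigr => a /eqP am; rewrite /radI am mulrA. Qed.

End Geometry.

Section PowerSeries.
Variable R : realType.

(** Bernoulli's inequality gives [(1 + m) r^m <= K r'^m] for the larger radius
    [r' = (1 + r) / 2]. *)
Lemma weighted_series_cvg (b : nat -> R) : (forall m, 0 <= b m) ->
  (forall r, 0 <= r < 1 -> cvgn (series (fun m => b m * r ^+ m))) ->
  forall r, 0 <= r < 1 -> cvgn (series (fun m => (1 + m)%:R * b m * r ^+ m)).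
Proof.
move=> b0 hb r /andP[r0 r1]; pose r' := (1 + r) / 2.
have r'1 : 0 <= r' < 1 by rewrite /r'; apply/andP; split; lra.
have [->|rn0] := eqVneq r 0.
  apply: (@series_le_cvg _ _ (fun m => b m * 0 ^+ m)) => [m|m|m|].
  - by rewrite !mulr_ge0// exprn_ge0.
  - by rewrite mulr_ge0// exprn_ge0.
  - by case: m => [|m]; rewrite ?expr0 ?mulr1 ?mul1r// exprS mul0r !mulr0.
  - by apply: hb; rewrite lexx ltr01.
have rp : 0 < r by rewrite lt_neqAle eq_sym rn0.
pose x := r' / r - 1; have x0 : 0 < x by rewrite subr_gt0 ltr_pdivlMr// mul1r /r'; lra.
pose K := 1 + x^-1; have K0 : 0 < K by rewrite addr_gt0// invr_gt0.
have key m : (1 + m)%:R * r ^+ m <= K * r' ^+ m.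
  have -> : r' ^+ m = (1 + x) ^+ m * r ^+ m by rewrite -exprMn /x addrC subrK divfK.
  rewrite mulrA ler_wpM2r ?exprn_ge0//.
  have bern : 1 + m%:R * x <= (1 + x) ^+ m.
    elim: m => [|m IH]; first by rewrite mul0r addr0 expr0.
    rewrite exprS -natr1; have m0 : 0 <= m%:R :> R by exact: ler0n.
    by have : (1 + x) * (1 + m%:R * x) <= (1 + x) * (1 + x) ^+ m; [rewrite ler_pM2l//; lra|nra].
  apply: (@le_trans _ _ (K * (1 + m%:R * x))); last by rewrite ler_pM2l.
  have -> : K * (1 + m%:R * x) = (1 + m)%:R + x^-1 + m%:R * x by rewrite natrD /K; field; rewrite gt_eqF.
  have m0 : 0 <= m%:R * x by rewrite mulr_ge0// ltW.
  have xi : 0 < x^-1 by rewrite invr_gt0.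
  lra.
apply: (@series_le_cvg _ _ (fun m => K * (b m * r' ^+ m))) => [m|m|m|].
- by rewrite !mulr_ge0// exprn_ge0.
- by rewrite !mulr_ge0 ?(ltW K0)// exprn_ge0//; case/andP: r'1.
- by rewrite mulrAC [leRHS]mulrCA [leLHS]mulrC ler_wpM2l.
- have -> : series (fun m => K * (b m * r' ^+ m)) = (fun n => K * series (fun m => b m * r' ^+ m) n).
    by apply/funext => n; rewrite /series/= mulr_sumr.
  by apply: is_cvgMr; exact: hb.
Qed.

Lemma csum_tail (a : nat -> R[i]) (b : nat -> R) : (forall m, cabs (a m) <= b m) -> cvgn (series b) ->
  exists l, forall n, cabs (\sum_(m < n) a m - l) <= limn (series b) - series b n.
Proof.
move=> ab cb.
have cr : cvgn (series (fun m => complex.Re (a m))).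
  apply: normed_cvg; apply: (@series_le_cvg _ _ b) => [m|m|m|//]; [exact: normr_ge0|exact: le_trans (cabs_ge0 _) (ab m)|].
  exact: le_trans (Re_cabs _) (ab m).
have ci : cvgn (series (fun m => complex.Im (a m))).
  apply: normed_cvg; apply: (@series_le_cvg _ _ b) => [m|m|m|//]; [exact: normr_ge0|exact: le_trans (cabs_ge0 _) (ab m)|].
  exact: le_trans (Im_cabs _) (ab m).
have reE n : series (fun m => complex.Re (a m)) n = complex.Re (\sum_(m < n) a m).
  by rewrite /series/= big_mkord (big_morph _ (@ReD R) (erefl : complex.Re (0 : R[i]) = 0)).
have imE n : series (fun m => complex.Im (a m)) n = complex.Im (\sum_(m < n) a m).
  by rewrite /series/= big_mkord (big_morph _ (@ImD R) (erefl : complex.Im (0 : R[i]) = 0)).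
pose l := (limn (series (fun m => complex.Re (a m))) +i* limn (series (fun m => complex.Im (a m))))%C.
exists l => n; apply/ler_addgt0Pr => e e0; have e2 : 0 < e / 2 by rewrite divr_gt0.
have /cvgrPdist_le/(_ _ e2) [M1 _ H1] := cr.
have /cvgrPdist_le/(_ _ e2) [M2 _ H2] := ci.
pose M := (n + maxn M1 M2)%N.
have {}H1 := H1 M (leq_trans (leq_maxl _ _) (leq_addl _ _)).
have {}H2 := H2 M (leq_trans (leq_maxr _ _) (leq_addl _ _)).
have nM : (n <= M)%N by exact: leq_addr.
have h1 : cabs (\sum_(m < M) a m - l) <= e.
  apply: (le_trans (cabs_le _)); rewrite ReB ImB -reE -imE distrC [X in _ + X]distrC/=.
  rewrite /= in H1 H2; lra.
have h2 : cabs (\sum_(m < n) a m - \sum_(m < M) a m) <= series b M - series b n.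
  rewrite cabsB -!(big_mkord xpredT a) /series/= (@big_cat_nat _ _ _ n)//= addrAC subrr add0r.
  rewrite [X in _ <= X - _](@big_cat_nat _ _ _ n)//= addrAC subrr add0r.
  by apply: (le_trans (cabs_sum _ _ _)); apply: ler_sum => m _.
have h3 : series b M <= limn (series b).
  apply: nondecreasing_cvgn_le => //; apply: nondecreasing_series => m _ _.
  exact: le_trans (cabs_ge0 _) (ab m).
rewrite -(subrK (\sum_(m < M) a m) (\sum_(m < n) a m)) -addrA.
by apply: (le_trans (cabsD _ _)); lra.
Qed.

End PowerSeries.

Section Slice.
Variables (R : realType) (d : nat).
Implicit Types (z : Pt R d) (c : d.-tuple nat -> R[i]).

Lemma ahom_summable c f z : holo_on_ball c f -> sphere d z ->
  forall r, 0 <= r < 1 -> cvgn (series (fun m => ahom c z m * r ^+ m)).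
Proof.
move=> hf /sphereP z1 r /andP[r0 r1].
have ob : open_ball d (cscale (r +i* 0)%C z).
  by apply/open_ballP; rewrite pn2_cscale z1 mulr1 -cabs_sq cabs_real// expr_lt1.
have [sm _] := hf _ ob; rewrite /abs_summable in sm.
case/cvg_ex: sm => l Hl; apply/cvg_ex; exists l; rewrite -cvg_shiftS.
rewrite (_ : (fun n => _) = apsum c (cscale (r +i* 0)%C z))//.
apply/funext => N; rewrite apsum_hom /series/= big_mkord; apply: eq_bigr => m _.
by rewrite ahom_cscale cabs_real// mulrC.
Qed.

Lemma pseries_lim c z (l : R[i]) (t : nat -> R) : (forall N, cabs (psum c z N - l) <= t N) ->
  t n @[n --> \oo] --> 0 -> pseries c z = l.
Proof.
move=> H t0.
have hr : complex.Re (psum c z N) @[N --> \oo] --> complex.Re l.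
  apply/cvgrPdist_le => e e0; have /cvgrPdist_le/(_ _ e0) := t0.
  apply: filterS => N; rewrite sub0r normrN => h; apply: le_trans h; apply: le_trans (ler_norm _).
  by rewrite distrC -ReB; apply: le_trans (Re_cabs _) _; exact: H.
have hi : complex.Im (psum c z N) @[N --> \oo] --> complex.Im l.
  apply/cvgrPdist_le => e e0; have /cvgrPdist_le/(_ _ e0) := t0.
  apply: filterS => N; rewrite sub0r normrN => h; apply: le_trans h; apply: le_trans (ler_norm _).
  by rewrite distrC -ImB; apply: le_trans (Im_cabs _) _; exact: H.
rewrite /pseries (cvg_lim _ hr)// (cvg_lim _ hi)//.
by case: l {H hr hi}.
Qed.

(* Along a complex line the degree-m parts are the Taylor coefficients. *)
Lemma pseries_slice c z (b : nat -> R) : (forall m, cabs (hom c z m) <= b m) ->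
  (forall r, 0 <= r < 1 -> cvgn (series (fun m => b m * r ^+ m))) ->
  forall w r, cabs w <= r -> r < 1 -> forall N,
    cabs (psum c (cscale w z) N - pseries c (cscale w z)) <=
      limn (series (fun m => b m * r ^+ m)) - series (fun m => b m * r ^+ m) N.+1.
Proof.
move=> hb sb w r wr r1; have r0 : 0 <= r by exact: le_trans (cabs_ge0 w) wr.
have sr := sb r ltac:(by rewrite r0).
have [l Hl] : exists l : R[i], forall n, cabs (\sum_(m < n) w ^+ m * hom c z m - l) <=
    limn (series (fun m => b m * r ^+ m)) - series (fun m => b m * r ^+ m) n.
  apply: (@csum_tail R (fun m => w ^+ m * hom c z m) (fun m => b m * r ^+ m)) => // m; rewrite cabsM cabsX mulrC ler_pM ?cabs_ge0 ?exprn_ge0 ?cabs_ge0//.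
  by rewrite lerXn2r ?nnegrE ?cabs_ge0.
have E N : psum c (cscale w z) N = \sum_(m < N.+1) w ^+ m * hom c z m.
  by rewrite psum_hom; apply: eq_bigr => m _; rewrite hom_cscale.
have -> : pseries c (cscale w z) = l.
  apply: (@pseries_lim _ _ _ (fun n => limn (series (fun m => b m * r ^+ m)) - series (fun m => b m * r ^+ m) n.+1)) => [N|].
    by rewrite E.
  rewrite -[X in _ --> X](subrr (limn (series (fun m => b m * r ^+ m)))).
  apply: cvgB; first exact: cvg_cst.
  by rewrite (cvg_shiftS (series (fun m => b m * r ^+ m))).
by move=> N; rewrite E.
Qed.

End Slice.

(** * Lower limits, subsequences and powers *)

Section ErealFacts.
Variable R : realType.
Local Open Scope ereal_scope.

Lemma le_of_lt (x L : \bar R) : 0 <= L -> (forall y : R, L < y%:E -> x <= y%:E) -> x <= L.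
Proof.
case: L => [r||]// _ H; last by rewrite leey.
by apply/lee_addgt0Pr => e e0; rewrite -EFinD; apply: H; rewrite lte_fin ltrDl.
Qed.

Lemma einf_freq_lt (u : (\bar R)^nat) y : limn_einf u < y -> forall k, exists n, (k <= n)%N /\ u n < y.
Proof.
move=> uy k; apply: contrapT => H; move: uy; apply/negP; rewrite -leNgt limn_einf_lim.
apply: lime_ge; first exact: is_cvg_einfs.
exists k => // n /= kn; apply: le_ereal_inf_tmp => _ [m /= nm <-].
by rewrite leNgt; apply/negP => h; apply: H; exists m; split=> //; exact: leq_trans kn nm.
Qed.

Lemma einf_le_freq (u : (\bar R)^nat) y : (forall k, exists n, (k <= n)%N /\ u n <= y) -> limn_einf u <= y.
Proof.
move=> H; rewrite limn_einf_lim; apply: lime_le; first exact: is_cvg_einfs.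
apply: nearW => k; have [n [kn un]] := H k.
by apply: le_trans un; apply: ereal_inf_lbound; exists n.
Qed.

Lemma le_poweR (x y : \bar R) (a : R) : (0 <= a)%R -> 0 <= x -> x <= y -> x `^ a <= y `^ a.
Proof.
move=> a0 x0 xy; apply: gt0_ler_poweR => //; rewrite in_itv/= ?leey ?andbT//.
exact: le_trans xy.
Qed.

End ErealFacts.

Section Subsequences.
Variable R : realType.

Lemma cvg_powR (u : nat -> R) (l p : R) : 0 < p -> (forall n, 0 <= u n) -> 0 <= l ->
  u n @[n --> \oo] --> l -> u n `^ p @[n --> \oo] --> l `^ p.
Proof.
move=> p0 u0 l0 ul.
have cp : continuous (fun x : R => `|x| `^ p) by apply: cts_powR_ge0 => //; move=> x; exact: norm_continuous.
have E : (fun n => u n `^ p) = (fun x : R => `|x| `^ p) \o u by apply/funext => n; rewrite /= ger0_norm.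
rewrite E -[in X in _ --> X](ger0_norm l0).
exact: (@continuous_cvg _ _ _ _ _ u (fun x : R => `|x| `^ p) l (cp l) ul).
Qed.

Lemma subseq_cvg (u : nat -> R) (l : R) (phi : nat -> nat) : (forall k, (k <= phi k)%N) ->
  u n @[n --> \oo] --> l -> u (phi k) @[k --> \oo] --> l.
Proof.
move=> hp /cvgrPdist_le H; apply/cvgrPdist_le => e e0; have [K _ HK] := H e e0.
by exists K => // k /= Kk; apply: HK; exact: leq_trans Kk (hp k).
Qed.

Lemma powR_succ (v a : R) : 0 <= v -> a + 1 != 0 -> v `^ (a + 1) = v `^ a * v.
Proof. by move=> v0 a1; rewrite powRD ?(negbTE a1)// powRr1. Qed.

Lemma mul_div_succ (C e : R) : 0 <= C -> 0 < e -> C * (e / (C + 1)) <= e.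
Proof. by move=> C0 e0; rewrite mulrA ler_pdivrMr; nra. Qed.

Lemma powR_half (q v : R) : 0 < q -> 0 <= v -> v `^ (q / 2) = v `^ ((q - 2) / 2) * v.
Proof.
move=> q0 v0; have E : (q - 2) / 2 + 1 = q / 2 by field.
by rewrite -powR_succ// E// gt_eqF// divr_gt0.
Qed.

Lemma n2_powR_half (w : R[i]) (q : R) : n2 w `^ (q / 2) = cabs w `^ q.
Proof. rewrite -cabs_sq -powR_mulrn ?cabs_ge0// -powRrM; congr (_ `^ _); lra. Qed.

(** Reduces a finite [q >= 2] to [q = 2]: with [v = |h'|^2] and [w = 1 - r^2], the surplus power
    [q - 2] of [|h'| w] is paid by the supremum bound [Y]. *)
Lemma power_trade (q v w Y : R) : 2 <= q -> 0 <= v -> 0 < w -> 0 <= Y -> w ^+ 2 * v <= Y ->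
  v `^ (q / 2) * w `^ (q - 1) <= Y `^ ((q - 2) / 2) * (v * w).
Proof.
move=> q2 v0 w0 Y0 wv; have q0 : 0 < q by lra.
have w0' := ltW w0.
have Ew : w `^ (q - 1) = (w ^+ 2) `^ ((q - 2) / 2) * w.
  rewrite -powR_mulrn// -powRrM (_ : 2%:R * ((q - 2) / 2) = q - 2); last by field.
  by rewrite -powR_succ//; [congr (_ `^ _); ring|rewrite gt_eqF//; lra].
rewrite powR_half// Ew mulrACA -powRM ?sqr_ge0//.
apply: ler_wpM2r; first exact: mulr_ge0.
have q20 : 0 <= (q - 2) / 2 by lra.
have vw : 0 <= v * w ^+ 2 by rewrite mulr_ge0 ?sqr_ge0.
by apply: ge0_ler_powR; rewrite ?nnegrE// mulrC.
Qed.

End Subsequences.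

(** * From polynomials to slices of a holomorphic function *)

Section Disc.
Variables (R : realType) (d : nat) (c : d.-tuple nat -> R[i]) (f : Pt R d -> R[i]) (z : Pt R d).
Hypotheses (hf : holo_on_ball c f) (cf : cont_closed_ball f) (z1 : sphere d z).
Local Notation tau := (pi *+ 2 : R).
Local Notation rk := (@rk R).

Lemma rk_cvg : rk n @[n --> \oo] --> (1 : R).
Proof.
rewrite -[X in _ --> X]subr0; apply: cvgB; first exact: cvg_cst.
rewrite (cvg_shiftS (fun n => (2^-1 : R) ^+ n)); apply: cvg_expr.
by rewrite ger0_norm; lra.
Qed.

Lemma rk_near (r : R) : r < 1 -> exists K, forall n, (K <= n)%N -> r <= rk n.
Proof.
move=> r1; have /cvgrPdist_le/(_ (1 - r)) := rk_cvg; rewrite subr_gt0 r1 => /(_ isT) [K _ H].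
exists K => n Kn; have := H n Kn; rewrite /= => h; have := le_trans (ler_norm _) h; lra.
Qed.

Lemma tail_cvg (u : nat -> R) : cvgn (series u) -> limn (series u) - series u n.+1 @[n --> \oo] --> 0.
Proof.
move=> cu; rewrite -[X in _ --> X](subrr (limn (series u))).
by apply: cvgB; [exact: cvg_cst|rewrite (cvg_shiftS (series u))].
Qed.

Lemma cabs_rcisE (r t : R) : cabs (rcis r t) = `|r|.
Proof. by rewrite /cabs -[X in Num.sqrt X]/(n2 _) n2_rcis sqrtr_sqr. Qed.

Lemma natC n : ((n%:R : R) +i* 0)%C = n%:R :> R[i].
Proof. by rewrite -(rmorph_nat (real_complex R)). Qed.

Lemma n2_ReIm (w : R[i]) : n2 w = cabs w ^+ 2.
Proof. by rewrite cabs_sq. Qed.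

Lemma cabs_dist (u v : R[i]) : `|cabs u - cabs v| <= cabs (u - v).
Proof.
rewrite ler_norml; have h1 := cabsD (u - v) v; have h2 := cabsD (v - u) u.
by rewrite !subrK in h1 h2; rewrite (cabsB v u) in h2; apply/andP; split; lra.
Qed.

Local Notation b := (ahom c z).
Local Notation b1 := (fun m => (1 + m)%:R * b m).
Local Notation b2 := (fun m => (1 + m)%:R * ((1 + m)%:R * b m)).

Lemma sb r : 0 <= r < 1 -> cvgn (series (fun m => b m * r ^+ m)).
Proof. exact: ahom_summable hf z1 r. Qed.
Lemma sb1 r : 0 <= r < 1 -> cvgn (series (fun m => (1 + m)%:R * b m * r ^+ m)).
Proof. apply: weighted_series_cvg => [m|]; [exact: ahom_ge0|exact: sb]. Qed.
Lemma sb2 r : 0 <= r < 1 -> cvgn (series (fun m => (1 + m)%:R * ((1 + m)%:R * b m) * r ^+ m)).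
Proof. by apply: weighted_series_cvg => [m|]; [rewrite mulr_ge0// ahom_ge0|exact: sb1]. Qed.

Lemma deg_ex : exists N : nat -> nat, forall n, (n <= N n)%N /\
  limn (series (fun m => b m * rk n ^+ m)) - series (fun m => b m * rk n ^+ m) (N n).+1 <= (2^-1) ^+ n.
Proof.
suff /choice[N HN] : forall n, exists N, (n <= N)%N /\
    limn (series (fun m => b m * rk n ^+ m)) - series (fun m => b m * rk n ^+ m) N.+1 <= (2^-1) ^+ n by exists N.
move=> n; have /cvgrPdist_le/(_ ((2^-1) ^+ n)) := tail_cvg (sb (rk_ge R n)).
rewrite exprn_gt0 ?invr_gt0// => /(_ isT) [K _ HK].
exists (maxn n K); split; first exact: leq_maxl.
by have := HK (maxn n K) (leq_maxr _ _); rewrite /= sub0r normrN; apply: le_trans (ler_norm _).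
Qed.

Definition degn := sval (cid deg_ex).
Lemma degnP n : (n <= degn n)%N /\
  limn (series (fun m => b m * rk n ^+ m)) - series (fun m => b m * rk n ^+ m) (degn n).+1 <= (2^-1) ^+ n.
Proof. exact: (svalP (cid deg_ex)). Qed.

(** Approximates [l f(l z)]: the slice is dilated by [r_n], so that its series converges uniformly
    on the closed disc, and cut at a degree where the error is at most [2^(-n)]. The factor ['X]
    turns [I + R] into a derivative. *)
Definition approx n : {poly R[i]} := 'X * \poly_(m < (degn n).+1) (hom c z m * (rk n +i* 0)%C ^+ m).

Lemma approx_horner n w : (approx n).[w] = w * psum c (cscale ((rk n +i* 0)%C * w) z) (degn n).
Proof.
rewrite /approx hornerM hornerX horner_poly psum_hom; congr (_ * _); apply: eq_bigr => m _.
by rewrite hom_cscale exprMn; ring.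
Qed.

Lemma approx_deriv n w : (approx n)^`().[w] = psum (radI 1 c) (cscale ((rk n +i* 0)%C * w) z) (degn n).
Proof.
have -> : deriv (approx n) = \poly_(m < (degn n).+1) ((1 + m)%:R * (hom c z m * (rk n +i* 0)%C ^+ m)).
  apply/polyP => i; rewrite coef_deriv coefXM/= !coef_poly; case: ifP => _; last by rewrite mul0rn.
  by rewrite add1n mulr_natl.
rewrite horner_poly psum_hom; apply: eq_bigr => m _.
by rewrite hom_cscale hom_radI expr1 natC exprMn; ring.
Qed.

Lemma one_sub_expr (x : R) m : 0 <= x <= 1 -> 0 <= 1 - x ^+ m <= m%:R * (1 - x).
Proof.
move=> /andP[x0 x1]; elim: m => [|m /andP[h1 h2]]; first by rewrite expr0 subrr mul0r lexx.
have p1 : 0 <= x ^+ m by exact: exprn_ge0.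
rewrite exprS -natr1; apply/andP; split; nra.
Qed.

Local Notation D r t := (pseries (radI 1 c) (cscale (rcis r t) z)).

Lemma hom1_le m : cabs (hom (radI 1 c) z m) <= (1 + m)%:R * b m.
Proof. by rewrite hom_radI expr1 cabsM cabs_real// ler_wpM2l// cabs_hom. Qed.

Lemma approx_deriv_cvg r t : 0 <= r < 1 -> cabs (approx n)^`().[rcis r t] @[n --> \oo] --> cabs (D r t).
Proof.
move=> r01; have /andP[r0 r1] := r01.
(* The dilation changes the term of degree [m] by a factor at most [m (1 - r_n)], which explains the
   second weight [1 + m] in this series. *)
pose B2 := limn (series (fun m => (1 + m)%:R * ((1 + m)%:R * b m) * r ^+ m)).
pose T n := limn (series (fun m => (1 + m)%:R * b m * r ^+ m)) - series (fun m => (1 + m)%:R * b m * r ^+ m) n.+1.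
have u0 m : 0 <= (1 + m)%:R * b m * r ^+ m by rewrite !mulr_ge0 ?ahom_ge0// exprn_ge0.
have key n : cabs ((approx n)^`().[rcis r t] - D r t) <= (1 - rk n) * B2 + T n.
  have /andP[k0 k1] := rk_ge R n; have [nN _] := degnP n.
  rewrite approx_deriv -(subrK (psum (radI 1 c) (cscale (rcis r t) z) (degn n)) (psum _ _ _)) -addrA.
  apply: (le_trans (cabsD _ _)); apply: lerD; last first.
    apply: (@le_trans _ _ (T (degn n))).
      apply: (pseries_slice hom1_le); [exact: sb1|by rewrite cabs_rcis|exact: r1].
    rewrite lerB// ; apply: (nondecreasing_series (P := xpredT)) => [m _ _|]; first exact: u0.
    by rewrite ltnS.
  rewrite !psum_hom -sumrB; apply: (le_trans (cabs_sum _ _ _)).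
  apply: (@le_trans _ _ ((1 - rk n) * series (fun m => (1 + m)%:R * ((1 + m)%:R * b m) * r ^+ m) (degn n).+1)).
    rewrite /series/= big_mkord mulr_sumr; apply: ler_sum => m _.
    rewrite !hom_cscale exprMn -mulrBl -{2}[rcis r t ^+ m]mul1r -mulrBl !cabsM cabsX cabs_rcis//.
    have -> : cabs ((rk n +i* 0)%C ^+ m - 1) = 1 - rk n ^+ m.
      rewrite cabsB (_ : 1 - (rk n +i* 0)%C ^+ m = ((1 - rk n ^+ m) +i* 0)%C).
        by rewrite cabs_real// subr_ge0 exprn_ile1// ltW.
      have -> : (rk n +i* 0)%C ^+ m = (rk n ^+ m +i* 0)%C by rewrite -(rmorphXn (real_complex R)).
      by apply/eqP; rewrite eq_complex/= subr0 !eqxx.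
    have /andP[e1 e2] : 0 <= 1 - rk n ^+ m <= m%:R * (1 - rk n) by apply: one_sub_expr; rewrite k0 ltW.
    have m1 : m%:R * (1 - rk n) <= (1 + m)%:R * (1 - rk n).
      by rewrite ler_wpM2r ?subr_ge0 ?(ltW k1)// ler_nat.
    have rm0 : 0 <= r ^+ m by exact: exprn_ge0.
    apply: (@le_trans _ _ ((1 + m)%:R * (1 - rk n) * r ^+ m * ((1 + m)%:R * b m))).
      apply: ler_pM; rewrite ?cabs_ge0 ?mulr_ge0 ?hom1_le//.
      by rewrite ler_wpM2r//; exact: le_trans e2 m1.
    by rewrite le_eqVlt; apply/orP; left; apply/eqP; ring.
  rewrite ler_wpM2l ?subr_ge0 ?(ltW k1)//; apply: nondecreasing_cvgn_le; last exact: sb2.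
  by apply: nondecreasing_series => m _ _; rewrite !mulr_ge0 ?ahom_ge0// exprn_ge0.
have lim0 : (1 - rk n) * B2 + T n @[n --> \oo] --> 0.
  rewrite -[X in _ --> X]addr0; apply: cvgD; last exact: tail_cvg (sb1 r01).
  rewrite -[X in _ --> X](mul0r B2); apply: cvgM; last exact: cvg_cst.
  rewrite -[X in _ --> X](subrr 1); apply: cvgB; [exact: cvg_cst|exact: rk_cvg].
apply/cvgrPdist_le => e e0; have /cvgrPdist_le/(_ e e0) := lim0; apply: filterS => n.
rewrite sub0r normrN distrC => h; apply: (le_trans (cabs_dist _ _)).
by apply: (le_trans (key n)); exact: le_trans (ler_norm _) h.
Qed.

Lemma slice_closed (w : R[i]) : cabs w <= 1 -> closed_ball d (cscale w z).
Proof.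
move=> w1; apply/closed_ballP; have /sphereP zz1 := z1.
by rewrite pn2_cscale zz1 mulr1 -cabs_sq exprn_ile1// cabs_ge0.
Qed.

Lemma slice_dist (w w' : R[i]) : pnorm (psub (cscale w z) (cscale w' z)) = cabs (w - w').
Proof.
have -> : psub (cscale w z) (cscale w' z) = cscale (w - w') z.
  apply: coord_inj => k; rewrite coord_cscale mulrBl -!coord_cscale /coord tnth_mktuple/=.
  by apply/eqP; rewrite eq_complex/= !eqxx.
by have /sphereP zz1 := z1; rewrite pnormE pn2_cscale zz1 mulr1.
Qed.

(** Continuity is given only on the closed ball; projecting the radius to [[0, 1]] makes the slice
    continuous on the whole plane. *)
Definition clamp (r : R) := Num.max 0 (Num.min r 1).
Lemma clamp_itv r : 0 <= clamp r <= 1.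
Proof. by rewrite /clamp le_max lexx ge_max ler01/= ge_min lexx orbT. Qed.
Lemma clampE r : 0 <= r <= 1 -> clamp r = r.
Proof. by move=> /andP[r0 r1]; rewrite /clamp (min_idPl r1) (max_idPr r0). Qed.

Lemma slice_cts : continuous (fun x : R * R => cabs (f (cscale (rcis (clamp x.1) x.2) z))).
Proof.
have cc : continuous clamp.
  apply: cts_max; first exact: cts_cst.
  by move=> r; apply: continuous_min; [exact: cvg_id|exact: cvg_cst].
have c1 : continuous (fun x : R * R => clamp x.1 * cos x.2).
  by apply: ctsM; [exact: cts_fst|apply: cts_snd; exact: continuous_cos].
have c2 : continuous (fun x : R * R => clamp x.1 * sin x.2).
  by apply: ctsM; [exact: cts_fst|apply: cts_snd; exact: continuous_sin].
have cl x : cabs (rcis (clamp x.1) x.2) <= 1.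
  by have /andP[h0 h1] := clamp_itv x.1; rewrite cabs_rcis.
move=> x; apply/cvgrPdist_lt => e e0.
have [dl dl0 H] := cf (slice_closed (cl x)) e0.
have d2 : 0 < dl / 2 by rewrite divr_gt0.
have /cvgrPdist_lt/(_ _ d2) H1 := c1 x; have /cvgrPdist_lt/(_ _ d2) H2 := c2 x.
near=> y; rewrite distrC; apply: (le_lt_trans (cabs_dist _ _)); apply: H; first exact: slice_closed.
rewrite slice_dist cabsB; apply: (le_lt_trans (cabs_le _)).
have h1 : `|clamp x.1 * cos x.2 - clamp y.1 * cos y.2| < dl / 2 by near: y.
have h2 : `|clamp x.1 * sin x.2 - clamp y.1 * sin y.2| < dl / 2 by near: y.
by rewrite /=; lra.
Unshelve. all: by end_near. Qed.

Lemma slice_bounded : exists2 M, 0 < M & forall r t, 0 <= r <= 1 -> cabs (f (cscale (rcis r t) z)) <= M.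
Proof.
have [M M0 HM] := @continuous2_bounded R _ 0 1 0 tau slice_cts.
exists M => // r t r01; have [k hk] := mod_tau t.
have -> : rcis r t = rcis r (t + k%:~R * tau).
  have pc : per (fun t : R => cos t) by move=> u; rewrite cosD2pi.
  have ps : per (fun t : R => sin t) by move=> u; rewrite sinD2pi.
  by rewrite /rcis (per_int k t pc) (per_int k t ps).
by have := HM r _ r01 hk; rewrite /= clampE// ger0_norm// cabs_ge0.
Qed.

Definition bd (t : R) := cabs (f (cscale (cis t) z)).
Lemma cis_rcis (t : R) : cis t = rcis 1 t.
Proof. by rewrite /rcis !mul1r. Qed.
Lemma bd_cts : continuous bd.
Proof.
have -> : bd = fun t => (fun x : R * R => cabs (f (cscale (rcis (clamp x.1) x.2) z))) (1, t).
  by apply/funext => t; rewrite /= clampE ?ler01 ?lexx// -cis_rcis.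
exact: continuous_slice1 slice_cts.
Qed.

Lemma approx_dist n t : cabs (psum c (cscale ((rk n +i* 0)%C * cis t) z) (degn n) - f (cscale (rcis (rk n) t) z)) <= (2^-1) ^+ n.
Proof.
have /andP[k0 k1] := rk_ge R n; have [_ H] := degnP n.
have -> : (rk n +i* 0)%C * cis t = rcis (rk n) t.
  by apply/eqP; rewrite eq_complex/=; apply/andP; split; apply/eqP; ring.
have ob : open_ball d (cscale (rcis (rk n) t) z).
  by apply/open_ballP; rewrite pn2_cscale; have /sphereP-> := z1; rewrite mulr1 n2_rcis expr_lt1.
have [_ ->] := hf ob.
apply: le_trans H; apply: (pseries_slice (cabs_hom c z)); [exact: sb|by rewrite cabs_rcis|exact: k1].
Qed.

Lemma cabs_approx n t : cabs (approx n).[cis t] = cabs (psum c (cscale ((rk n +i* 0)%C * cis t) z) (degn n)).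
Proof. by rewrite approx_horner cabsM cis_rcis cabs_rcis// mul1r. Qed.

Lemma half_expr_cvg : (2^-1 : R) ^+ n @[n --> \oo] --> 0.
Proof. by apply: cvg_expr; rewrite ger0_norm; lra. Qed.

Lemma approx_cvg t : cabs (approx n).[cis t] @[n --> \oo] --> bd t.
Proof.
apply/cvgrPdist_lt => e e0; have e2 : 0 < e / 2 by rewrite divr_gt0.
have cl : closed_ball d (cscale (cis t) z) by apply: slice_closed; rewrite cis_rcis cabs_rcis.
have [dl dl0 H] := cf cl e2.
have /cvgrPdist_lt/(_ _ dl0) H1 := rk_cvg; have /cvgrPdist_lt/(_ _ e2) H2 := half_expr_cvg.
near=> n; have /andP[k0 k1] := rk_ge R n.
have h1 : `|1 - rk n| < dl by near: n.
have h2 : `|0 - (2^-1 : R) ^+ n| < e / 2 by near: n.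
rewrite distrC cabs_approx; apply: (le_lt_trans (cabs_dist _ _)).
rewrite -(subrK (f (cscale (rcis (rk n) t) z)) (psum _ _ _)) -addrA.
apply: (le_lt_trans (cabsD _ _)).
have h3 := approx_dist n t.
have h4 : cabs (f (cscale (rcis (rk n) t) z) - f (cscale (cis t) z)) < e / 2.
  apply: H; first by apply: slice_closed; rewrite cabs_rcis// ltW.
  rewrite slice_dist (_ : rcis (rk n) t - cis t = rcis (rk n - 1) t).
    by rewrite cabs_rcisE distrC.
  by apply/eqP; rewrite eq_complex/=; apply/andP; split; apply/eqP; ring.
by rewrite sub0r normrN ger0_norm ?exprn_ge0 ?invr_ge0// in h2; lra.
Unshelve. all: by end_near. Qed.

Lemma a2_approx p n t : a2 (approx n) 0 t `^ (p / 2) = cabs (approx n).[cis t] `^ p.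
Proof.
rewrite a2_n2 zz_rcis expR0 -cis_rcis n2_ReIm -powR_mulrn ?cabs_ge0// -powRrM; congr (_ `^ _); lra.
Qed.

Lemma cint_bd_cvg p : 0 < p ->
  (cint 0 tau (fun t => a2 (approx n) 0 t `^ (p / 2)))%:E @[n --> \oo] --> (cint 0 tau (fun t => bd t `^ p))%:E.
Proof.
move=> p0; have p2 : 0 < p / 2 by rewrite divr_gt0.
have ca n := @a2_powR_cts R (approx n) _ p2.
have cb : continuous (fun t => bd t `^ p).
  by apply: cts_powR_ge0 => //; [move=> t; exact: cabs_ge0|exact: bd_cts].
have [M M0 HM] := slice_bounded.
rewrite -cintE//; under eq_fun do rewrite -cintE//.
apply: (@dominated_cvg _ _ R lebesgue_measure `[0, tau]%classic (measurable_itv _) _ _ (fun=> ((M + 1) `^ p)%:E)) => //.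
- by move=> n; apply/measurable_EFinP; apply: measurable_funTS; exact: continuous_measurable_fun.
- move=> t _; apply: cvg_EFin; first by apply: nearW.
  under eq_fun do rewrite /= a2_approx.
  by apply: (@cvg_powR R (fun n => cabs (approx n).[cis t])) => //; [move=> n; exact: cabs_ge0|exact: cabs_ge0|exact: (@approx_cvg t)].
- exact: (@cint_int R 0 tau (fun=> (M + 1) `^ p) (@cts_cst _ _ _)).
- move=> n t _; rewrite /= ger0_norm ?powR_ge0// lee_fin a2_approx.
  apply: ge0_ler_powR; rewrite ?nnegrE ?cabs_ge0 ?(ltW p0)//; first by rewrite addr_ge0// ltW.
  rewrite cabs_approx -(subrK (f (cscale (rcis (rk n) t) z)) (psum _ _ _)).
  apply: (le_trans (cabsD _ _)); have := approx_dist n t.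
  have /andP[k0 k1] := rk_ge R n; have := HM (rk n) t ltac:(by rewrite k0 ltW).
  have /andP[_ h1] := half_expn R n; lra.
Qed.

(** A bound holding for infinitely many [n] passes to the limit along a subsequence [phi], which may
    depend on the angle because the estimate is pointwise. For finite [q], Fatou's lemma is applied
    to integrals cut at the radius up to which [X n] is a bound. *)
Lemma inner_le (q : \bar R) p t (X : nat -> R) (y : R) : 0 < p -> (2%:E <= q)%E -> 0 < y ->
  (forall n, 0 <= X n) ->
  (forall n r, 0 <= r -> r <= rk n -> (1 - r ^+ 2) ^+ 2 * n2 (approx n)^`().[rcis r t] <= X n) ->
  (forall n, cint 0 (rk n) (fun r => n2 (approx n)^`().[rcis r t] * (1 - r ^+ 2)) <= X n) ->
  (forall k, exists n, (k <= n)%N /\ X n `^ (p / 2) <= y) ->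
  (poweR (HF_inner 0 q c (cscale (cis t) z)) (outer_exp p q) <= y%:E)%E.
Proof.
move=> p0 q2 y0 X0 HX1 HX2 Hy; pose Y := y `^ (2 / p).
have Y0 : 0 < Y by rewrite powR_gt0.
have YE a : Y `^ a = y `^ (2 / p * a) by rewrite powRrM.
have /choice[phi Hphi] : forall k, exists n, (k <= n)%N /\ X n <= Y.
  move=> k; have [n [kn Xy]] := Hy k; exists n; split=> //.
  have -> : X n = (X n `^ (p / 2)) `^ (2 / p).
    by rewrite -powRrM (_ : p / 2 * (2 / p) = 1) ?powRr1//; field; rewrite gt_eqF.
  by apply: ge0_ler_powR; rewrite ?nnegrE ?powR_ge0 ?divr_ge0 ?(ltW p0) ?(ltW y0).
have phi_near r : r < 1 -> exists K, forall k, (K <= k)%N -> r <= rk (phi k).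
  move=> r1; have [K HK] := rk_near r1; exists K => k Kk; apply: HK.
  by apply: (leq_trans Kk); have [] := Hphi k.
have phi_cvg r : 0 <= r < 1 -> cabs (approx (phi k))^`().[rcis r t] @[k --> \oo] --> cabs (D r t).
  move=> r01; apply: (@subseq_cvg R (fun n => cabs (approx n)^`().[rcis r t])); last exact: (@approx_deriv_cvg r t r01).
  by move=> k; have [] := Hphi k.
case: q q2 => [q q2|q2|//]; last first.
  rewrite /HF_inner /splus truncn0 /outer_exp.
  have key : (ereal_sup [set (cabs (pseries (radI 1 c) (scale r (cscale (cis t) z))) * (1 - r ^+ 2) `^ (1%:R - 0))%:E
        | r in `[0%R, 1%R[] <= (Y `^ 2^-1)%:E)%E.
    apply: ge_ereal_sup => _ [r /= /[!in_itv]/= r01 <-]; have /andP[r0 r1] := r01.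
    have w0 : 0 <= 1 - r ^+ 2 by rewrite subr_ge0 exprn_ile1// ltW.
    rewrite lee_fin scale_rcis subr0 powRr1//.
    have [K HK] := phi_near r r1.
    have lim : cabs (approx (phi k))^`().[rcis r t] * (1 - r ^+ 2) @[k --> \oo] --> cabs (D r t) * (1 - r ^+ 2).
      by apply: cvgM; [exact: phi_cvg|exact: cvg_cst].
    rewrite -(cvg_lim _ lim)//; apply: limr_le; first by apply/cvg_ex; eexists; exact: lim.
    exists K => // k /= Kk; have := HX1 (phi k) r r0 (HK k Kk); have [_ hY] := Hphi k => hX.
    set v := cabs (deriv (approx (phi k))).[_]; have v0 : 0 <= v * (1 - r ^+ 2) by rewrite mulr_ge0 ?cabs_ge0.
    have -> : v * (1 - r ^+ 2) = ((v * (1 - r ^+ 2)) ^+ 2) `^ 2^-1.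
      by rewrite -powR_mulrn// -powRrM divff// powRr1.
    apply: ge0_ler_powR; rewrite ?nnegrE ?sqr_ge0 ?(ltW Y0) ?invr_ge0//.
    by apply: le_trans hY; apply: le_trans hX; rewrite n2_ReIm exprMn mulrC.
  have p0' := ltW p0.
  apply: (@le_trans _ _ (poweR (Y `^ 2^-1)%:E p)).
    apply: le_poweR => //; apply: le_trans (ereal_sup_ubound _); last first.
      by exists 0 => //=; rewrite in_itv/= lexx ltr01.
    by rewrite lee_fin mulr_ge0 ?cabs_ge0 ?powR_ge0.
  rewrite poweR_EFin lee_fin -powRrM YE (_ : 2 / p * (2^-1 * p) = 1); first by rewrite powRr1// ltW.
  by field; rewrite gt_eqF.
rewrite lee_fin in q2; have q0 : 0 < q by lra.
rewrite /HF_inner /splus truncn0 /outer_exp.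
set e := (1%:R - 0) * q - 1; have eE : e = q - 1 by rewrite /e subr0 mul1r.
have e0 : 0 < e by lra.
pose g k r := n2 (approx (phi k))^`().[rcis r t] `^ (q / 2) * (1 - r ^+ 2) `^ e.
have mg k : measurable_fun setT (g k).
  apply: measurable_funM; apply: (measurableT_comp (measurable_powR _)); apply: continuous_measurable_fun.
    exact: cts_n2_ray.
  by apply: ctsB; [exact: cts_cst|apply: ctsX; exact: cts_id].
have g0 k r : 0 <= g k r by rewrite mulr_ge0 ?powR_ge0.
pose F k r := ((g k r)%:E * (\1_(`[0, rk (phi k)]%classic : set R) r)%:E)%E.
have mF k : measurable_fun (`[0, 1[%classic : set R) (F k).
  apply: measurable_funTS; apply: emeasurable_funM; apply/measurable_EFinP; first exact: mg.
  by apply: (@measurable_indic _ _ R setT (`[0, rk (phi k)]%classic : set R)).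
have F0 k r : (0 <= F k r)%E by rewrite mule_ge0 ?lee_fin ?g0// indicE ler0n.
have Fle k : (\int[lebesgue_measure]_(r in `[0%R, 1%R[) F k r <= (Y `^ (q / 2))%:E)%E.
  have /andP[k0 k1] := rk_ge R (phi k); have [_ hY] := Hphi k.
  have -> : F k = (fun r => (g k r)%:E) \_ (`[0, rk (phi k)]%classic : set R).
    by apply/funext => r; rewrite /F /patch indicE; case: ifP => _; rewrite ?mule1 ?mule0.
  rewrite -integral_mkcondr.
  have -> : `[0, 1[%classic `&` `[0, rk (phi k)]%classic = `[0, rk (phi k)]%classic :> set R.
    apply/seteqP; split=> r /=; rewrite !in_itv/=; first by case.
    by move=> /andP[r0 rK]; rewrite r0 rK (le_lt_trans rK k1).
  pose G r := Y `^ ((q - 2) / 2) * (n2 (approx (phi k))^`().[rcis r t] * (1 - r ^+ 2)).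
  have cG0 : continuous (fun r : R => n2 (approx (phi k))^`().[rcis r t] * (1 - r ^+ 2)).
    apply: ctsM; first exact: cts_n2_ray.
    by apply: ctsB; [exact: cts_cst|apply: ctsX; exact: cts_id].
  have cG : continuous G by apply: ctsM => //; exact: cts_cst.
  apply: (@le_trans _ _ (\int[lebesgue_measure]_(r in `[0%R, rk (phi k)]) (G r)%:E)%E).
    apply: ge0_le_integral => //.
    - by move=> r _; rewrite lee_fin.
    - by apply: measurable_funTS; apply/measurable_EFinP; exact: mg.
    - by apply: measurable_funTS; apply/measurable_EFinP; exact: continuous_measurable_fun.
    move=> r /=; rewrite in_itv/= => /andP[r0 rK]; rewrite lee_fin /g /G.
    have r1 : r < 1 by exact: le_lt_trans rK k1.
    have hX := HX1 (phi k) r r0 rK.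
    set v := n2 _ in hX *; have v0 : 0 <= v by exact: n2_ge0.
    set w := 1 - r ^+ 2 in hX *; have w0 : 0 < w by rewrite subr_gt0 expr_lt1.
    rewrite eE; apply: power_trade => //; first exact: ltW.
    exact: le_trans hX hY.
  rewrite cintE// lee_fin /G cintZ//.
  rewrite (powR_half q0 (ltW Y0)).
  by apply: ler_wpM2l; [exact: powR_ge0|exact: le_trans (HX2 _) hY].
have q2' : 0 < q / 2 by rewrite divr_gt0.
have inner_Y : (\int[lebesgue_measure]_(r in `[0%R, 1%R[)
    (cabs (pseries (radI 1 c) (scale r (cscale (cis t) z))) `^ q * (1 - r ^+ 2) `^ e)%:E <= (Y `^ (q / 2))%:E)%E.
  apply: (@le_trans _ _ (limn_einf (fun k => \int[lebesgue_measure]_(r in `[0%R, 1%R[) F k r)%E)); last first.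
    by apply: einf_le_freq => k; exists k.
  have FT := @fatou _ _ R lebesgue_measure (`[0, 1[%classic : set R) (measurable_itv _) F mF.
  apply: le_trans (FT _) => //.
  rewrite le_eqVlt; apply/orP; left; apply/eqP; apply: eq_integral => r; rewrite inE/= in_itv/= => r01.
  have /andP[r0 r1] := r01; rewrite scale_rcis.
  have [K HK] := phi_near r r1.
  suff lim : F k r @[k --> \oo] --> (cabs (D r t) `^ q * (1 - r ^+ 2) `^ e)%:E.
    by have [-> _] := cvg_limn_einf_sup lim.
  have lim' : (cabs (approx (phi k))^`().[rcis r t] `^ q * (1 - r ^+ 2) `^ e)%:E @[k --> \oo] --> (cabs (D r t) `^ q * (1 - r ^+ 2) `^ e)%:E.
    apply: cvg_EFin; first exact: nearW.
    apply: cvgM; last exact: cvg_cst.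
    by apply: (@cvg_powR R (fun k => cabs (approx (phi k))^`().[rcis r t])) => //; [move=> k; exact: cabs_ge0|exact: cabs_ge0|exact: (phi_cvg r r01)].
  apply: cvg_trans lim'; apply: near_eq_cvg; exists K => // k /= Kk.
  rewrite /F indicE mem_set ?mule1/=; last by rewrite in_itv/= r0 HK.
  by rewrite /g n2_powR_half.
apply: (@le_trans _ _ (poweR (Y `^ (q / 2))%:E (p / q))).
  apply: le_poweR => //; first by rewrite divr_ge0// ltW.
  by apply: integral_ge0 => r _; rewrite lee_fin mulr_ge0 ?powR_ge0.
rewrite poweR_EFin lee_fin -powRrM YE (_ : 2 / p * (q / 2 * (p / q)) = 1); first by rewrite powRr1// ltW.
by field; rewrite !gt_eqF.
Qed.

(** The functions [X n] need not converge, so their lower limit is used and Fatou's lemma is applied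
    in [t]. On the right the boundary values converge boundedly. *)
Lemma disc_bound p C (q : \bar R) : 0 < p -> (2%:E <= q)%E -> 0 <= C ->
  (forall K h, exists X : R -> R,
  [/\ continuous X, forall t, 0 <= X t,
    cm (fun t => X t `^ (p / 2)) <= C * cm (fun t => a2 h 0 t `^ (p / 2)),
    forall t r, 0 <= r -> r <= rk K -> (1 - r ^+ 2) ^+ 2 * n2 h^`().[rcis r t] <= X t &
    forall t, cint 0 (rk K) (fun r => n2 h^`().[rcis r t] * (1 - r ^+ 2)) <= X t]) ->
  measurable_fun `[0, tau]%classic (fun t => poweR (HF_inner 0 q c (cscale (cis t) z)) (outer_exp p q)) ->
  (\int[lebesgue_measure]_(t in `[0%R, tau]) poweR (HF_inner 0 q c (cscale (cis t) z)) (outer_exp p q) <=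
   C%:E * \int[lebesgue_measure]_(t in `[0%R, tau]) (bd t `^ p)%:E)%E.
Proof.
move=> p0 q2 C0 HC mI; have p2 : 0 < p / 2 by rewrite divr_gt0.
have /choice[X HX] := fun n => HC n (approx n).
have cX n : continuous (fun t => X n t `^ (p / 2)).
  by have [h1 h2 _ _ _] := HX n; exact: cts_powR_ge0.
have mX n : measurable_fun `[0, tau]%classic (fun t => (X n t `^ (p / 2))%:E).
  by apply: measurable_funTS; apply/measurable_EFinP; exact: continuous_measurable_fun.
have cb : continuous (fun t => bd t `^ p).
  by apply: cts_powR_ge0 => //; [move=> t; exact: cabs_ge0|exact: bd_cts].
apply: (@le_trans _ _ (\int[lebesgue_measure]_(t in `[0%R, tau]) limn_einf (fun n => (X n t `^ (p / 2))%:E))%E).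
  apply: ge0_le_integral => //; first by move=> t _; exact: poweR_ge0.
    rewrite /limn_einf; apply: measurableT_comp => //; apply: measurable_fun_limn_esup => n.
    by apply: measurableT_comp => //; exact: mX.
  move=> t _; apply: le_of_lt.
    rewrite limn_einf_lim; apply: lime_ge; first exact: is_cvg_einfs.
    by apply: nearW => n; apply: le_ereal_inf_tmp => _ [m _ <-]; rewrite lee_fin powR_ge0.
  move=> y Ly; have fr := einf_freq_lt Ly.
  have y0 : 0 < y.
    have [n [_ h]] := fr 0; rewrite lte_fin in h; exact: le_lt_trans (powR_ge0 _ _) h.
  apply: (inner_le (X := fun n => X n t) p0 q2 y0).
  - by move=> n; have [_ h2 _ _ _] := HX n.
  - by move=> n r; have [_ _ _ h _] := HX n; exact: h.
  - by move=> n; have [_ _ _ _ h] := HX n; exact: h.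
  - by move=> k; have [n [kn h]] := fr k; exists n; split=> //; rewrite lte_fin in h; exact: ltW.
have FT := @fatou _ _ R lebesgue_measure `[0, tau]%classic (measurable_itv _) (fun n t => (X n t `^ (p / 2))%:E) mX.
apply: (le_trans (FT _)); first by move=> n t _; rewrite lee_fin powR_ge0.
rewrite cintE// -EFinM; apply/lee_addgt0Pr => e e0.
have e1 : 0 < e / (C + 1) by rewrite divr_gt0//; lra.
apply: einf_le_freq => k.
have := cint_bd_cvg p0 => /fine_cvgP[_ /cvgrPdist_le/(_ _ e1) [K _ HK]].
pose n := maxn k K; exists n; split; first exact: leq_maxl.
have := HK n (leq_maxr _ _); rewrite /= distrC => h.
rewrite cintE// -EFinD lee_fin.
have [_ _ h3 _ _] := HX n.
have {}h3 : cint 0 tau (fun t => X n t `^ (p / 2)) <= C * cint 0 tau (fun t => a2 (approx n) 0 t `^ (p / 2)).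
  by move: h3; rewrite /cm mulrCA ler_pM2l// invr_gt0; exact: tau_gt0.
apply: (le_trans h3); have := le_trans (ler_norm _) h; rewrite lerBlDl => h4.
by apply: (le_trans (ler_wpM2l C0 h4)); rewrite mulrDr lerD2l mul_div_succ.
Qed.

End Disc.

(** * Measurability of series and of maps of the ball *)

Section Measurability.
Variable R : realType.

Section Complex.
Context {dT} {T : measurableType dT}.
Implicit Types g h : T -> R[i].

Definition mfc g := measurable_fun setT (fun x => complex.Re (g x)) /\ measurable_fun setT (fun x => complex.Im (g x)).

Lemma mfc_cst (w : R[i]) : mfc (fun=> w).
Proof. by split; exact: measurable_cst. Qed.
Lemma mfcD g h : mfc g -> mfc h -> mfc (fun x => g x + h x).
Proof.
move=> [g1 g2] [h1 h2]; split; (under eq_fun do rewrite (ReD, ImD)); exact: measurable_funD.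
Qed.
Lemma mfcM g h : mfc g -> mfc h -> mfc (fun x => g x * h x).
Proof.
move=> [g1 g2] [h1 h2]; split; (under eq_fun do rewrite (ReM, ImM)).
  by apply: measurable_funB; exact: measurable_funM.
by apply: measurable_funD; exact: measurable_funM.
Qed.
Lemma mfcX g n : mfc g -> mfc (fun x => g x ^+ n).
Proof.
move=> mg; elim: n => [|n IH]; first by under eq_fun do rewrite expr0; exact: mfc_cst.
by under eq_fun do rewrite exprS; exact: mfcM.
Qed.
Lemma mfc_sum (I : Type) (r : seq I) (P : pred I) (F : I -> T -> R[i]) :
  (forall i, mfc (F i)) -> mfc (fun x => \sum_(i <- r | P i) F i x).
Proof.
move=> mF; elim: r => [|i r IH]; first by under eq_fun do rewrite big_nil; exact: mfc_cst.
by case Pi : (P i); (under eq_fun do rewrite big_cons Pi); [exact: mfcD|].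
Qed.
Lemma mfc_prod (I : Type) (r : seq I) (P : pred I) (F : I -> T -> R[i]) :
  (forall i, mfc (F i)) -> mfc (fun x => \prod_(i <- r | P i) F i x).
Proof.
move=> mF; elim: r => [|i r IH]; first by under eq_fun do rewrite big_nil; exact: mfc_cst.
by case Pi : (P i); (under eq_fun do rewrite big_cons Pi); [exact: mfcM|].
Qed.
Lemma mfc_n2 g : mfc g -> measurable_fun setT (fun x => n2 (g x)).
Proof. by move=> [g1 g2]; apply: measurable_funD; exact: measurable_funX. Qed.
Lemma mfc_cabs g : mfc g -> measurable_fun setT (fun x => cabs (g x)).
Proof.
move=> mg; rewrite (_ : (fun x => cabs (g x)) = (fun x => n2 (g x) `^ 2^-1)).
  by apply: (measurableT_comp (measurable_powR _)); exact: mfc_n2.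
by apply/funext => x; rewrite powR12_sqrt// n2_ge0.
Qed.
End Complex.

Context {d : nat}.
Implicit Types (c : d.-tuple nat -> R[i]).

Lemma mfc_coord k : mfc (fun z : Pt R d => coord z k).
Proof.
split; rewrite /coord/=.
  by apply: (measurableT_comp (f := fst)) => //; exact: measurable_tnth.
by apply: (measurableT_comp (f := snd)) => //; exact: measurable_tnth.
Qed.
Lemma mfc_psum c N : mfc (fun z : Pt R d => psum c z N).
Proof.
apply: mfc_sum => a; apply: mfcM; first exact: mfc_cst.
by apply: mfc_prod => k; apply: mfcX; exact: mfc_coord.
Qed.
Lemma mfc_comp {dT dT'} {T : measurableType dT} {T' : measurableType dT'} (h : T' -> T) (g : T -> R[i]) :
  mfc g -> measurable_fun setT h -> mfc (fun x => g (h x)).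
Proof. by move=> [g1 g2] mh; split; [exact: (measurableT_comp g1)|exact: (measurableT_comp g2)]. Qed.

Lemma measurable_cscale {dT} {T : measurableType dT} (w : T -> R[i]) (z : T -> Pt R d) :
  mfc w -> measurable_fun setT z -> measurable_fun setT (fun x => cscale (w x) (z x)).
Proof.
move=> mw mz; apply/measurable_fun_tnthP => k.
have [h1 h2] := mfcM mw (mfc_comp (mfc_coord k) mz).
rewrite (_ : _ \o _ = (fun x => (complex.Re (w x * coord (z x) k), complex.Im (w x * coord (z x) k)))).
  exact: measurable_fun_pair.
by apply/funext => x; rewrite /= tnth_mktuple.
Qed.

Lemma mfc_real {dT} {T : measurableType dT} (g : T -> R) : measurable_fun setT g -> mfc (fun x => (g x +i* 0)%C).
Proof. by move=> mg; split=> //=; exact: measurable_cst. Qed.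

Lemma mfc_cis {dT} {T : measurableType dT} (g : T -> R) : measurable_fun setT g -> mfc (fun x => cis (g x)).
Proof.
move=> mg; split; rewrite /cis/=; apply: (measurableT_comp _ mg); apply: continuous_measurable_fun.
  exact: continuous_cos.
exact: continuous_sin.
Qed.

Lemma measurable_pn2 : measurable_fun setT (@pn2 R d).
Proof.
rewrite /pn2; elim: (index_enum _) => [|k r IH]; first by under eq_fun do rewrite big_nil; exact: measurable_cst.
under eq_fun do rewrite big_cons; apply: measurable_funD => //; apply: mfc_n2; exact: mfc_coord.
Qed.
Lemma measurable_sphere : measurable (@sphere R d).
Proof.
rewrite (_ : sphere d = setT `&` (@pn2 R d) @^-1` [set 1]); first exact: measurable_pn2.
by apply/seteqP; split => z; rewrite setTI => /sphereP.
Qed.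
Lemma measurable_closed_ball : measurable (@closed_ball R d).
Proof.
rewrite (_ : closed_ball d = setT `&` (@pn2 R d) @^-1` `]-oo, 1]%classic).
  by apply: measurable_pn2 => //; exact: measurable_itv.
by apply/seteqP; split => z; rewrite setTI/= in_itv/= => /closed_ballP.
Qed.

End Measurability.

Section FiniteMeasure.
Context {dT} {T : measurableType dT} {R : realType}.
Variables (m : {measure set T -> \bar R}) (h : (m setT < +oo)%E).

(** Repackages a measure of finite total mass as a finite measure, hence a sigma-finite one, as
    Tonelli's theorem demands. *)
Definition fmeas of (m setT < +oo)%E : set T -> \bar R := m.
HB.instance Definition _ := isMeasure.Build dT T R (fmeas h) (measure0 m) (measure_ge0 m) (@measure_semi_sigma_additive _ _ _ m).
Let fmeas_fin : fin_num_fun (fmeas h).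
Proof.
move=> A mA; rewrite ge0_fin_numE ?measure_ge0//; apply: le_lt_trans h.
by apply: le_measure; rewrite ?inE.
Qed.
HB.instance Definition _ := Measure_isFinite.Build dT T R (fmeas h) fmeas_fin.

Definition fin_measure : {finite_measure set T -> \bar R} := fmeas h.
End FiniteMeasure.

(** * Integration over the orbits of scalar rotations *)

Section Invariance.
Variables (R : realType) (d : nat) (sigma : {measure set (Pt R d) -> \bar R}).
Hypothesis hs : normalized_surface_measure sigma.
Local Notation tau := (pi *+ 2 : R).

Lemma sigma_fin : (sigma setT < +oo)%E.
Proof. by have [-> _ _] := hs; rewrite ltry. Qed.

Lemma mul_row_coord (U : 'M[R[i]]_d) (z : Pt R d) k : coord (act U z) k = \sum_j U k j * coord z j.
Proof. by rewrite {1}/coord tnth_mktuple/=; case: (\sum_j _). Qed.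

Lemma measurable_act (U : 'M[R[i]]_d) : measurable_fun setT (act U : Pt R d -> Pt R d).
Proof.
apply/measurable_fun_tnthP => k.
have [h1 h2] : mfc (fun z : Pt R d => \sum_j U k j * coord z j).
  by apply: mfc_sum => j; apply: mfcM; [exact: mfc_cst|exact: mfc_coord].
rewrite (_ : _ \o _ = (fun z : Pt R d => (complex.Re (\sum_j U k j * coord z j), complex.Im (\sum_j U k j * coord z j)))).
  exact: measurable_fun_pair.
by apply/funext => x; rewrite /= tnth_mktuple.
Qed.

Lemma integral_act (U : 'M[R[i]]_d) (g : Pt R d -> \bar R) : unitary U -> measurable_fun setT g ->
  (forall z, (0 <= g z)%E) -> (\int[sigma]_z g (act U z) = \int[sigma]_z g z)%E.
Proof.
move=> uU mg g0; have [_ _ inv] := hs.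
have mU := measurable_act U.
rewrite -[LHS](@ge0_integral_pushforward _ _ _ _ _ _ mU sigma setT g) //.
apply: eq_measure_integral => A mA _; exact: inv.
Qed.

Lemma cscale_act t (z : Pt R d) : cscale (cis t) z = act ((cis t)%:M) z.
Proof.
apply: coord_inj => k; rewrite coord_cscale mul_row_coord (bigD1 k)//= mxE eqxx mulr1n big1 ?addr0// => j jk.
by rewrite mxE eq_sym (negbTE jk) mulr0n mul0r.
Qed.
Lemma unitary_cis (t : R) : unitary ((cis t)%:M : 'M[R[i]]_d).
Proof.
rewrite /unitary map_scalar_mx tr_scalar_mx -scalar_mxM; congr (_%:M).
apply/eqP; rewrite eq_complex/=; apply/andP; split; apply/eqP; last by ring.
by rewrite -[RHS](cos2Dsin2 t); ring.
Qed.

Lemma orbit_measurable (g : Pt R d -> \bar R) : measurable_fun setT g -> (forall z, (0 <= g z)%E) ->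
  measurable_fun setT (fun z => \int[lebesgue_measure]_(t in `[0%R, tau]) g (cscale (cis t) z))%E.
Proof.
move=> mg g0.
pose F (x : R * Pt R d) : \bar R := (g (cscale (cis x.1) x.2) * (\1_(`[0%R, tau]%classic : set R) x.1)%:E)%E.
have mF : measurable_fun setT F.
  apply: emeasurable_funM.
    apply: (measurableT_comp mg); apply: measurable_cscale; last exact: measurable_snd.
    by apply: mfc_cis; exact: measurable_fst.
  have m1 : measurable_fun setT (\1_(`[0%R, tau]%classic) : R -> R) by apply: measurable_indic.
  have m2 := measurableT_comp m1 (@measurable_fst _ _ R (Pt R d)).
  by apply/measurable_EFinP; exact: m2.
have F0 x : (0 <= F x)%E by rewrite mule_ge0// lee_fin indicE.
have := @measurable_fun_fubini_tonelli_G _ _ _ _ R lebesgue_measure F mF F0.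
rewrite (_ : fubini_G _ _ = (fun z => \int[lebesgue_measure]_(t in `[0%R, tau]) g (cscale (cis t) z))%E)//.
apply/funext => z; rewrite /fubini_G [RHS]integral_mkcond; apply: eq_integral => t _.
by rewrite /F /patch indicE/=; case: ifP => _; rewrite ?mule1 ?mule0.
Qed.

(** Scalar rotations are unitary, so after Tonelli's theorem the integral over the whole space does
    not depend on [t]. This is how functions on the sphere are reduced to slices. *)
Lemma orbit_average (g : Pt R d -> \bar R) : measurable_fun setT g -> (forall z, (0 <= g z)%E) ->
  (\int[sigma]_z \int[lebesgue_measure]_(t in `[0%R, tau]) g (cscale (cis t) z) = tau%:E * \int[sigma]_z g z)%E.
Proof.
move=> mg g0; have t0 := @tau_gt0 R.
pose F (x : R * Pt R d) : \bar R := (g (cscale (cis x.1) x.2) * (\1_(`[0%R, tau]%classic : set R) x.1)%:E)%E.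
have mF : measurable_fun setT F.
  apply: emeasurable_funM.
    apply: (measurableT_comp mg); apply: measurable_cscale; last exact: measurable_snd.
    by apply: mfc_cis; exact: measurable_fst.
  have m1 : measurable_fun setT (\1_(`[0%R, tau]%classic) : R -> R) by apply: measurable_indic.
  have m2 := measurableT_comp m1 (@measurable_fst _ _ R (Pt R d)).
  by apply/measurable_EFinP; exact: m2.
have F0 x : (0 <= F x)%E by rewrite mule_ge0// lee_fin indicE.
have E1 := @fubini_tonelli1 _ _ _ _ R lebesgue_measure (fin_measure sigma_fin) F mF F0.
have E2 := @fubini_tonelli2 _ _ _ _ R lebesgue_measure (fin_measure sigma_fin) F mF F0.
have E : (\int[lebesgue_measure]_t \int[sigma]_z F (t, z) = \int[sigma]_z \int[lebesgue_measure]_t F (t, z))%E.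
  by rewrite -[LHS]E1 E2.
transitivity (\int[sigma]_z \int[lebesgue_measure]_t F (t, z))%E.
  apply: eq_integral => z _; rewrite integral_mkcond; apply: eq_integral => t _.
  by rewrite /F /patch indicE/=; case: ifP => _; rewrite ?mule1 ?mule0.
rewrite -E.
transitivity (\int[lebesgue_measure]_(t in `[0%R, tau]) \int[sigma]_z g z)%E.
  rewrite [RHS]integral_mkcond; apply: eq_integral => t _; rewrite /F/= /patch indicE.
  case: ifP => _; last by rewrite integral0_eq// => z _; rewrite mule0.
  under eq_integral do rewrite mule1 cscale_act.
  by apply: integral_act => //; exact: unitary_cis.
have L : lebesgue_measure (`[0%R, tau]%classic : set R) = tau%:E.
  by rewrite lebesgue_measure_itv/= lte_fin t0 -EFinB subr0.
by rewrite integral_cst// [X in (_ * X)%E]L muleC.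
Qed.

End Invariance.

(** * Domination of the norm by the Hardy norm *)

Section UpperBound.
Variables (R : realType) (d : nat) (sigma : {measure set (Pt R d) -> \bar R}).
Hypothesis hs : normalized_surface_measure sigma.
Local Notation tau := (pi *+ 2 : R).
Implicit Types (c : d.-tuple nat -> R[i]) (z : Pt R d).

Lemma cabs_cvg (u : nat -> R[i]) (l : R[i]) (t : nat -> R) : (forall n, cabs (u n - l) <= t n) ->
  t n @[n --> \oo] --> 0 -> cabs (u n) @[n --> \oo] --> cabs l.
Proof.
move=> H t0; apply/cvgrPdist_le => e e0; have /cvgrPdist_le/(_ e e0) := t0; apply: filterS => n.
rewrite sub0r normrN distrC => h; apply: (le_trans (cabs_dist _ _)).
by apply: (le_trans (H n)); exact: le_trans (ler_norm _) h.
Qed.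

Lemma psum_cvg c z : abs_summable c z -> cabs (psum c z N) @[N --> \oo] --> cabs (pseries c z).
Proof.
move=> sm; have sb : cvgn (series (ahom c z)).
  case/cvg_ex: sm => l Hl; apply/cvg_ex; exists l; rewrite -cvg_shiftS.
  rewrite (_ : (fun n => _) = apsum c z)//.
  by apply/funext => N; rewrite apsum_hom /series/= big_mkord.
have [l Hl] := csum_tail (cabs_hom c z) sb.
have H N : cabs (psum c z N - l) <= limn (series (ahom c z)) - series (ahom c z) N.+1 by rewrite psum_hom.
rewrite (pseries_lim H (tail_cvg sb)); exact: cabs_cvg H (tail_cvg sb).
Qed.

(** An upper limit is measurable on the whole space, whether or not the series converges there. *)
Definition msup c z : \bar R := limn_esup (fun N => (cabs (psum c z N))%:E).

Lemma measurable_msup c : measurable_fun setT (msup c).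
Proof.
apply: measurable_fun_limn_esup => N; apply/measurable_EFinP; apply: mfc_cabs; exact: mfc_psum.
Qed.

Lemma msupE c z (l : R) : cabs (psum c z N) @[N --> \oo] --> l -> msup c z = l%:E.
Proof.
move=> h; have h' : (cabs (psum c z N))%:E @[N --> \oo] --> l%:E by apply: cvg_EFin => //; exact: nearW.
by rewrite /msup; have [_ ->] := cvg_limn_einf_sup h'.
Qed.

(** [f] is arbitrary off the closed ball and not assumed measurable. This iterated upper limit is
    measurable everywhere and equals [|f|] on the closed ball. *)
Definition bsup c z : \bar R := limn_esup (fun n => msup c (cscale (rk R n +i* 0)%C z)).

Lemma measurable_bsup c : measurable_fun setT (bsup c).
Proof.
apply: measurable_fun_limn_esup => n; apply: (measurableT_comp (measurable_msup c)).
by apply: measurable_cscale; [exact: mfc_cst|exact: measurable_id].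
Qed.

Lemma cscale_open n z : closed_ball d z -> open_ball d (cscale (rk R n +i* 0)%C z).
Proof.
move=> /closed_ballP z1; apply/open_ballP; have /andP[k0 k1] := rk_ge R n.
rewrite pn2_cscale -cabs_sq cabs_real//; have := pn2_ge0 z => p0.
apply: (@le_lt_trans _ _ (rk R n ^+ 2 * 1)); first by rewrite ler_wpM2l ?sqr_ge0.
by rewrite mulr1 expr_lt1.
Qed.

Lemma bsupE c f z : holo_on_ball c f -> cont_closed_ball f -> closed_ball d z -> bsup c z = (cabs (f z))%:E.
Proof.
move=> hf cf zb; have E n : msup c (cscale (rk R n +i* 0)%C z) = (cabs (f (cscale (rk R n +i* 0)%C z)))%:E.
  by have [sm ->] := hf _ (cscale_open n zb); apply: msupE; exact: psum_cvg.
suff h : cabs (f (cscale (rk R n +i* 0)%C z)) @[n --> \oo] --> cabs (f z).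
  have h' : (cabs (f (cscale (rk R n +i* 0)%C z)))%:E @[n --> \oo] --> (cabs (f z))%:E by apply: cvg_EFin => //; exact: nearW.
  by rewrite /bsup; under eq_fun do rewrite E; have [_ ->] := cvg_limn_einf_sup h'.
apply/cvgrPdist_lt => e e0; have [dl dl0 H] := cf z zb e e0.
have /cvgrPdist_lt/(_ _ dl0) H1 := @rk_cvg R.
near=> n; rewrite distrC; apply: (le_lt_trans (cabs_dist _ _)); apply: H.
  apply/closed_ballP/ltW/open_ballP; exact: cscale_open.
have h1 : `|1 - rk R n| < dl by near: n.
have -> : psub (cscale (rk R n +i* 0)%C z) z = cscale ((rk R n - 1) +i* 0)%C z.
  apply: coord_inj => k; rewrite coord_cscale /coord tnth_mktuple/= !tnth_mktuple/=.
  by apply/eqP; rewrite eq_complex/=; apply/andP; split; apply/eqP; ring.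
rewrite pnormE pn2_cscale (_ : n2 _ = (1 - rk R n) ^+ 2); last by rewrite /n2/= expr0n/= addr0; ring.
rewrite sqrtrM ?sqr_ge0// sqrtr_sqr; by apply: le_lt_trans h1; rewrite ler_piMr.
Unshelve. all: by end_near. Qed.

Lemma sphere_closed z : sphere d z -> closed_ball d z.
Proof. by move=> /sphereP z1; apply/closed_ballP; rewrite z1. Qed.
Lemma sphere_cis t z : sphere d (cscale (cis t) z) <-> sphere d z.
Proof. by rewrite !sphereP pn2_cscale cis_rcis n2_rcis expr1n mul1r. Qed.

Lemma measurable_cabs_powR c f p : holo_on_ball c f -> cont_closed_ball f ->
  measurable_fun (@closed_ball R d) (fun z => (cabs (f z) `^ p)%:E).
Proof.
move=> hf cf; apply: (eq_measurable_fun (fun z => poweR (bsup c z) p)).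
  by move=> z; rewrite inE => zb; rewrite (bsupE hf cf zb).
by apply: measurable_funTS; apply: (measurableT_comp (measurable_poweR _)); exact: measurable_bsup.
Qed.

Lemma radial_cvg c f z r : holo_on_ball c f -> sphere d z -> 0 <= r < 1 ->
  cabs (psum (radI 1 c) (scale r z) N) @[N --> \oo] --> cabs (pseries (radI 1 c) (scale r z)).
Proof.
move=> hf z1 /andP[r0 r1]; rewrite scaleE.
apply: cabs_cvg (tail_cvg (sb1 hf z1 (_ : 0 <= r < 1))); last by rewrite r0.
move=> N; apply: (@pseries_slice R d (radI 1 c) z (fun m => (1 + m)%:R * ahom c z m) (@hom1_le R d c z)) => //.
  exact: sb1 hf z1.
by rewrite cabs_real.
Qed.

Lemma realX (x : R) n : ((x +i* 0)%C : R[i]) ^+ n = (x ^+ n +i* 0)%C.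
Proof. by rewrite -(rmorphXn (real_complex R)). Qed.

(** The factor [rho] replaces the exponent [m - 1] on the other side: the case [m = 0] needs no
    exception, and the bound fits a series in [rho^m]. *)
Lemma expr_lip (r r' rho : R) m : 0 <= r <= rho -> 0 <= r' <= rho ->
  rho * `|r ^+ m - r' ^+ m| <= m%:R * rho ^+ m * `|r - r'|.
Proof.
move=> /andP[r0 rr] /andP[r'0 rr']; elim: m => [|m IH]; first by rewrite !expr0 subrr normr0 mulr0 !mul0r.
have rho0 : 0 <= rho by exact: le_trans rr.
have -> : r ^+ m.+1 - r' ^+ m.+1 = r * (r ^+ m - r' ^+ m) + (r - r') * r' ^+ m by rewrite !exprS; ring.
apply: (@le_trans _ _ (rho * (rho * `|r ^+ m - r' ^+ m| + `|r - r'| * rho ^+ m))).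
  rewrite ler_wpM2l//; apply: (le_trans (ler_normD _ _)); rewrite !normrM; apply: lerD.
    by rewrite ger0_norm// ler_wpM2r.
  by rewrite ler_wpM2l// ger0_norm ?exprn_ge0// lerXn2r ?nnegrE.
rewrite mulrDr -natr1 exprS; have := ler_wpM2l rho0 IH; lra.
Qed.

Lemma radial_lip c f z rho : holo_on_ball c f -> sphere d z -> 0 < rho < 1 ->
  exists2 K, 0 <= K & forall r r', 0 <= r <= rho -> 0 <= r' <= rho ->
    cabs (pseries (radI 1 c) (scale r z)) <= cabs (pseries (radI 1 c) (scale r' z)) + K * `|r - r'|.
Proof.
move=> hf z1 /andP[rho0 rho1].
have rho01 : 0 <= rho < 1 by rewrite ltW.
pose u m := (1 + m)%:R * ((1 + m)%:R * ahom c z m) * rho ^+ m.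
have u0 m : 0 <= u m by rewrite !mulr_ge0 ?ahom_ge0// exprn_ge0// ltW.
have su : cvgn (series u) := sb2 hf z1 rho01.
have B0 : 0 <= limn (series u).
  apply: limr_ge => //; apply: nearW => n; rewrite /series/=; exact: sumr_ge0.
exists (limn (series u) / rho); first by rewrite divr_ge0// ltW.
move=> r r' hr hr'; have /andP[r0 rr] := hr; have /andP[r'0 rr'] := hr'.
have r1 : 0 <= r < 1 by rewrite r0 (le_lt_trans rr).
have r'1 : 0 <= r' < 1 by rewrite r'0 (le_lt_trans rr').
have lim : cabs (psum (radI 1 c) (scale r z) N) - cabs (psum (radI 1 c) (scale r' z) N) @[N --> \oo] -->
    cabs (pseries (radI 1 c) (scale r z)) - cabs (pseries (radI 1 c) (scale r' z)).
  by apply: cvgB; [exact: radial_cvg hf z1 r1|exact: radial_cvg hf z1 r'1].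
rewrite -lerBlDl -(cvg_lim _ lim)//; apply: limr_le; first by apply/cvg_ex; eexists; exact: lim.
apply: nearW => N; apply: (le_trans (ler_norm _)); apply: (le_trans (cabs_dist _ _)).
rewrite !scaleE !psum_hom -sumrB; apply: (le_trans (cabs_sum _ _ _)).
apply: (@le_trans _ _ (`|r - r'| / rho * series u N.+1)); last first.
  rewrite (_ : limn (series u) / rho * `|r - r'| = `|r - r'| / rho * limn (series u)); last by ring.
  apply: ler_wpM2l; first by rewrite divr_ge0// ltW.
  by apply: nondecreasing_cvgn_le => //; apply: nondecreasing_series => m _ _.
rewrite /series/= big_mkord mulr_sumr; apply: ler_sum => m _.
rewrite !hom_cscale -mulrBl cabsM !realX.
have -> : ((r ^+ m +i* 0) - (r' ^+ m +i* 0))%C = ((r ^+ m - r' ^+ m) +i* 0)%C :> R[i].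
  by apply/eqP; rewrite eq_complex/= subrr !eqxx.
have -> : cabs ((r ^+ m - r' ^+ m) +i* 0)%C = `|r ^+ m - r' ^+ m|.
  by rewrite /cabs/= expr0n/= addr0 sqrtr_sqr.
have h1 := expr_lip m hr hr'; have h2 := @hom1_le R d c z m.
have hm : m%:R <= (1 + m)%:R :> R by rewrite ler_nat.
have b0 : 0 <= (1 + m)%:R * ahom c z m by rewrite mulr_ge0 ?ahom_ge0.
apply: (@le_trans _ _ (`|r ^+ m - r' ^+ m| * ((1 + m)%:R * ahom c z m))); first by rewrite ler_wpM2l.
rewrite -(ler_pM2l rho0) mulrA.
apply: (@le_trans _ _ ((1 + m)%:R * rho ^+ m * `|r - r'| * ((1 + m)%:R * ahom c z m))).
  apply: ler_wpM2r => //; apply: (le_trans h1); apply: ler_wpM2r => //; apply: ler_wpM2r => //.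
  by rewrite exprn_ge0// ltW.
by rewrite le_eqVlt; apply/orP; left; apply/eqP; rewrite /u; field; rewrite gt_eqF.
Qed.

(** Enumerates the rationals of [[0, 1)]; all other codes are sent to 0, itself an admissible
    radius. *)
Definition ratj (j : nat) : R :=
  if unpickle j is Some x then (if 0 <= (ratr x : R) < 1 then ratr x else 0) else 0.
Lemma ratj_itv j : 0 <= ratj j < 1.
Proof. by rewrite /ratj; case: unpickle => [x|]; [case: ifP => //|]; rewrite lexx ltr01. Qed.

(** A version of [HF_inner] that is measurable in [z] on the whole space: the integral runs over the
    line with an indicator, and the supremum over countably many radii. *)
Definition innerm (q : \bar R) c z : \bar R :=
  match q with
  | q'%:E => (\int[lebesgue_measure]_r
      (poweR (msup (radI 1 c) (scale r z)) q' * ((1 - r ^+ 2) `^ ((1%:R - 0) * q' - 1))%:E *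
       (\1_(`[0%R, 1%R[%classic : set R) r)%:E))%E
  | +oo%E => esups (fun j => msup (radI 1 c) (scale (ratj j) z) * (1 - ratj j ^+ 2)%:E)%E 0
  | -oo%E => 0%E
  end.

Lemma measurable_innerm q c : measurable_fun setT (innerm q c).
Proof.
case: q => [q| |].
- pose F (x : Pt R d * R) : \bar R := (poweR (msup (radI 1 c) (scale x.2 x.1)) q * ((1 - x.2 ^+ 2) `^ ((1%:R - 0) * q - 1))%:E *
       (\1_(`[0%R, 1%R[%classic : set R) x.2)%:E)%E.
  have msnd : measurable_fun setT (@snd (Pt R d) R) by exact: measurable_snd.
  have mF : measurable_fun setT F.
    apply: emeasurable_funM; first apply: emeasurable_funM.
    + apply: (measurableT_comp (measurable_poweR _)); apply: (measurableT_comp (measurable_msup _)).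
      rewrite (_ : (fun x : Pt R d * R => _) = (fun x : Pt R d * R => cscale (x.2 +i* 0)%C x.1)).
        by apply: measurable_cscale; [exact: mfc_real|exact: measurable_fst].
      by apply/funext => x; rewrite scaleE.
    + apply/measurable_EFinP; apply: (measurableT_comp (measurable_powR _)).
      by apply: measurable_funB => //; apply: measurable_funX.
    + have m1 : measurable_fun setT (\1_(`[0%R, 1%R[%classic) : R -> R) by apply: measurable_indic.
      have m2 := measurableT_comp m1 msnd.
      by apply/measurable_EFinP; exact: m2.
  have F0 x : (0 <= F x)%E by rewrite !mule_ge0 ?poweR_ge0// lee_fin ?powR_ge0// indicE.
  have := @measurable_fun_fubini_tonelli_F _ _ _ _ R lebesgue_measure F mF F0.
  by have -> : innerm q%:E c = fubini_F (@lebesgue_measure R) F by [].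
- apply: (@measurable_fun_esups _ _ R setT (fun j z => msup (radI 1 c) (scale (ratj j) z) * (1 - ratj j ^+ 2)%:E)%E) => j.
  apply: emeasurable_funM; last exact: measurable_cst.
  apply: (measurableT_comp (measurable_msup _)).
  rewrite (_ : scale (ratj j) = cscale (ratj j +i* 0)%C); last by apply/funext => x; rewrite scaleE.
  by apply: measurable_cscale; [exact: mfc_cst|exact: measurable_id].
- exact: measurable_cst.
Qed.

Lemma innermE q c f z : holo_on_ball c f -> sphere d z -> HF_inner 0 q c z = innerm q c z.
Proof.
move=> hf z1; rewrite /HF_inner /splus truncn0.
have mE r : 0 <= r < 1 -> msup (radI 1 c) (scale r z) = (cabs (pseries (radI 1 c) (scale r z)))%:E.
  by move=> r01; apply: msupE; exact: radial_cvg hf z1 r01.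
case: q => [q| |//].
  rewrite integral_mkcond; apply: eq_integral => r _; rewrite /patch indicE.
  case: ifPn => [|_]; last by rewrite mule0.
  by rewrite inE/= in_itv/= => r01; rewrite mule1 mE// poweR_EFin -EFinM.
apply/eqP; rewrite eq_le; apply/andP; split; last first.
  apply: ge_ereal_sup => _ [j _ <-]; apply: ereal_sup_ubound; exists (ratj j).
    by rewrite /= in_itv/=; exact: ratj_itv.
  have /andP[j0 j1] := ratj_itv j.
  by rewrite mE ?ratj_itv// subr0 powRr1 ?EFinM// subr_ge0 exprn_ile1// ltW.
apply: ge_ereal_sup => _ [r /= /[!in_itv]/= r01 <-]; have /andP[r0 r1] := r01.
set v := fun r => cabs (pseries (radI 1 c) (scale r z)).
rewrite subr0 powRr1 ?subr_ge0 ?exprn_ile1 ?(ltW r1)//.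
apply/lee_addgt0Pr => e e0; pose rho := (1 + r) / 2.
have rho01 : 0 < rho < 1 by rewrite /rho; apply/andP; split; lra.
have [K K0 HK] := radial_lip hf z1 rho01.
have v0 x : 0 <= v x by exact: cabs_ge0.
have v0r := v0 r.
(* Moving from [r] to a slightly larger rational [y] loses at most [A (y - r)]: [K] bounds the
   variation of [v] and 2 that of the weight [1 - r^2]. *)
pose A := 2 * (v r + K) + K + 1; have A0 : 0 < A by rewrite /A; lra.
pose eta := Num.min (e / A) (rho - r).
have eta0 : 0 < eta by rewrite lt_min divr_gt0//= /rho; lra.
have [x /= ] := @rat_in_itvoo R r (r + eta) ltac:(by rewrite ltrDl).
rewrite in_itv/= => /andP[rx xe].
have e1 : eta <= e / A by rewrite ge_min lexx.
have e2 : eta <= rho - r by rewrite ge_min lexx orbT.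
have xrho : ratr x <= rho :> R by lra.
have x1 : ratr x < 1 :> R by case/andP: rho01 => _; lra.
have x0 : 0 <= ratr x :> R by lra.
have jE : ratj (pickle x) = ratr x by rewrite /ratj pickleK x0 x1.
apply: (@le_trans _ _ ((v (ratr x) * (1 - (ratr x) ^+ 2))%:E + e%:E)%E); last first.
  rewrite leeD2r//; apply: ereal_sup_ubound; exists (pickle x) => //.
  by rewrite jE mE ?EFinM// x0.
rewrite -EFinD lee_fin -/(v r).
have rr : 0 <= r <= rho by rewrite r0 /rho; lra.
have xx : 0 <= (ratr x : R) <= rho by apply/andP; split.
have h1 := HK r (ratr x) rr xx; have h2 := HK (ratr x) r xx rr.
rewrite -/(v r) -/(v (ratr x)) ltr0_norm in h1; last by lra.
rewrite -/(v r) -/(v (ratr x)) gtr0_norm in h2; last by lra.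
set y : R := ratr x in rx xe xrho x1 x0 h1 h2 *.
have vy0 := v0 y.
have dy : y - r <= 1 by lra.
have h3 : v y <= v r + K by nra.
have h4 : (y - r) * A <= e by rewrite -ler_pdivlMr//; lra.
have h5 : 0 <= 1 - r ^+ 2 by rewrite subr_ge0 exprn_ile1// ltW.
have h6 : 1 - r ^+ 2 <= 1 by rewrite gerBl sqr_ge0.
have h7 : (1 - r ^+ 2) - (1 - y ^+ 2) <= 2 * (y - r) by rewrite !expr2; nra.
have h8 : v r * (1 - r ^+ 2) <= (v y + K * (y - r)) * (1 - r ^+ 2) by rewrite ler_wpM2r//; lra.
have h9 : K * (y - r) * (1 - r ^+ 2) <= K * (y - r) by rewrite ler_piMr// mulr_ge0//; lra.
have h10 : v y * ((1 - r ^+ 2) - (1 - y ^+ 2)) <= (v r + K) * (2 * (y - r)).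
  apply: (@le_trans _ _ (v y * (2 * (y - r)))); first by rewrite ler_wpM2l.
  by rewrite ler_wpM2r//; lra.
have h11 : (y - r) * A = (v r + K) * (2 * (y - r)) + K * (y - r) + (y - r) by rewrite /A; ring.
have h12 : 0 <= y - r by lra.
lra.
Qed.

(** Both integrals are averaged over rotations, which leaves [disc_bound] on each slice. The
    indicator of the sphere turns the integrands into measurable functions on the whole space. *)
Lemma HF_upper p q : 0 < p -> (2%:E <= q)%E -> exists2 C, 0 <= C & forall c f,
  holo_on_ball c f -> cont_closed_ball f ->
  (HF_pnorm sigma 0 p q c <= C%:E * \int[sigma]_(z in sphere d) (cabs (f z) `^ p)%:E)%E.
Proof.
move=> p0 q2; have [C C0 HC] := LP_interface p0; exists C => // c f hf cf.
have t0 := @tau_gt0 R.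
pose S1 z : \bar R := (\1_(@sphere R d) z : R)%:E.
have mS : measurable_fun setT S1.
  by apply/measurable_EFinP; apply: measurable_indic; exact: measurable_sphere.
have S10 z : (0 <= S1 z)%E by rewrite lee_fin indicE.
pose g1 z := (poweR (innerm q c z) (outer_exp p q) * S1 z)%E.
pose g2 z := (poweR (bsup c z) p * S1 z)%E.
have mg1 : measurable_fun setT g1.
  by apply: emeasurable_funM => //; apply: (measurableT_comp (measurable_poweR _)); exact: measurable_innerm.
have mg2 : measurable_fun setT g2.
  by apply: emeasurable_funM => //; apply: (measurableT_comp (measurable_poweR _)); exact: measurable_bsup.
have g10 z : (0 <= g1 z)%E by rewrite mule_ge0 ?poweR_ge0.
have g20 z : (0 <= g2 z)%E by rewrite mule_ge0 ?poweR_ge0.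
have g1E z : sphere d z -> g1 z = poweR (HF_inner 0 q c z) (outer_exp p q).
  by move=> zs; rewrite /g1 /S1 indicE mem_set// mule1 (innermE _ hf zs).
have g2E z : sphere d z -> g2 z = (cabs (f z) `^ p)%:E.
  by move=> zs; rewrite /g2 /S1 indicE mem_set// mule1 (bsupE hf cf (sphere_closed zs)).
have S1N z : ~ sphere d z -> S1 z = 0%E by move=> zs; rewrite /S1 indicE memNset.
have -> : HF_pnorm sigma 0 p q c = (\int[sigma]_z g1 z)%E.
  rewrite /HF_pnorm integral_mkcond; apply: eq_integral => z _; rewrite /patch.
  case: ifPn => [|zs]; first by rewrite inE => zs; rewrite g1E.
  by rewrite /g1 S1N ?mule0//; move: zs; rewrite notin_setE.
have -> : (\int[sigma]_(z in sphere d) (cabs (f z) `^ p)%:E = \int[sigma]_z g2 z)%E.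
  rewrite integral_mkcond; apply: eq_integral => z _; rewrite /patch.
  case: ifPn => [|zs]; first by rewrite inE => zs; rewrite g2E.
  by rewrite /g2 S1N ?mule0//; move: zs; rewrite notin_setE.
rewrite -(@lee_pmul2l _ tau%:E) ?lte_fin//.
rewrite -(orbit_average hs mg1 g10) muleCA -(orbit_average hs mg2 g20).
rewrite -ge0_integralZl_EFin//; last 2 first.
- by move=> z _; exact: integral_ge0.
- exact: orbit_measurable.
apply: ge0_le_integral => //.
- by move=> z _; exact: integral_ge0.
- exact: orbit_measurable.
- apply: emeasurable_funM; [exact: measurable_cst|exact: orbit_measurable].
move=> z _; have [zs|zs] := pselect (sphere d z); last first.
  rewrite integral0_eq; last by move=> t _; rewrite /g1 S1N ?mule0// => /sphere_cis.
  by rewrite mule_ge0// integral_ge0.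
have mI : measurable_fun (`[0, tau]%classic : set R) (fun t => poweR (HF_inner 0 q c (cscale (cis t) z)) (outer_exp p q)).
  apply: (eq_measurable_fun (fun t => g1 (cscale (cis t) z))).
    by move=> t _; rewrite g1E//; exact/sphere_cis.
  apply: measurable_funTS; apply: (measurableT_comp mg1).
  by apply: measurable_cscale; [apply: mfc_cis; exact: measurable_id|exact: measurable_cst].
have H := disc_bound hf cf zs p0 q2 C0 HC mI.
have E1 : (\int[lebesgue_measure]_(t in `[0%R, tau]) g1 (cscale (cis t) z) =
    \int[lebesgue_measure]_(t in `[0%R, tau]) poweR (HF_inner 0 q c (cscale (cis t) z)) (outer_exp p q))%E.
  by apply: eq_integral => t _; rewrite g1E//; exact/sphere_cis.
have E2 : (\int[lebesgue_measure]_(t in `[0%R, tau]) g2 (cscale (cis t) z) =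
    \int[lebesgue_measure]_(t in `[0%R, tau]) (bd f z t `^ p)%:E)%E.
  by apply: eq_integral => t _; rewrite g2E//; exact/sphere_cis.
by rewrite E1 E2.
Qed.

End UpperBound.

(** * Unitary invariance and non-isotropic balls *)

Section Unitary.
Variables (R : realType) (d : nat).
Implicit Types (z w : Pt R d).

Definition cvec z : 'cV[R[i]]_d := \col_k coord z k.
Definition adj m n (A : 'M[R[i]]_(m, n)) : 'M[R[i]]_(n, m) := (map_mx (@conjc R) A)^T.

Lemma adj_mul m n k (A : 'M[R[i]]_(m, n)) (B : 'M[R[i]]_(n, k)) : adj (A *m B) = adj B *m adj A.
Proof. by rewrite /adj map_mxM trmx_mul. Qed.

Lemma cinner_adj z w : cinner z w = (adj (cvec w) *m cvec z) 0 0.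
Proof. by rewrite mxE; apply: eq_bigr => k _; rewrite !mxE mulrC. Qed.

Lemma cvec_act (U : 'M[R[i]]_d) z : cvec (act U z) = U *m cvec z.
Proof.
apply/matrixP => k l; rewrite !mxE mul_row_coord; apply: eq_bigr => j _.
by rewrite mxE.
Qed.

Lemma cinner_act (U : 'M[R[i]]_d) z w : unitary U -> cinner (act U z) (act U w) = cinner z w.
Proof.
move=> /mulmx1C uU; rewrite !cinner_adj !cvec_act adj_mul -mulmxA (mulmxA _ U) .
by rewrite -/(adj U) in uU; rewrite uU mul1mx.
Qed.

Lemma cinner_self z : cinner z z = (pn2 z +i* 0)%C.
Proof.
rewrite /cinner /pn2 (big_morph (fun x : R => (x +i* 0)%C : R[i]) (id1 := 0) (op1 := +%R)) //.
  apply: eq_bigr => k _; case: (coord z k) => a b.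
  by apply/eqP; rewrite eq_complex/=; apply/andP; split; apply/eqP; rewrite /n2/=; ring.
by move=> x y; apply/eqP; rewrite eq_complex/= addr0 !eqxx.
Qed.

Lemma pn2_act (U : 'M[R[i]]_d) z : unitary U -> pn2 (act U z) = pn2 z.
Proof. by move=> uU; have := cinner_act z z uU; rewrite !cinner_self => -[]. Qed.

Lemma sphere_act (U : 'M[R[i]]_d) z : unitary U -> sphere d (act U z) <-> sphere d z.
Proof. by move=> uU; rewrite !sphereP pn2_act. Qed.

Lemma pn2_psub z w : pn2 z = 1 -> pn2 w = 1 -> pn2 (psub z w) = 2 * complex.Re (1 - cinner z w).
Proof.
move=> z1 w1; have -> : complex.Re (1 - cinner z w) = 1 - \sum_k complex.Re (coord z k * ((coord w k)^*)%C).
  by rewrite ReB /cinner (big_morph _ (@ReD R) (erefl : complex.Re (0 : R[i]) = 0)).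
set S := \sum_k _; have -> : 2 * (1 - S) = pn2 z + pn2 w - 2 * S by rewrite z1 w1; ring.
rewrite /S mulr_sumr /pn2 -big_split/= -sumrB; apply: eq_bigr => k _.
rewrite /coord tnth_mktuple/= /n2 /=; case: (tnth z k) (tnth w k) => [a b] [a' b'] /=; ring.
Qed.

Lemma coord_psub z w k : coord (psub z w) k = coord z k - coord w k.
Proof. by rewrite /coord tnth_mktuple; apply/eqP; rewrite eq_complex/= !eqxx. Qed.

Lemma cinner_psub z w : cinner z (psub z w) = cinner z z - cinner z w.
Proof.
rewrite /cinner -sumrB; apply: eq_bigr => k _; rewrite -mulrBr; congr (_ * _).
rewrite coord_psub; case: (coord z k) (coord w k) => [a b] [a' b'].
by apply/eqP; rewrite eq_complex/=; apply/andP; split; apply/eqP; ring.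
Qed.

Lemma psub0 z w : pn2 (psub z w) = 0 -> z = w.
Proof.
move=> /eqP; rewrite psumr_eq0 => [/allP h|k _]; last exact: n2_ge0.
apply: coord_inj => k; have := h k (mem_index_enum k); rewrite /= /coord tnth_mktuple/= /n2/=.
rewrite paddr_eq0 ?sqr_ge0// !sqrf_eq0 !subr_eq0 => /andP[/eqP-> /eqP->] //.
Qed.

(* Householder: with [v = z - w] and [s = <z, v>], the map [1 - v v^H / s] sends [z] to [w]; it is unitary because [|v|^2 = 2 Re s]. *)
Lemma transitive_sphere z w : sphere d z -> sphere d w -> exists2 U : 'M[R[i]]_d, unitary U & act U z = w.
Proof.
move=> /sphereP z1 /sphereP w1; pose v := psub z w; pose s := 1 - cinner z w.
have vs : pn2 v = 2 * complex.Re s by exact: pn2_psub.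
have [s0|s0] := eqVneq s 0.
  exists 1%:M; first by rewrite /unitary map_mx1 trmx1 mul1mx.
  have -> : z = w by apply: psub0; rewrite -/v vs s0 mulr0.
  by apply: coord_inj => k; rewrite mul_row_coord (bigD1 k)//= mxE eqxx mul1r big1 ?addr0// => j jk; rewrite mxE eq_sym (negbTE jk) mul0r.
pose V := cvec v; pose H := V *m adj V; pose U : 'M[R[i]]_d := 1%:M - s^-1 *: H.
have VV : adj V *m V = (pn2 v +i* 0)%C%:M.
  by rewrite [LHS]mx11_scalar -cinner_adj cinner_self.
have HH : H *m H = (pn2 v +i* 0)%C *: H.
  by rewrite /H mulmxA -(mulmxA V) VV mul_mx_scalar -scalemxAl.
have adjH : adj H = H.
  rewrite /H adj_mul; congr (_ *m _); apply/matrixP => i j; rewrite !mxE; exact: conjcK.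
have aU : (map_mx (@conjc R) U)^T = 1%:M - (s^*)%C^-1 *: H.
  rewrite /U map_mxB map_mx1 map_mxZ linearB/= trmx1 linearZ/= -/(adj H) adjH; congr (_ - _ *: _).
  exact: fmorphV.
have sc0 : (s^*)%C != 0 by rewrite fmorph_eq0.
have key : s^-1 + (s^*)%C^-1 = s^-1 * (s^*)%C^-1 * (pn2 v +i* 0)%C.
  have -> : (pn2 v +i* 0)%C = s + (s^*)%C.
    by rewrite vs; case: (s) => a b; apply/eqP; rewrite eq_complex/=; apply/andP; split; apply/eqP; ring.
  by rewrite mulrDr mulrAC mulVf// mul1r divfK// addrC.
exists U.
  rewrite /unitary aU /U mulmxBl mul1mx mulmxBr mulmx1 -scalemxAl -scalemxAr HH !scalerA.
  rewrite opprB addrA addrAC -!addrA [- _ + _]addrC.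
  have E : s^-1 / (s^*)%C * (pn2 v +i* 0)%C *: H = s^-1 *: H + (s^*)%C^-1 *: H by rewrite -scalerDl key.
  by rewrite E; apply/matrixP => i j; rewrite !mxE; ring.
have cz : U *m cvec z = cvec w.
  rewrite /U mulmxBl mul1mx -scalemxAl /H -mulmxA.
  have -> : adj V *m cvec z = s%:M.
    by rewrite [LHS]mx11_scalar -cinner_adj cinner_psub cinner_self z1.
  rewrite mul_mx_scalar scalerA mulVf// scale1r; apply/matrixP => k l; rewrite !mxE /v.
  by rewrite coord_psub subKr.
apply: coord_inj => k; have /matrixP/(_ k 0) : cvec (act U z) = cvec w by rewrite cvec_act.
by rewrite !mxE.
Qed.

Lemma cabs_conj (u : R[i]) : cabs (u^*)%C = cabs u.
Proof. by case: u => a b; rewrite /cabs/= sqrrN. Qed.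

Lemma coord_le1 z k : pn2 z = 1 -> cabs (coord z k) <= 1.
Proof.
move=> z1; rewrite -(@ler_pXn2r _ 2) ?nnegrE ?cabs_ge0// expr1n cabs_sq -z1 /pn2 (bigD1 k)//= lerDl.
by apply: sumr_ge0 => j _; exact: n2_ge0.
Qed.

Lemma cinner_C z w : cinner w z = ((cinner z w)^*)%C.
Proof.
rewrite /cinner rmorph_sum; apply: eq_bigr => k _; case: (coord z k) (coord w k) => [a b] [a' b'].
by apply/eqP; rewrite eq_complex/=; apply/andP; split; apply/eqP; ring.
Qed.

Lemma mfc_conj {dT} {T : measurableType dT} (g : T -> R[i]) : mfc g -> mfc (fun x => ((g x)^*)%C).
Proof.
move=> [g1 g2]; split.
  by rewrite (_ : (fun x => _) = (fun x => complex.Re (g x)))//; apply/funext => x; case: (g x).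
rewrite (_ : (fun x => _) = (fun x => - complex.Im (g x))); last by apply/funext => x; case: (g x).
exact: measurable_funN.
Qed.

Lemma mfc_cinner {dT} {T : measurableType dT} (g h : T -> Pt R d) : measurable_fun setT g -> measurable_fun setT h ->
  mfc (fun x => cinner (g x) (h x)).
Proof.
move=> mg mh.
have m1 k : mfc (fun x => coord (g x) k) by have h0 := @mfc_comp R _ _ _ _ g (fun z => coord z k) (@mfc_coord R d k) mg; exact: h0.
have m2 k : mfc (fun x => coord (h x) k) by have h0 := @mfc_comp R _ _ _ _ h (fun z => coord z k) (@mfc_coord R d k) mh; exact: h0.
by apply: mfc_sum => k; apply: (mfcM (m1 k)); apply: mfc_conj; exact: m2.
Qed.

(** Incidence kernel of the balls of radius [dl]; it is symmetric because [|1 - <z, w>|] is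
    ([qkerC]). *)
Definition qker (dl : R) (x : Pt R d * Pt R d) : R :=
  (\1_[set x : Pt R d * Pt R d | sphere d x.1 /\ sphere d x.2 /\ cabs (1 - cinner x.1 x.2) <= dl]) x.

Lemma measurable_qset dl : measurable [set x : Pt R d * Pt R d | sphere d x.1 /\ sphere d x.2 /\ cabs (1 - cinner x.1 x.2) <= dl].
Proof.
have m1 : measurable_fun setT (fun x : Pt R d * Pt R d => cabs (1 - cinner x.1 x.2)).
  apply: mfc_cabs; apply: mfcD; first exact: mfc_cst.
  have [h1 h2] : mfc (fun x : Pt R d * Pt R d => (-1) * cinner x.1 x.2).
    apply: mfcM; first exact: mfc_cst.
    by apply: mfc_cinner; [exact: measurable_fst|exact: measurable_snd].
  by split; (under eq_fun do rewrite -mulN1r).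
have ms := @measurable_sphere R d.
rewrite (_ : [set x | _] = (fst @^-1` (sphere d)) `&` ((snd @^-1` (sphere d)) `&` ((fun x : Pt R d * Pt R d => cabs (1 - cinner x.1 x.2)) @^-1` `]-oo, dl]%classic))).
  apply: measurableI; first by rewrite -[X in measurable X]setTI; exact: measurable_fst.
  apply: measurableI; first by rewrite -[X in measurable X]setTI; exact: measurable_snd.
  by rewrite -[X in measurable X]setTI; apply: m1 => //; exact: measurable_itv.
by apply/seteqP; split => x /=; rewrite in_itv/=.
Qed.

Lemma measurable_qker dl : measurable_fun setT (qker dl).
Proof. by apply: measurable_indic; exact: measurable_qset. Qed.

Lemma qkerE1 dl z w : sphere d z -> qker dl (z, w) = \1_(nonisotropic_ball z dl) w.
Proof.
move=> zs; rewrite /qker !indicE; congr ((nat_of_bool _)%:R); apply/idP/idP; rewrite !inE/=.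
  by move=> [_ [ws h]].
by move=> [ws h].
Qed.

Lemma measurable_nonisotropic z dl : sphere d z -> measurable (nonisotropic_ball z dl).
Proof.
move=> zs; rewrite (_ : nonisotropic_ball z dl = xsection [set x : Pt R d * Pt R d | sphere d x.1 /\ sphere d x.2 /\ cabs (1 - cinner x.1 x.2) <= dl] z).
  by apply: measurable_xsection; exact: measurable_qset.
by apply/seteqP; split => w; rewrite /xsection/= inE/=; [move=> [ws h]|move=> [_ [ws h]]].
Qed.

End Unitary.

Section Balls.
Variables (R : realType) (d : nat) (sigma : {measure set (Pt R d) -> \bar R}).
Hypotheses (d0 : (1 <= d)%N) (hs : normalized_surface_measure sigma).
Implicit Types (z w : Pt R d).

Lemma sigma_sphere : sigma (@sphere R d) = 1%E.
Proof.
have [h1 h2 _] := hs; have ms := @measurable_sphere R d.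
rewrite -h1 -(setUv (@sphere R d)) measureU//; last 2 first.
- exact: measurableC.
- exact: setICr.
by transitivity (sigma (@sphere R d) + 0)%E; [rewrite adde0|congr (_ + _)%E; exact/esym/h2].
Qed.

Lemma sigma_ball_const z w dl : sphere d z -> sphere d w ->
  sigma (nonisotropic_ball z dl) = sigma (nonisotropic_ball w dl).
Proof.
move=> zs ws; have [U uU Uz] := transitive_sphere zs ws; have [_ _ inv] := hs.
rewrite -(inv U uU (nonisotropic_ball w dl)); last exact: measurable_nonisotropic.
have E x : cinner w (act U x) = cinner z x by rewrite -Uz cinner_act.
congr (sigma _); apply/seteqP; split => x; rewrite /nonisotropic_ball/= E => -[xs h]; split=> //.
  exact/sphere_act.
exact: (sphere_act x uU).1.
Qed.

Lemma cabs_one_sub z w : pn2 z = 1 -> cabs (1 - cinner z w) <= \sum_k cabs (coord z k - coord w k).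
Proof.
move=> z1; have -> : 1 - cinner z w = cinner z (psub z w) by rewrite cinner_psub cinner_self z1.
apply: (le_trans (cabs_sum _ _ _)); apply: ler_sum => k _.
by rewrite cabsM cabs_conj coord_psub ler_piMl ?cabs_ge0// coord_le1.
Qed.

(** Countably many balls of radius [dl] cover the sphere, and they have equal measure by
    transitivity. If one were null, the sphere would be too. *)
Lemma sigma_ball_gt0 z dl : sphere d z -> 0 < dl -> (0 < sigma (nonisotropic_ball z dl))%E.
Proof.
move=> zs dl0; rewrite lt0e measure_ge0 andbT; apply/negP => /eqP s0.
have dR : 0 < d%:R :> R by rewrite ltr0n.
pose h := dl / (2 * d%:R); have h0 : 0 < h by rewrite divr_gt0// mulr_gt0.
(* The cell of a grid of mesh [h]: two points of one cell differ by at most [2 h] in each complex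
   coordinate, and [2 h d = dl]. Each cell that meets the sphere receives a representative [c j]. *)
pose key (x : Pt R d) : d.-tuple (int * int) := [tuple (Num.floor ((tnth x k).1 / h), Num.floor ((tnth x k).2 / h)) | k < d].
pose P j x := sphere d x /\ unpickle j = Some (key x).
have /choice[c Hc] : forall j, exists x, sphere d x /\ ((exists y, P j y) -> P j x).
  move=> j; have [[y Py]|N] := pselect (exists y, P j y); first by exists y; split=> //; case: Py.
  by exists z.
have cov : sphere d `<=` \bigcup_j nonisotropic_ball (c j) dl.
  move=> x xs; exists (pickle (key x)) => //.
  have [cs /(_ _)[]] := Hc (pickle (key x)); first by exists x; split=> //; rewrite pickleK.
  move=> _; rewrite pickleK => /(@Some_inj _ _ _) ke; split=> //.
  have /sphereP c1 := cs; apply: (le_trans (cabs_one_sub x c1)).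
  apply: (@le_trans _ _ (\sum_(k < d) 2 * h)); last first.
    by rewrite sumr_const card_ord -mulr_natl /h le_eqVlt; apply/orP; left; apply/eqP; field; rewrite gt_eqF.
  apply: ler_sum => k _; apply: (le_trans (cabs_le _)); rewrite ReB ImB /coord/=.
  have := congr1 (fun t => tnth t k) ke; rewrite !tnth_mktuple => -[e1 e2].
  have fl (a b : R) : Num.floor (a / h) = Num.floor (b / h) -> `|a - b| <= h.
    move=> e; have a1 := floor_le (a / h); have a2 := floorD1_gt (a / h).
    have b1 := floor_le (b / h); have b2 := floorD1_gt (b / h).
    rewrite e intrD in a1 a2; rewrite intrD in b2.
    have -> : a - b = (a / h - b / h) * h by field; rewrite gt_eqF.
    rewrite normrM (gtr0_norm h0) ler_piMl ?(ltW h0)// ler_norml; apply/andP; split; lra.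
  by have := fl _ _ e1; have := fl _ _ e2; move=> h2 h1; rewrite distrC [X in _ + X]distrC; lra.
have mc j : measurable (nonisotropic_ball (c j) dl).
  by apply: measurable_nonisotropic; have [] := Hc j.
have : (sigma (@sphere R d) <= 0)%E.
  apply: (@le_trans _ _ (\sum_(0 <= j <oo) sigma (nonisotropic_ball (c j) dl))%E).
    by apply: measure_sigma_subadditive => //; exact: measurable_sphere.
  rewrite eseries0// => j _ _; have [cs _] := Hc j; by rewrite (sigma_ball_const dl cs zs).
by rewrite sigma_sphere lee_fin ler10.
Qed.

End Balls.

Section BoundedConvergence.
Context {dT} {T : measurableType dT} {R : realType} (m : {measure set T -> \bar R}).

Lemma bounded_cvg (K : R) (f : nat -> T -> \bar R) (g : T -> \bar R) : (m setT < +oo)%E ->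
  (forall n, measurable_fun setT (f n)) -> measurable_fun setT g ->
  (forall n x, (`|f n x| <= K%:E)%E) -> (forall x, f n x @[n --> \oo] --> g x) ->
  (\int[m]_x f n x)%E @[n --> \oo] --> (\int[m]_x g x)%E.
Proof.
move=> mfin mf mg fK fg.
apply: (@dominated_cvg _ _ R m setT measurableT f g (fun=> K%:E)) => //.
apply/integrableP; split; first exact: measurable_cst.
rewrite integral_cst//.
by apply: lte_mul_pinfty; rewrite ?abse_ge0// abse_fin_num.
Qed.

End BoundedConvergence.

(** * Sufficiency of the condition on balls *)

Section Averaging.
Variables (R : realType) (d : nat) (sigma mu : {measure set (Pt R d) -> \bar R}).
Hypotheses (d0 : (1 <= d)%N) (hs : normalized_surface_measure sigma) (hmu : finite_measure_on_closed_ball mu).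
Implicit Types (z w : Pt R d).

Definition north (h : (1 <= d)%N) : Pt R d := [tuple (if k == Ordinal h then (1, 0) else (0, 0)) | k < d].
Lemma north_sphere : sphere d (north d0).
Proof.
apply/sphereP; rewrite /pn2 (bigD1 (Ordinal d0))//= big1.
  by rewrite /coord tnth_mktuple eqxx /n2/= expr1n expr0n/= !addr0.
by move=> k /negbTE k0; rewrite /coord tnth_mktuple k0 /n2/= expr0n/= addr0.
Qed.

Lemma mu_fin : (mu setT < +oo)%E. Proof. by case: hmu. Qed.
Let sg := fin_measure (sigma_fin hs).
Let mf := fin_measure mu_fin.
Let S1 z : \bar R := (\1_(@sphere R d) z : R)%:E.

Lemma int_sphere (m : {measure set (Pt R d) -> \bar R}) (f g : Pt R d -> \bar R) :
  (forall z, sphere d z -> g z = f z) -> (forall z, ~ sphere d z -> g z = 0%E) ->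
  (\int[m]_(z in sphere d) f z = \int[m]_z g z)%E.
Proof.
move=> h1 h2; rewrite integral_mkcond; apply: eq_integral => z _; rewrite /patch.
by case: ifPn => [|]; [rewrite inE => /h1|rewrite notin_setE => /h2].
Qed.

Lemma qker_ge0 (dl : R) (x : Pt R d * Pt R d) : 0 <= qker dl x.
Proof. by rewrite /qker indicE. Qed.
Lemma qkerC (dl : R) z w : qker dl (z, w) = qker dl (w, z).
Proof.
rewrite /qker !indicE; congr ((nat_of_bool _)%:R).
have e : cabs (1 - cinner z w) = cabs (1 - cinner w z) by rewrite (cinner_C z w) -cabs_conj rmorphB rmorph1.
by apply/idP/idP; rewrite !inE/= e => -[? []].
Qed.
Lemma qker0 (dl : R) z w : ~ sphere d z -> qker dl (z, w) = 0.
Proof. by move=> zs; rewrite /qker indicE memNset// => -[]. Qed.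

Lemma qker_int (m : {measure set (Pt R d) -> \bar R}) (dl : R) z : sphere d z ->
  (\int[m]_w (qker dl (z, w))%:E = m (nonisotropic_ball z dl))%E.
Proof.
move=> zs; under eq_integral do rewrite qkerE1//.
by rewrite integral_indic ?setIT//; exact: measurable_nonisotropic.
Qed.

Variables (c : R) (c0 : 0 < c).
Hypothesis H : forall z (dl : R), sphere d z -> 0 < dl ->
  (c%:E * sigma (nonisotropic_ball z dl) <= mu (nonisotropic_ball z dl))%E.

Section Fixed.
Variables (g : Pt R d -> R) (K : R).
Hypotheses (mg : measurable_fun setT g) (g0 : forall z, 0 <= g z <= K).
Hypothesis cg : forall z, sphere d z -> forall e, 0 < e -> exists2 dl, 0 < dl &
  forall w, sphere d w -> cabs (1 - cinner z w) <= dl -> `|g w - g z| <= e.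

Let av (dl : R) w := (\int[sigma]_z (g z * qker dl (z, w))%:E)%E.

Let mGF (dl : R) : measurable_fun setT (fun x : Pt R d * Pt R d => (g x.1 * qker dl x)%:E).
Proof.
apply/measurable_EFinP; apply: measurable_funM; last exact: measurable_qker.
exact: (measurableT_comp mg (@measurable_fst _ _ (Pt R d) (Pt R d))).
Qed.
Let GF0 (dl : R) (x : Pt R d * Pt R d) : (0 <= (g x.1 * qker dl x)%:E)%E.
Proof. by rewrite lee_fin mulr_ge0 ?qker_ge0//; case/andP: (g0 x.1). Qed.

(** After the exchange of integrals the value [g z] is weighted by the [mu]-measure of the ball
    centred at [z], which is at least [c s]. *)
Lemma average_tonelli (dl s : R) : 0 < dl -> (forall z, sphere d z -> sigma (nonisotropic_ball z dl) = s%:E) ->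
  (c%:E * (s%:E * \int[sigma]_(z in sphere d) (g z)%:E) <= \int[mu]_w av dl w)%E.
Proof.
move=> dl0 sE; have s0 : 0 <= s by rewrite -lee_fin -(sE _ north_sphere) measure_ge0.
have E1 := @fubini_tonelli1 _ _ _ _ R sg mf _ (mGF dl) (GF0 dl).
have E2 := @fubini_tonelli2 _ _ _ _ R sg mf _ (mGF dl) (GF0 dl).
have E : (\int[sigma]_z \int[mu]_w (g z * qker dl (z, w))%:E = \int[mu]_w av dl w)%E.
  by rewrite -[LHS]E1 E2.
have mG := @measurable_fun_fubini_tonelli_F _ _ _ _ R mf _ (mGF dl) (GF0 dl).
rewrite -E (@int_sphere _ _ (fun z => (g z)%:E * S1 z)%E); last 2 first.
- by move=> z zs; rewrite /S1 indicE mem_set// mule1.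
- by move=> z zs; rewrite /S1 indicE memNset// mule0.
have mgS : measurable_fun setT (fun z => (g z)%:E * S1 z)%E.
  apply: emeasurable_funM; first exact/measurable_EFinP.
  by apply/measurable_EFinP; apply: measurable_indic; exact: measurable_sphere.
have gS0 z : (0 <= (g z)%:E * S1 z)%E by rewrite mule_ge0 ?lee_fin ?indicE//; case/andP: (g0 z).
rewrite -ge0_integralZl_EFin// -ge0_integralZl_EFin ?(ltW c0)//; last 2 first.
- by move=> z _; rewrite mule_ge0.
- by apply: emeasurable_funM => //; exact: measurable_cst.
apply: ge0_le_integral => //.
- by move=> z _; apply: mule_ge0; [rewrite lee_fin ltW|apply: mule_ge0 => //; rewrite lee_fin].
- by do 2 (apply: emeasurable_funM; first exact: measurable_cst).
move=> z _; have [zs|zs] := pselect (sphere d z); last first.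
  rewrite /S1 indicE memNset// !mule0; by apply: integral_ge0 => w _; exact: (GF0 dl (z, w)).
have -> : (\int[mu]_w (g z * qker dl (z, w))%:E = (g z)%:E * mu (nonisotropic_ball z dl))%E.
  rewrite -qker_int//; under eq_integral do rewrite EFinM.
  rewrite ge0_integralZl_EFin//; last by case/andP: (g0 z).
    by move=> w _; rewrite lee_fin qker_ge0.
  apply/measurable_EFinP; apply: (measurableT_comp (measurable_qker dl)); exact: measurable_fun_pair.
rewrite /S1 indicE mem_set// mule1 muleA muleC; apply: lee_wpmul2l; first by rewrite lee_fin; case/andP: (g0 z).
by rewrite -(sE z zs); exact: H.
Qed.

Lemma average_bounds (dl s a b : R) w : sphere d w -> sigma (nonisotropic_ball w dl) = s%:E -> 0 <= a -> 0 <= b ->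
  (forall z, sphere d z -> cabs (1 - cinner w z) <= dl -> a <= g z <= b) ->
  (a%:E * s%:E <= av dl w <= b%:E * s%:E)%E.
Proof.
move=> ws sE a0 b0 hg.
have mq : measurable_fun setT (fun z => qker dl (w, z)).
  by apply: (measurableT_comp (measurable_qker dl)); exact: measurable_fun_pair.
have key z : a * qker dl (w, z) <= g z * qker dl (z, w) <= b * qker dl (w, z).
  rewrite (qkerC dl z w) (qkerE1 dl z ws) indicE.
  have [|_] := boolP (z \in _); last by rewrite !mulr0 lexx.
  by rewrite inE => -[zs h]; rewrite !mulr1; exact: hg.
have mgq : measurable_fun setT (fun z => (g z * qker dl (z, w))%:E).
  apply/measurable_EFinP; apply: measurable_funM => //.
  by under eq_fun do rewrite qkerC.
rewrite -sE -(qker_int sigma dl ws); apply/andP; split.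
  rewrite -ge0_integralZl_EFin//; last 2 first.
  - by move=> z _; rewrite lee_fin qker_ge0.
  - exact/measurable_EFinP.
  apply: ge0_le_integral => //.
  - by move=> z _; rewrite -EFinM lee_fin mulr_ge0 ?qker_ge0.
  - by apply: emeasurable_funM; [exact: measurable_cst|exact/measurable_EFinP].
  - by move=> z _; rewrite -EFinM lee_fin; case/andP: (key z).
rewrite -ge0_integralZl_EFin//; last 2 first.
- by move=> z _; rewrite lee_fin qker_ge0.
- exact/measurable_EFinP.
apply: ge0_le_integral => //.
- by move=> z _; rewrite lee_fin mulr_ge0 ?qker_ge0//; case/andP: (g0 z).
- by apply: emeasurable_funM; [exact: measurable_cst|exact/measurable_EFinP].
- by move=> z _; rewrite -EFinM lee_fin; case/andP: (key z).
Qed.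

(** [A n] is the mean of [g] over a shrinking ball at points of the sphere and 0 elsewhere. Bounded
    convergence, with the bound [K], therefore retains only the part of [mu] carried by the
    sphere. *)
Lemma average_le : (c%:E * \int[sigma]_(z in sphere d) (g z)%:E <= \int[mu]_(z in sphere d) (g z)%:E)%E.
Proof.
pose dl n : R := n.+1%:R^-1; have dl0 n : 0 < dl n by rewrite invr_gt0.
pose s n : R := fine (sigma (nonisotropic_ball (north d0) (dl n))).
have sE n z : sphere d z -> sigma (nonisotropic_ball z (dl n)) = (s n)%:E.
  move=> zs; rewrite (sigma_ball_const hs (dl n) zs north_sphere) fineK//.
  rewrite ge0_fin_numE ?measure_ge0//; apply: le_lt_trans (sigma_fin hs).
  by apply: le_measure; rewrite ?inE//; apply: measurable_nonisotropic; exact: north_sphere.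
have s0 n : 0 < s n by rewrite -lte_fin -(sE n _ north_sphere); exact: sigma_ball_gt0 north_sphere (dl0 n).
pose A n w := ((s n)^-1%:E * av (dl n) w)%E.
have K0 : 0 <= K by case/andP: (g0 (north d0)); exact: le_trans.
have mav n : measurable_fun setT (av (dl n)).
  exact: (@measurable_fun_fubini_tonelli_G _ _ _ _ R sg _ (mGF (dl n)) (GF0 (dl n))).
have av0 n w : (0 <= av (dl n) w)%E by apply: integral_ge0 => z _; exact: (GF0 (dl n) (z, w)).
have mA n : measurable_fun setT (A n) by apply: emeasurable_funM; [exact: measurable_cst|exact: mav].
have A0 n w : (0 <= A n w)%E by rewrite mule_ge0// lee_fin invr_ge0 ltW.
have avS n w : ~ sphere d w -> av (dl n) w = 0%E.
  by move=> ws; rewrite /av integral0_eq// => z _; rewrite qkerC qker0// mulr0.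
have step n : (c%:E * \int[sigma]_(z in sphere d) (g z)%:E <= \int[mu]_w A n w)%E.
  rewrite ge0_integralZl_EFin ?invr_ge0 ?(ltW (s0 n))//.
  rewrite -(@lee_pmul2l _ (s n)%:E) ?lte_fin// [leRHS]muleA -EFinM divff ?gt_eqF// mul1e muleCA.
  exact: average_tonelli (sE n).
have bnd n a b w : sphere d w -> 0 <= a -> 0 <= b ->
    (forall z, sphere d z -> cabs (1 - cinner w z) <= dl n -> a <= g z <= b) -> (a%:E <= A n w <= b%:E)%E.
  move=> ws a0 b0 hg; have /andP[h1 h2] := average_bounds ws (sE n w ws) a0 b0 hg.
  rewrite /A.
  have e : ((s n)%:E * ((s n)^-1%:E * av (dl n) w) = av (dl n) w)%E by rewrite muleA -EFinM divff ?gt_eqF// mul1e.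
  by apply/andP; split; rewrite -(@lee_pmul2l _ (s n)%:E) ?lte_fin// e muleC.
pose G w := ((g w)%:E * S1 w)%E.
have AK n w : (`|A n w| <= K%:E)%E.
  rewrite gee0_abs//; have [ws|ws] := pselect (sphere d w); last by rewrite /A avS// mule0 lee_fin.
  by have /andP[] := bnd n 0 K w ws (lexx _) K0 (fun z _ _ => g0 z).
have cvA w : A ^~ w @ \oo --> G w.
  have [ws|ws] := pselect (sphere d w); last first.
    rewrite /G /S1 indicE memNset// mule0 (_ : A ^~ w = fun=> 0%E); first exact: cvg_cst.
    by apply/funext => n; rewrite /A avS// mule0.
  rewrite /G /S1 indicE mem_set// mule1.
  have Afin n : A n w \is a fin_num.
    by rewrite ge0_fin_numE//; apply: (@le_lt_trans _ _ K%:E); [rewrite -(gee0_abs (A0 n w))|rewrite ltry].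
  apply/fine_cvgP; split; first exact: nearW.
  apply/cvgrPdist_le => e e0; have [h h0 hh] := cg ws e0.
  have /cvgrPdist_lt/(_ h h0) := @cvg_harmonic R; apply: filterS => n.
  rewrite sub0r normrN ger0_norm ?invr_ge0// => dn.
  have gw0 : 0 <= g w by case/andP: (g0 w).
  have a0 : 0 <= Num.max 0 (g w - e) by rewrite le_max lexx.
  have b0 : 0 <= g w + e by lra.
  have hz z : sphere d z -> cabs (1 - cinner w z) <= dl n -> Num.max 0 (g w - e) <= g z <= g w + e.
    move=> zs zd; have := hh z zs (le_trans zd (ltW dn)); rewrite ler_distl => /andP[h1 h2].
    by rewrite ge_max h1 h2; case/andP: (g0 z) => ->.
  have /andP[] := bnd n _ _ w ws a0 b0 hz.
  rewrite -(fineK (Afin n)) !lee_fin /comp ge_max => /andP[_ h1] h2.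
  by rewrite ler_distlC; apply/andP; split=> //; lra.
rewrite (@int_sphere _ _ G) //; last 2 first.
- by move=> z zs; rewrite /G /S1 indicE mem_set// mule1.
- by move=> z zs; rewrite /G /S1 indicE memNset// mule0.
rewrite (@int_sphere _ _ G) //; last 2 first.
- by move=> z zs; rewrite /G /S1 indicE mem_set// mule1.
- by move=> z zs; rewrite /G /S1 indicE memNset// mule0.
have mG : measurable_fun setT G.
  apply: emeasurable_funM; first exact/measurable_EFinP.
  by apply/measurable_EFinP; apply: measurable_indic; exact: measurable_sphere.
have L : (\int[mu]_w A n w)%E @[n --> \oo] --> (\int[mu]_w G w)%E.
  by apply: (bounded_cvg mu_fin mA mG AK).
have := cvge_ge _ L; apply; apply: nearW => n.
have := step n; rewrite (@int_sphere _ _ G) // => z zs; rewrite /G /S1 indicE.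
  by rewrite mem_set// mule1.
by rewrite memNset// mule0.
Qed.

End Fixed.

(** The truncation provides the bound required by [average_le] and is removed by monotone
    convergence in [ball_average]. [g] is built from [bsup] in order to be measurable. *)
Lemma closed_ball_min_powR (p K : R) : 0 < p -> 0 <= K -> forall f cf, holo_on_ball cf f -> cont_closed_ball f ->
  (c%:E * \int[sigma]_(z in sphere d) (Num.min (cabs (f z) `^ p) K)%:E <=
   \int[mu]_(z in closed_ball d) (cabs (f z) `^ p)%:E)%E.
Proof.
move=> p0 K0 f cf hf cof.
pose g z := Num.min (fine (poweR (bsup cf z) p)) K.
have gE z : closed_ball d z -> g z = Num.min (cabs (f z) `^ p) K.
  by move=> zb; rewrite /g (bsupE hf cof zb).
have g0 z : 0 <= g z <= K.
  by rewrite /g le_min K0 andbT fine_ge0 ?poweR_ge0//= ge_min lexx orbT.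
have mg : measurable_fun setT g.
  apply: measurable_minr; last exact: measurable_cst.
  apply: (measurableT_comp (f := fine)) => //; apply: (measurableT_comp (measurable_poweR _)); exact: measurable_bsup.
have cg z : sphere d z -> forall e, 0 < e -> exists2 dl, 0 < dl &
  forall w, sphere d w -> cabs (1 - cinner z w) <= dl -> `|g w - g z| <= e.
  move=> zs e e0; have zc := sphere_closed zs.
  have cp : continuous (fun x : R => `|x| `^ p) by apply: cts_powR_ge0 => //; move=> x; exact: norm_continuous.
  have /cvgrPdist_le/(_ e e0)/nbhs_ballP[h /= h0 hh] := cp (cabs (f z)).
  have [dl dl0 Hd] := cof z zc h h0.
  (* On the sphere [|z - w|^2 = 2 Re (1 - <z, w>)], here at most [dl^2 / 2]. *)
  exists (dl ^+ 2 / 4); first by rewrite divr_gt0// exprn_gt0.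
  move=> w ws wd; have wc := sphere_closed ws; rewrite !gE//.
  have fw : cabs (f w - f z) < h.
    apply: Hd => //; rewrite pnormE -[ltRHS](ger0_norm (ltW dl0)) -sqrtr_sqr ltr_sqrt ?exprn_gt0//.
    have /sphereP z1 := zs; have /sphereP w1 := ws.
    rewrite pn2_psub// (cinner_C z w) (_ : complex.Re (1 - (cinner z w)^*%C) = complex.Re (1 - cinner z w)); last by rewrite !ReB; case: (cinner z w).
    have := Re_cabs (1 - cinner z w); have := ler_norm (complex.Re (1 - cinner z w)).
    have : 0 < dl ^+ 2 by rewrite exprn_gt0.
    lra.
  have := hh (cabs (f w)); rewrite /ball/= => /(_ _).
  have h1 : `|cabs (f z) - cabs (f w)| < h by rewrite distrC; exact: le_lt_trans (cabs_dist _ _) fw.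
  move=> /(_ h1); rewrite (ger0_norm (cabs_ge0 (f z))) (ger0_norm (cabs_ge0 (f w))) distrC => h2.
  apply: le_trans h2; set x := _ `^ p; set y := _ `^ p.
  by rewrite /Num.min; case: ifPn; case: ifPn; rewrite -?leNgt => ? ?; rewrite !ler_norml ?ler_normr //; (have := ler_norm (x - y); have := ler_norm (y - x); rewrite distrC); lra.
have := average_le mg g0 cg => L.
rewrite (eq_integral (fun z => (g z)%:E)); last by move=> z; rewrite inE => /sphere_closed zs; rewrite gE.
apply: (le_trans L); apply: (@le_trans _ _ (\int[mu]_(z in closed_ball d) (g z)%:E)%E).
  apply: ge0_subset_integral => //; [exact: measurable_sphere|exact: measurable_closed_ball| | |].
  - by apply/measurable_EFinP; apply: measurable_funTS.
  - by move=> z _; rewrite lee_fin; case/andP: (g0 z).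
  - by move=> z; exact: sphere_closed.
apply: ge0_le_integral => //; [exact: measurable_closed_ball| | | |].
- by move=> z _; rewrite lee_fin; case/andP: (g0 z).
- by apply/measurable_EFinP; apply: measurable_funTS.
- by apply: measurable_cabs_powR hf cof.
- by move=> z zb; rewrite lee_fin gE// ge_min lexx.
Qed.

Lemma ball_average (p : R) f cf : 0 < p -> holo_on_ball cf f -> cont_closed_ball f ->
  (c%:E * \int[sigma]_(z in sphere d) (cabs (f z) `^ p)%:E <=
   \int[mu]_(z in closed_ball d) (cabs (f z) `^ p)%:E)%E.
Proof.
move=> p0 hf cof.
have mf' : measurable_fun (@sphere R d) (fun z => (cabs (f z) `^ p)%:E).
  apply: (measurable_funS (@measurable_closed_ball R d)); first by move=> z; exact: sphere_closed.
  exact: measurable_cabs_powR hf cof.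
have mf'' : measurable_fun (@sphere R d) (fun z => cabs (f z) `^ p) by apply/measurable_EFinP.
have L : (\int[sigma]_(z in sphere d) (Num.min (cabs (f z) `^ p) n%:R)%:E)%E @[n --> \oo] -->
    (\int[sigma]_(z in sphere d) (cabs (f z) `^ p)%:E)%E.
  rewrite (_ : (fun z => (cabs (f z) `^ p)%:E) = (fun z => limn (fun n => (Num.min (cabs (f z) `^ p) n%:R)%:E))).
    apply: cvg_monotone_convergence => //; first exact: measurable_sphere.
    - by move=> n; apply/measurable_EFinP; apply: measurable_minr => //; exact: measurable_cst.
    - by move=> n z _; rewrite lee_fin le_min powR_ge0 ler0n.
    - by move=> z _ m n mn; rewrite lee_fin le_min2//= ler_nat.
  apply/funext => z; apply/esym/cvg_lim => //; apply: cvg_near_cst.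
  near=> n; congr (_%:E); apply/min_idPl.
  apply: ltW; near: n; exact: nbhs_infty_gtr.
have : (c%:E * \int[sigma]_(z in sphere d) (Num.min (cabs (f z) `^ p) n%:R)%:E)%E @[n --> \oo] -->
    (c%:E * \int[sigma]_(z in sphere d) (cabs (f z) `^ p)%:E)%E by exact: cvgeZl.
move=> L'; rewrite -(cvg_lim _ L')//; apply: lime_le; first by apply/cvg_ex; eexists; exact: L'.
by apply: nearW => n; apply: (closed_ball_min_powR p0 _ hf cof).
Unshelve. all: by end_near. Qed.

End Averaging.

(** * Random test polynomials *)

Section Khinchine.
Variable R : realType.

Definition sgn (b : bool) : R := if b then 1 else -1.

(** A sub-Gaussian bound on the exponential moment of a sign. The exponent is generous enough for a
    proof from [e^y >= 1 + y], with a case distinction at [1/2]. *)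
Lemma cosh_le (x : R) : expR x + expR (- x) <= 2 * expR (2 * x ^+ 2).
Proof.
wlog x0 : x / 0 <= x => [W|].
  case: (leP 0 x) => [/W//|x0]; rewrite addrC -{2}(opprK x) -sqrrN; apply: W; lra.
have [h|h] := leP x (1/2).
  have e1 : expR x <= 1 + x + 2 * x ^+ 2.
    have h1 := expR_ge1Dx (- x); have h2 := expR_gt0 x.
    have h3 : expR x * expR (- x) = 1 by rewrite -expRD subrr expR0.
    have h4 : expR x * (1 - x) <= 1 by rewrite -[leRHS]h3 ler_pM2l.
    have h5 : 1 <= (1 - x) * (1 + x + 2 * x ^+ 2) by rewrite expr2; nra.
    rewrite -(@ler_pM2r _ (1 - x)); last by lra.
    by apply: (le_trans h4); rewrite mulrC.
  have e2 : expR (- x) <= 1 - x + x ^+ 2.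
    have h1 := expR_ge1Dx x; have h2 := expR_gt0 (- x).
    have h3 : expR (- x) * expR x = 1 by rewrite -expRD addNr expR0.
    have h4 : expR (- x) * (1 + x) <= 1 by rewrite -[leRHS]h3 ler_pM2l.
    have h5 : 1 <= (1 + x) * (1 - x + x ^+ 2) by rewrite !expr2; have := mulr_ge0 x0 (mulr_ge0 x0 x0); lra.
    rewrite -(@ler_pM2r _ (1 + x)); last by lra.
    by apply: (le_trans h4); rewrite mulrC.
  have := expR_ge1Dx (2 * x ^+ 2); have := sqr_ge0 x; lra.
have e : x <= 2 * x ^+ 2 by rewrite expr2; nra.
have e1 : expR x <= expR (2 * x ^+ 2) by rewrite ler_expR.
have e2 : expR (- x) <= expR (2 * x ^+ 2) by rewrite ler_expR; have := sqr_ge0 x; lra.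
lra.
Qed.

Lemma powR_le_exp (p x : R) : 0 < p -> 0 <= x -> x `^ p <= p `^ p * expR x.
Proof.
move=> p0 x0; have -> : x = p * (x / p) by field; rewrite gt_eqF.
rewrite powRM ?(ltW p0) ?divr_ge0 ?(ltW p0)// ler_wpM2l ?powR_ge0//.
have y0 : 0 <= x / p by rewrite divr_ge0// ltW.
rewrite [p * _]mulrC expRM; apply: ge0_ler_powR; rewrite ?nnegrE ?(ltW p0) ?expR_ge0//.
by have := expR_ge1Dx (x / p); lra.
Qed.

Variable T : finType.
Implicit Types (u : T -> R[i]) (x : T -> R) (e : {ffun T -> bool}).

Definition rsum x e : R := \sum_t sgn (e t) * x t.
Definition csum u e : R[i] := \sum_t (sgn (e t) +i* 0)%C * u t.
Local Notation card := (2 ^+ #|T| : R).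

Lemma sum_signs_prod (F : T -> bool -> R) : \sum_(e : {ffun T -> bool}) \prod_t F t (e t) = \prod_t (F t true + F t false).
Proof.
rewrite -bigA_distr_bigA; apply: eq_bigr => t _; by rewrite big_bool.
Qed.

Lemma exp_moment x : \sum_(e : {ffun T -> bool}) expR (rsum x e) <= card * expR (2 * \sum_t x t ^+ 2).
Proof.
under eq_bigr do rewrite /rsum expR_sum.
rewrite (sum_signs_prod (fun t b => expR (sgn b * x t))) mulr_sumr expR_sum.
have -> : card = \prod_(t : T) 2 by rewrite prodr_const.
rewrite -big_split/=; apply: ler_prod => t _.
by rewrite addr_ge0 ?expR_ge0//= mul1r mulN1r cosh_le.
Qed.

Lemma rsumN x e : rsum (fun t => - x t) e = - rsum x e.
Proof. by rewrite /rsum -sumrN; apply: eq_bigr => t _; rewrite mulrN. Qed.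

Lemma real_moment p x : 0 < p -> \sum_t x t ^+ 2 <= 1 ->
  \sum_(e : {ffun T -> bool}) `|rsum x e| `^ p <= card * (p `^ p * (2 * expR 2)).
Proof.
move=> p0 x1; apply: (@le_trans _ _ (\sum_(e : {ffun T -> bool}) p `^ p * (expR (rsum x e) + expR (rsum (fun t => - x t) e)))).
  apply: ler_sum => e _; apply: (le_trans (powR_le_exp p0 (normr_ge0 _))).
  rewrite ler_wpM2l ?powR_ge0// rsumN; have := expR_ge0 (rsum x e); have := expR_ge0 (- rsum x e).
  by case: (ger0P (rsum x e)) => _; lra.
rewrite -mulr_sumr [leRHS]mulrCA ler_wpM2l ?powR_ge0// big_split/=.
have c0 : 0 <= card by rewrite exprn_ge0.
have E : expR (2 * \sum_t x t ^+ 2) <= expR 2 by rewrite ler_expR; lra.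
have h1 := exp_moment x; have h2 := exp_moment (fun t => - x t).
have e2 : \sum_t (- x t) ^+ 2 = \sum_t x t ^+ 2 by apply: eq_bigr => t _; rewrite sqrrN.
rewrite e2 in h2.
have : card * expR (2 * \sum_t x t ^+ 2) <= card * expR 2 by rewrite ler_wpM2l.
lra.
Qed.

Lemma Re_csum u e : complex.Re (csum u e) = rsum (fun t => complex.Re (u t)) e.
Proof.
rewrite /csum (big_morph _ (@ReD R) (erefl : complex.Re (0 : R[i]) = 0)); apply: eq_bigr => t _.
by case: (u t) => a b /=; rewrite mul0r subr0.
Qed.
Lemma Im_csum u e : complex.Im (csum u e) = rsum (fun t => complex.Im (u t)) e.
Proof.
rewrite /csum (big_morph _ (@ImD R) (erefl : complex.Im (0 : R[i]) = 0)); apply: eq_bigr => t _.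
by case: (u t) => a b /=; rewrite mul0r addr0.
Qed.

Definition variance u : R := \sum_t n2 (u t).
Lemma variance_ge0 u : 0 <= variance u.
Proof. by apply: sumr_ge0 => t _; exact: n2_ge0. Qed.

Lemma csum_scale u (k : R) e : csum (fun t => (k +i* 0)%C * u t) e = (k +i* 0)%C * csum u e.
Proof. by rewrite /csum mulr_sumr; apply: eq_bigr => t _; rewrite mulrCA. Qed.

Definition khinchine_const (p : R) : R := 2 `^ p * (4 * (p `^ p * expR 2)).

Lemma khinchine_const_gt0 p : 0 < p -> 0 < khinchine_const p.
Proof. by move=> p0; rewrite /khinchine_const !mulr_gt0 ?powR_gt0 ?expR_gt0. Qed.

(** Scaling reduces the claim to variance 1, where [real_moment] is applied to the real and
    imaginary parts. Zero variance, which cannot be scaled, forces every term to vanish. *)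
Lemma khinchine p u : 0 < p -> \sum_(e : {ffun T -> bool}) cabs (csum u e) `^ p <= card * (khinchine_const p * variance u `^ (p / 2)).
Proof.
move=> p0; have c0 : 0 <= card by rewrite exprn_ge0.
have norm1 w : variance w <= 1 -> \sum_(e : {ffun T -> bool}) cabs (csum w e) `^ p <= card * khinchine_const p.
  move=> w1.
  have r1 : \sum_t complex.Re (w t) ^+ 2 <= 1.
    by apply: le_trans w1; apply: ler_sum => t _; rewrite lerDl sqr_ge0.
  have i1 : \sum_t complex.Im (w t) ^+ 2 <= 1.
    by apply: le_trans w1; apply: ler_sum => t _; rewrite lerDr sqr_ge0.
  have h1 := real_moment p0 r1; have h2 := real_moment p0 i1.
  apply: (@le_trans _ _ (\sum_(e : {ffun T -> bool}) 2 `^ p * (`|rsum (fun t => complex.Re (w t)) e| `^ p + `|rsum (fun t => complex.Im (w t)) e| `^ p))).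
    apply: ler_sum => e _; have := cabs_le (csum w e); rewrite Re_csum Im_csum.
    set a := `|_|; set b := `|_|; have a0 : 0 <= a by exact: normr_ge0. have b0 : 0 <= b by exact: normr_ge0.
    move=> ab; apply: (@le_trans _ _ ((2 * Num.max a b) `^ p)).
      apply: ge0_ler_powR; rewrite ?nnegrE ?(ltW p0) ?cabs_ge0 ?mulr_ge0 ?le_max ?a0//.
      by apply: (le_trans ab); rewrite mulr2n mulrDl mul1r lerD// le_max lexx ?orbT.
    rewrite powRM ?le_max ?a0// ler_wpM2l ?powR_ge0//.
    by rewrite /Num.max; case: ifP => _; rewrite ?lerDl ?lerDr powR_ge0.
  rewrite -mulr_sumr big_split/= /khinchine_const [leRHS]mulrCA ler_wpM2l ?powR_ge0//.
  apply: (le_trans (lerD h1 h2)); rewrite -mulrDr ler_wpM2l//; lra.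
have v0 := variance_ge0 u.
have [z|vn0] := eqVneq (variance u) 0.
  rewrite z powR0 ?mulr0; last by rewrite gt_eqF// divr_gt0.
  rewrite big1// => e _; suff -> : csum u e = 0 by rewrite cabs0 powR0// gt_eqF.
  rewrite /csum big1// => t _; move/eqP: z; rewrite psumr_eq0 => [/allP/(_ t (mem_index_enum t))/=|? _]; last exact: n2_ge0.
  rewrite /n2 paddr_eq0 ?sqr_ge0// !sqrf_eq0 => /andP[/eqP a /eqP b].
  have -> : u t = 0 by move: a b; case: (u t) => a b /= -> ->.
  by rewrite mulr0.
have vp : 0 < variance u by rewrite lt_neqAle eq_sym vn0.
pose k := (Num.sqrt (variance u))^-1; have s0 : 0 < Num.sqrt (variance u) by rewrite sqrtr_gt0.
have k0 : 0 < k by rewrite invr_gt0.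
have := norm1 (fun t => (k +i* 0)%C * u t).
have -> : variance (fun t => (k +i* 0)%C * u t) = 1.
  rewrite /variance; under eq_bigr do rewrite n2M.
  by rewrite -mulr_sumr {1}/n2/= expr0n/= addr0 /k exprVn sqr_sqrtr// mulVf.
move=> /(_ (lexx _)); under eq_bigr do rewrite csum_scale cabsM (cabs_real (ltW k0)) powRM ?cabs_ge0 ?(ltW k0)//.
rewrite -mulr_sumr => h.
have E : k `^ p * variance u `^ (p / 2) = 1.
  have -> : variance u `^ (p / 2) = Num.sqrt (variance u) `^ p.
    by rewrite -powR12_sqrt// -powRrM mulrC.
  by rewrite -powRM ?(ltW k0) ?(ltW s0)// /k mulVf ?gt_eqF// powR1.
rewrite -(@ler_pM2l _ (k `^ p)) ?powR_gt0//; apply: (le_trans h).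
by rewrite [leRHS](_ : _ = card * khinchine_const p * (k `^ p * variance u `^ (p / 2))); [rewrite E mulr1|ring].
Qed.

Lemma sign_orth s t : \sum_(e : {ffun T -> bool}) sgn (e s) * sgn (e t) = if s == t then card else 0.
Proof.
case: eqP => [->|/eqP st].
  rewrite (eq_bigr (fun=> 1)) => [|e _]; last by case: (e t); rewrite /sgn ?mulr1// mulrNN mulr1.
  by rewrite sumr_const card_ffun card_bool -mulr_natl mulr1 natrX.
pose F r (b : bool) : R := if (r == s) || (r == t) then sgn b else 1.
transitivity (\sum_(e : {ffun T -> bool}) \prod_r F r (e r)).
  apply: eq_bigr => e _; rewrite (bigD1 s)//= (bigD1 t)/=; last by rewrite eq_sym.
  rewrite big1 /F ?eqxx ?orbT/= ?mulr1// => r /andP[/negbTE-> /negbTE->] //.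
by rewrite sum_signs_prod (bigD1 s)//= /F eqxx/= subrr mul0r.
Qed.

Lemma real_second_moment x : \sum_(e : {ffun T -> bool}) rsum x e ^+ 2 = card * \sum_t x t ^+ 2.
Proof.
transitivity (\sum_s \sum_t x s * x t * \sum_(e : {ffun T -> bool}) sgn (e s) * sgn (e t)).
  under eq_bigr do rewrite expr2 /rsum big_distrlr/=.
  rewrite exchange_big; apply: eq_bigr => s _; rewrite exchange_big/=; apply: eq_bigr => t _.
  by rewrite mulr_sumr; apply: eq_bigr => e _; ring.
rewrite mulr_sumr; apply: eq_bigr => s _; rewrite (bigD1 s)//= [X in _ + X]big1 ?addr0.
  by rewrite sign_orth eqxx mulrC -expr2.
by move=> t ts; rewrite sign_orth eq_sym (negbTE ts) mulr0.
Qed.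

Lemma second_moment u : \sum_(e : {ffun T -> bool}) n2 (csum u e) = card * variance u.
Proof.
rewrite /variance /n2; under eq_bigr do rewrite Re_csum Im_csum.
by rewrite big_split/= !real_second_moment -mulrDr big_split.
Qed.

Definition large_prob : R := (4 * khinchine_const 4)^-1.
Lemma large_prob_gt0 : 0 < large_prob.
Proof. by rewrite invr_gt0 mulr_gt0// khinchine_const_gt0. Qed.

(* Paley-Zygmund from the second and fourth moments *)
Lemma large_signs u : card * large_prob <= \sum_(e : {ffun T -> bool}) (variance u / 4 <= n2 (csum u e))%R%:R.
Proof.
set v := variance u; set K := khinchine_const 4; have K0 : 0 < K by exact: khinchine_const_gt0.
have v0 : 0 <= v by exact: variance_ge0.
have c0 : 0 <= card by rewrite exprn_ge0.
have [z|vn0] := eqVneq v 0.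
  rewrite (eq_bigr (fun=> 1)) => [|e _]; last by rewrite z mul0r n2_ge0.
  rewrite sumr_const card_ffun card_bool -mulr_natl mulr1 natrX ler_piMr//.
  rewrite /large_prob -/K invf_le1 ?mulr_gt0// /K /khinchine_const.
  have p1 : 1 <= 2 `^ (4 : R) by rewrite powR_mulrn// exprn_ege1//; lra.
  have p2 : 1 <= (4 : R) `^ (4 : R) by rewrite powR_mulrn// exprn_ege1//; lra.
  have p3 : 1 <= expR 2 :> R by have := expR_ge1Dx (2 : R); lra.
  have p4 : 1 <= (4 : R) `^ 4 * expR 2 by rewrite -[leLHS]mulr1; apply: ler_pM.
  have p5 : 1 <= 2 `^ 4 * (4 * ((4 : R) `^ 4 * expR 2)) by rewrite -[leLHS]mulr1; apply: ler_pM => //; lra.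
  lra.
have vp : 0 < v by rewrite lt_neqAle eq_sym vn0.
set P := \sum_(e : {ffun T -> bool}) _.
have m4 : \sum_(e : {ffun T -> bool}) n2 (csum u e) ^+ 2 <= card * (K * v ^+ 2).
  have h := @khinchine 4 u ltac:(by rewrite ltr0n).
  rewrite -/K -/v (_ : (4 : R) / 2 = 2%:R) in h; last by field.
  rewrite powR_mulrn// in h; apply: le_trans h; apply: ler_sum => e _.
  by rewrite powR_mulrn ?cabs_ge0// -cabs_sq -exprM.
have m2 : card * v = \sum_(e : {ffun T -> bool}) n2 (csum u e) by rewrite second_moment.
(* Summed over the signs, this is [Z <= v / 4 + Z^2 / (4 K v)], plus [K v] when [Z >= v / 4], where
   [Z] is the squared modulus of the random sum. In that case it follows from
   [(Z - 2 K v)^2 >= 0]. *)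
have key : card * v <= card * (v / 4) + (card * (K * v ^+ 2)) / (4 * K * v) + K * v * P.
  rewrite {1}m2; apply: (@le_trans _ _ (\sum_(e : {ffun T -> bool}) (v / 4 + n2 (csum u e) ^+ 2 / (4 * K * v) + K * v * (v / 4 <= n2 (csum u e))%R%:R))).
    apply: ler_sum => e _; set Z := n2 _; have Z0 : 0 <= Z by exact: n2_ge0.
    have q0 : 0 <= Z ^+ 2 / (4 * K * v) by rewrite divr_ge0 ?sqr_ge0// !mulr_ge0// ltW.
    case: (leP (v / 4) Z) => h; last by rewrite mulr0; lra.
    rewrite mulr1; have : 0 <= (Z - 2 * K * v) ^+ 2 / (4 * K * v) by rewrite divr_ge0 ?sqr_ge0// !mulr_ge0// ltW.
    have -> : (Z - 2 * K * v) ^+ 2 / (4 * K * v) = Z ^+ 2 / (4 * K * v) - Z + K * v by field; rewrite !gt_eqF.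
    have := divr_ge0 v0 (ler0n R 4); lra.
  rewrite !big_split/= sumr_const card_ffun card_bool -[v / 4 *+ _]mulr_natl natrX -mulr_sumr -mulr_suml lerD2r lerD2l.
  by rewrite ler_wpM2r// invr_ge0 !mulr_ge0// ltW.
have E : card * (K * v ^+ 2) / (4 * K * v) = card * v / 4 by field; rewrite !gt_eqF.
rewrite E in key.
have key2 : card * v / 2 <= K * v * P by lra.
have : card / (2 * K) <= P.
  rewrite ler_pdivrMr ?mulr_gt0//; rewrite -(ler_pM2r vp); lra.
apply: le_trans; rewrite /large_prob -/K ler_wpM2l// lef_pV2 ?posrE ?mulr_gt0//.
lra.
Qed.

Lemma moment_lower p u : 0 < p ->
  card * (large_prob * (variance u / 4) `^ (p / 2)) <= \sum_(e : {ffun T -> bool}) cabs (csum u e) `^ p.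
Proof.
move=> p0; rewrite mulrA; apply: (@le_trans _ _ ((\sum_(e : {ffun T -> bool}) (variance u / 4 <= n2 (csum u e))%R%:R) * (variance u / 4) `^ (p / 2))).
  by rewrite ler_wpM2r ?powR_ge0// large_signs.
rewrite mulr_suml; apply: ler_sum => e _; case: (leP (variance u / 4) _) => h; last by rewrite mul0r powR_ge0.
rewrite mul1r.
have -> : cabs (csum u e) `^ p = n2 (csum u e) `^ (p / 2).
  rewrite -cabs_sq -(powR_mulrn 2 (cabs_ge0 _)) -powRrM; congr (_ `^ _); by field.
by apply: ge0_ler_powR; rewrite ?nnegrE ?divr_ge0 ?variance_ge0 ?n2_ge0// ltW.
Qed.

End Khinchine.

(** * Polynomials with prescribed homogeneous parts *)

Section TestPolynomials.
Variables (R : realType) (d : nat).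
Implicit Types (z w : Pt R d) (h : Pt R d -> R[i]) (c : d.-tuple nat -> R[i]).

Definition madd (a b : d.-tuple nat) : d.-tuple nat := [tuple (tnth a k + tnth b k)%N | k < d].
Lemma mono_madd z a b : mono z (madd a b) = mono z a * mono z b.
Proof. by rewrite /mono -big_split/=; apply: eq_bigr => k _; rewrite tnth_mktuple exprD. Qed.
Lemma mdeg_madd a b : mdeg (madd a b) = (mdeg a + mdeg b)%N.
Proof. by rewrite /mdeg -big_split/=; apply: eq_bigr => k _; rewrite tnth_mktuple. Qed.

Definition pev (s : seq (R[i] * d.-tuple nat)) z : R[i] := \sum_(x <- s) x.1 * mono z x.2.
Definition pco (s : seq (R[i] * d.-tuple nat)) a : R[i] := \sum_(x <- s | x.2 == a) x.1.

(** The list of terms may repeat a multi-index, so that sums are concatenations and products are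
    lists of all pairs; [pco] collects the coefficients afterwards. *)
Definition homog m h := exists2 s : seq (R[i] * d.-tuple nat), all (fun x => mdeg x.2 == m) s & forall z, h z = pev s z.

Lemma homog_ext m h h' : h =1 h' -> homog m h -> homog m h'.
Proof. by move=> e [s hs E]; exists s => // z; rewrite -e. Qed.
Lemma homog0 m : homog m (fun=> 0).
Proof. by exists [::] => // z; rewrite /pev big_nil. Qed.
Lemma homog_cst (v : R[i]) : homog 0 (fun=> v).
Proof.
exists [:: (v, [tuple 0%N | k < d])].
  by rewrite /= andbT /mdeg big1// => k _; rewrite tnth_mktuple.
by move=> z; rewrite /pev big_seq1 /mono big1 ?mulr1// => k _; rewrite tnth_mktuple expr0.
Qed.
Lemma homog_coord k : homog 1 (fun z => coord z k).
Proof.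
exists [:: (1, [tuple (j == k : nat) | j < d])].
  rewrite /= andbT /mdeg (bigD1 k)//= tnth_mktuple eqxx big1// => j /negbTE jk.
  by rewrite tnth_mktuple jk.
move=> z; rewrite /pev big_seq1 mul1r /mono (bigD1 k)//= tnth_mktuple eqxx big1 ?mulr1// => j /negbTE jk.
by rewrite tnth_mktuple jk.
Qed.
Lemma homogD m h h' : homog m h -> homog m h' -> homog m (fun z => h z + h' z).
Proof.
move=> [s hs E] [s' hs' E']; exists (s ++ s'); first by rewrite all_cat hs.
by move=> z; rewrite E E' /pev big_cat.
Qed.
Lemma homogM m m' h h' : homog m h -> homog m' h' -> homog (m + m')%N (fun z => h z * h' z).
Proof.
move=> [s hs E] [s' hs' E']; exists [seq (x.1 * y.1, madd x.2 y.2) | x <- s, y <- s'].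
  apply/allP => _ /allpairsP[[x y] [/= xs ys ->]] /=.
  by rewrite mdeg_madd (eqP (allP hs _ xs)) (eqP (allP hs' _ ys)).
move=> z; rewrite E E' /pev big_allpairs_dep/= big_distrlr/=; apply: eq_bigr => x _; apply: eq_bigr => y _.
by rewrite mono_madd mulrACA.
Qed.
Lemma homogZ m h (v : R[i]) : homog m h -> homog m (fun z => v * h z).
Proof. exact: (homogM (homog_cst v)). Qed.
Lemma homogX m h n : homog m h -> homog (n * m)%N (fun z => h z ^+ n).
Proof.
move=> hh; elim: n => [|n IH]; first by apply: homog_ext (homog_cst 1) => z; rewrite expr0.
by rewrite mulSn; apply: homog_ext (homogM hh IH) => z; rewrite exprS.
Qed.
Lemma homog_sum (I : Type) (r : seq I) (P : pred I) m (F : I -> Pt R d -> R[i]) :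
  (forall i, homog m (F i)) -> homog m (fun z => \sum_(i <- r | P i) F i z).
Proof.
move=> hF; elim: r => [|i r IH]; first by apply: homog_ext (homog0 m) => z; rewrite big_nil.
case Pi : (P i); last by apply: homog_ext IH => z; rewrite big_cons Pi.
by apply: homog_ext (homogD (hF i) IH) => z; rewrite big_cons Pi.
Qed.
Lemma homog_prod (I : Type) (r : seq I) (m : I -> nat) (F : I -> Pt R d -> R[i]) :
  (forall i, homog (m i) (F i)) -> homog (\sum_(i <- r) m i)%N (fun z => \prod_(i <- r) F i z).
Proof.
move=> hF; elim: r => [|i r IH]; first by rewrite big_nil; apply: homog_ext (homog_cst 1) => z; rewrite big_nil.
by rewrite big_cons; apply: homog_ext (homogM (hF i) IH) => z; rewrite big_cons.
Qed.
Lemma homog_cinner z0 : homog 1 (fun z => cinner z z0).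
Proof.
by apply: homog_sum => k; apply: homog_ext (homogZ (((coord z0 k)^*)%C) (homog_coord k)) => z; rewrite mulrC.
Qed.

Lemma hom_pco s m z c : all (fun x => mdeg x.2 == m) s -> (forall a, mdeg a = m -> c a = pco s a) -> hom c z m = pev s z.
Proof.
move=> hs hc; rewrite /hom; transitivity (\sum_(a : {ffun 'I_d -> 'I_m.+1} | mdeg (midx a) == m)
   \sum_(x <- s | x.2 == midx a) x.1 * mono z x.2).
  apply: eq_bigr => a /eqP am; rewrite hc// /pco mulr_suml.
  by apply: eq_bigr => x /eqP ->.
rewrite (exchange_big_dep xpredT)//= /pev !big_seq; apply: eq_bigr => x xs.
have /eqP xm := allP hs _ xs.
pose b : {ffun 'I_d -> 'I_m.+1} := [ffun k => inord (tnth x.2 k)].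
have bE : midx b = x.2.
  apply: eq_from_tnth => k; rewrite tnth_mktuple ffunE inordK// ltnS -xm; exact: le_mdeg.
rewrite (bigD1 b)/=; last by rewrite bE xm !eqxx.
rewrite big1 ?addr0// => a /andP[/andP[_ /eqP xa] /eqP ab]; exfalso; apply: ab.
apply/ffunP => k; rewrite ffunE; apply: val_inj; rewrite /= xa tnth_mktuple inordK//.
Qed.

Lemma test_poly M (h : nat -> Pt R d -> R[i]) : (forall m, homog m (h m)) ->
  exists2 c, (forall z m, hom c z m = if (m < M)%N then h m z else 0) & forall a, (M <= mdeg a)%N -> c a = 0.
Proof.
move=> hh; have /choice[s Hs] : forall m, exists s : seq (R[i] * d.-tuple nat),
    all (fun x => mdeg x.2 == m) s /\ forall z, h m z = pev s z.
  by move=> m; have [s h1 h2] := hh m; exists s.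
exists (fun a => if (mdeg a < M)%N then pco (s (mdeg a)) a else 0) => [z m|a Ma]; last by rewrite ltnNge Ma.
have [s1 s2] := Hs m; case: ifP => mM.
  by rewrite s2; apply: hom_pco s1 _ => a am; rewrite am mM.
by rewrite /hom big1// => a /eqP am; rewrite am mM mul0r.
Qed.

Section Poly.
Variables (M : nat) (h : nat -> Pt R d -> R[i]) (c : d.-tuple nat -> R[i]).
Hypotheses (hh : forall m, homog m (h m)) (hc : forall z m, hom c z m = if (m < M)%N then h m z else 0)
  (hc0 : forall a, (M <= mdeg a)%N -> c a = 0).

Definition hpoly z : R[i] := \sum_(m < M) h m z.

Lemma test_radI k z N : (M <= N.+1)%N -> psum (radI k c) z N = \sum_(m < M) ((1 + m)%:R ^+ k +i* 0)%C * h m z.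
Proof.
move=> MN; rewrite psum_hom (big_ord_widen _ (fun m => ((1 + m)%:R ^+ k +i* 0)%C * h m z) MN) [RHS]big_mkcond/=.
apply: eq_bigr => m _; rewrite hom_radI hc; case: ifP => // _; by rewrite mulr0.
Qed.

Lemma test_pseries k z : pseries (radI k c) z = \sum_(m < M) ((1 + m)%:R ^+ k +i* 0)%C * h m z.
Proof.
set S := \sum_(m < M) _; apply/eqP; rewrite eq_complex/=; apply/andP; split; apply/eqP; apply: cvg_lim => //;
  apply: cvg_near_cst; exists M => // N /= MN; rewrite test_radI//; exact: leqW.
Qed.

Lemma radI0 : radI 0 c = c.
Proof. by apply/funext => a; rewrite /radI expr0 (_ : (1 +i* 0)%C = 1) ?mul1r. Qed.

Lemma test_abs_summable z : abs_summable c z.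
Proof.
have ah m : (M <= m)%N -> ahom c z m = 0.
  by move=> Mm; rewrite /ahom big1// => a /eqP am; rewrite hc0 ?am// mul0r cabs0.
apply/cvg_ex; exists (apsum c z M); apply: cvg_near_cst; exists M => // N /= MN.
rewrite !apsum_hom -!(big_mkord xpredT (ahom c z)) (@big_cat_nat _ _ _ M.+1 0 N.+1)//=.
by rewrite [X in _ + X]big_nat_cond [X in _ + X]big1 ?addr0// => m /andP[/andP[/ltnW Mm _] _]; exact: ah.
Qed.

Lemma test_holo : holo_on_ball c hpoly.
Proof.
move=> z _; split; first exact: test_abs_summable.
rewrite -{1}radI0 test_pseries; apply: eq_bigr => m _.
by rewrite expr0 (_ : (1 +i* 0)%C = 1) ?mul1r.
Qed.
End Poly.

(** Boundedness and the Lipschitz bound are kept together because the Lipschitz bound of a product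
    needs both. *)
Definition tame h := exists2 L : R, 0 <= L & forall z w, closed_ball d z -> closed_ball d w ->
  cabs (h z) <= L /\ cabs (h z - h w) <= L * \sum_k cabs (coord z k - coord w k).

Lemma tame_ext h h' : h =1 h' -> tame h -> tame h'.
Proof. by move=> e [L L0 H]; exists L => // z w zb wb; rewrite -!e; exact: H. Qed.
Let dist0 z w : 0 <= \sum_k cabs (coord z k - coord w k).
Proof. by apply: sumr_ge0 => k _; exact: cabs_ge0. Qed.
Lemma tame_cst (v : R[i]) : tame (fun=> v).
Proof.
exists (cabs v); first exact: cabs_ge0.
by move=> z w _ _; rewrite subrr cabs0 lexx mulr_ge0 ?cabs_ge0.
Qed.
Lemma coord_le z k : closed_ball d z -> cabs (coord z k) <= 1.
Proof.
move=> /closed_ballP z1; rewrite -(@ler_pXn2r _ 2) ?nnegrE ?cabs_ge0// expr1n cabs_sq; apply: le_trans z1.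
by rewrite /pn2 (bigD1 k)//= lerDl; apply: sumr_ge0 => j _; exact: n2_ge0.
Qed.
Lemma tame_coord k : tame (fun z => coord z k).
Proof.
exists 1 => // z w zb wb; split; first exact: coord_le.
by rewrite mul1r (bigD1 k)//= lerDl; apply: sumr_ge0 => j _; exact: cabs_ge0.
Qed.
Lemma tameD h h' : tame h -> tame h' -> tame (fun z => h z + h' z).
Proof.
move=> [L L0 H] [L' L0' H']; exists (L + L'); first exact: addr_ge0.
move=> z w zb wb; have [h1 h2] := H z w zb wb; have [h3 h4] := H' z w zb wb; split.
  by apply: (le_trans (cabsD _ _)); exact: lerD.
rewrite opprD addrACA mulrDl; apply: (le_trans (cabsD _ _)); exact: lerD.
Qed.
Lemma tameM h h' : tame h -> tame h' -> tame (fun z => h z * h' z).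
Proof.
move=> [L L0 H] [L' L0' H']; exists (2 * L * L' + L * L'); first by rewrite addr_ge0 ?mulr_ge0.
move=> z w zb wb; have [h1 h2] := H z w zb wb; have [h3 h4] := H' z w zb wb; have [h5 _] := H w z wb zb.
have LL : 0 <= L * L' by exact: mulr_ge0.
split; first by rewrite cabsM; apply: (@le_trans _ _ (L * L')); [apply: ler_pM; rewrite ?cabs_ge0|lra].
have -> : h z * h' z - h w * h' w = (h z - h w) * h' z + h w * (h' z - h' w) by ring.
apply: (le_trans (cabsD _ _)); rewrite !cabsM; set D := \sum_k _ in h2 h4 *; have D0 : 0 <= D by exact: dist0.
apply: (@le_trans _ _ ((L * D) * L' + L * (L' * D))).
  by apply: lerD; apply: ler_pM; rewrite ?cabs_ge0.
have -> : (L * D) * L' + L * (L' * D) = 2 * L * L' * D by ring.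
by rewrite ler_wpM2r//; lra.
Qed.
Lemma tameX h n : tame h -> tame (fun z => h z ^+ n).
Proof.
move=> th; elim: n => [|n IH]; first by apply: tame_ext (tame_cst 1) => z; rewrite expr0.
by apply: tame_ext (tameM th IH) => z; rewrite exprS.
Qed.
Lemma tame_sum (I : Type) (r : seq I) (F : I -> Pt R d -> R[i]) : (forall i, tame (F i)) ->
  tame (fun z => \sum_(i <- r) F i z).
Proof.
move=> hF; elim: r => [|i r IH]; first by apply: tame_ext (tame_cst 0) => z; rewrite big_nil.
by apply: tame_ext (tameD (hF i) IH) => z; rewrite big_cons.
Qed.
Lemma tame_mono a : tame (fun z => mono z a).
Proof.
rewrite /mono; elim: (index_enum _) => [|k r IH]; first by apply: tame_ext (tame_cst 1) => z; rewrite big_nil.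
by apply: tame_ext (tameM (tameX (tnth a k) (tame_coord k)) IH) => z; rewrite big_cons.
Qed.
Lemma tame_homog m h : homog m h -> tame h.
Proof.
move=> [s _ E]; apply: (@tame_ext (pev s)); first by move=> z; rewrite E.
by apply: tame_sum => x; apply: tameM (tame_cst _) (tame_mono _).
Qed.

Lemma tame_continuous h : tame h -> cont_closed_ball h.
Proof.
move=> [L L0 H] z zb e e0; pose A := L * d%:R + 1; have A0 : 0 < A by rewrite ltr_wpDl// mulr_ge0.
exists (e / A); first exact: divr_gt0.
move=> w wb wz; have [_ h2] := H w z wb zb; apply: (le_lt_trans h2).
apply: (@le_lt_trans _ _ (L * (d%:R * pnorm (psub w z)))).
  rewrite ler_wpM2l// mulr_natl -[X in _ *+ X]card_ord -sumr_const; apply: ler_sum => k _.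
  rewrite -coord_psub pnormE -[leLHS](ger0_norm (cabs_ge0 _)) -sqrtr_sqr cabs_sq ler_wsqrtr//.
  by rewrite /pn2 (bigD1 k)//= lerDl; apply: sumr_ge0 => j _; exact: n2_ge0.
rewrite mulrA; apply: (@le_lt_trans _ _ (A * pnorm (psub w z))).
  by rewrite ler_wpM2r ?sqrtr_ge0// /A lerDl.
by rewrite mulrC -ltr_pdivlMr.
Qed.

Lemma mfc_mono a : mfc (fun z : Pt R d => mono z a).
Proof. by apply: mfc_prod => k; apply: mfcX; exact: mfc_coord. Qed.
Lemma mfc_homog m h : homog m h -> mfc h.
Proof.
move=> [s _ E]; rewrite (_ : h = pev s); last exact/funext.
by apply: mfc_sum => x; apply: mfcM; [exact: mfc_cst|exact: mfc_mono].
Qed.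
Lemma scale_closed (r : R) z : 0 <= r <= 1 -> closed_ball d z -> closed_ball d (scale r z).
Proof.
move=> /andP[r0 r1] /closed_ballP z1; apply/closed_ballP; rewrite scaleE pn2_cscale -cabs_sq cabs_real//.
by have := pn2_ge0 z => p0; rewrite mulr_ile1// ?sqr_ge0 ?exprn_ile1.
Qed.
Lemma homog_scale m h (w : R[i]) z : homog m h -> h (cscale w z) = w ^+ m * h z.
Proof.
move=> [s hs E]; rewrite !E /pev mulr_sumr !big_seq; apply: eq_bigr => x xs.
by rewrite mono_cscale (eqP (allP hs _ xs)) mulrCA.
Qed.
End TestPolynomials.

(** The integral of a nonnegative function is a supremum over simple functions below it, hence
    monotone without any measurability. This spares measurability proofs for [HF_inner] in the
    comparisons below. *)
Lemma ge0_le_integral_any {dT} {T : measurableType dT} {R : realType} (m : {measure set T -> \bar R})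
  (D : set T) (f g : T -> \bar R) : (forall x, D x -> (0 <= f x)%E) -> (forall x, D x -> (f x <= g x)%E) ->
  (\int[m]_(x in D) f x <= \int[m]_(x in D) g x)%E.
Proof.
move=> f0 fg; have g0 x : D x -> (0 <= g x)%E by move=> Dx; exact: le_trans (f0 x Dx) (fg x Dx).
rewrite !ge0_integralE//; apply: le_ereal_sup => _ [h /= hf <-]; exists h => // x.
apply: (le_trans (hf x)); rewrite /patch; case: ifPn => //; rewrite inE; exact: fg.
Qed.

(** * Integrability of the radial weight *)

Section Weight.
Variable R : realType.

Lemma weight_part (a y : R) : 0 < a -> 0 <= y < 1 ->
  (\int[lebesgue_measure]_(x in `[0%R, y]) ((1 - x) `^ (a - 1))%:E <= (a^-1)%:E)%E.
Proof.
(* The base equals [1 - x] up to [y] and stays at [1 - y > 0] beyond, so [f] is continuous on the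
   whole line. *)
move=> a0 /andP[y0 y1]; pose f (x : R) := (1 - y + (`|y - x| + (y - x)) / 2) `^ (a - 1).
have cf : continuous f.
  have cy : continuous (fun x : R => y - x) by apply: ctsB; [exact: cts_cst|move=> u; exact: cvg_id].
  apply: cts_powR; first by move=> x; have := ler_norm (- (y - x)); rewrite normrN; lra.
  apply: ctsD; first exact: cts_cst.
  apply: ctsM; last exact: cts_cst.
  by apply: ctsD => //; apply: (cts_comp (h := fun u : R => `|u|)) => //; move=> u; exact: norm_continuous.
pose F (x : R) := - a^-1 * (1 - x) `^ a.
have fE (x : R) : 0 <= x <= y -> f x = (1 - x) `^ (a - 1).
  by move=> /andP[_ xy]; rewrite /f ger0_norm ?subr_ge0//; congr (_ `^ _); field.
have dF (x : R) : 0 <= x <= y -> is_derive x 1 F (f x).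
  move=> xy; rewrite fE//; have x1 : 0 < 1 - x by case/andP: xy; lra.
  have D1 : is_derive x 1 (fun u : R => 1 - u) (0 - 1) by exact: (isdB (isdcst 1 x) (isdid x)).
  have D2 := isdcomp (f := fun u => u `^ a) (g := fun u => 1 - u) (is_derive1_powR a x1) D1.
  apply: (isdE (isdM (isdcst (- a^-1) x) D2)).
  by rewrite mul0r add0r sub0r mulrN1 mulrNN mulrA mulVf ?mul1r// gt_eqF.
have E := cint_FTC y0 cf dF.
have -> : (\int[lebesgue_measure]_(x in `[0%R, y]) ((1 - x) `^ (a - 1))%:E = \int[lebesgue_measure]_(x in `[0%R, y]) (f x)%:E)%E.
  by apply: eq_integral => x; rewrite inE/= in_itv/= => /fE ->.
rewrite [leLHS](_ : _ = (cint 0 y f)%:E); last exact: cintE.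
rewrite E lee_fin /F subr0 powR1 mulr1 opprK mulNr.
by have := powR_ge0 (1 - y) a => h; rewrite gerDr oppr_le0 mulr_ge0// invr_ge0 ltW.
Qed.

Lemma weight_finite (a : R) : 0 < a ->
  (\int[lebesgue_measure]_(x in `[0%R, 1%R[) ((1 - x ^+ 2) `^ (a - 1))%:E <= (Num.max 1 a^-1)%:E)%E.
Proof.
move=> a0; have m1 : measurable (`[0, 1[%classic : set R) by exact: measurable_itv.
have mw : measurable_fun (`[0, 1[%classic : set R) (fun x : R => (1 - x) `^ (a - 1)).
  apply: measurable_funTS; apply: (measurableT_comp (measurable_powR _)); exact: measurable_funB.
have [a1|a1] := leP 1 a.
  apply: (@le_trans _ _ (\int[lebesgue_measure]_(x in (`[0%R, 1%R[%classic : set R)) 1%:E)%E).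
    apply: ge0_le_integral_any => x /=; rewrite in_itv/= => /andP[x0 x1]; rewrite lee_fin ?powR_ge0//.
    have q : 0 <= 1 - x ^+ 2 <= 1 by rewrite subr_ge0 exprn_ile1 ?(ltW x1)//= gerBl sqr_ge0.
    case/andP: q => q0 q1; have e1 : 1 `^ (a - 1) = 1 :> R by rewrite powR1.
    rewrite -[leRHS]e1; apply: ge0_ler_powR => //; rewrite ?nnegrE ?subr_ge0//.
  rewrite integral_cst// [X in (_ * X)%E]lebesgue_measure_itv/= lte_fin ltr01 -EFinB subr0 mule1 lee_fin.
  by rewrite le_max lexx.
apply: (@le_trans _ _ (\int[lebesgue_measure]_(x in (`[0%R, 1%R[%classic : set R)) ((1 - x) `^ (a - 1))%:E)%E).
  apply: ge0_le_integral_any => x /=; rewrite in_itv/= => /andP[x0 x1]; rewrite lee_fin ?powR_ge0//.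
  have e : a - 1 = - (1 - a) by ring.
  have p1 : 0 < 1 - x by lra.
  have p2 : 1 - x <= 1 - x ^+ 2 by rewrite expr2; nra.
  rewrite e !powRN lef_pV2 ?posrE ?powR_gt0//; last by apply: lt_le_trans p2.
  by apply: ge0_ler_powR; rewrite ?nnegrE; lra.
pose v n (x : R) : \bar R := if x <= 1 - n.+1%:R^-1 then ((1 - x) `^ (a - 1))%:E else 0%E.
have L : (\int[lebesgue_measure]_(x in (`[0%R, 1%R[%classic : set R)) v n x)%E @[n --> \oo] -->
    (\int[lebesgue_measure]_(x in (`[0%R, 1%R[%classic : set R)) ((1 - x) `^ (a - 1))%:E)%E.
  have -> : (\int[lebesgue_measure]_(x in (`[0%R, 1%R[%classic : set R)) ((1 - x) `^ (a - 1))%:E =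
      \int[lebesgue_measure]_(x in (`[0%R, 1%R[%classic : set R)) limn (v ^~ x))%E; last first.
    apply: cvg_monotone_convergence => //.
    - move=> n; rewrite (_ : v n = (fun x => ((1 - x) `^ (a - 1) * (\1_(`]-oo, 1 - n.+1%:R^-1]%classic : set R) x))%:E)).
        by apply/measurable_EFinP; apply: measurable_funM => //; apply: measurable_indic; exact: measurable_itv.
      apply/funext => x; rewrite /v indicE; case: ifPn => h.
        by rewrite mem_set ?mulr1//= in_itv/=.
      by rewrite memNset ?mulr0//= in_itv/=; exact/negP.
    - by move=> n x _; rewrite /v; case: ifP => // _; rewrite lee_fin powR_ge0.
    - move=> x _ m n mn; rewrite /v; case: ifPn => h; last by case: ifP => // _; rewrite lee_fin powR_ge0.
      rewrite (le_trans h)// lerD2l lerN2 lef_pV2 ?posrE// ler_nat//.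
  apply: eq_integral => x; rewrite inE/= in_itv/= => /andP[x0 x1]; apply/esym/cvg_lim => //; apply: cvg_near_cst.
  have x1' : 0 < 1 - x by lra.
  have /cvgrPdist_lt/(_ _ x1') := @cvg_harmonic R; apply: filterS => n.
  rewrite sub0r normrN ger0_norm ?invr_ge0// => h; rewrite /v ifT// lerBrDr addrC -lerBrDr; exact: ltW.
rewrite -(cvg_lim _ L)//; apply: lime_le; first by apply/cvg_ex; eexists; exact: L.
apply: nearW => n; have n0 : 0 < n.+1%:R^-1 :> R by rewrite invr_gt0.
have n1 : n.+1%:R^-1 <= 1 :> R by rewrite invf_le1// ler1n.
apply: (@le_trans _ _ (a^-1)%:E); last by rewrite lee_fin le_max lexx orbT.
apply: le_trans (@weight_part a (1 - n.+1%:R^-1) a0 _); last by rewrite subr_ge0 n1/= gtrBl.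
rewrite integral_mkcond [leRHS]integral_mkcond; apply: ge0_le_integral_any => x _; rewrite /patch.
  by case: ifP => // _; rewrite /v; case: ifP => // _; rewrite lee_fin powR_ge0.
case: ifPn => [|_]; last by case: ifP => // _; rewrite lee_fin powR_ge0.
rewrite inE/= in_itv/= => /andP[x0 x1]; rewrite /v; case: ifPn => h.
  by rewrite ifT// inE/= in_itv/= x0.
by case: ifP => // _; rewrite lee_fin powR_ge0.
Qed.

End Weight.

(** * Test functions and lower bounds for the radial integral *)

Section LowerBounds.
Variables (R : realType) (d : nat) (sigma : {measure set (Pt R d) -> \bar R}).
Hypothesis hs : normalized_surface_measure sigma.
Implicit Types (z w : Pt R d) (c : d.-tuple nat -> R[i]).

Lemma powR_le1 (x e : R) : 0 <= x <= 1 -> 0 <= e -> x `^ e <= 1.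
Proof.
move=> /andP[x0 x1] e0; have e1 : 1 `^ e = 1 :> R by rewrite powR1.
by rewrite -[leRHS]e1; apply: ge0_ler_powR => //; rewrite nnegrE.
Qed.

Lemma one_sub_sq (r : R) : 0 <= r < 1 -> 0 <= 1 - r ^+ 2 <= 1.
Proof. by move=> /andP[r0 r1]; rewrite subr_ge0 exprn_ile1 ?(ltW r1)//= gerBl sqr_ge0. Qed.

Lemma splus_gt (s : R) : 0 <= s -> 0 < (splus s)%:R - s.
Proof. by move=> s0; rewrite subr_gt0; exact: truncnS_gt. Qed.

Lemma outer_exp_ge0 (p : R) (q : \bar R) : 0 < p -> (0 < q)%E -> 0 <= outer_exp p q.
Proof.
by move=> p0; case: q => [q| |]//= q0; rewrite ?(ltW p0)//; rewrite divr_ge0// ltW.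
Qed.

Lemma HF_inner_ge0 s q c z : (0 <= HF_inner s q c z)%E.
Proof.
case: q => [q| |] //=.
  by apply: integral_ge0 => r _; rewrite lee_fin mulr_ge0// powR_ge0.
apply: (@le_trans _ _ (cabs (pseries (radI (splus s) c) (scale 0 z)) * (1 - 0 ^+ 2) `^ ((splus s)%:R - s))%:E).
  by rewrite lee_fin mulr_ge0 ?cabs_ge0 ?powR_ge0.
by apply: ereal_sup_ubound; exists 0 => //=; rewrite in_itv/= lexx ltr01.
Qed.

Lemma test_finite (s p : R) (q : \bar R) M (h : nat -> Pt R d -> R[i]) c : 0 <= s -> 0 < p -> (0 < q)%E ->
  (forall m, homog m (h m)) -> (forall z m, hom c z m = if (m < M)%N then h m z else 0) ->
  (HF_pnorm sigma s p q c < +oo)%E.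
Proof.
move=> s0 p0 q0 hh hc; set k := splus s.
have ks : 0 < k%:R - s by exact: splus_gt.
have [L L0 HL] : tame (fun z => \sum_(m < M) ((1 + m)%:R ^+ k +i* 0)%C * h m z).
  apply: tame_sum => m; apply: tameM; [exact: tame_cst|exact: tame_homog (hh m)].
have gL z r : sphere d z -> 0 <= r < 1 -> cabs (pseries (radI k c) (scale r z)) <= L.
  move=> /sphere_closed zb /andP[r0 r1]; rewrite (test_pseries hc).
  have sb : closed_ball d (scale r z) by apply: scale_closed; rewrite ?r0 ?ltW.
  by have [] := HL _ _ sb sb.
have [B B0 HB] : exists2 B : R, 0 <= B & forall z, sphere d z -> (HF_inner s q c z <= B%:E)%E.
  case: q q0 => [q| |//] q0.
    have qp : 0 < q by rewrite -lte_fin.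
    pose a := (k%:R - s) * q; have a0 : 0 < a by exact: mulr_gt0.
    exists (L `^ q * Num.max 1 a^-1); first by rewrite mulr_ge0 ?powR_ge0// le_max ler01.
    move=> z zs; rewrite /HF_inner -/k -/a EFinM.
    apply: (@le_trans _ _ (\int[lebesgue_measure]_(r in `[0%R, 1%R[) ((L `^ q)%:E * ((1 - r ^+ 2) `^ (a - 1))%:E))%E).
      apply: ge0_le_integral_any => r /=; rewrite in_itv/= => r01; first by rewrite lee_fin mulr_ge0 ?powR_ge0.
      rewrite -EFinM lee_fin ler_wpM2r ?powR_ge0//; apply: ge0_ler_powR; rewrite ?nnegrE ?(ltW qp) ?cabs_ge0//.
      exact: gL.
    rewrite ge0_integralZl_EFin ?powR_ge0//; last 2 first.
    - by move=> r _; rewrite lee_fin powR_ge0.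
    - apply/measurable_EFinP; apply: measurable_funTS; apply: (measurableT_comp (measurable_powR _)).
      by apply: measurable_funB => //; apply: measurable_funX.
    by apply: lee_wpmul2l; [rewrite lee_fin powR_ge0|exact: weight_finite].
  exists L => // z zs; rewrite /HF_inner -/k; apply: ge_ereal_sup => _ [r /= /[!in_itv]/= r01 <-].
  rewrite lee_fin -[leRHS]mulr1; apply: ler_pM; rewrite ?cabs_ge0 ?powR_ge0 ?gL//.
  by apply: powR_le1 (one_sub_sq r01) (ltW ks).
apply: (@le_lt_trans _ _ (\int[sigma]_(z in sphere d) (B `^ outer_exp p q)%:E)%E).
  apply: ge0_le_integral_any => z zs; first exact: poweR_ge0.
  rewrite -poweR_EFin; apply: le_poweR; rewrite ?outer_exp_ge0 ?HF_inner_ge0//; exact: HB.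
rewrite integral_cst; last exact: measurable_sphere.
apply: lte_mul_pinfty; rewrite ?lee_fin ?powR_ge0//.
apply: (@le_lt_trans _ _ (sigma setT)); last exact: sigma_fin.
by apply: le_measure; rewrite ?inE//; exact: measurable_sphere.
Qed.

(** For finite [q] only the shell [1 - 2 eta <= r <= 1 - eta] is kept: its length is [eta], and
    [1 - r^2] lies there between [eta] and [4 eta]. For [q = oo] the single radius [1 - eta]
    suffices. *)
Lemma inner_lower (s p : R) (q : \bar R) : 0 <= s -> 0 < p -> (0 < q)%E -> exists2 k0 : R, 0 < k0 &
  forall c z (eta G : R), 0 < eta <= 1 / 2 -> 0 <= G ->
  (forall r : R, 1 - 2 * eta <= r <= 1 - eta -> G <= cabs (pseries (radI (splus s) c) (scale r z))) ->
  ((k0 * (G * eta `^ ((splus s)%:R - s)) `^ p)%:E <= poweR (HF_inner s q c z) (outer_exp p q))%E.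
Proof.
move=> s0 p0 q0; set k := splus s; have ks : 0 < k%:R - s by exact: splus_gt.
case: q q0 => [q| |//] q0; last first.
  exists 1 => // c z eta G /andP[e0 e1] G0 hG; rewrite mul1r -poweR_EFin.
  apply: (@le_poweR _ _ _ p (ltW p0)); first by rewrite lee_fin mulr_ge0 ?powR_ge0.
  have r01 : 0 <= 1 - eta < 1 by apply/andP; split; lra.
  apply: (@le_trans _ _ (cabs (pseries (radI k c) (scale (1 - eta) z)) * (1 - (1 - eta) ^+ 2) `^ (k%:R - s))%:E).
    rewrite lee_fin; apply: ler_pM; rewrite ?powR_ge0//; first by apply: hG; apply/andP; split; lra.
    apply: ge0_ler_powR; rewrite ?nnegrE ?(ltW ks) ?(ltW e0)//; first by case/andP: (one_sub_sq r01).
    by rewrite expr2; nra.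
  by apply: ereal_sup_ubound; exists (1 - eta) => //=; rewrite in_itv.
have qp : 0 < q by rewrite -lte_fin.
(* [M0] makes [M0 eta^b] a lower bound of the weight on the shell for either sign of [b]. *)
pose b := (k%:R - s) * q - 1; pose M0 := Num.min 1 (4 `^ b) : R.
have M00 : 0 < M0 by rewrite lt_min ltr01 powR_gt0.
exists (M0 `^ (p / q)); first exact: powR_gt0.
move=> c z eta G /andP[e0 e1] G0 hG.
have -> : M0 `^ (p / q) * (G * eta `^ (k%:R - s)) `^ p = (M0 * (G * eta `^ (k%:R - s)) `^ q) `^ (p / q).
  rewrite [RHS]powRM ?powR_ge0 ?(ltW M00)// -powRrM; congr (_ * _ `^ _); by field; rewrite gt_eqF.
rewrite -poweR_EFin; apply: le_poweR; rewrite ?divr_ge0 ?(ltW p0) ?(ltW qp) ?lee_fin ?mulr_ge0 ?(ltW M00) ?powR_ge0//.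
rewrite /HF_inner -/k -/b.
pose I := (`[1 - 2 * eta, 1 - eta]%classic : set R).
have LI : lebesgue_measure I = eta%:E.
  rewrite lebesgue_measure_itv/= lte_fin ifT; last by lra.
  by rewrite -EFinB; congr (_%:E); ring.
apply: (@le_trans _ _ (\int[lebesgue_measure]_(r in I) (G `^ q * (M0 * eta `^ b))%:E)%E).
  rewrite integral_cst; last exact: measurable_itv.
  rewrite [X in (_ * X)%E]LI -EFinM lee_fin powRM ?powR_ge0// -powRrM.
  have -> : eta `^ ((k%:R - s) * q) = eta `^ b * eta.
    rewrite -{3}(powRr1 (ltW e0)) -powRD; last by apply/implyP => _; rewrite gt_eqF.
    by rewrite /b subrK.
  by rewrite le_eqVlt; apply/orP; left; apply/eqP; ring.
have key (r : R) : 1 - 2 * eta <= r <= 1 - eta -> 0 <= r < 1 /\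
    G `^ q * (M0 * eta `^ b) <= cabs (pseries (radI k c) (scale r z)) `^ q * (1 - r ^+ 2) `^ b.
  move=> /andP[r1 r2]; split; first by apply/andP; split; lra.
  have h1 : eta <= 1 - r ^+ 2 by rewrite expr2; nra.
  have h2 : 1 - r ^+ 2 <= 4 * eta by rewrite expr2; nra.
  have h0 : 0 < 1 - r ^+ 2 by lra.
  apply: ler_pM; rewrite ?powR_ge0 ?mulr_ge0 ?(ltW M00) ?powR_ge0//.
    by apply: ge0_ler_powR; rewrite ?nnegrE ?(ltW qp) ?cabs_ge0//; apply: hG; rewrite r1.
  have [b0|b0] := leP 0 b.
    apply: (@le_trans _ _ (1 * eta `^ b)); first by rewrite ler_wpM2r ?powR_ge0// ge_min lexx.
    by rewrite mul1r; apply: ge0_ler_powR; rewrite ?nnegrE// ltW.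
  apply: (@le_trans _ _ (4 `^ b * eta `^ b)); first by rewrite ler_wpM2r ?powR_ge0// ge_min lexx orbT.
  have p4 : 0 < 4 * eta by rewrite mulr_gt0.
  rewrite -powRM ?(ltW e0)// -(opprK b) !(powRN _ (- b)) lef_pV2 ?posrE ?powR_gt0//.
  by apply: ge0_ler_powR; rewrite ?nnegrE ?(ltW p4) ?(ltW h0)//; lra.
rewrite integral_mkcond [leRHS]integral_mkcond; apply: ge0_le_integral_any => r _; rewrite /patch.
  by case: ifP => // _; rewrite lee_fin !mulr_ge0 ?powR_ge0// ltW.
case: ifPn => [|_]; last by case: ifP => // _; rewrite lee_fin mulr_ge0 ?powR_ge0.
rewrite /I inE/= in_itv/= => /key[r01 h].
by rewrite ifT ?lee_fin// inE/= in_itv/=.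
Qed.

Variables (mu : {measure set (Pt R d) -> \bar R}).
Local Notation Ip p f := (\int[mu]_(z in closed_ball d) (cabs (f z) `^ p)%:E)%E.

Lemma carleson_power (s p : R) (q : \bar R) : 0 < p -> reverse_carleson sigma s p q mu ->
  exists2 C : R, 0 < C & forall c f, holo_on_ball c f -> cont_closed_ball f ->
    (HF_pnorm sigma s p q c < +oo)%E -> (HF_pnorm sigma s p q c <= C%:E * Ip p f)%E.
Proof.
move=> p0 [C C0 H]; exists (C `^ p); first exact: powR_gt0.
move=> c f hf cf fin; have := H c f hf cf fin; rewrite /HF_norm /Lp_norm.
set N := HF_pnorm _ _ _ _ _; set I := (\int[_]_(_ in _) _)%E => h.
have N0 : (0 <= N)%E by apply: integral_ge0 => z _; exact: poweR_ge0.
have I0 : (0 <= I)%E by apply: integral_ge0 => z _; rewrite lee_fin powR_ge0.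
have e x : (0 <= x)%E -> poweR (poweR x p^-1) p = x.
  by move=> x0; rewrite -poweRrM mulVf ?gt_eqF// poweRe1.
have := le_poweR (ltW p0) (poweR_ge0 _ _) h.
by rewrite e// poweRM ?poweR_ge0 ?lee_fin ?(ltW C0)// e// poweR_EFin.
Qed.

Lemma carleson_of_power (s p : R) (q : \bar R) C : 0 < p -> 0 <= C ->
  (forall c f, holo_on_ball c f -> cont_closed_ball f -> (HF_pnorm sigma s p q c <= C%:E * Ip p f)%E) ->
  reverse_carleson sigma s p q mu.
Proof.
move=> p0 C0 H; exists ((C + 1) `^ p^-1); first by rewrite powR_gt0// ltr_wpDl.
move=> c f hf cf _; rewrite /HF_norm /Lp_norm -poweR_EFin -poweRM ?lee_fin ?addr_ge0//; last first.
  by apply: integral_ge0 => z _; rewrite lee_fin powR_ge0.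
apply: le_poweR; rewrite ?invr_ge0 ?(ltW p0)//.
  by apply: integral_ge0 => z _; exact: poweR_ge0.
apply: (le_trans (H c f hf cf)); apply: lee_wpmul2r.
  by apply: integral_ge0 => z _; rewrite lee_fin powR_ge0.
by rewrite lee_fin lerDl.
Qed.

End LowerBounds.

(** * Words in the coordinates *)

Section TestFamilies.
Variables (R : realType) (d : nat).
Hypothesis d0 : (1 <= d)%N.
Implicit Types (z w : Pt R d) (c : d.-tuple nat -> R[i]).

Lemma natr_complex n : (n%:R : R[i]) = (n%:R +i* 0)%C.
Proof.
elim: n => [|n IH]; first by rewrite !mulr0n.
by rewrite -!natr1 IH; apply/eqP; rewrite eq_complex/= addr0 !eqxx.
Qed.

Lemma cauchy_schwarz z w : pn2 w = 1 -> n2 (cinner z w) <= pn2 z.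
Proof.
move=> w1; set a := cinner z w.
have : 0 <= pn2 (psub z (cscale a w)) by exact: pn2_ge0.
have -> : pn2 (psub z (cscale a w)) = pn2 z + n2 a * pn2 w - 2 * complex.Re ((a^*)%C * a).
  have -> : complex.Re ((a^*)%C * a) = \sum_k complex.Re ((a^*)%C * (coord z k * ((coord w k)^*)%C)).
    by rewrite -(big_morph _ (@ReD R) (erefl : complex.Re (0 : R[i]) = 0)) -mulr_sumr.
  rewrite [2 * _]mulr_sumr.
  rewrite /pn2 mulr_sumr -big_split/= -sumrB; apply: eq_bigr => k _; rewrite coord_psub coord_cscale.
  by rewrite /coord/=; case: (tnth z k) (tnth w k) (a) => [x1 x2] [y1 y2] [a1 a2]; rewrite /n2/=; ring.
have -> : complex.Re ((a^*)%C * a) = n2 a by case: (a) => a1 a2; rewrite /n2/=; ring.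
by rewrite w1; lra.
Qed.

Lemma cabs_cinner z w : sphere d z -> sphere d w -> cabs (cinner z w) <= 1.
Proof.
move=> /sphereP z1 /sphereP w1; rewrite -(@ler_pXn2r _ 2) ?nnegrE ?cabs_ge0// expr1n cabs_sq -z1.
exact: cauchy_schwarz.
Qed.

Lemma cabs_one_add (u : R[i]) : cabs u <= 1 -> cabs (1 + u) <= 2.
Proof. move=> h; apply: (le_trans (cabsD _ _)); rewrite (_ : (1 : R[i]) = (1 +i* 0)%C)// cabs_real//; lra. Qed.

Section Family.
Variables (n M : nat).
Hypothesis nM : (n <= M)%N.
(** A word with [M] letters of which the first [n] choose coordinates. Every other letter
    contributes [1 / sqrt d], whose squares sum to 1 over the [d] choices, so words of different
    lengths are indexed by one finite type without changing the variance. *)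
Definition unit_mono (i : {ffun 'I_M -> 'I_d}) z : R[i] :=
  \prod_(k < M) (if (k < n)%N then coord z (i k) else ((Num.sqrt d%:R)^-1 +i* 0)%C).

Lemma homog_unit_mono i : homog n (unit_mono i).
Proof.
have E : (\sum_(k < M) (k < n : nat) = n)%N.
  rewrite (eq_bigr (fun k : 'I_M => if (k < n)%N then 1 else 0)%N) => [|k _]; last by case: ifP.
  by rewrite -big_mkcond/= -(big_ord_widen _ (fun=> 1%N) nM) sum1_card card_ord.
have H : forall k : 'I_M, homog (k < n)%N (fun z : Pt R d => if (k < n)%N then coord z (i k) else ((Num.sqrt d%:R)^-1 +i* 0)%C).
  by move=> k; case: (k < n)%N; [exact: homog_coord|exact: homog_cst].
by have := homog_prod (index_enum _) H; rewrite E.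
Qed.

Lemma unit_mono_variance z : \sum_i n2 (unit_mono i z) = pn2 z ^+ n.
Proof.
have dp : 0 < (d%:R : R) by rewrite ltr0n.
pose F (k : 'I_M) (j : 'I_d) : R := if (k < n)%N then n2 (coord z j) else d%:R^-1.
transitivity (\sum_(i : {ffun 'I_M -> 'I_d}) \prod_k F k (i k)).
  apply: eq_bigr => i _; rewrite /unit_mono (big_morph _ (@n2M R) (_ : n2 1 = 1)).
    apply: eq_bigr => k _; rewrite /F; case: ifP => // _.
    by rewrite /n2/= expr0n/= addr0 exprVn sqr_sqrtr// ler0n.
  by rewrite /n2/= expr1n expr0n/= addr0.
rewrite -bigA_distr_bigA/= (eq_bigr (fun k : 'I_M => if (k < n)%N then pn2 z else 1)) => [|k _].
  by rewrite -big_mkcond/= -(big_ord_widen _ (fun=> pn2 z) nM) prodr_const card_ord.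
rewrite /F; case: (k < n)%N; first by [].
by rewrite sumr_const card_ord -[LHS]mulr_natl divff// gt_eqF.
Qed.
End Family.

End TestFamilies.

(** * Lower bounds for the functions [(1 + <z, z0>)^N S] *)

Section Binomial.
Variables (R : realType) (d : nat) (s p : R) (q : \bar R).
Hypotheses (s0 : 0 <= s) (p0 : 0 < p) (q0 : (0 < q)%E).
Implicit Types (z w : Pt R d) (c : d.-tuple nat -> R[i]).

Definition binom_test (N n : nat) z0 (S : Pt R d -> R[i]) m z : R[i] :=
  if (m < n)%N then 0 else ('C(N, m - n)%:R * cinner z z0 ^+ (m - n)) * S z.

Lemma homog_binom_test N n z0 S : homog n S -> forall m, homog m (binom_test N n z0 S m).
Proof.
move=> hS m; rewrite /binom_test; case: ltnP => nm; first exact: homog0.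
have hX := homogX (m - n) (homog_cinner z0); rewrite muln1 in hX.
by have := homogM (homogZ 'C(N, m - n)%:R hX) hS; rewrite subnK.
Qed.

Lemma sum_binom_test N n z0 S z (a : nat -> R[i]) :
  \sum_(m < n + N.+1) a m * binom_test N n z0 S m z =
  (\sum_(j < N.+1) a (n + j)%N * ('C(N, j)%:R * cinner z z0 ^+ j)) * S z.
Proof.
rewrite -(big_mkord xpredT (fun m => a m * binom_test N n z0 S m z)) (@big_cat_nat _ _ _ n)//= ?leq_addr//.
rewrite big_nat_cond big1 ?add0r; last by move=> m /andP[/andP[_ mn] _]; rewrite /binom_test mn mulr0.
rewrite -{1}(add0n n) big_addn addKn big_mkord mulr_suml; apply: eq_bigr => j _.
by rewrite /binom_test ltnNge leq_addl/= addnK addnC -!mulrA.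
Qed.

Lemma hpoly_binom N n z0 S z : hpoly (n + N.+1) (binom_test N n z0 S) z = (1 + cinner z z0) ^+ N * S z.
Proof.
rewrite /hpoly (eq_bigr (fun m : 'I_(n + N.+1) => 1 * binom_test N n z0 S m z)) => [|m _]; last by rewrite mul1r.
rewrite (@sum_binom_test N n z0 S z (fun=> 1)) exprDn; congr (_ * _); apply: eq_bigr => j _.
by rewrite mul1r expr1n mul1r mulr_natl.
Qed.

(** The degrees lie between [n] and [n + N], where the multiplier [(1 + m)^k] equals [(1 + n)^k] up
    to a relative error of order [1 / n]. Hence at distance about [1 / n] from the sphere the
    derivative is comparable to [n^k] times the function. [K] collects the errors and vanishes for
    [N = 0]. *)
Lemma binom_lower : exists2 k0 : R, 0 < k0 & forall N, exists2 K : R, 0 <= K /\ (N = 0%N -> K = 0) &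
  forall z0 n c S, sphere d z0 -> (0 < n)%N -> homog n S ->
   (forall z m, hom c z m = if (m < n + N.+1)%N then binom_test N n z0 S m z else 0) ->
   forall z, sphere d z ->
   ((k0 * (n%:R `^ s * (cabs (S z) * Num.max 0 (cabs (1 + cinner z z0) ^+ N - K / n%:R))) `^ p)%:E
     <= poweR (HF_inner s q c z) (outer_exp p q))%E.
Proof.
have [k1 k10 Hk] := @inner_lower R d s p q s0 p0 q0; set k := splus s in Hk.
have ks : 0 < k%:R - s by exact: splus_gt.
pose b : R := 1 / 2 * (4 `^ (k%:R - s))^-1; have b0 : 0 < b by rewrite mulr_gt0 ?invr_gt0 ?powR_gt0.
exists (k1 * b `^ p); first by rewrite mulr_gt0 ?powR_gt0.
move=> N; pose E : R := k%:R * N%:R * (1 + N%:R) ^+ k.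
have E0 : 0 <= E by rewrite !mulr_ge0 ?exprn_ge0 ?addr_ge0.
exists ((N%:R + E) * 2 ^+ N).
  split; first by rewrite mulr_ge0 ?exprn_ge0 ?addr_ge0.
  by move=> N0; rewrite /E N0 mulr0 mul0r add0r mul0r.
set K := (N%:R + E) * _.
move=> z0 n c S z0s n0 hS hc z zs.
have nR : 0 < n%:R :> R by rewrite ltr0n.
have n1 : 1 <= n%:R :> R by rewrite ler1n.
set u := cinner z z0; have u1 : cabs u <= 1 by exact: cabs_cinner.
set X := Num.max 0 _; have X0 : 0 <= X by rewrite le_max lexx.
(* On the corresponding shell [r^n >= 1/2], by Bernoulli's inequality. *)
pose eta : R := (4 * n%:R)^-1; have e0 : 0 < eta by rewrite invr_gt0 mulr_gt0.
have e1 : eta * n%:R = 1 / 4 by rewrite /eta; field; rewrite gt_eqF.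
have e2 : eta <= 1 / 4 by rewrite -e1 ler_peMr// ltW.
pose G : R := 1 / 2 * ((1 + n%:R) ^+ k * (cabs (S z) * X)).
have np : 0 <= (1 + n%:R) ^+ k :> R by rewrite exprn_ge0// addr_ge0.
have G0 : 0 <= G by rewrite !mulr_ge0// cabs_ge0.
have hG (r : R) : 1 - 2 * eta <= r <= 1 - eta -> G <= cabs (pseries (radI k c) (scale r z)).
  move=> /andP[r1 r2]; have r0 : 0 <= r by lra.
  have r3 : r <= 1 by lra.
  rewrite (test_pseries hc) (eq_bigr (fun m : 'I_(n + N.+1) => (((1 + m)%:R ^+ k +i* 0)%C * (r +i* 0)%C ^+ m) * binom_test N n z0 S m z)); last first.
    by move=> m _; rewrite scaleE (homog_scale _ _ (homog_binom_test N z0 hS m)) mulrA.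
  rewrite (@sum_binom_test N n z0 S z (fun m => ((1 + m)%:R ^+ k +i* 0)%C * (r +i* 0)%C ^+ m)) -/u.
  pose A : R[i] := \sum_(j < N.+1) ((1 + (n + j))%:R ^+ k +i* 0)%C * ('C(N, j)%:R * ((r +i* 0)%C * u) ^+ j).
  have -> : \sum_(j < N.+1) ((1 + (n + j))%:R ^+ k +i* 0)%C * (r +i* 0)%C ^+ (n + j) * ('C(N, j)%:R * u ^+ j) =
      (r +i* 0)%C ^+ n * A.
    rewrite /A mulr_sumr; apply: eq_bigr => j _; rewrite exprD exprMn; ring.
  rewrite !cabsM cabsX cabs_real//.
  have rn : 1 / 2 <= r ^+ n.
    have h1 : 1 - 2 * eta <= r by [].
    have h2 : 1 - n%:R * (2 * eta) <= (1 - 2 * eta) ^+ n.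
      have x01 : 0 <= 1 - 2 * eta <= 1 by apply/andP; split; lra.
      by have /andP[_] := one_sub_expr n x01; rewrite subKr; lra.
    apply: le_trans (_ : (1 - 2 * eta) ^+ n <= _); first lra.
    by rewrite lerXn2r// nnegrE; lra.
  have ru : cabs ((r +i* 0)%C * u) <= 1 by rewrite cabsM cabs_real// mulr_ile1// cabs_ge0.
  have A1 : (1 + n%:R) ^+ k * X <= cabs A.
    (* The part of [A] due to the variation of the multiplier with [j]; the remaining part is
       [(1 + n)^k (1 + r u)^N]. *)
    pose D : R[i] := \sum_(j < N.+1) (((1 + (n + j))%:R ^+ k - (1 + n%:R) ^+ k) +i* 0)%C * ('C(N, j)%:R * ((r +i* 0)%C * u) ^+ j).
    have AE : A = ((1 + n%:R) ^+ k +i* 0)%C * (1 + (r +i* 0)%C * u) ^+ N + D.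
      rewrite [(1 + (r +i* 0)%C * u) ^+ N]exprDn mulr_sumr /A /D -big_split/=; apply: eq_bigr => j _.
      rewrite expr1n mul1r -[X in _ * X + _]mulr_natl -mulrDl; congr (_ * _).
      by apply/eqP; rewrite eq_complex/= addr0 addrC subrK !eqxx.
    have D1 : cabs D <= (1 + n%:R) ^+ k * (E / n%:R) * 2 ^+ N.
      apply: (le_trans (cabs_sum _ _ _)).
      have -> : (2 : R) ^+ N = \sum_(j < N.+1) 'C(N, j)%:R.
        by rewrite -[X in X ^+ _](_ : 1 + 1 = 2 :> R)// exprDn; apply: eq_bigr => j _; rewrite !expr1n mulr1.
      rewrite [leRHS]mulr_sumr.
      apply: ler_sum => j _.
      rewrite !cabsM natr_complex [cabs (_%:R +i* _)%C]cabs_real// cabsX.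
      have jN : j%:R <= N%:R :> R by rewrite ler_nat -ltnS.
      have L : `|(1 + n%:R + j%:R : R) ^+ k - (1 + n%:R) ^+ k| <= (1 + n%:R) ^+ k * (E / n%:R).
        pose rho : R := (1 + n%:R) * (1 + N%:R); have rho0 : 0 < rho by rewrite mulr_gt0// ltr_wpDr.
        have h1 : 0 <= (1 + n%:R + j%:R : R) <= rho.
          rewrite !addr_ge0//= /rho mulrDr mulr1 lerD2l; apply: (le_trans jN).
          by rewrite ler_peMl// lerDl.
        have h2 : 0 <= (1 + n%:R : R) <= rho by rewrite addr_ge0//= /rho ler_peMr ?addr_ge0// lerDl.
        have := expr_lip k h1 h2; rewrite [1 + n%:R + j%:R - _]addrAC subrr add0r (ger0_norm (ler0n _ _)).
        set Y := `|_| => h3; have : rho * Y <= rho * ((1 + n%:R) ^+ k * (E / n%:R)); last by rewrite ler_pM2l.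
        apply: (le_trans h3); rewrite /E {1}/rho exprMn.
        have -> : rho * ((1 + n%:R) ^+ k * (k%:R * N%:R * (1 + N%:R) ^+ k / n%:R)) =
           k%:R * ((1 + n%:R) ^+ k * (1 + N%:R) ^+ k) * (N%:R * (rho / n%:R)) by ring.
        apply: ler_wpM2l; first by rewrite mulr_ge0// mulr_ge0 ?exprn_ge0 ?addr_ge0.
        rewrite -[leLHS]mulr1; apply: ler_pM => //.
        rewrite ler_pdivlMr// mul1r /rho; apply: (@le_trans _ _ (1 + n%:R)); first by rewrite lerDr.
        by rewrite ler_peMr ?addr_ge0// lerDl.
      have -> : cabs (((1 + (n + j))%:R ^+ k - (1 + n%:R) ^+ k) +i* 0)%C = `|(1 + n%:R + j%:R : R) ^+ k - (1 + n%:R) ^+ k|.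
        by rewrite /cabs/= expr0n/= addr0 sqrtr_sqr !natrD addrA.
      apply: ler_pM => //; first by rewrite mulr_ge0// exprn_ge0// cabs_ge0.
      by rewrite ler_piMr// exprn_ile1// cabs_ge0.
    (* Replacing [r u] by [u] costs at most [N 2^N / n], because [1 - r <= 2 eta]. *)
    have B1 : cabs (1 + u) ^+ N - N%:R * 2 ^+ N / n%:R <= cabs (1 + (r +i* 0)%C * u) ^+ N.
      have h1 : 0 <= cabs (1 + u) <= 2 by rewrite cabs_ge0 cabs_one_add.
      have h2 : 0 <= cabs (1 + (r +i* 0)%C * u) <= 2 by rewrite cabs_ge0 cabs_one_add.
      have h3 := expr_lip N h1 h2.
      have h4 : `|cabs (1 + u) - cabs (1 + (r +i* 0)%C * u)| <= n%:R^-1.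
        apply: (le_trans (cabs_dist _ _)).
        have -> : 1 + u - (1 + (r +i* 0)%C * u) = ((1 - r) +i* 0)%C * u.
          by case: (u) => x y; apply/eqP; rewrite eq_complex/=; apply/andP; split; apply/eqP; ring.
        rewrite cabsM cabs_real; last by lra.
        apply: (@le_trans _ _ ((1 - r) * 1)); first by rewrite ler_wpM2l//; lra.
        have : 1 - r <= 2 * eta by lra.
        have : 2 * eta <= n%:R^-1 by rewrite /eta invfM; have : 0 < n%:R^-1 :> R by [rewrite invr_gt0]; lra.
        lra.
      have h5 : 0 <= N%:R * 2 ^+ N :> R by rewrite mulr_ge0// exprn_ge0.
      have h6 : N%:R * 2 ^+ N * `|cabs (1 + u) - cabs (1 + (r +i* 0)%C * u)| <= N%:R * 2 ^+ N / n%:R by rewrite ler_wpM2l.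
      have h7 := ler_norm (cabs (1 + u) ^+ N - cabs (1 + (r +i* 0)%C * u) ^+ N).
      have h8 := normr_ge0 (cabs (1 + u) ^+ N - cabs (1 + (r +i* 0)%C * u) ^+ N).
      lra.
    have A2 : (1 + n%:R) ^+ k * cabs (1 + (r +i* 0)%C * u) ^+ N - cabs D <= cabs A.
      have := cabsD A (- D); rewrite {1}AE addrK cabsN cabsM cabsX cabs_real//; lra.
    rewrite /X; case: (ltP 0 (cabs (1 + u) ^+ N - K / n%:R)) => h; last by rewrite mulr0 cabs_ge0.
    apply: le_trans A2; rewrite lerBrDr.
    apply: (@le_trans _ _ ((1 + n%:R) ^+ k * (cabs (1 + u) ^+ N - N%:R * 2 ^+ N / n%:R))); last by rewrite ler_wpM2l.
    have -> : K / n%:R = N%:R * 2 ^+ N / n%:R + E / n%:R * 2 ^+ N by rewrite /K; ring.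
    rewrite opprD addrA [X in X + _]mulrBr -lerBrDl; apply: (le_trans D1).
    by rewrite -mulrA opprB addrCA subrr addr0.
  have -> : G = 1 / 2 * ((1 + n%:R) ^+ k * X) * cabs (S z) by rewrite /G; ring.
  rewrite ler_wpM2r ?cabs_ge0//; apply: ler_pM => //; exact: mulr_ge0.
have e12 : 0 < eta <= 1 / 2 by rewrite e0; lra.
apply: le_trans (Hk c z eta G e12 G0 hG).
rewrite lee_fin -mulrA ler_pM2l// -powRM ?(ltW b0) ?mulr_ge0 ?powR_ge0 ?cabs_ge0//.
apply: ge0_ler_powR; rewrite ?nnegrE ?(ltW p0) ?mulr_ge0 ?(ltW b0) ?powR_ge0 ?cabs_ge0//.
have -> : eta `^ (k%:R - s) = (4 `^ (k%:R - s))^-1 * (n%:R `^ s / n%:R ^+ k).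
  rewrite /eta -powR_inv1 ?mulr_ge0 ?(ltW nR)// -powRrM mulN1r powRM ?(ltW nR)// !powRN; congr (_ * _).
  rewrite -[n%:R ^+ k]powR_mulrn ?(ltW nR)// -!powRN -powRD; last by apply/implyP => _; rewrite gt_eqF.
  by congr (_ `^ _); ring.
have -> : G * ((4 `^ (k%:R - s))^-1 * (n%:R `^ s / n%:R ^+ k)) =
   b * (n%:R `^ s * (cabs (S z) * X)) * ((1 + n%:R) ^+ k / n%:R ^+ k).
  by rewrite /G /b; ring.
rewrite -[leLHS]mulr1; apply: ler_pM; rewrite ?mulr_ge0 ?(ltW b0) ?powR_ge0 ?cabs_ge0//.
by rewrite ler_pdivlMr ?exprn_gt0// mul1r lerXn2r ?nnegrE ?addr_ge0// lerDr.
Qed.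

End Binomial.

(** * Summation over signs *)

Section Randomized.
Variables (R : realType) (d : nat) (sigma mu : {measure set (Pt R d) -> \bar R}).
Hypothesis hs : normalized_surface_measure sigma.
Implicit Types (z w : Pt R d) (c : d.-tuple nat -> R[i]).
Variables (s p : R) (q : \bar R).
Hypotheses (s0 : 0 <= s) (p0 : 0 < p) (q0 : (0 < q)%E).
Variable C : R.
Hypotheses (C0 : 0 < C) (HC : forall c f, holo_on_ball c f -> cont_closed_ball f ->
    (HF_pnorm sigma s p q c < +oo)%E ->
    (HF_pnorm sigma s p q c <= C%:E * \int[mu]_(z in closed_ball d) (cabs (f z) `^ p)%:E)%E).

(** The inequality is summed over a whole family of tests; on the right only the sum of the [p]-th
    powers matters, and [B] bounds it pointwise. *)
Lemma random_test (I : finType) (h : I -> nat -> Pt R d -> R[i]) M (B : Pt R d -> R) :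
  (forall e m, homog m (h e m)) ->
  (forall z, closed_ball d z -> \sum_e cabs (hpoly M (h e) z) `^ p <= B z) ->
  exists2 c : I -> d.-tuple nat -> R[i],
    (forall e, (forall z m, hom (c e) z m = if (m < M)%N then h e m z else 0) /\ holo_on_ball (c e) (hpoly M (h e))) &
    (\sum_e HF_pnorm sigma s p q (c e) <= C%:E * \int[mu]_(z in closed_ball d) (B z)%:E)%E.
Proof.
move=> hh hB.
have /choice[c Hc] : forall e, exists c : d.-tuple nat -> R[i], (forall z m, hom c z m = if (m < M)%N then h e m z else 0) /\
    forall a, (M <= mdeg a)%N -> c a = 0.
  by move=> e; have [c h1 h2] := test_poly M (hh e); exists c.
have Hh e : holo_on_ball (c e) (hpoly M (h e)) by have [h1 h2] := Hc e; exact: test_holo.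
exists c; first by move=> e; split; [have [] := Hc e|exact: Hh].
have ct e : cont_closed_ball (hpoly M (h e)).
  by apply: tame_continuous; apply: tame_sum => m; exact: tame_homog (hh e m).
apply: (@le_trans _ _ (\sum_e C%:E * \int[mu]_(z in closed_ball d) (cabs (hpoly M (h e) z) `^ p)%:E)%E).
  apply: lee_sum => e _; apply: HC => //.
  by have [h1 _] := Hc e; exact: (test_finite hs s0 p0 q0 (hh e) h1).
rewrite -ge0_sume_distrr; last by move=> e _; apply: integral_ge0 => z _; rewrite lee_fin powR_ge0.
apply: lee_wpmul2l; first by rewrite lee_fin ltW.
rewrite -ge0_integral_sum; last 3 first.
- exact: measurable_closed_ball.
- by move=> e; exact: measurable_cabs_powR (Hh e) (ct e).
- by move=> e z _; rewrite lee_fin powR_ge0.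
apply: ge0_le_integral_any => z zb; first by apply: sume_ge0 => e _; rewrite lee_fin powR_ge0.
by rewrite sumEFin lee_fin; exact: hB.
Qed.

End Randomized.

(** * Nonexistence for positive [s] and transfer to the sphere *)

Section Consequences.
Variables (R : realType) (d : nat) (sigma mu : {measure set (Pt R d) -> \bar R}).
Hypotheses (d0 : (1 <= d)%N) (hs : normalized_surface_measure sigma) (hmu : finite_measure_on_closed_ball mu).
Implicit Types (z w : Pt R d) (c : d.-tuple nat -> R[i]).

Definition phi z0 z : R := cabs (1 + cinner z z0).
Lemma phi_ge0 z0 z : 0 <= phi z0 z. Proof. exact: cabs_ge0. Qed.
Lemma phi_le2 z0 z : sphere d z0 -> closed_ball d z -> phi z0 z <= 2.
Proof.
move=> /sphereP z1 /closed_ballP zb; apply: cabs_one_add.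
rewrite -(@ler_pXn2r _ 2) ?nnegrE ?cabs_ge0// expr1n cabs_sq; apply: le_trans zb; exact: cauchy_schwarz.
Qed.
Lemma measurable_phi2 : measurable_fun setT (fun x : Pt R d * Pt R d => phi x.1 x.2).
Proof.
apply: mfc_cabs; apply: mfcD; first exact: mfc_cst.
by apply: mfc_cinner; [exact: measurable_snd|exact: measurable_fst].
Qed.
Lemma measurable_phi z0 : measurable_fun setT (phi z0).
Proof.
apply: mfc_cabs; apply: mfcD; first exact: mfc_cst.
by apply: mfc_cinner; [exact: measurable_id|exact: measurable_cst].
Qed.

Section Main.
Variables (s p : R) (q : \bar R).
Hypotheses (s0 : 0 <= s) (p0 : 0 < p) (q0 : (0 < q)%E).
Hypothesis HRC : reverse_carleson sigma s p q mu.

(** [moment_lower] is used on the sphere, where the variance of the random polynomial is 1, and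
    [khinchine] on the closed ball, where it is [|z|^(2 n)]. The number of sign patterns cancels. *)
Lemma binom_main : exists k0 k1 : R, [/\ 0 < k0, 0 < k1 & forall N, exists2 K : R, 0 <= K /\ (N = 0%N -> K = 0) &
  forall z0 n, sphere d z0 -> (0 < n)%N ->
  ((k0 * n%:R `^ s `^ p)%:E * \int[sigma]_(z in sphere d) ((Num.max 0 (phi z0 z ^+ N - K / n%:R)) `^ p)%:E <=
   k1%:E * \int[mu]_(z in closed_ball d) ((phi z0 z ^+ N) `^ p * (pn2 z ^+ n) `^ (p / 2))%:E)%E].
Proof.
have [C C0 HC] := carleson_power p0 HRC.
have [k0 k00 Hk] := @binom_lower R d s p q s0 p0 q0.
pose c0 : R := large_prob R * (1 / 4) `^ (p / 2); have c00 : 0 < c0 by rewrite mulr_gt0 ?powR_gt0 ?large_prob_gt0.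
have Kp0 := @khinchine_const_gt0 R p p0.
exists (k0 * c0), (C * khinchine_const p); split; [exact: mulr_gt0|exact: mulr_gt0|].
move=> N; have [K HK H] := Hk N; exists K => // z0 n z0s n0.
pose T : finType := {ffun 'I_n -> 'I_d}.
pose S (e : {ffun T -> bool}) z := csum (fun i : T => unit_mono n i z) e.
have hS e : homog n (S e).
  apply: homog_sum => i; apply: homogZ; exact: (homog_unit_mono R (leqnn n) i).
have varS z : variance (fun i : T => unit_mono n i z) = pn2 z ^+ n by exact: unit_mono_variance.
pose card : R := 2 ^+ #|T|; have card0 : 0 < card by rewrite exprn_gt0.
pose h e := binom_test N n z0 (S e).
pose B' z : R := (phi z0 z ^+ N) `^ p * (pn2 z ^+ n) `^ (p / 2).
have B'0 z : 0 <= B' z by rewrite mulr_ge0 ?powR_ge0.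
pose B z : R := card * khinchine_const p * B' z.
have hB z : closed_ball d z -> \sum_e cabs (hpoly (n + N.+1) (h e) z) `^ p <= B z.
  move=> zb; under eq_bigr do rewrite hpoly_binom cabsM cabsX powRM ?exprn_ge0 ?cabs_ge0//.
  rewrite -mulr_sumr /B /B' -/(phi z0 z) [leRHS]mulrCA ler_wpM2l ?powR_ge0//.
  by rewrite -(varS z) -mulrA; exact: khinchine.
have [c Hc Hle] := random_test hs s0 p0 q0 C0 HC (fun e => homog_binom_test N z0 (hS e)) hB.
pose X z : R := Num.max 0 (phi z0 z ^+ N - K / n%:R).
have X0 z : 0 <= X z by rewrite le_max lexx.
pose L e z : R := k0 * (n%:R `^ s * (cabs (S e z) * X z)) `^ p.
have mX : measurable_fun setT X.
  apply: measurable_maxr; first exact: measurable_cst.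
  by apply: measurable_funB => //; apply: measurable_funX; exact: measurable_phi.
have mL e : measurable_fun (@sphere R d) (fun z => (L e z)%:E).
  apply/measurable_EFinP; apply: measurable_funTS; apply: measurable_funM => //.
  apply: (measurableT_comp (measurable_powR _)); apply: measurable_funM => //; apply: measurable_funM => //.
  by apply: mfc_cabs; exact: mfc_homog (hS e).
have L0 e z : 0 <= L e z by rewrite mulr_ge0 ?powR_ge0// ltW.
have low e : (\int[sigma]_(z in sphere d) (L e z)%:E <= HF_pnorm sigma s p q (c e))%E.
  apply: ge0_le_integral_any => z zs; first by rewrite lee_fin.
  by have [hc _] := Hc e; exact: (H z0 n (c e) (S e) z0s n0 (hS e) hc z zs).
have mXp : measurable_fun (@sphere R d) (fun z => (X z `^ p)%:E).
  apply/measurable_EFinP; apply: measurable_funTS; exact: (measurableT_comp (measurable_powR _)).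
have mB' : measurable_fun (@closed_ball R d) (fun z => (B' z)%:E).
  apply/measurable_EFinP; apply: measurable_funTS; apply: measurable_funM.
    by apply: (measurableT_comp (measurable_powR _)); apply: measurable_funX; exact: measurable_phi.
  by apply: (measurableT_comp (measurable_powR _)); apply: measurable_funX; exact: measurable_pn2.
have step : (card%:E * ((k0 * c0 * n%:R `^ s `^ p)%:E * \int[sigma]_(z in sphere d) (X z `^ p)%:E) <=
    \sum_e HF_pnorm sigma s p q (c e))%E.
  apply: (@le_trans _ _ (\sum_e \int[sigma]_(z in sphere d) (L e z)%:E)%E); last by apply: lee_sum => e _.
  rewrite -ge0_integral_sum//; last 2 first.
  - exact: measurable_sphere.
  - by move=> e z _; rewrite lee_fin.
  have k00' : 0 <= card * (k0 * c0 * n%:R `^ s `^ p).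
    apply: mulr_ge0; first exact: ltW.
    by apply: mulr_ge0; [apply: mulr_ge0; exact: ltW|exact: powR_ge0].
  rewrite muleA -EFinM -ge0_integralZl_EFin//; last 2 first.
  - exact: measurable_sphere.
  - by move=> z _; rewrite lee_fin powR_ge0.
  apply: ge0_le_integral_any => z zs; first by rewrite -EFinM lee_fin mulr_ge0// powR_ge0.
  rewrite sumEFin -EFinM lee_fin /L.
  under eq_bigr do rewrite powRM ?powR_ge0 ?mulr_ge0 ?cabs_ge0// powRM ?cabs_ge0// [cabs _ `^ p * _]mulrC !mulrA.
  rewrite -mulr_sumr.
  have := moment_lower (fun i : T => unit_mono n i z) p0; rewrite varS; have /sphereP -> := zs.
  rewrite expr1n -/card -/c0 => hm.
  apply: (@le_trans _ _ (k0 * n%:R `^ s `^ p * X z `^ p * (card * c0))); last first.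
    by rewrite ler_wpM2l// !mulr_ge0 ?powR_ge0// ltW.
  by rewrite le_eqVlt; apply/orP; left; apply/eqP; ring.
have BE : (\int[mu]_(z in closed_ball d) (B z)%:E =
    (card * khinchine_const p)%:E * \int[mu]_(z in closed_ball d) (B' z)%:E)%E.
  have cK0 := mulr_ge0 (ltW card0) (ltW Kp0).
  rewrite -ge0_integralZl_EFin//; last 2 first.
  - exact: measurable_closed_ball.
  - by move=> z _; rewrite lee_fin.
have := le_trans step Hle; rewrite BE.
have e2 : C * (card * khinchine_const p) = card * (C * khinchine_const p) by ring.
by rewrite [X in (_ <= X)%E]muleA -EFinM e2 [(card * _)%:E]EFinM -[X in (_ <= X)%E]muleA lee_pmul2l ?lte_fin.
Qed.

End Main.

Lemma no_carleson_pos (s p : R) (q : \bar R) : 0 < s -> 0 < p -> (0 < q)%E -> ~ reverse_carleson sigma s p q mu.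
Proof.
move=> s0 p0 q0 HRC; have [k0 [k1 [k00 k10 H]]] := binom_main (ltW s0) p0 q0 HRC.
have [K [_ K0] {}H] := H 0%N.
have mfin := mu_fin hmu.
pose m := fine (mu setT); have mE : mu setT = m%:E by rewrite fineK// ge0_fin_numE ?measure_ge0.
have m0 : 0 <= m by rewrite fine_ge0 ?measure_ge0.
have key n : (0 < n)%N -> k0 * n%:R `^ s `^ p <= k1 * m.
  move=> n0; have := H (north R d0) n (north_sphere R d0) n0; rewrite (K0 erefl) mul0r.
  rewrite (eq_integral (fun=> 1%:E)); last by move=> z _; rewrite expr0 subr0 max_r ?ler01// powR1.
  rewrite integral_cst; last exact: measurable_sphere.
  rewrite mul1e (sigma_sphere hs) mule1 => h; rewrite -lee_fin; apply: (le_trans h).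
  rewrite EFinM; apply: lee_wpmul2l; first by rewrite lee_fin ltW.
  apply: (@le_trans _ _ (\int[mu]_(z in closed_ball d) 1%:E)%E).
    apply: ge0_le_integral_any => z /closed_ballP zb; rewrite lee_fin; first by rewrite mulr_ge0 ?powR_ge0.
    rewrite expr0 powR1 mul1r; apply: powR_le1; last by rewrite divr_ge0// ltW.
    by rewrite exprn_ge0 ?pn2_ge0//= exprn_ile1 ?pn2_ge0.
  rewrite integral_cst; last exact: measurable_closed_ball.
  by rewrite mul1e -mE le_measure ?inE//; exact: measurable_closed_ball.
(* [n] is taken with [n^(s p) >= D], while [k0 D] exceeds the bound [k1 m]. *)
pose D := k1 * m / k0 + 1; have D0 : 0 < D by rewrite ltr_wpDl// divr_ge0 ?mulr_ge0// ltW.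
pose n := (Num.truncn (D `^ (s * p)^-1)).+1.
have nD : D `^ (s * p)^-1 <= n%:R by apply: ltW; exact: truncnS_gt.
have := key n (ltn0Sn _); rewrite -powRrM.
have h : D <= n%:R `^ (s * p).
  have sp0 : 0 < s * p by exact: mulr_gt0.
  have E : (D `^ (s * p)^-1) `^ (s * p) = D by rewrite -powRrM mulVf ?gt_eqF// powRr1// ltW.
  rewrite -[leLHS]E.
  by apply: ge0_ler_powR; rewrite ?nnegrE ?powR_ge0 ?ler0n// ltW.
have : k0 * D <= k0 * n%:R `^ (s * p) by rewrite ler_pM2l.
rewrite {1}/D mulrDr mulr1 mulrCA divff ?gt_eqF// mulr1; lra.
Qed.

(** [K] depends on [N], but it enters only as [K / n] and disappears in the limit, so the constant
    [k1 / k0] is the same for all [N]. The localisation below relies on this uniformity. *)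
Lemma sphere_transfer (p : R) (q : \bar R) : 0 < p -> (0 < q)%E -> reverse_carleson sigma 0 p q mu ->
  exists2 C : R, 0 < C & forall N z0, sphere d z0 ->
    (\int[sigma]_(z in sphere d) ((phi z0 z ^+ N) `^ p)%:E <=
     C%:E * \int[mu]_(z in sphere d) ((phi z0 z ^+ N) `^ p)%:E)%E.
Proof.
move=> p0 q0 HRC; have [k0 [k1 [k00 k10 H]]] := binom_main (lexx 0) p0 q0 HRC.
exists (k1 / k0); first exact: divr_gt0.
move=> N z0 z0s; have [K [K0 _] {}H] := H N.
pose S1 z : \bar R := (\1_(@sphere R d) z : R)%:E.
pose B1 z : \bar R := (\1_(@closed_ball R d) z : R)%:E.
have mS : measurable_fun setT S1.
  by apply/measurable_EFinP; apply: measurable_indic; exact: measurable_sphere.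
have mB : measurable_fun setT B1.
  by apply/measurable_EFinP; apply: measurable_indic; exact: measurable_closed_ball.
have S1E z : sphere d z -> S1 z = 1%E by move=> zs; rewrite /S1 indicE mem_set.
have S10 z : ~ sphere d z -> S1 z = 0%E by move=> zs; rewrite /S1 indicE memNset.
have B1E z : closed_ball d z -> B1 z = 1%E by move=> zs; rewrite /B1 indicE mem_set.
have B10 z : ~ closed_ball d z -> B1 z = 0%E by move=> zs; rewrite /B1 indicE memNset.
have phN0 z : 0 <= phi z0 z ^+ N by rewrite exprn_ge0 ?phi_ge0.
have phN z : closed_ball d z -> phi z0 z ^+ N <= 2 ^+ N.
  by move=> zb; rewrite lerXn2r ?nnegrE ?phi_ge0// phi_le2.
pose X n z : R := Num.max 0 (phi z0 z ^+ N - K / n.+1%:R).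
pose F n z : \bar R := ((X n z `^ p)%:E * S1 z)%E.
pose F' z : \bar R := (((phi z0 z ^+ N) `^ p)%:E * S1 z)%E.
pose G n z : \bar R := (((phi z0 z ^+ N) `^ p * (pn2 z ^+ n.+1) `^ (p / 2))%:E * B1 z)%E.
have mX n : measurable_fun setT (X n).
  apply: measurable_maxr; first exact: measurable_cst.
  by apply: measurable_funB => //; apply: measurable_funX; exact: measurable_phi.
have mphp : measurable_fun setT (fun z => (phi z0 z ^+ N) `^ p).
  by apply: (measurableT_comp (measurable_powR _)); apply: measurable_funX; exact: measurable_phi.
have mF n : measurable_fun setT (F n).
  by apply: emeasurable_funM => //; apply/measurable_EFinP; exact: (measurableT_comp (measurable_powR _)).
have mF' : measurable_fun setT F' by apply: emeasurable_funM => //; exact/measurable_EFinP.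
have mG n : measurable_fun setT (G n).
  apply: emeasurable_funM => //; apply/measurable_EFinP; apply: measurable_funM => //.
  by apply: (measurableT_comp (measurable_powR _)); apply: measurable_funX; exact: measurable_pn2.
have Kn0 n : 0 <= K / n.+1%:R by rewrite divr_ge0.
have X0 n z : 0 <= X n z by rewrite le_max lexx.
have XL n z : X n z <= phi z0 z ^+ N by rewrite ge_max phN0/= gerBl.
have p2 : 0 < p / 2 by rewrite divr_gt0.
have cF z : F n z @[n --> \oo] --> F' z.
  have [zs|zs] := pselect (sphere d z); last first.
    by rewrite /F' S10// mule0; under eq_fun do rewrite /F S10// mule0; exact: cvg_cst.
  rewrite /F' S1E// mule1; under eq_fun do rewrite /F S1E// mule1.
  apply: cvg_EFin; first exact: nearW.
  apply: (@cvg_powR R (X ^~ z)) => //.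
  apply/cvgrPdist_le => e e0.
  have h0 : K / n.+1%:R @[n --> \oo] --> 0 by rewrite -(mulr0 K); apply: cvgMr; exact: cvg_harmonic.
  have /cvgrPdist_le/(_ e e0) := h0; apply: filterS => n; rewrite sub0r normrN ger0_norm// => hn.
  rewrite ger0_norm ?subr_ge0// lerBlDr; apply: (@le_trans _ _ (e + (phi z0 z ^+ N - K / n.+1%:R))); first by rewrite addrCA lerDl subr_ge0.
  by rewrite lerD2l le_max lexx orbT.
have cG z : G n z @[n --> \oo] --> F' z.
  have [zb|zb] := pselect (closed_ball d z); last first.
    rewrite /F' S10 ?mule0; last by move=> /sphere_closed.
    by under eq_fun do rewrite /G B10// mule0; exact: cvg_cst.
  under eq_fun do rewrite /G B1E// mule1.
  have [zs|zs] := pselect (sphere d z).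
    rewrite /F' S1E// mule1; have /sphereP z1 := zs; under eq_fun do rewrite z1 expr1n powR1 mulr1.
    exact: cvg_cst.
  rewrite /F' S10// mule0; apply: cvg_EFin; first exact: nearW.
  rewrite -(mulr0 ((phi z0 z ^+ N) `^ p)); apply: cvgMr.
  have -> : 0 = 0 `^ (p / 2) :> R by rewrite powR0// gt_eqF.
  apply: (@cvg_powR R (fun n => pn2 z ^+ n.+1)) => //; first by move=> n; rewrite exprn_ge0 ?pn2_ge0.
  have z1 : pn2 z < 1.
    have /closed_ballP := zb; rewrite le_eqVlt => /predU1P[e|//].
    by case: zs; apply/sphereP.
  rewrite (cvg_shiftS (fun n => pn2 z ^+ n)); apply: cvg_expr; rewrite ger0_norm ?pn2_ge0//.
have bF n z : (`|F n z| <= ((2 ^+ N) `^ p)%:E)%E.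
  rewrite gee0_abs; last by rewrite mule_ge0// lee_fin ?powR_ge0 ?indicE.
  have [zs|zs] := pselect (sphere d z); last by rewrite /F S10// mule0 lee_fin powR_ge0.
  rewrite /F S1E// mule1 lee_fin; apply: ge0_ler_powR; rewrite ?nnegrE ?(ltW p0) ?exprn_ge0//.
  by apply: (le_trans (XL _ _)); apply: phN; exact: sphere_closed.
have bG n z : (`|G n z| <= ((2 ^+ N) `^ p)%:E)%E.
  rewrite gee0_abs; last by rewrite mule_ge0// lee_fin ?indicE// mulr_ge0 ?powR_ge0.
  have [zb|zb] := pselect (closed_ball d z); last by rewrite /G B10// mule0 lee_fin powR_ge0.
  rewrite /G B1E// mule1 lee_fin -[leRHS]mulr1; apply: ler_pM; rewrite ?powR_ge0//.
    by apply: ge0_ler_powR; rewrite ?nnegrE ?(ltW p0) ?exprn_ge0 ?phi_ge0// phN.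
  apply: powR_le1; last exact: ltW.
  by have /closed_ballP z1 := zb; rewrite exprn_ge0 ?pn2_ge0//= exprn_ile1 ?pn2_ge0.
have LF := bounded_cvg (sigma_fin hs) mF mF' bF cF.
have LG := bounded_cvg (mu_fin hmu) mG mF' bG cG.
have int_S (m : {measure set (Pt R d) -> \bar R}) (f g : Pt R d -> \bar R) : (forall z, g z = f z * S1 z)%E ->
    (\int[m]_(z in sphere d) f z = \int[m]_z g z)%E.
  by move=> E; apply: int_sphere => z zs; rewrite E; [rewrite S1E// mule1|rewrite S10// mule0].
rewrite !(@int_S _ _ F')//.
have step n : (k0%:E * \int[sigma]_z F n z <= k1%:E * \int[mu]_z G n z)%E.
  have := H z0 n.+1 z0s (ltn0Sn n); rewrite powRr0 powR1 mulr1 (@int_S _ _ (F n))// => h; apply: (le_trans h).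
  rewrite integral_mkcond; apply: lee_wpmul2l; first by rewrite lee_fin ltW.
  rewrite le_eqVlt; apply/orP; left; apply/eqP; apply: eq_integral => z _; rewrite /patch /G.
  case: ifPn => [|]; first by rewrite inE => zb; rewrite B1E// mule1.
  by rewrite notin_setE => zb; rewrite B10// mule0.
have h : (k0%:E * \int[sigma]_z F' z <= k1%:E * \int[mu]_z F' z)%E.
  have L1 : (k0%:E * \int[sigma]_z F n z)%E @[n --> \oo] --> (k0%:E * \int[sigma]_z F' z)%E by exact: cvgeZl.
  have L2 : (k1%:E * \int[mu]_z G n z)%E @[n --> \oo] --> (k1%:E * \int[mu]_z F' z)%E by exact: cvgeZl.
  rewrite -(cvg_lim _ L1)// -(cvg_lim _ L2)//; apply: lee_lim; [apply/cvg_ex; eexists; exact: L1|apply/cvg_ex; eexists; exact: L2|].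
  exact: nearW.
rewrite -(@lee_pmul2l _ k0%:E) ?lte_fin//; apply: (le_trans h).
by rewrite muleA -EFinM mulrCA divff ?gt_eqF// mulr1.
Qed.

End Consequences.

(** * Concentration on a non-isotropic ball *)

Section Localization.
Variables (R : realType) (d : nat) (sigma mu : {measure set (Pt R d) -> \bar R}).
Hypotheses (d0 : (1 <= d)%N) (hs : normalized_surface_measure sigma) (hmu : finite_measure_on_closed_ball mu).
Implicit Types (z w : Pt R d).

Lemma phiC z w : phi z w = phi w z.
Proof. by rewrite /phi (cinner_C z w) -[RHS]cabs_conj rmorphD rmorph1. Qed.

Lemma phi_act (U : 'M[R[i]]_d) z w : unitary U -> phi (act U z) (act U w) = phi z w.
Proof. by move=> uU; rewrite /phi cinner_act. Qed.

Lemma cinner_psub2 (z w u : Pt R d) : cinner z (psub w u) = cinner z w - cinner z u.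
Proof.
rewrite /cinner -sumrB; apply: eq_bigr => k _; rewrite -mulrBr; congr (_ * _).
rewrite coord_psub; case: (coord w k) (coord u k) => [a b] [a' b'].
by apply/eqP; rewrite eq_complex/=; apply/andP; split; apply/eqP; ring.
Qed.

(** With [u = <z, z0>] one has [|1 + u|^2 <= 2 + 2 Re u = 4 - |z - z0|^2] on the sphere. *)
Lemma phi_far z0 z (k : R) : sphere d z0 -> sphere d z -> 0 <= k -> k ^+ 2 <= pn2 (psub z z0) -> phi z0 z <= Num.sqrt (4 - k ^+ 2).
Proof.
move=> z0s zs k0 hk; have /sphereP z01 := z0s; have /sphereP z1 := zs.
rewrite pn2_psub// ReB in hk.
have h : phi z0 z ^+ 2 <= 4 - k ^+ 2.
  rewrite cabs_sq /n2 ReD ImD /=; have u1 := cabs_cinner zs z0s.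
  have u2 : n2 (cinner z z0) <= 1 by rewrite -cabs_sq exprn_ile1 ?cabs_ge0.
  by rewrite /n2 in u2; move: u2 hk; rewrite /=; move: (complex.Re (cinner z z0)) (complex.Im (cinner z z0)) => a b; rewrite !expr2; nra.
by rewrite -[leLHS](ger0_norm (phi_ge0 _ _)) -sqrtr_sqr ler_wsqrtr.
Qed.

Variables (p : R).
Hypothesis p0 : 0 < p.

Definition peak N : \bar R := (\int[sigma]_(z in sphere d) ((phi (north R d0) z ^+ N) `^ p)%:E)%E.

Let S1 z : \bar R := (\1_(@sphere R d) z : R)%:E.
Let mS : measurable_fun setT S1.
Proof. by apply/measurable_EFinP; apply: measurable_indic; exact: measurable_sphere. Qed.
Let S1E z : sphere d z -> S1 z = 1%E. Proof. by move=> zs; rewrite /S1 indicE mem_set. Qed.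
Let S10 z : ~ sphere d z -> S1 z = 0%E. Proof. by move=> zs; rewrite /S1 indicE memNset. Qed.
Let S1_ge0 z : (0 <= S1 z)%E. Proof. by rewrite lee_fin indicE. Qed.
Let int_S (m : {measure set (Pt R d) -> \bar R}) (f : Pt R d -> \bar R) :
  (\int[m]_(z in sphere d) f z = \int[m]_z (f z * S1 z))%E.
Proof. by apply: int_sphere => z zs; [rewrite S1E// mule1|rewrite S10// mule0]. Qed.

Let mphp N z0 : measurable_fun setT (fun z => ((phi z0 z ^+ N) `^ p)%:E).
Proof.
by apply/measurable_EFinP; apply: (measurableT_comp (measurable_powR _)); apply: measurable_funX; exact: measurable_phi.
Qed.
Let php0 N z0 z : (0 <= ((phi z0 z ^+ N) `^ p)%:E)%E. Proof. by rewrite lee_fin powR_ge0. Qed.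

Lemma peakE N z0 : sphere d z0 -> (\int[sigma]_(z in sphere d) ((phi z0 z ^+ N) `^ p)%:E = peak N)%E.
Proof.
move=> zs; have [U uU Uz] := transitive_sphere zs (north_sphere R d0).
rewrite /peak !int_S -[RHS](integral_act hs uU); last 2 first.
- by apply: emeasurable_funM.
- by move=> z; rewrite mule_ge0.
apply: eq_integral => z _; rewrite -Uz phi_act//; congr (_ * _)%E.
have [zs'|zs'] := pselect (sphere d z); first by rewrite !S1E//; exact/sphere_act.
by rewrite !S10// => /(sphere_act _ uU).
Qed.

Lemma peak_lower N (h : R) : 0 < h <= 2 ->
  ((((2 - h) ^+ N) `^ p)%:E * sigma (nonisotropic_ball (north R d0) h) <= peak N)%E.
Proof.
move=> /andP[h0 h2]; have ns := north_sphere R d0; have mQ := measurable_nonisotropic h ns.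
rewrite -(integral_cst sigma mQ) /peak integral_mkcond [leRHS]integral_mkcond.
apply: ge0_le_integral_any => z _; rewrite /patch; first by case: ifP => // _; rewrite lee_fin powR_ge0.
case: ifPn => [|_]; last by case: ifP.
rewrite inE => -[zs hz]; rewrite ifT ?inE// lee_fin.
apply: ge0_ler_powR; rewrite ?nnegrE ?(ltW p0) ?exprn_ge0 ?phi_ge0 ?subr_ge0//.
rewrite lerXn2r ?nnegrE ?phi_ge0 ?subr_ge0// phiC /phi.
have -> : 1 + cinner (north R d0) z = 2%:R - (1 - cinner (north R d0) z) by ring.
have := cabs_dist 2%:R (1 - cinner (north R d0) z); rewrite natr_complex cabs_real//.
by move=> /(le_trans (ler_norm _)); lra.
Qed.

Lemma peak_upper N : (peak N <= ((2 ^+ N) `^ p)%:E)%E.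
Proof.
rewrite -[leRHS]mule1 -(sigma_sphere hs) -(integral_cst sigma (@measurable_sphere R d)).
apply: ge0_le_integral_any => z zs; rewrite lee_fin ?powR_ge0//.
apply: ge0_ler_powR; rewrite ?nnegrE ?(ltW p0) ?exprn_ge0 ?phi_ge0//.
by rewrite lerXn2r ?nnegrE ?phi_ge0// phi_le2//; [exact: north_sphere|exact: sphere_closed].
Qed.

Variable C : R.
Hypotheses (C0 : 0 < C) (HC : forall N z0, sphere d z0 ->
    (\int[sigma]_(z in sphere d) ((phi z0 z ^+ N) `^ p)%:E <=
     C%:E * \int[mu]_(z in sphere d) ((phi z0 z ^+ N) `^ p)%:E)%E).

Section Ball.
Variables (z1 : Pt R d) (dl : R).
Hypotheses (z1s : sphere d z1) (dl0 : 0 < dl).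
Local Notation Q := (nonisotropic_ball z1 dl).
Let Q1 z : \bar R := (\1_Q z : R)%:E.
Let mQ : measurable_fun setT Q1.
Proof. by apply/measurable_EFinP; apply: measurable_indic; exact: measurable_nonisotropic. Qed.
Let Q1_ge0 z : (0 <= Q1 z)%E. Proof. by rewrite lee_fin indicE. Qed.

(** Superposition of the peak functions over the centres in [Q]. Divided by [peak N] it is at most 1
    everywhere and tends to 0 off [Q]. *)
Definition ballavg N z : \bar R := (\int[sigma]_w (((phi w z ^+ N) `^ p)%:E * Q1 w * S1 z))%E.

Let F N (x : Pt R d * Pt R d) : \bar R := (((phi x.1 x.2 ^+ N) `^ p)%:E * Q1 x.1 * S1 x.2)%E.
Let mF N : measurable_fun setT (F N).
Proof.
apply: emeasurable_funM; last exact: (measurableT_comp mS (@measurable_snd _ _ (Pt R d) (Pt R d))).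
apply: emeasurable_funM; last exact: (measurableT_comp mQ (@measurable_fst _ _ (Pt R d) (Pt R d))).
apply/measurable_EFinP; apply: (measurableT_comp (measurable_powR _)); apply: measurable_funX; exact: measurable_phi2.
Qed.
Let F0 N x : (0 <= F N x)%E. Proof. by rewrite /F !mule_ge0. Qed.

Lemma measurable_ballavg N : measurable_fun setT (ballavg N).
Proof.
exact: (@measurable_fun_fubini_tonelli_G _ _ _ _ R (fin_measure (sigma_fin hs)) _ (mF N) (F0 N)).
Qed.
Lemma ballavg_ge0 N z : (0 <= ballavg N z)%E.
Proof. by apply: integral_ge0 => w _; exact: (F0 N (w, z)). Qed.

Lemma ballavg_tonelli N : (peak N * sigma Q <= C%:E * \int[mu]_z ballavg N z)%E.
Proof.
have mQ' := measurable_nonisotropic dl z1s.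
have E1 := @fubini_tonelli1 _ _ _ _ R (fin_measure (sigma_fin hs)) (fin_measure (mu_fin hmu)) _ (mF N) (F0 N).
have E2 := @fubini_tonelli2 _ _ _ _ R (fin_measure (sigma_fin hs)) (fin_measure (mu_fin hmu)) _ (mF N) (F0 N).
have E : (\int[sigma]_w \int[mu]_z F N (w, z) = \int[mu]_z ballavg N z)%E by rewrite -[LHS]E1 E2.
have mG := @measurable_fun_fubini_tonelli_F _ _ _ _ R (fin_measure (mu_fin hmu)) _ (mF N) (F0 N).
rewrite -E -ge0_integralZl_EFin ?(ltW C0)//; last by move=> w _; apply: integral_ge0.
have pf : (peak N \is a fin_num)%E.
  rewrite ge0_fin_numE; first by apply: (le_lt_trans (peak_upper N)); rewrite ltry.
  by apply: integral_ge0.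
rewrite -(fineK pf) -(integral_cst sigma mQ') integral_mkcond.
apply: ge0_le_integral_any => w _; rewrite /patch.
  by case: ifP => // _; rewrite lee_fin fine_ge0//; apply: integral_ge0.
case: ifPn => [|_]; last by rewrite mule_ge0 ?lee_fin ?(ltW C0)//; apply: integral_ge0.
rewrite inE => wQ; have ws : sphere d w by case: wQ.
rewrite /cst fineK// -(peakE N ws); apply: (le_trans (HC N ws)).
apply: lee_wpmul2l; first by rewrite lee_fin ltW.
rewrite int_S le_eqVlt; apply/orP; left; apply/eqP; apply: eq_integral => z _.
by rewrite /F/= /Q1 indicE mem_set// mule1.
Qed.

Lemma ballavg_le N z : (ballavg N z <= peak N)%E.
Proof.
have [zs|zs] := pselect (sphere d z); last first.
  by rewrite /ballavg integral0_eq ?integral_ge0// => w _; rewrite S10// mule0.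
rewrite -(peakE N zs) int_S; apply: ge0_le_integral_any => w _; first exact: (F0 N (w, z)).
rewrite S1E// mule1 phiC; apply: lee_wpmul2l => //.
rewrite lee_fin !indicE; case: (boolP (w \in Q)) => // ; rewrite inE => -[ws _].
by rewrite mem_set.
Qed.

(** The gap [k = |1 - <z1, z>| - dl] is positive and bounds [|<z1, w - z>|] from below, hence also
    [|w - z|], for every centre [w] in [Q]; then [phi_far] applies uniformly. *)
Lemma ballavg_far z : sphere d z -> ~ Q z -> exists2 r : R, 0 <= r < 2 &
  forall N, (ballavg N z <= ((r ^+ N) `^ p)%:E)%E.
Proof.
move=> zs zQ; pose k := cabs (1 - cinner z1 z) - dl.
have k0 : 0 < k by rewrite subr_gt0 ltNge; apply/negP => h; apply: zQ; split.
exists (Num.sqrt (4 - k ^+ 2)).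
  rewrite sqrtr_ge0/= (_ : 2 = Num.sqrt (2 ^+ 2)); last by rewrite sqrtr_sqr ger0_norm.
  have kk : 0 < k ^+ 2 by rewrite exprn_gt0.
  by rewrite ltr_sqrt; rewrite ?exprn_gt0//; lra.
move=> N; rewrite -[leRHS]mule1 -(sigma_sphere hs) -(integral_cst sigma (@measurable_sphere R d)) int_S.
apply: ge0_le_integral_any => w _; first exact: (F0 N (w, z)).
rewrite S1E// mule1 /Q1 /S1 !indicE; case: (boolP (w \in Q)) => [|_]; last by rewrite mule0 mule_ge0 ?lee_fin ?powR_ge0.
rewrite inE => -[ws hw]; rewrite mem_set// !mule1 lee_fin.
apply: ge0_ler_powR; rewrite ?nnegrE ?(ltW p0) ?exprn_ge0 ?phi_ge0 ?sqrtr_ge0//.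
rewrite lerXn2r ?nnegrE ?phi_ge0 ?sqrtr_ge0//; apply: phi_far => //; first exact: ltW.
have e : 1 - cinner z1 z = (1 - cinner z1 w) + cinner z1 (psub w z) by rewrite cinner_psub2; ring.
have h1 : cabs (1 - cinner z1 z) <= dl + cabs (cinner z1 (psub w z)).
  by rewrite {1}e; apply: (le_trans (cabsD _ _)); rewrite lerD2r.
have h2 : cabs (cinner z1 (psub w z)) ^+ 2 <= pn2 (psub w z).
  by rewrite cinner_C cabs_conj cabs_sq; apply: cauchy_schwarz; exact/sphereP.
have h3 : k <= cabs (cinner z1 (psub w z)) by rewrite /k; lra.
have -> : pn2 (psub z w) = pn2 (psub w z).
  by rewrite /pn2; apply: eq_bigr => j _; rewrite !coord_psub -[X in n2 X = _]opprB -!cabs_sq cabsN.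
by apply: le_trans h2; rewrite lerXn2r ?nnegrE ?cabs_ge0// ltW.
Qed.

Lemma ball_domination : (sigma Q <= C%:E * mu Q)%E.
Proof.
have ns := north_sphere R d0; have mQ' := measurable_nonisotropic dl z1s.
have pgt N : (0 < peak N)%E.
  apply: lt_le_trans (@peak_lower N 1 _); last by rewrite ltr01 ler1n.
  apply: mule_gt0; last exact: sigma_ball_gt0.
  by rewrite lte_fin powR_gt0// exprn_gt0// subr_gt0 ltr1n.
have pf N : (peak N \is a fin_num)%E.
  rewrite ge0_fin_numE ?(ltW (pgt N))//; by apply: (le_lt_trans (peak_upper N)); rewrite ltry.
pose t N := fine (peak N); have tE N : peak N = (t N)%:E by rewrite fineK.
have t0 N : 0 < t N by rewrite -lte_fin -tE.
pose b N z : \bar R := ((t N)^-1%:E * (ballavg N z * (\1_(~` Q) z : R)%:E))%E.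
have mb N : measurable_fun setT (b N).
  apply: emeasurable_funM; first exact: measurable_cst.
  apply: emeasurable_funM; first exact: measurable_ballavg.
  by apply/measurable_EFinP; apply: measurable_indic; exact: measurableC.
have I0 z : (0 <= (\1_(~` Q) z : R)%:E :> \bar R)%E by rewrite lee_fin indicE.
have b0 N z : (0 <= b N z)%E by rewrite !mule_ge0 ?ballavg_ge0// lee_fin invr_ge0 ltW.
have bal1 N z : ((t N)^-1%:E * ballavg N z <= 1)%E.
  rewrite -(@lee_pmul2l _ (t N)%:E) ?lte_fin// muleA -EFinM divff ?gt_eqF// mul1e mule1 -tE.
  exact: ballavg_le.
have b1 N z : (`|b N z| <= 1%:E)%E.
  rewrite gee0_abs// /b muleA; apply: le_trans (bal1 N z).
  rewrite -[leRHS]mule1; apply: lee_wpmul2l; first by rewrite mule_ge0 ?ballavg_ge0// lee_fin invr_ge0 ltW.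
  by rewrite lee_fin indicE; case: (_ \in _).
have cb z : b N z @[N --> \oo] --> (0 : \bar R)%E.
  have [zQ|zQ] := pselect (Q z).
    rewrite (_ : b ^~ z = fun=> 0%E); first exact: cvg_cst.
    by apply/funext => N; rewrite /b indicE memNset ?mule0//=; exact.
  have [zs|zs] := pselect (sphere d z); last first.
    rewrite (_ : b ^~ z = fun=> 0%E); first exact: cvg_cst.
    apply/funext => N; rewrite /b /ballavg integral0_eq ?mul0e ?mule0// => w _; by rewrite S10// mule0.
  have [r /andP[r0 r2] Hr] := ballavg_far zs zQ.
  (* Ensures [r < 2 - h]. As [peak N] is at least a multiple of [(2 - h)^(N p)], the quotient decays
     geometrically. *)
  pose h := (2 - r) / 2; have h0 : 0 < h by rewrite divr_gt0// subr_gt0.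
  have h2 : h <= 2 by rewrite /h; lra.
  have r2h : r < 2 - h by rewrite /h; lra.
  have h2p : 0 < 2 - h by apply: le_lt_trans r2h.
  pose sg := fine (sigma (nonisotropic_ball (north R d0) h)).
  have sgE : sigma (nonisotropic_ball (north R d0) h) = sg%:E.
    rewrite fineK// ge0_fin_numE ?measure_ge0//; apply: le_lt_trans (sigma_fin hs).
    by apply: le_measure; rewrite ?inE//; exact: measurable_nonisotropic.
  have sg0 : 0 < sg by rewrite -lte_fin -sgE; exact: sigma_ball_gt0.
  pose x := (r / (2 - h)) `^ p.
  have q1 : r / (2 - h) < 1 by rewrite ltr_pdivrMr// mul1r.
  have q0' : 0 <= r / (2 - h) by rewrite divr_ge0// ltW.
  have x1 : `|x| < 1.
    rewrite ger0_norm ?powR_ge0//; have e1 : 1 `^ p = 1 :> R by rewrite powR1.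
    by rewrite -[ltRHS]e1 /x; apply: gt0_ltr_powR; rewrite ?nnegrE.
  have bnd N : (b N z <= (x ^+ N * sg^-1)%:E)%E.
    have hb : (b N z <= (t N)^-1%:E * ((r ^+ N) `^ p)%:E)%E.
      apply: lee_wpmul2l; first by rewrite lee_fin invr_ge0 ltW.
      rewrite indicE mem_set// mule1; exact: Hr.
    apply: (le_trans hb); rewrite -EFinM lee_fin.
    have tl : ((2 - h) ^+ N) `^ p * sg <= t N.
      by rewrite -lee_fin -tE EFinM -sgE; apply: peak_lower; rewrite h0.
    have a0 : 0 < ((2 - h) ^+ N) `^ p by rewrite powR_gt0// exprn_gt0.
    have -> : x ^+ N = (r ^+ N) `^ p / ((2 - h) ^+ N) `^ p.
      rewrite /x -powR_mulrn ?powR_ge0// -powRrM [p * _]mulrC powRrM powR_mulrn// expr_div_n.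
      apply: (canRL (mulfK (lt0r_neq0 a0))).
      by rewrite -powRM ?divr_ge0 ?exprn_ge0 ?(ltW h2p)// divfK// gt_eqF// exprn_gt0.
    rewrite mulrC -mulrA ler_wpM2l ?powR_ge0// -invfM lef_pV2 ?posrE// mulr_gt0//.
  have hx : x ^+ N * sg^-1 @[N --> \oo] --> 0.
    by rewrite -(mul0r sg^-1); apply: cvgMl; exact: cvg_expr.
  apply: (@squeeze_cvge _ _ _ _ (fun=> 0%E) _ (fun N => (x ^+ N * sg^-1)%:E)).
  - by apply: nearW => N; rewrite b0 bnd.
  - exact: cvg_cst.
  - by apply: cvg_EFin => //; exact: nearW.
have LB := bounded_cvg (mu_fin hmu) mb (measurable_cst (0 : \bar R)%E) b1 cb.
rewrite integral0 in LB.
have step N : (sigma Q <= C%:E * (mu Q + \int[mu]_z b N z))%E.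
  rewrite -(@lee_pmul2l _ (t N)%:E) ?lte_fin// -tE; apply: (le_trans (ballavg_tonelli N)).
  rewrite muleCA; apply: lee_wpmul2l; first by rewrite lee_fin ltW.
  have split z : (ballavg N z <= (t N)%:E * Q1 z + (t N)%:E * b N z)%E.
    have e : ((t N)%:E * b N z = ballavg N z * (\1_(~` Q) z : R)%:E)%E.
      by rewrite /b muleA -EFinM divff ?gt_eqF// mul1e.
    rewrite e /Q1 !indicE.
    have [zQ|zQ] := pselect (Q z).
      by rewrite mem_set// memNset ?mule1 ?mule0 ?adde0 -?tE ?ballavg_le//=; exact.
    by rewrite memNset// mem_set// mule0 mule1 add0e.
  apply: (@le_trans _ _ (\int[mu]_z ((t N)%:E * Q1 z + (t N)%:E * b N z))%E).
    by apply: ge0_le_integral_any => z _; [exact: ballavg_ge0|exact: split].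
  have tN := ltW (t0 N).
  rewrite ge0_integralD//; last 4 first.
  - by move=> z _; rewrite mule_ge0.
  - by apply: emeasurable_funM => //; exact: measurable_cst.
  - by move=> z _; rewrite mule_ge0.
  - by apply: emeasurable_funM => //; exact: measurable_cst.
  have q1 : (\int[mu]_z Q1 z = mu Q)%E.
    by transitivity (mu (Q `&` setT)); [exact: integral_indic|rewrite setIT].
  have i1 : (\int[mu]_z ((t N)%:E * Q1 z) = (t N)%:E * mu Q)%E by rewrite ge0_integralZl_EFin// q1.
  have i2 : (\int[mu]_z ((t N)%:E * b N z) = (t N)%:E * \int[mu]_z b N z)%E.
    by apply: ge0_integralZl_EFin.
  have J0 : (0 <= \int[mu]_z b N z)%E by apply: integral_ge0 => z _; exact: b0.
  by rewrite i1 i2 tE -ge0_muleDr// measure_ge0.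
have L : (C%:E * (mu Q + \int[mu]_z b N z))%E @[N --> \oo] --> (C%:E * (mu Q + 0))%E.
  apply: cvgeZl => //; apply: cvgeD; [|exact: cvg_cst|exact: LB].
  by rewrite ge0_adde_def// inE.
rewrite adde0 in L; rewrite -(cvg_lim _ L)//; apply: lime_ge; first by apply/cvg_ex; eexists; exact: L.
by apply: nearW.
Qed.
End Ball.

End Localization.

(** * Lacunary test functions for [q <= 1] *)

Section Lacunary.
Variables (R : realType) (d : nat) (sigma mu : {measure set (Pt R d) -> \bar R}).
Hypotheses (d0 : (1 <= d)%N) (hs : normalized_surface_measure sigma) (hmu : finite_measure_on_closed_ball mu).
Implicit Types (z w : Pt R d).

(** Sets the [l]-th shell [1 - 2 leta l <= r < 1 - leta l], at distance about [2^(-l)] from 1, the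
    scale of the degree [2^l]. Halving at each step makes the shells disjoint. *)
Definition leta (l : nat) : R := (2 ^+ l.+2)^-1.
Lemma leta_gt0 l : 0 < leta l. Proof. by rewrite invr_gt0 exprn_gt0. Qed.
Lemma letaS l : leta l = 2 * leta l.+1.
Proof. by rewrite /leta !exprS; field; rewrite expf_neq0// pnatr_eq0. Qed.
Lemma leta_mono l l' : (l <= l')%N -> leta l' <= leta l.
Proof. by move=> ll; rewrite lef_pV2 ?posrE ?exprn_gt0// ler_weXn2l// ler1n. Qed.
Lemma leta_le l : leta l <= 1 / 4.
Proof. by apply: (le_trans (leta_mono (leq0n l))); rewrite /leta expr2; lra. Qed.

Definition lind l (r : R) : R := (1 - 2 * leta l <= r < 1 - leta l)%R%:R.
Definition lint l : set R := `[1 - 2 * leta l, 1 - leta l[%classic.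

Lemma lindE l r : lind l r = \1_(lint l) r.
Proof.
rewrite /lind indicE; congr ((nat_of_bool _)%:R).
by apply/idP/idP; rewrite inE /lint/= in_itv.
Qed.
Lemma measurable_lind l : measurable_fun setT (lind l).
Proof. by rewrite (_ : lind l = \1_(lint l)); [apply: measurable_indic; exact: measurable_itv|apply/funext => r; exact: lindE]. Qed.
Lemma lind_ge0 l r : 0 <= lind l r. Proof. by []. Qed.

Lemma integral_lind l : (\int[lebesgue_measure]_r ((leta l)^-1 * lind l r)%:E = 1)%E.
Proof.
have l0 := leta_gt0 l.
under eq_integral do rewrite lindE EFinM.
rewrite ge0_integralZl_EFin ?invr_ge0 ?(ltW l0)//; last first.
  by apply/measurable_EFinP; apply: measurable_indic; exact: measurable_itv.
rewrite integral_indic ?setIT//; last exact: measurable_itv.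
rewrite /lint [X in (_ * X)%E]lebesgue_measure_itv/= lte_fin ifT; last by lra.
by rewrite -EFinB -EFinM; congr (_%:E); field; rewrite gt_eqF.
Qed.

Lemma lind_disjoint l l' r : l != l' -> lind l r != 0 -> lind l' r = 0.
Proof.
wlog ll : l l' / (l < l')%N => [W|_].
  rewrite neq_ltn => /orP[h|h] h1; first by apply: (W l l') => //; rewrite neq_ltn h.
  apply/eqP; apply: contraT => h2; have := W l' l h _ h2; rewrite neq_ltn h => /(_ isT) e.
  by rewrite e eqxx in h1.
rewrite /lind !pnatr_eq0 !eqb0 negbK => /andP[h1 h2]; apply/eqP; rewrite pnatr_eq0 eqb0; apply/negP => /andP[h3 h4].
by have := leta_mono ll; have := letaS l; lra.
Qed.

Lemma sum_disjoint m (r : R) (F : 'I_m -> R) (X : R) : 0 <= X -> (forall l, F l * lind l r <= X) ->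
  \sum_(l < m) F l * lind l r <= X.
Proof.
move=> X0 hF; have [/existsP[l hl]|N] := boolP [exists l : 'I_m, lind l r != 0].
  rewrite (bigD1 l)//= big1 ?addr0// => j jl; rewrite (@lind_disjoint l j r) ?mulr0//.
  by rewrite eq_sym.
rewrite big1// => l _; move: N; rewrite negb_exists => /forallP/(_ l); rewrite negbK => /eqP->.
by rewrite mulr0.
Qed.

(* [(1 - 2^(-l-1))^(2^l) >= 1/2] by Bernoulli *)
Lemma lac_power l (r : R) : 1 - 2 * leta l <= r < 1 - leta l -> 1 / 2 <= r ^+ (2 ^ l).
Proof.
move=> /andP[h1 h2]; have l4 := leta_le l; have l0 := leta_gt0 l.
have x01 : 0 <= 1 - 2 * leta l <= 1 by apply/andP; split; lra.
have /andP[_] := one_sub_expr (2 ^ l) x01; rewrite subKr natrX => h.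
have e : 2 ^+ l * (2 * leta l) = 1 / 2 :> R.
  by rewrite /leta !exprS; field; rewrite expf_neq0// pnatr_eq0.
rewrite e in h; apply: (@le_trans _ _ ((1 - 2 * leta l) ^+ (2 ^ l))); first lra.
by rewrite lerXn2r// nnegrE; lra.
Qed.

Variables (p q : R).
Hypotheses (p0 : 0 < p) (q0 : 0 < q) (q1 : q <= 1).
Hypothesis HRC : reverse_carleson sigma 0 p q%:E mu.

Section Fixed.
Variable m : nat.
Hypothesis m0 : (0 < m)%N.
Local Notation T := ('I_m * {ffun 'I_(2 ^ m) -> 'I_d})%type.
Local Notation sign := {ffun T -> bool}.

Definition lmono (t : T) z : R[i] := unit_mono (2 ^ t.1) t.2 z.
Lemma lev_le (j : 'I_m) : (2 ^ j <= 2 ^ m)%N. Proof. by rewrite leq_exp2l// ltnW. Qed.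

Lemma sum_lmono (F : 'I_m -> R) z : \sum_(t : T) F t.1 * n2 (lmono t z) = \sum_(j < m) F j * pn2 z ^+ (2 ^ j).
Proof.
rewrite -(pair_big xpredT xpredT (fun (j : 'I_m) i => F j * n2 (lmono (j, i) z)))/=.
by apply: eq_bigr => j _; rewrite -mulr_sumr (unit_mono_variance d0 (lev_le j)).
Qed.

Definition lpart (e : sign) k z : R[i] := \sum_(t : T | (2 ^ t.1)%N == k) (sgn R (e t) +i* 0)%C * lmono t z.

Lemma homog_lpart e k : homog k (lpart e k).
Proof.
have H : forall t : T, homog k (fun z => if (2 ^ t.1)%N == k then (sgn R (e t) +i* 0)%C * lmono t z else 0).
  move=> t; case: eqP => [<-|_]; last exact: homog0.
  by apply: homogZ; exact: (homog_unit_mono R (lev_le t.1) t.2).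
by apply: homog_ext (homog_sum (index_enum _) xpredT H) => z; rewrite /lpart [RHS]big_mkcond.
Qed.

Local Notation M := (2 ^ m).+1.
Lemma sum_lpart (a : nat -> R[i]) e z :
  \sum_(k < M) a k * lpart e k z = csum (fun t : T => a (2 ^ t.1)%N * lmono t z) e.
Proof.
have lt (t : T) : (2 ^ t.1 < M)%N by rewrite ltnS lev_le.
rewrite /csum (partition_big (fun t : T => Ordinal (lt t)) xpredT)//=; apply: eq_bigr => k _.
by rewrite /lpart mulr_sumr; apply: eq_bigr => t /eqP tk; rewrite tk mulrCA.
Qed.

Definition lfun (e : sign) z : R[i] := hpoly M (lpart e) z.
Lemma lfunE e z : lfun e z = csum (fun t : T => lmono t z) e.
Proof.
rewrite /lfun /hpoly (eq_bigr (fun k : 'I_M => 1 * lpart e k z)) => [|k _]; last by rewrite mul1r.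
by rewrite (sum_lpart (fun=> 1)); congr (csum _ e); apply/funext => t; rewrite mul1r.
Qed.

Lemma lfun_moment z : closed_ball d z ->
  \sum_(e : sign) cabs (lfun e z) `^ p <= 2 ^+ #|{: T}| * (khinchine_const p * m%:R `^ (p / 2)).
Proof.
move=> /closed_ballP zb; under eq_bigr do rewrite lfunE.
apply: (le_trans (khinchine _ p0)); rewrite ler_wpM2l ?exprn_ge0// ler_wpM2l ?(ltW (khinchine_const_gt0 p0))//.
apply: ge0_ler_powR; rewrite ?nnegrE ?variance_ge0 ?ler0n ?divr_ge0 ?(ltW p0)//.
rewrite /variance (eq_bigr (fun t : T => 1 * n2 (lmono t z))) => [|t _]; last by rewrite mul1r.
rewrite (sum_lmono (fun=> 1)) -[X in _ <= X%:R](card_ord m) -sum1_card natr_sum; apply: ler_sum => j _.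
by rewrite mul1r exprn_ile1 ?pn2_ge0.
Qed.

Variables (c : sign -> d.-tuple nat -> R[i]).
Hypothesis hc : forall e z k, hom (c e) z k = if (k < M)%N then lpart e k z else 0.

Definition lgrad e z (r : R) : R := cabs (pseries (radI 1 (c e)) (scale r z)).

Lemma lgradE e z r : lgrad e z r =
  cabs (csum (fun t : T => (((1 + 2 ^ t.1)%:R * r ^+ (2 ^ t.1)) +i* 0)%C * lmono t z) e).
Proof.
rewrite /lgrad (test_pseries (hc e)) (eq_bigr (fun k : 'I_M => (((1 + k)%:R * r ^+ k) +i* 0)%C * lpart e k z)) => [|k _].
  by rewrite (sum_lpart (fun k => (((1 + k)%:R * r ^+ k) +i* 0)%C)).
rewrite scaleE (homog_scale _ _ (homog_lpart e k)) mulrA; congr (_ * _); rewrite expr1.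
have -> : (r +i* 0)%C ^+ k = (r ^+ k +i* 0)%C.
  elim: (nat_of_ord k) => [|j IH]; first by rewrite !expr0.
  by rewrite !exprS IH; apply/eqP; rewrite eq_complex/=; apply/andP; split; apply/eqP; ring.
by apply/eqP; rewrite eq_complex/=; apply/andP; split; apply/eqP; ring.
Qed.

Lemma measurable_lgrad e z : measurable_fun setT (lgrad e z).
Proof.
rewrite (_ : lgrad e z = (fun r => cabs (csum (fun t : T => (((1 + 2 ^ t.1)%:R * r ^+ (2 ^ t.1)) +i* 0)%C * lmono t z) e))).
  apply: mfc_cabs; apply: mfc_sum => t; apply: mfcM; first exact: mfc_cst.
  apply: mfcM; last exact: mfc_cst.
  by apply: mfc_real; apply: measurable_funM; [exact: measurable_cst|exact: measurable_funX].
by apply/funext => r; rewrite lgradE.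
Qed.

(* the derivative is of size [2^l] on the [l]-th dyadic shell, for a fixed proportion of signs *)
Lemma lgrad_large z (l : 'I_m) r : sphere d z -> 1 - 2 * leta l <= r < 1 - leta l ->
  2 ^+ #|{: T}| * large_prob R <= \sum_(e : sign) ((1 / 16 <= leta l * lgrad e z r)%R%:R : R).
Proof.
move=> /sphereP z1 hr; set u := fun t : T => (((1 + 2 ^ t.1)%:R * r ^+ (2 ^ t.1)) +i* 0)%C * lmono t z.
have r0 : 0 <= r by case/andP: hr => h1 _; have := leta_le l; lra.
have v : (2 ^+ l / 2) ^+ 2 <= variance u.
  rewrite /variance (eq_bigr (fun t : T => ((1 + 2 ^ t.1)%:R * r ^+ (2 ^ t.1)) ^+ 2 * n2 (lmono t z))) => [|t _].
    rewrite (sum_lmono (fun j : 'I_m => ((1 + 2 ^ j)%:R * r ^+ (2 ^ j)) ^+ 2)) z1 (bigD1 l)//= expr1n mulr1.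
    apply: (@le_trans _ _ (((1 + 2 ^ l)%:R * r ^+ (2 ^ l)) ^+ 2)).
      rewrite lerXn2r ?nnegrE ?divr_ge0 ?mulr_ge0 ?exprn_ge0//; apply: ler_pM; rewrite ?exprn_ge0//.
        by rewrite natrD natrX lerDr.
      by have := lac_power hr; rewrite mul1r.
    by rewrite lerDl; apply: sumr_ge0 => j _; rewrite expr1n mulr1 sqr_ge0.
  by rewrite /u n2M {1}/n2/= expr0n/= addr0.
have hh e : variance u / 4 <= n2 (csum u e) -> 1 / 16 <= leta l * lgrad e z r.
  move=> h; have g : 2 ^+ l / 4 <= lgrad e z r.
    rewrite lgradE -/u -(@ler_pXn2r _ 2) ?nnegrE ?cabs_ge0 ?divr_ge0 ?exprn_ge0// cabs_sq; apply: le_trans h.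
    rewrite ler_pdivlMr//; apply: le_trans v; rewrite le_eqVlt; apply/orP; left; apply/eqP; by field.
  apply: (@le_trans _ _ (leta l * (2 ^+ l / 4))); last by rewrite ler_wpM2l// ltW// leta_gt0.
  by rewrite /leta !exprS le_eqVlt; apply/orP; left; apply/eqP; field; rewrite expf_neq0// pnatr_eq0.
apply: (le_trans (large_signs u)); apply: ler_sum => e _; rewrite ler_nat.
by case: (boolP (variance u / 4 <= n2 (csum u e))) => // /hh ->.
Qed.

(** Each shell contributes a density of integral at most 1, restricted to the radii where the
    gradient has its expected size. The integral thus counts the good shells. *)
Definition lcount e z (r : R) : R :=
  \sum_(l < m) ((leta l)^-1 * (1 / 16 <= leta l * lgrad e z r)%R%:R) * lind l r.
Lemma lcount_ge0 e z r : 0 <= lcount e z r.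
Proof. by apply: sumr_ge0 => l _; rewrite !mulr_ge0// invr_ge0 ltW// leta_gt0. Qed.

Lemma measurable_lcount e z : measurable_fun setT (lcount e z).
Proof.
apply: measurable_sum => l; apply: measurable_funM; last exact: measurable_lind.
apply: measurable_funM; first exact: measurable_cst.
rewrite (_ : (fun r => _) = (fun r => \1_([set r | 1 / 16 <= leta l * lgrad e z r]) r)).
  apply: measurable_indic.
  rewrite (_ : [set r | _] = (fun r => leta l * lgrad e z r) @^-1` `[1 / 16, +oo[%classic).
    rewrite -[X in measurable X]setTI; have mh : measurable_fun setT (fun r => leta l * lgrad e z r).
      by apply: measurable_funM; [exact: measurable_cst|exact: measurable_lgrad].
    by apply: mh => //; exact: measurable_itv.
  by apply/seteqP; split => r /=; rewrite in_itv/= andbT.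
by apply/funext => r; rewrite indicE; congr ((nat_of_bool _)%:R); apply/idP/idP; rewrite inE.
Qed.

Definition lk : R := (1 / 16) `^ q * 4 `^ (q - 1).
Lemma lk_gt0 : 0 < lk. Proof. by rewrite mulr_gt0 ?powR_gt0. Qed.

(** At a good radius of the [l]-th shell the gradient is at least [1 / (16 leta l)], and the weight,
    whose exponent [q - 1] is not positive, is at least [(4 leta l)^(q - 1)]. The product of the
    [q]-th power and the weight is [lk / leta l]. *)
Lemma inner_lcount e z : (lk%:E * \int[lebesgue_measure]_r (lcount e z r)%:E <= HF_inner 0 q%:E (c e) z)%E.
Proof.
have lk0 := lk_gt0.
rewrite -ge0_integralZl_EFin ?(ltW lk0)//; last 2 first.
- by move=> r _; rewrite lee_fin lcount_ge0.
- by apply/measurable_EFinP; exact: measurable_lcount.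
rewrite /HF_inner (_ : splus 0 = 1%N); last by rewrite /splus truncn0.
rewrite [leRHS]integral_mkcond.
have key (r : R) : lk * lcount e z r <=
   if r \in (`[0%R, 1%R[%classic : set R) then lgrad e z r `^ q * (1 - r ^+ 2) `^ ((1%:R - 0) * q - 1) else 0.
  rewrite /lcount mulr_sumr (eq_bigr (fun l : 'I_m => (lk * ((leta l)^-1 * (1 / 16 <= leta l * lgrad e z r)%R%:R)) * lind l r)) => [|l _].
    apply: sum_disjoint; first by case: ifP => // _; rewrite mulr_ge0 ?powR_ge0.
    move=> l; have l0 := leta_gt0 l; have l4 := leta_le l; rewrite {1}/lind; case: (boolP (_ <= _ < _)) => [/andP[h1 h2]|_]; last first.
      by rewrite mulr0; case: ifP => // _; rewrite mulr_ge0 ?powR_ge0.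
    rewrite mulr1 ifT; last by rewrite inE/= in_itv/=; apply/andP; split; lra.
    case: (leP (1 / 16) _) => hg; last by rewrite !mulr0 mulr_ge0 ?powR_ge0.
    rewrite mulr1 subr0 mul1r.
    have w1 : 1 - r ^+ 2 <= 4 * leta l by rewrite expr2; nra.
    have w0 : 0 < 1 - r ^+ 2 by rewrite expr2; nra.
    have g1 : 1 / 16 / leta l <= lgrad e z r by rewrite ler_pdivrMr// [_ * leta l]mulrC.
    have p4 : 0 < 4 * leta l by rewrite mulr_gt0.
    have -> : lk / leta l = (1 / 16 / leta l) `^ q * (4 * leta l) `^ (q - 1).
      have li : 0 <= (leta l)^-1 by rewrite invr_ge0 ltW.
      rewrite /lk [(1 / 16 / leta l) `^ q]powRM// [(4 * leta l) `^ _]powRM ?(ltW l0)//.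
      have -> : (leta l)^-1 `^ q = leta l `^ (- q) by rewrite -powR_inv1 ?(ltW l0)// -powRrM mulN1r.
      rewrite mulrACA -powRD; last by apply/implyP => _; rewrite gt_eqF.
      by rewrite addrA addNr add0r powR_inv1 ?(ltW l0).
    apply: ler_pM; rewrite ?powR_ge0//.
      by apply: ge0_ler_powR; rewrite ?nnegrE ?(ltW q0) ?cabs_ge0// divr_ge0// ltW.
    have eq1 : q - 1 = - (1 - q) by ring.
    rewrite eq1 !(powRN _ (1 - q)) lef_pV2 ?posrE ?powR_gt0//.
    by apply: ge0_ler_powR; rewrite ?nnegrE ?(ltW p4) ?(ltW w0)// subr_ge0.
  by rewrite mulrA.
apply: ge0_le_integral_any => r _; first by rewrite -EFinM lee_fin mulr_ge0 ?lcount_ge0 ?(ltW lk0).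
by rewrite -EFinM /patch; case: ifPn => h; have := key r; rewrite ?h ?(negbTE h) lee_fin.
Qed.

Definition lavg e z : \bar R := (\int[lebesgue_measure]_r (lcount e z r)%:E)%E.

Lemma lavg_le e z : (lavg e z <= m%:R%:E)%E.
Proof.
apply: (@le_trans _ _ (\int[lebesgue_measure]_r (\sum_(l < m) ((leta l)^-1 * lind l r)%:E))%E).
  apply: ge0_le_integral_any => r _; rewrite ?sumEFin lee_fin ?lcount_ge0//.
  apply: ler_sum => l _; rewrite ler_wpM2r ?lind_ge0// ler_piMr ?invr_ge0 ?(ltW (leta_gt0 l))//.
  by rewrite lern1 leq_b1.
rewrite ge0_integral_sum//.
- by rewrite (eq_bigr (fun=> 1%E)) => [|l _]; rewrite ?integral_lind// sumEFin sumr_const card_ord.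
- by move=> l; apply/measurable_EFinP; apply: measurable_funM; [exact: measurable_cst|exact: measurable_lind].
- by move=> l r _; rewrite lee_fin mulr_ge0 ?lind_ge0// invr_ge0 ltW// leta_gt0.
Qed.

Lemma sum_lavg z : sphere d z -> ((2 ^+ #|{: T}| * large_prob R * m%:R)%:E <= \sum_(e : sign) lavg e z)%E.
Proof.
move=> zs; set A := _ * large_prob R; have A0 : 0 <= A by rewrite mulr_ge0 ?exprn_ge0// ltW// large_prob_gt0.
rewrite -ge0_integral_sum//; last 2 first.
- by move=> e; apply/measurable_EFinP; exact: measurable_lcount.
- by move=> e r _; rewrite lee_fin lcount_ge0.
apply: (@le_trans _ _ (\int[lebesgue_measure]_r (\sum_(l < m) (A * ((leta l)^-1 * lind l r))%:E))%E).
  rewrite ge0_integral_sum//.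
  - rewrite (eq_bigr (fun=> A%:E)) => [|l _]; first by rewrite sumEFin sumr_const card_ord mulr_natr.
    under eq_integral do rewrite EFinM.
    rewrite ge0_integralZl_EFin ?integral_lind ?mule1//.
      by move=> r _; rewrite lee_fin mulr_ge0 ?lind_ge0// invr_ge0 ltW// leta_gt0.
    by apply/measurable_EFinP; apply: measurable_funM; [exact: measurable_cst|exact: measurable_lind].
  - move=> l; apply/measurable_EFinP; apply: measurable_funM; first exact: measurable_cst.
    by apply: measurable_funM; [exact: measurable_cst|exact: measurable_lind].
  - by move=> l r _; rewrite lee_fin; apply: mulr_ge0 => //; rewrite mulr_ge0 ?lind_ge0// invr_ge0 ltW// leta_gt0.
apply: ge0_le_integral_any => r _; rewrite !sumEFin lee_fin.
  by apply: sumr_ge0 => l _; apply: mulr_ge0 => //; rewrite mulr_ge0 ?lind_ge0// invr_ge0 ltW// leta_gt0.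
rewrite /lcount exchange_big/=; apply: ler_sum => l _; rewrite -mulr_suml -mulr_sumr.
rewrite [leLHS]mulrCA mulrA [leRHS]mulrAC [leRHS]mulrC mulrC [leLHS]mulrC.
rewrite {1 2}/lind; case: (boolP (_ <= _ < _)) => [hr|_]; last by rewrite !(mulr0, mul0r).
rewrite (_ : true%:R = 1 :> R)// !mulr1 [leLHS]mul1r; have := lgrad_large zs hr; rewrite -/A => h.
by rewrite ler_wpM2l// invr_ge0 ltW// leta_gt0.
Qed.

(** A quantity with values in [[0, m]] and mean at least [A m] is at least [A m / 2] with
    probability at least [A / 2]. Here it is the number of good shells, which [inner_lcount] turns
    into a lower bound of the norm. *)
Lemma sum_inner z : sphere d z ->
  ((2 ^+ #|{: T}| * (large_prob R / 2) * (lk * (large_prob R / 2 * m%:R)) `^ (p / q))%:E <=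
   \sum_(e : sign) poweR (HF_inner 0 q%:E (c e) z) (p / q))%E.
Proof.
move=> zs; have lp := large_prob_gt0 R; set A := large_prob R in lp *; have lk0 := lk_gt0.
have mp : 0 < m%:R :> R by rewrite ltr0n.
have lfin e : lavg e z \is a fin_num.
  rewrite ge0_fin_numE; first by apply: (le_lt_trans (lavg_le e z)); rewrite ltry.
  by apply: integral_ge0 => r _; rewrite lee_fin lcount_ge0.
pose Y e := fine (lavg e z); have YE e : lavg e z = (Y e)%:E by rewrite fineK.
have Y0 e : 0 <= Y e by rewrite -lee_fin -YE; apply: integral_ge0 => r _; rewrite lee_fin lcount_ge0.
have Ym e : Y e <= m%:R by rewrite -lee_fin -YE; exact: lavg_le.
have sY : 2 ^+ #|{: T}| * A * m%:R <= \sum_(e : sign) Y e.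
  by have := sum_lavg zs; under eq_bigr do rewrite YE; rewrite sumEFin lee_fin.
pose big (e : sign) : R := (A / 2 * m%:R <= Y e)%R%:R.
have hbig : 2 ^+ #|{: T}| * (A / 2) <= \sum_e big e.
  have : \sum_(e : sign) Y e <= \sum_(e : sign) (A / 2 * m%:R + m%:R * big e).
    apply: ler_sum => e _; rewrite /big; case: (leP (A / 2 * m%:R) (Y e)) => h.
      by rewrite mulr1; apply: (le_trans (Ym e)); rewrite lerDr mulr_ge0 ?ltW// divr_gt0.
    by rewrite mulr0 addr0 ltW.
  rewrite big_split/= sumr_const card_ffun card_bool -[X in _ <= X + _]mulr_natl natrX -mulr_sumr => h.
  rewrite -(ler_pM2l mp); have := le_trans sY h; set N : R := 2 ^+ _; set B := \sum_e _; move=> h2.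
  have -> : m%:R * (N * (A / 2)) = N * A * m%:R - N * (A / 2 * m%:R) by field.
  by rewrite lerBlDl.
set V := (lk * (A / 2 * m%:R)) `^ (p / q).
have V0 : 0 <= V by exact: powR_ge0.
apply: (@le_trans _ _ (\sum_(e : sign) (big e * V)%:E)%E).
  by rewrite sumEFin lee_fin -mulr_suml ler_wpM2r.
apply: lee_sum => e _; rewrite /big; case: (leP (A / 2 * m%:R) (Y e)) => h; last by rewrite mul0r poweR_ge0.
have pq : 0 <= p / q by rewrite divr_ge0// ltW.
rewrite mul1r /V -poweR_EFin; apply: le_poweR => //.
  by rewrite lee_fin; apply: mulr_ge0; [exact: ltW|rewrite mulr_ge0// divr_ge0// ltW].
apply: le_trans (inner_lcount e z); rewrite -/(lavg e z) YE -EFinM lee_fin.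
by rewrite ler_wpM2l// ltW.
Qed.
End Fixed.

Lemma no_carleson_small : False.
Proof.
have [C C0 HC] := carleson_power p0 HRC.
have mfin := mu_fin hmu.
pose mm := fine (mu setT); have mE : mu setT = mm%:E by rewrite fineK// ge0_fin_numE ?measure_ge0.
have mm0 : 0 <= mm by rewrite fine_ge0 ?measure_ge0.
have lp := large_prob_gt0 R; have lk0 := lk_gt0; have Kp := khinchine_const_gt0 p0.
have pq0 : 0 < p / q by exact: divr_gt0.
pose a : R := large_prob R / 2 * (lk * (large_prob R / 2)) `^ (p / q).
have a0 : 0 < a by rewrite mulr_gt0 ?divr_gt0// powR_gt0// mulr_gt0// divr_gt0.
pose b : R := C * khinchine_const p * mm.
have key m : (0 < m)%N -> a * m%:R `^ (p / q) <= b * m%:R `^ (p / 2).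
  move=> m0; have mp : 0 <= m%:R :> R by [].
  have q0' : (0 < q%:E)%E by rewrite lte_fin.
  have [c Hc Hle] := random_test hs (lexx 0) p0 q0' C0 HC (@homog_lpart m) (@lfun_moment m).
  have hc e z k : hom (c e) z k = if (k < (2 ^ m).+1)%N then lpart e k z else 0 by have [h _] := Hc e; exact: h.
  pose card : R := 2 ^+ #|{: 'I_m * {ffun 'I_(2 ^ m) -> 'I_d}}|.
  have card0 : 0 < card by rewrite exprn_gt0.
  (* The sum over signs is moved under the integral as an equality, which requires a measurable
     integrand; [innerm] provides it. *)
  have mI e : measurable_fun (@sphere R d) (fun z => poweR (HF_inner 0 q%:E (c e) z) (p / q)).
    have [_ hol] := Hc e.
    apply: (eq_measurable_fun (fun z => poweR (innerm q%:E (c e) z) (p / q))).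
      by move=> z; rewrite inE => zs; rewrite (innermE _ hol zs).
    apply: measurable_funTS; apply: (measurableT_comp (measurable_poweR _)); exact: measurable_innerm.
  have low : ((card * (a * m%:R `^ (p / q)))%:E <= \sum_e HF_pnorm sigma 0 p q%:E (c e))%E.
    rewrite /HF_pnorm -ge0_integral_sum//; last 2 first.
    - exact: measurable_sphere.
    - by move=> e z _; exact: poweR_ge0.
    rewrite -[leLHS]mule1 -(sigma_sphere hs) -(integral_cst sigma (@measurable_sphere R d)).
    apply: ge0_le_integral_any => z zs.
      by rewrite lee_fin; apply: mulr_ge0; [exact: ltW|apply: mulr_ge0; [exact: ltW|exact: powR_ge0]].
    apply: le_trans (sum_inner m0 hc zs); rewrite lee_fin -/card.
    rewrite /a [lk * (_ * m%:R)]mulrA [(_ * m%:R) `^ _]powRM//; last by rewrite mulr_ge0 ?divr_ge0 ?(ltW lk0)// ltW.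
    by rewrite !mulrA.
  have up : (\int[mu]_(z in closed_ball d) (card * (khinchine_const p * m%:R `^ (p / 2)))%:E <=
      (card * (khinchine_const p * m%:R `^ (p / 2)) * mm)%:E)%E.
    rewrite integral_cst; last exact: measurable_closed_ball.
    rewrite [leRHS]EFinM; apply: lee_wpmul2l.
      by rewrite lee_fin; apply: mulr_ge0; [exact: ltW|apply: mulr_ge0; [exact: ltW|exact: powR_ge0]].
    by rewrite -mE le_measure ?inE//; exact: measurable_closed_ball.
  have C0' : (0 <= C%:E)%E by rewrite lee_fin ltW.
  have := le_trans low (le_trans Hle (lee_wpmul2l C0' up)).
  rewrite -EFinM lee_fin => h; rewrite -(ler_pM2l card0); apply: (le_trans h).
  by rewrite /b le_eqVlt; apply/orP; left; apply/eqP; ring.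
(* Since [q <= 1], the exponent [p / q] exceeds [p / 2] by at least [p / 2], so [key] must fail for
   large [m]. *)
have gap : p / 2 <= p / q - p / 2.
  have : p <= p / q by rewrite ler_pdivlMr// ler_piMr// ltW.
  lra.
have p20 : 0 < p / 2 by rewrite divr_gt0.
pose D : R := b / a + 1; have b0 : 0 <= b by rewrite mulr_ge0// mulr_ge0// ltW.
have D0 : 0 < D by rewrite ltr_wpDl// divr_ge0// ltW.
pose n := (Num.truncn (D `^ (p / 2)^-1)).+1.
have nD : D `^ (p / 2)^-1 <= n%:R by apply: ltW; exact: truncnS_gt.
have n1 : 1 <= n%:R :> R by rewrite ler1n.
have np : 0 < n%:R :> R by rewrite ltr0n.
have hD : D <= n%:R `^ (p / 2).
  have E : (D `^ (p / 2)^-1) `^ (p / 2) = D by rewrite -powRrM mulVf ?gt_eqF// powRr1// ltW.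
  by rewrite -[leLHS]E; apply: ge0_ler_powR; rewrite ?nnegrE ?powR_ge0 ?ler0n// ltW.
have := key n (ltn0Sn _).
have -> : n%:R `^ (p / q) = n%:R `^ (p / 2) * n%:R `^ (p / q - p / 2) :> R.
  by rewrite -powRD; [congr (_ `^ _); ring|apply/implyP => _; rewrite gt_eqF].
have x0 : 0 < n%:R `^ (p / 2) :> R by rewrite powR_gt0.
have h1 : n%:R `^ (p / 2) <= n%:R `^ (p / q - p / 2) :> R by exact: ler_powR.
clearbody n; rewrite mulrCA [b * _]mulrC ler_pM2l// => h2.
have h3 : a * D <= b by apply: le_trans h2; rewrite ler_pM2l//; exact: le_trans h1.
have : a * D = b + a by rewrite /D; field; rewrite gt_eqF.
lra.
Qed.

End Lacunary.

Theorem theorem7p2 (R : realType) (d : nat)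
    (sigma : {measure set (Pt R d) -> \bar R}) (p : R) (q : \bar R) :
  (1 <= d)%N -> normalized_surface_measure sigma -> 0 < p -> (0 < q)%E ->
  (* (a) *)
  (forall s : R, 0 < s ->
     ~ exists mu : {measure set (Pt R d) -> \bar R},
         finite_measure_on_closed_ball mu /\ reverse_carleson sigma s p q mu) /\
  (* (b) *)
  ((2%:E <= q)%E ->
     forall mu : {measure set (Pt R d) -> \bar R},
       finite_measure_on_closed_ball mu ->
       (reverse_carleson sigma 0 p q mu <->
        exists2 c : R, 0 < c &
          forall (zeta : Pt R d) (delta : R), sphere d zeta -> 0 < delta ->
            (c%:E * sigma (nonisotropic_ball zeta delta)
               <= mu (nonisotropic_ball zeta delta))%E)) /\
  (* (c) *)
  ((q <= 1%:E)%E ->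
     ~ exists mu : {measure set (Pt R d) -> \bar R},
         finite_measure_on_closed_ball mu /\ reverse_carleson sigma 0 p q mu).
Proof.
move=> d1 hs p0 q0; split; [|split].
- by move=> s s0 [mu [hmu rc]]; exact: (no_carleson_pos d1 hs hmu s0 p0 q0 rc).
- move=> q2 mu hmu; split=> [rc|[c c0 H]].
    have [C C0 HC] := sphere_transfer d1 hs hmu p0 q0 rc.
    exists C^-1; first by rewrite invr_gt0.
    move=> z dl zs dl0; rewrite -(@lee_pmul2l _ C%:E) ?lte_fin//.
    rewrite muleA -EFinM divff ?gt_eqF// mul1e.
    exact: (ball_domination d1 hs hmu p0 C0 HC dl zs).
  (* The integral over the sphere links both sides: it dominates the norm with constant [C], and the
     [mu]-integral dominates it with constant [1 / c]. *)
  have [C C0 HU] := HF_upper hs p0 q2.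
  apply: (@carleson_of_power _ _ sigma mu 0 p q (C / c) p0); first by rewrite divr_ge0// ltW.
  move=> cf f hf cof; apply: (le_trans (HU cf f hf cof)).
  rewrite EFinM -muleA; apply: lee_wpmul2l; first by rewrite lee_fin.
  rewrite -(@lee_pmul2l _ c%:E) ?lte_fin// [leRHS]muleA -EFinM divff ?gt_eqF// mul1e.
  exact: (ball_average d1 hs hmu c0 H p0 hf cof).
- move=> q1 [mu [hmu rc]]; case: q q0 q1 rc => [q| |]//; rewrite lte_fin lee_fin => q0 q1 rc.
  exact: (no_carleson_small d1 hs hmu p0 q0 q1 rc).
Qed.
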